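(* Let $n=2$, let $\Omega=\Omega_0\setminus\overline\Omega_1$ be a convex ring in $\mathbb R^2$ and $u$ its $\infty$-harmonic potential. Then $Du$ is differentiable and $u$ is twice differentiable at almost every point of $\Omega$, and the absolutely continuous part (with respect to Lebesgue measure) of the matrix-valued Radon measure $\mathcal D^2u$ equals $D^2u\,dx$, where $D^2u$ is the pointwise (a.e.) Hessian. Consequently, for almost every $x\in\Omega$: $\langle D^2u(x)Du(x),Du(x)\rangle=0$, $$u(x)=\tfrac12\big[u(x+hDu(x))+u(x-hDu(x))\big]+o(h^2)\quad\text{as }h\to0,$$ and $$u(x)=\tfrac12\Big(\max_{\overline{B(x,\epsilon)}}u+\min_{\overline{B(x,\epsilon)}}u\Big)+o(\epsilon^2)\quad\text{as }\epsilon\to0.$$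
   Context: A convex ring in $\mathbb R^2$ is $\Omega=\Omega_0\setminus\overline{\Omega}_1$, where $\Omega_0$ is a bounded convex domain and $\overline\Omega_1\subset\Omega_0$ is a nonempty compact convex set (possibly with empty interior); $\partial\Omega_1$ denotes the boundary of $\overline\Omega_1$. The $\infty$-harmonic potential $u\in C^0(\overline\Omega)$ is the unique viscosity solution of $\langle D^2u\,Du,Du\rangle=0$ in $\Omega$ with $u=0$ on $\partial\Omega_0$, $u=1$ on $\partial\Omega_1$. It is known that $u\in C^1(\Omega)$ and that its distributional second derivatives $\mathcal D^2u$ are Radon measures on $\Omega$. *)

(* Defs.v *)
From HB Require Import structures.
From mathcomp Require Import all_boot all_order all_algebra.
From mathcomp Require Import all_classical all_reals all_analysis.
Set Implicit Arguments. Unset Strict Implicit. Unset Printing Implicit Defensive.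
Import Order.TTheory GRing.Theory Num.Theory.
Import numFieldNormedType.Exports.
Local Open Scope classical_set_scope.
Local Open Scope ring_scope.

Definition lam2 (R : realType) := ((@lebesgue_measure R) \x (@lebesgue_measure R))%E.
Arguments lam2 R : clear implicits.

Definition e_ {R : realType} (b : bool) : R * R := if b then (0, 1) else (1, 0).

Definition dot {R : realType} (p q : R * R) : R := p.1 * q.1 + p.2 * q.2.
Definition enorm {R : realType} (p : R * R) : R := Num.sqrt (dot p p).
Definition cball {R : realType} (x : R * R) (r : R) : set (R * R) :=
  [set y | enorm (y - x) <= r].

Fixpoint dpart {R : realType} (s : seq bool) (f : R * R -> R) : R * R -> R :=
  match s with
  | [::] => f
  | b :: s' => fun x => 'D_(e_ b) (dpart s' f) x
  end.

Definition Ck {R : realType} (k : nat) (f : R * R -> R) : Prop :=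
  forall s : seq bool, (size s <= k)%N ->
    continuous (dpart s f) /\
    ((size s < k)%N -> forall (b : bool) (x : R * R), derivable (dpart s f) x (e_ b)).

Definition smooth {R : realType} (f : R * R -> R) : Prop := forall k, Ck k f.

Definition inflap {R : realType} (phi : R * R -> R) (x : R * R) : R :=
  \sum_(i : bool) \sum_(j : bool)
     dpart [:: i] phi x * dpart [:: j] phi x * dpart [:: i; j] phi x.

Definition visc_sub {R : realType} (O : set (R * R)) (u : R * R -> R) : Prop :=
  forall (x0 : R * R) (phi : R * R -> R), O x0 -> Ck 2 phi ->
    (\forall y \near x0, u y - phi y <= u x0 - phi x0) -> 0 <= inflap phi x0.
Definition visc_super {R : realType} (O : set (R * R)) (u : R * R -> R) : Prop :=
  forall (x0 : R * R) (phi : R * R -> R), O x0 -> Ck 2 phi ->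
    (\forall y \near x0, u x0 - phi x0 <= u y - phi y) -> inflap phi x0 <= 0.
Definition visc_sol {R : realType} (O : set (R * R)) (u : R * R -> R) : Prop :=
  visc_sub O u /\ visc_super O u.

Definition convex2 {R : realType} (A : set (R * R)) : Prop :=
  forall (x y : R * R) (t : R), A x -> A y -> 0 <= t <= 1 ->
    A (t *: x + (1 - t) *: y).
Definition bounded2 {R : realType} (A : set (R * R)) : Prop :=
  exists M : R, forall x, A x -> enorm x <= M.

(* convex ring Omega0 \ K, with K = closure of Omega1 *)
Definition convex_ring {R : realType} (O0 K : set (R * R)) : Prop :=
  [/\ open O0, connected O0, O0 !=set0, bounded2 O0 & convex2 O0] /\
  [/\ compact K, convex2 K, K !=set0 & K `<=` O0].

Definition bdry {R : realType} (A : set (R * R)) : set (R * R) :=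
  closure A `\` interior A.

Definition inf_potential {R : realType} (O0 K : set (R * R)) (u : R * R -> R) : Prop :=
  [/\ {within closure (O0 `\` K), continuous u},
      visc_sol (O0 `\` K) u,
      (forall x, bdry O0 x -> u x = 0) &
      (forall x, bdry K x -> u x = 1)].

Definition grad {R : realType} (f : R * R -> R) (x : R * R) : R * R :=
  ('d f x (e_ false), 'd f x (e_ true)).
Definition hessv {R : realType} (f : R * R -> R) (x p : R * R) : R * R :=
  'd (grad f) x p.
Definition hess {R : realType} (f : R * R -> R) (x : R * R) (i j : bool) : R :=
  let v := hessv f x (e_ i) in if j then v.2 else v.1.

Definition twice_diff {R : realType} (u : R * R -> R) (x : R * R) : Prop :=
  [/\ differentiable u x, differentiable (grad u) x &
     (fun h : R * R =>
        (u (x + h) - u x - dot (grad u x) h - dot (hessv u x h) h / 2)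
          / enorm h ^+ 2) @ (0 : R * R)^' --> 0].

Definition supp_in {R : realType} (phi : R * R -> R) (O : set (R * R)) : Prop :=
  exists C : set (R * R), [/\ compact C, C `<=` O & forall x, ~ C x -> phi x = 0].

Definition loc_finite {R : realType} (O : set (R * R))
  (nu : {measure set (R * R) -> \bar R}) : Prop :=
  forall A, compact A -> A `<=` O -> (nu A < +oo)%E.

(* the signed Radon measure nup - num is the distributional derivative
   d_i d_j u in O:  int_O u d_i d_j phi dx = int_O phi d(nup - num) *)
Definition is_D2 {R : realType} (O : set (R * R)) (u : R * R -> R) (i j : bool)
  (nup num : {measure set (R * R) -> \bar R}) : Prop :=
  forall phi : R * R -> R, smooth phi -> supp_in phi O ->
    (\int[lam2 R]_(x in O) (u x * dpart [:: i; j] phi x)%:E =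
     \int[nup]_(x in O) (phi x)%:E - \int[num]_(x in O) (phi x)%:E)%E.

Definition rel_cpt {R : realType} (A O : set (R * R)) : Prop :=
  compact (closure A) /\ closure A `<=` O.

(* the absolutely continuous part (w.r.t. Lebesgue) of the signed Radon
   measure nup - num on O is f dx: f is locally integrable in O and
   nup - num = f dx off a Lebesgue-null set N (the singular part lives on N) *)
Definition ac_part_is {R : realType} (O : set (R * R))
  (nup num : {measure set (R * R) -> \bar R}) (f : R * R -> R) : Prop :=
  (forall A, measurable A -> rel_cpt A O -> (lam2 R).-integrable A (fun x => (f x)%:E)) /\
  exists N : set (R * R), [/\ measurable N, lam2 R N = 0%E &
    forall A, measurable A -> rel_cpt A O ->
      (nup (A `\` N) - num (A `\` N) = \int[lam2 R]_(x in A) (f x)%:E)%E].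

(* Main.v *)
(** Extend u by 1 on K and by 0 off O0. In the wedge between two lines the rescaled
    angle is infinity-harmonic; comparison with it, together with the comparison of
    Armstrong and Smart on small balls, shows that u equals its quasi-concave
    envelope: each x in the ring has a unit normal n such that u <= u x on the
    half-plane beyond the line through x normal to n. Barriers in strips give that u
    is differentiable with gradient -T n, where T > 0 is the local Lipschitz constant,
    and wedges give monotonicity inequalities between (x, n, T, u) at two points. They
    imply that x and T n are, locally, Lipschitz functions of some Y(x) in the plane.
    By the theorem of Rademacher, and because the critical values of a Lipschitz map
    are null, the gradient of u is differentiable almost everywhere. The viscosity
    inequalities at such a point give the equation, and the second-order expansion
    along the gradient and on small balls gives the two mean value formulas.

    For the distributional Hessian, consider the points at which u is within
    |h|^2 / (m + 1), at scale 1 / (k + 1), of a quadratic polynomial with Hessian Q.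
    Testing with a smooth partition of unity on a fine grid shows that on a Borel set
    of such points the measure D_ij u differs from Q_ij dx by O(1 / (m + 1)) dx.
    Countably many such sets cover the points of second-order differentiability. *)
Require Import Defs.
From HB Require Import structures.
From mathcomp Require Import all_boot all_order all_algebra.
From mathcomp Require Import all_classical all_reals all_analysis.
From mathcomp Require Import measurable_realfun ring lra.
Set Implicit Arguments. Unset Strict Implicit. Unset Printing Implicit Defensive.
Import Order.TTheory GRing.Theory Num.Theory.
Import numFieldNormedType.Exports.
Local Open Scope classical_set_scope.
Local Open Scope ring_scope.

(** The chart [Y] is Minty's parametrisation of a monotone graph, as in proofs of Alexandrov's
    theorem. Divided by the slopes and subtracted, the two wedge inequalities say that, up to a
    small error, the pairs (tangential coordinate, [U]) and (tangential component of [n], - 1 / [T])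
    are monotonically related; a suitably weighted sum of the two pairs then determines [x] and the
    gradient in a Lipschitz way. [Y] itself is only continuous, so Rademacher's theorem is applied
    to the inverse map, in the target plane. Carrying the result back to [x] requires that preimages
    of null sets be null and that the differential of the inverse be invertible. The envelope is
    compared with [U] without being shown to be a viscosity subsolution: the argument on small balls
    only uses that the supremum over radius r is at most the mean of the centre value and the
    supremum over radius 2 r, and a single wedge gives this. Distributional derivatives are known
    only through test functions; the bumps are tensor products, so that integration by parts against
    quadratic polynomials reduces to moments on the line. *)

Section plane.
Context {R : realType}.
Local Notation E := (R * R)%type.
Implicit Types (x y z p q h : E) (t : R).

(** * Euclidean inner product and norm on the plane *)

Lemma fstD x y : (x + y).1 = x.1 + y.1. Proof. by []. Qed.
Lemma sndD x y : (x + y).2 = x.2 + y.2. Proof. by []. Qed.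
Lemma fstN x : (- x).1 = - x.1. Proof. by []. Qed.
Lemma sndN x : (- x).2 = - x.2. Proof. by []. Qed.
Lemma fstZ t x : (t *: x).1 = t * x.1. Proof. by []. Qed.
Lemma sndZ t x : (t *: x).2 = t * x.2. Proof. by []. Qed.
Lemma fst0 : (0 : E).1 = 0. Proof. by []. Qed.
Lemma snd0 : (0 : E).2 = 0. Proof. by []. Qed.
Definition vE := (fstD, sndD, fstN, sndN, fstZ, sndZ, fst0, snd0).

Lemma dotxx_ge0 x : 0 <= dot x x.
Proof. by rewrite /dot -!expr2 addr_ge0 // sqr_ge0. Qed.

Lemma enorm_ge0 x : 0 <= enorm x. Proof. exact: sqrtr_ge0. Qed.

Lemma enorm_sqr x : enorm x ^+ 2 = dot x x.
Proof. by rewrite /enorm sqr_sqrtr // dotxx_ge0. Qed.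

Lemma dotC x y : dot x y = dot y x.
Proof. by rewrite /dot; ring. Qed.
Lemma dotDl x y z : dot (x + y) z = dot x z + dot y z.
Proof. by rewrite /dot !vE; ring. Qed.
Lemma dotDr x y z : dot z (x + y) = dot z x + dot z y.
Proof. by rewrite /dot !vE; ring. Qed.
Lemma dotNl x z : dot (- x) z = - dot x z.
Proof. by rewrite /dot !vE; ring. Qed.
Lemma dotNr x z : dot z (- x) = - dot z x.
Proof. by rewrite /dot !vE; ring. Qed.
Lemma dotZl t x z : dot (t *: x) z = t * dot x z.
Proof. by rewrite /dot !vE; ring. Qed.
Lemma dotZr t x z : dot z (t *: x) = t * dot z x.
Proof. by rewrite /dot !vE; ring. Qed.
Lemma dot0l z : dot 0 z = 0.
Proof. by rewrite /dot !vE; ring. Qed.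
Lemma dot0r z : dot z 0 = 0.
Proof. by rewrite /dot !vE; ring. Qed.
Definition dotE := (dotDl, dotDr, dotNl, dotNr, dotZl, dotZr, dot0l, dot0r).

Lemma dot_sqr_le x y : dot x y ^+ 2 <= dot x x * dot y y.
Proof.
rewrite -subr_ge0 (_ : _ - _ = (x.1 * y.2 - x.2 * y.1) ^+ 2) ?sqr_ge0 //.
by rewrite /dot; ring.
Qed.

Lemma dot_abs_le x y : `|dot x y| <= enorm x * enorm y.
Proof.
rewrite -(ler_pXn2r (n:=2)) ?nnegrE ?mulr_ge0 ?enorm_ge0 //.
by rewrite real_normK ?num_real // exprMn !enorm_sqr dot_sqr_le.
Qed.

Lemma dot_le x y : dot x y <= enorm x * enorm y.
Proof. exact: le_trans (ler_norm _) (dot_abs_le x y). Qed.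

Lemma dot_ge x y : - (enorm x * enorm y) <= dot x y.
Proof. by have := dot_abs_le x y; rewrite ler_norml => /andP[]. Qed.

Lemma enorm_leP x t : 0 <= t -> (enorm x <= t) = (dot x x <= t ^+ 2).
Proof. by move=> t0; rewrite -enorm_sqr ler_pXn2r // nnegrE ?enorm_ge0. Qed.

Lemma enorm_ltP x t : 0 <= t -> (enorm x < t) = (dot x x < t ^+ 2).
Proof. by move=> t0; rewrite -enorm_sqr ltr_pXn2r // nnegrE ?enorm_ge0. Qed.

Lemma enorm_triangle x y : enorm (x + y) <= enorm x + enorm y.
Proof.
rewrite enorm_leP ?addr_ge0 ?enorm_ge0 // !dotE (dotC y x) -!enorm_sqr.
by have := dot_le x y; lra.
Qed.

Lemma enorm0 : enorm (0 : E) = 0.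
Proof. by rewrite /enorm dot0l sqrtr0. Qed.

Lemma enormN x : enorm (- x) = enorm x.
Proof. by rewrite /enorm !dotE opprK. Qed.

Lemma enormB x y : enorm (x - y) = enorm (y - x).
Proof. by rewrite -enormN opprB. Qed.

Lemma enormZ t x : enorm (t *: x) = `|t| * enorm x.
Proof.
by rewrite /enorm !dotE mulrA -expr2 sqrtrM ?sqr_ge0 // sqrtr_sqr.
Qed.

Lemma enorm_triangle3 x y z : enorm (x - z) <= enorm (x - y) + enorm (y - z).
Proof. by rewrite -[x - z](subrKA y) enorm_triangle. Qed.

Lemma dotxx_eq0 x : dot x x = 0 -> x = 0.
Proof.
rewrite /dot -!expr2 => /eqP; rewrite paddr_eq0 ?sqr_ge0 //.
by rewrite !sqrf_eq0 => /andP[/eqP x1 /eqP x2]; case: x x1 x2 => a b /= -> ->.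
Qed.

Lemma enorm_eq0 x : enorm x = 0 -> x = 0.
Proof. by move=> x0; apply: dotxx_eq0; rewrite -enorm_sqr x0 expr0n. Qed.

Lemma enorm_gt0 x : x != 0 -> 0 < enorm x.
Proof.
move=> x0; rewrite lt_neqAle enorm_ge0 andbT eq_sym.
by apply: contra x0 => /eqP/enorm_eq0 ->.
Qed.

Lemma enorm_unit x : dot x x = 1 -> enorm x = 1.
Proof. by move=> x1; rewrite /enorm x1 sqrtr1. Qed.

Lemma dot_normalize x : x != 0 ->
  dot ((enorm x)^-1 *: x) ((enorm x)^-1 *: x) = 1.
Proof.
move=> x0; rewrite !dotE -enorm_sqr; field.
by rewrite gt_eqF // enorm_gt0.
Qed.

Lemma norm_le_enorm x : `|x| <= enorm x.
Proof.
rewrite /Num.norm /= ge_max; apply/andP; split.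
- rewrite -sqrtr_sqr /enorm ler_sqrt ?dotxx_ge0 // /dot -!expr2.
  by rewrite lerDl sqr_ge0.
- rewrite -sqrtr_sqr /enorm ler_sqrt ?dotxx_ge0 // /dot -!expr2.
  by rewrite lerDr sqr_ge0.
Qed.

Lemma fst_le_enorm x : `|x.1| <= enorm x.
Proof. by apply: le_trans (norm_le_enorm x); rewrite {2}/Num.norm /= le_max lexx. Qed.

Lemma snd_le_enorm x : `|x.2| <= enorm x.
Proof. by apply: le_trans (norm_le_enorm x); rewrite {2}/Num.norm /= le_max lexx orbT. Qed.

Lemma enorm_le_l1 x : enorm x <= `|x.1| + `|x.2|.
Proof.
rewrite enorm_leP ?addr_ge0 // sqrrD /dot -!expr2 !real_normK ?num_real //.
by have := mulr_ge0 (normr_ge0 x.1) (normr_ge0 x.2); rewrite mulr2n; lra.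
Qed.

Lemma enorm_le_norm x : enorm x <= 2 * `|x|.
Proof.
apply: le_trans (enorm_le_l1 x) _.
have h1 : `|x.1| <= `|x| by rewrite {2}/Num.norm /= le_max lexx.
have h2 : `|x.2| <= `|x| by rewrite {2}/Num.norm /= le_max lexx orbT.
by lra.
Qed.

Lemma enorm_dist x y : `|enorm x - enorm y| <= enorm (x - y).
Proof.
have h1 := enorm_triangle (x - y) y; have h2 := enorm_triangle (y - x) x.
rewrite subrK in h1; rewrite subrK enormB in h2.
by rewrite ler_norml; lra.
Qed.

Definition perp x : E := (- x.2, x.1).

Lemma dot_perp x : dot x (perp x) = 0.
Proof. by rewrite /dot /perp /=; ring. Qed.

Lemma perp_unit x : dot x x = 1 -> dot (perp x) (perp x) = 1.
Proof. by rewrite /dot /perp /= => <-; ring. Qed.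

Lemma dot_perp2 x y z : dot x x = 1 ->
  dot y z = dot y x * dot z x + dot y (perp x) * dot z (perp x).
Proof.
move=> x1; rewrite -[LHS]mulr1 -x1 /dot /perp /=; ring.
Qed.

(** * Topology of the plane in Euclidean balls *)

Lemma nbhs_enormP x (P : set E) :
  (\forall y \near x, P y) <-> exists2 d, 0 < d & forall y, enorm (y - x) < d -> P y.
Proof.
split.
- move=> /nbhs_normP[d /= d0 dP]; exists d => // y yd; apply: dP => /=.
  by rewrite /ball_ /= distrC; apply: le_lt_trans (norm_le_enorm _) yd.
- move=> [d d0 dP]; apply/nbhs_normP; exists (d / 2) => /=; first by rewrite divr_gt0.
  move=> y /=; rewrite /ball_ /= distrC => yd; apply: dP.
  by apply: le_lt_trans (enorm_le_norm _) _; lra.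
Qed.

Lemma continuous_enormP (f : E -> R) x :
  {for x, continuous f} <->
  forall e, 0 < e -> exists2 d, 0 < d & forall y, enorm (y - x) < d -> `|f y - f x| < e.
Proof.
split.
- move=> /cvgrPdist_lt cf e e0; have /nbhs_enormP[d d0 dP] := cf _ e0.
  by exists d => // y yd; rewrite distrC; exact: dP.
- move=> H; apply/cvgrPdist_lt => e e0; apply/nbhs_enormP.
  by have [d d0 dP] := H _ e0; exists d => // y yd; rewrite distrC; exact: dP.
Qed.

Lemma open_enormP (O : set E) :
  open O <-> forall x, O x -> exists2 d, 0 < d & forall y, enorm (y - x) < d -> O y.
Proof.
rewrite openE; split => [H x Ox|H x Ox]; first by apply/nbhs_enormP; exact: H.
by apply/nbhs_enormP; exact: H.
Qed.

Lemma closed_enormP (C : set E) :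
  closed C <-> forall x, (forall d, 0 < d -> exists2 y, enorm (y - x) < d & C y) -> C x.
Proof.
split.
- move=> cC x H; apply: cC => A /nbhs_enormP[d d0 dA].
  by have [y yd Cy] := H _ d0; exists y; split => //; exact: dA.
- move=> H x clx; apply: H => d d0.
  have [|y [Cy yd]] := clx [set y | enorm (y - x) < d]; first by apply/nbhs_enormP; exists d.
  by exists y.
Qed.

Lemma fst_continuous : continuous (fun x : E => x.1).
Proof. by move=> x; exact: cvg_fst. Qed.
Lemma snd_continuous : continuous (fun x : E => x.2).
Proof. by move=> x; exact: cvg_snd. Qed.

Lemma enorm_lipschitz_continuous (f : E -> R) (L : R) :
  (forall x y, `|f x - f y| <= L * enorm (x - y)) -> continuous f.
Proof.
move=> fL x; apply/continuous_enormP => e e0.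
have L1 : 0 < `|L| + 1 by have := normr_ge0 L; lra.
exists (e / (`|L| + 1)); first by rewrite divr_gt0.
move=> y; rewrite ltr_pdivlMr // => yx; apply: le_lt_trans (fL y x) _.
apply: le_lt_trans yx; rewrite mulrC ler_wpM2l ?enorm_ge0 //.
by have := ler_norm L; lra.
Qed.

Lemma enorm_continuous : continuous (@enorm R).
Proof.
by apply: (@enorm_lipschitz_continuous _ 1) => x y; rewrite mul1r enorm_dist.
Qed.

Lemma dot_continuous p : continuous (fun x => dot p x).
Proof.
apply: (@enorm_lipschitz_continuous _ (enorm p)) => x y.
by rewrite -dotNr -dotDr dot_abs_le.
Qed.

Lemma bounded_closed_compact2 (C : set E) (M : R) :
  closed C -> (forall x, C x -> enorm x <= M) -> compact C.
Proof.
move=> cC CM.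
apply: (@subclosed_compact _ C (`[-M, M] `*` `[-M, M])) => //.
  by apply: compact_setX; exact: segment_compact.
move=> x Cx /=; rewrite !in_itv /= -!ler_norml.
by split; apply: le_trans (CM _ Cx); [exact: fst_le_enorm|exact: snd_le_enorm].
Qed.

Lemma compact_bounded2 (C : set E) : compact C ->
  exists2 M, 0 < M & forall x, C x -> enorm x <= M.
Proof.
move=> /compact_bounded /ex_strict_bound_gt0 [M M0 HM].
exists (2 * M); first by lra.
move=> x Cx; apply: le_trans (enorm_le_norm x) _.
by have := HM _ Cx; rewrite /=; lra.
Qed.

Lemma cball_closed x t : closed (cball x t).
Proof.
apply/closed_enormP => y H; rewrite /cball /=.
rewrite leNgt; apply/negP => ty.
have [|z zy zt] := H (enorm (y - x) - t); first by rewrite subr_gt0.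
have := enorm_triangle3 y z x; rewrite /cball /= in zt.
by rewrite (enormB y z); lra.
Qed.

Lemma cball_compact x t : compact (cball x t).
Proof.
apply: (bounded_closed_compact2 (M:= t + enorm x)); first exact: cball_closed.
move=> y; rewrite /cball /= => yx.
by have := enorm_triangle (y - x) x; rewrite subrK; lra.
Qed.

Lemma compact_max2 (C : set E) (f : E -> R) : C !=set0 -> compact C ->
  {within C, continuous f} ->
  exists2 c, C c & forall y, C y -> f y <= f c.
Proof.
move=> C0 cC cf; have [c /set_mem Cc H] := compact_EVT_max C0 cC cf.
by exists c => // y Cy; apply: H; exact: mem_set.
Qed.

Lemma compact_min2 (C : set E) (f : E -> R) : C !=set0 -> compact C ->
  {within C, continuous f} ->
  exists2 c, C c & forall y, C y -> f c <= f y.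
Proof.
move=> C0 cC cf; have [c /set_mem Cc H] := compact_EVT_min C0 cC cf.
by exists c => // y Cy; apply: H; exact: mem_set.
Qed.

Lemma closed_continuous_le (f : E -> R) t : continuous f -> closed [set x | f x <= t].
Proof. by move=> /continuous_closedP /(_ [set y | y <= t] (@closed_le _ t)). Qed.

Lemma closed_continuous_ge (f : E -> R) t : continuous f -> closed [set x | t <= f x].
Proof. by move=> /continuous_closedP /(_ [set y | y >= t] (@closed_ge _ t)). Qed.

End plane.

(** * Jets and comparison *)

Section jets.
Context {R : realType}.
Local Notation E := (R * R)%type.
Implicit Types (x y z p q h : E) (A : R * R * R) (f : E -> R).

(** [A] is a symmetric matrix stored as the triple (a11, a12, a22). *)
Definition qf A h : R := A.1.1 * h.1 ^+ 2 + 2 * A.1.2 * (h.1 * h.2) + A.2 * h.2 ^+ 2.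

Definition jet2 f x p A : Prop := forall e, 0 < e -> exists2 d, 0 < d &
  forall h, enorm h < d -> `|f (x + h) - f x - dot p h - qf A h / 2| <= e * dot h h.

(* Second-order form of the viscosity inequality: every second-order Taylor
   bound of f from above has nonnegative infinity-Laplacian. *)
Definition jsub (O : set E) f : Prop := forall x p A, O x ->
  (forall e, 0 < e -> exists2 d, 0 < d &
     forall h, enorm h < d -> f (x + h) <= f x + dot p h + qf A h / 2 + e * dot h h) ->
  0 <= qf A p.

Definition quad x (c0 c1 c2 a b c : R) y : R :=
  c0 + c1 * (y.1 - x.1) + c2 * (y.2 - x.2) + a * (y.1 - x.1) ^+ 2
   + b * ((y.1 - x.1) * (y.2 - x.2)) + c * (y.2 - x.2) ^+ 2.

Lemma derive_quotientP f y v (L M : R) :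
  (forall t, f (t *: v + y) - f y = t * L + t ^+ 2 * M) ->
  derivable f y v /\ 'D_v f y = L.
Proof.
move=> H.
have cv : (fun t : R => t^-1 *: (f (t *: v + y) - f y)) @ 0^' --> L.
  apply: (@cvg_trans _ ((fun t : R => L + t * M) @ 0^')).
    apply: near_eq_cvg; near=> t.
    rewrite H /GRing.scale /=; field.
    by near: t; exact: nbhs_dnbhs_neq.
  have -> : nbhs L = nbhs (L + 0 * M) by rewrite mul0r addr0.
  apply: cvgD; first exact: cvg_cst.
  by apply: cvgM; [exact: cvg_within|exact: cvg_cst].
split; first by apply/cvg_ex; exists L.
exact/cvg_lim.
Unshelve. all: by end_near. Qed.

Lemma derive_quad x c0 c1 c2 a b c (i : bool) y :
  derivable (quad x c0 c1 c2 a b c) y (e_ i) /\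
  'D_(e_ i) (quad x c0 c1 c2 a b c) y =
    if i then quad x c2 b (2 * c) 0 0 0 y else quad x c1 (2 * a) b 0 0 0 y.
Proof.
by case: i; [apply: (@derive_quotientP _ _ _ _ c)|apply: (@derive_quotientP _ _ _ _ a)] => t;
  rewrite /quad /e_ !vE /=; ring.
Qed.

Lemma dpart_quad (s : seq bool) x c0 c1 c2 a b c :
  exists d0 d1 d2 u v w, dpart s (quad x c0 c1 c2 a b c) = quad x d0 d1 d2 u v w.
Proof.
elim: s => [|i s [d0 [d1 [d2 [u [v [w IH]]]]]]]; first by do 6 eexists.
rewrite /= IH.
case: i.
- exists d2, v, (2 * w), 0, 0, 0.
  by apply/funext => y; rewrite (derive_quad _ _ _ _ _ _ _ true y).2.
- exists d1, (2 * u), v, 0, 0, 0.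
  by apply/funext => y; rewrite (derive_quad _ _ _ _ _ _ _ false y).2.
Qed.

Lemma quad_continuous x c0 c1 c2 a b c : continuous (quad x c0 c1 c2 a b c).
Proof.
have c1' : continuous (fun y : E => y.1 - x.1).
  by move=> y; apply: cvgB; [exact: fst_continuous|exact: cvg_cst].
have c2' : continuous (fun y : E => y.2 - x.2).
  by move=> y; apply: cvgB; [exact: snd_continuous|exact: cvg_cst].
move=> y; apply: cvgD; last first.
  by apply: cvgM; [exact: cvg_cst|apply: cvgM; exact: c2'].
apply: cvgD; last first.
  by apply: cvgM; [exact: cvg_cst|apply: cvgM; [exact: c1'|exact: c2']].
apply: cvgD; last first.
  by apply: cvgM; [exact: cvg_cst|apply: cvgM; exact: c1'].
apply: cvgD; last by apply: cvgM; [exact: cvg_cst|exact: c2'].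
apply: cvgD; first exact: cvg_cst.
by apply: cvgM; [exact: cvg_cst|exact: c1'].
Qed.

Lemma Ck_quad k x c0 c1 c2 a b c : Ck k (quad x c0 c1 c2 a b c).
Proof.
move=> s _; have [d0 [d1 [d2 [u [v [w ->]]]]]] := dpart_quad s x c0 c1 c2 a b c.
split=> [|_ i y]; first exact: quad_continuous.
exact: (derive_quad _ _ _ _ _ _ _ i y).1.
Qed.

Lemma inflap_quad x c0 c1 c2 a b c :
  inflap (quad x c0 c1 c2 a b c) x = qf (2 * a, b, 2 * c) (c1, c2).
Proof.
have D1 i : dpart [:: i] (quad x c0 c1 c2 a b c) =
    if i then quad x c2 b (2 * c) 0 0 0 else quad x c1 (2 * a) b 0 0 0.
  apply/funext => y; have [_] := derive_quad x c0 c1 c2 a b c i y.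
  by case: i => /= ->.
have D2 i j : dpart [:: i; j] (quad x c0 c1 c2 a b c) x =
    if j then (if i then 2 * c else b) else (if i then b else 2 * a).
  transitivity ('D_(e_ i) (dpart [:: j] (quad x c0 c1 c2 a b c)) x) => //.
  rewrite D1; case: j.
    have [_ ->] := derive_quad x c2 b (2 * c) 0 0 0 i x.
    by rewrite /quad !subrr; case: i; ring.
  have [_ ->] := derive_quad x c1 (2 * a) b 0 0 0 i x.
  by rewrite /quad !subrr; case: i; ring.
rewrite /inflap; under eq_bigr do under eq_bigr do rewrite D2 !D1.
rewrite !big_bool /quad !subrr /qf.
move: c1 c2 a b c {D1 D2} => u1 u2 u3 u4 u5 /=; ring.
Qed.

(** Adding e' |y - x|^2 to a Taylor polynomial that bounds [f] up to this error makes [x] a true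
    local maximum of the difference, so it is enough to test with quadratic polynomials. *)
Lemma jsub_test (O : set E) f :
  (forall x c1 c2 a b c, O x ->
    (\forall y \near x, f y - quad x 0 c1 c2 a b c y <= f x - quad x 0 c1 c2 a b c x) ->
    0 <= qf (2 * a, b, 2 * c) (c1, c2)) -> jsub O f.
Proof.
move=> H x p [[a b] c] Ox up; apply/ler_addgt0Pl => e e0.
have pp0 : 0 < dot p p + 1 by have := dotxx_ge0 p; lra.
(* The added term raises the form at [p] by 2 e' |p|^2, which is at most [e]. *)
pose e' := e / (dot p p + 1) / 2.
have e'0 : 0 < e' by rewrite !divr_gt0.
have /(_ Ox) := H x p.1 p.2 (a / 2 + e') b (c / 2 + e').
have -> : qf (2 * (a / 2 + e'), b, 2 * (c / 2 + e')) (p.1, p.2)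
   = qf (a, b, c) p + 2 * e' * dot p p by rewrite /qf /dot /=; field.
move=> /(_ _)/le_trans; apply; last first.
  rewrite addrC lerD2r.
  have -> : 2 * e' * dot p p = e * (dot p p / (dot p p + 1)).
    by rewrite /e'; field; rewrite gt_eqF.
  rewrite ger_pMr // ler_pdivrMr //; lra.
apply/nbhs_enormP; have [d d0 dP] := up _ e'0.
exists d => // y /dP; rewrite [x + _]addrC subrK => /le_trans.
move=> /(_ (f x + quad x 0 p.1 p.2 (a / 2 + e') b (c / 2 + e') y)) U.
rewrite lerBlDr; apply: le_trans (U _) _.
  rewrite le_eqVlt; apply/orP; left; apply/eqP.
  by rewrite /quad /qf /dot !vE /=; field.
by rewrite /quad !subrr; (clear -R; lra).
Qed.

Lemma visc_sub_jsub (O : set E) f : visc_sub O f -> jsub O f.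
Proof.
move=> vf; apply: jsub_test => x c1 c2 a b c Ox H.
by rewrite -(inflap_quad x 0); apply: vf => //; exact: Ck_quad.
Qed.

Lemma visc_super_jsub (O : set E) f : visc_super O f -> jsub O (fun x => - f x).
Proof.
move=> vf; apply: jsub_test => x c1 c2 a b c Ox H.
have := vf x (quad x 0 (- c1) (- c2) (- a) (- b) (- c)) Ox.
rewrite inflap_quad => /(_ (@Ck_quad 2 _ _ _ _ _ _ _))/(_ _).
have -> : qf (2 * - a, - b, 2 * - c) (- c1, - c2) = - qf (2 * a, b, 2 * c) (c1, c2).
  by rewrite /qf /=; ring.
rewrite oppr_le0; apply.
by apply: filterS H => y; rewrite /quad; lra.
Qed.

Lemma jet2_cont f x p A : jet2 f x p A -> {for x, continuous f}.
Proof.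
move=> j; apply/continuous_enormP => e e0.
have [d d0 dP] := j _ (ltr01).
pose C := enorm p + (`|A.1.1| + 2 * `|A.1.2| + `|A.2|) + 1.
have A0 : 0 <= `|A.1.1| + 2 * `|A.1.2| + `|A.2| by rewrite !addr_ge0 // mulr_ge0.
have C0 : 0 < C by rewrite /C; have := enorm_ge0 p; lra.
exists (Num.min d (Num.min 1 (e / C / 2))).
  by rewrite !lt_min d0 ltr01 !divr_gt0.
move=> y; rewrite !lt_min => /andP[yd /andP[y1 yC]].
have := dP _ yd; rewrite [x + _]addrC subrK mul1r; move: (y - x) yd y1 yC => h yd y1 yC.
have h0 := enorm_ge0 h.
have hh : dot h h <= enorm h by rewrite -enorm_sqr expr2 ler_piMl // ltW.
have hq : `|qf A h / 2| <= (`|A.1.1| + 2 * `|A.1.2| + `|A.2|) * enorm h.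
  have f1 := fst_le_enorm h; have f2 := snd_le_enorm h.
  have g1 : `|h.1 ^+ 2| <= enorm h.
    by rewrite normrX expr2; apply: le_trans (ler_pM _ _ f1 f1) _ => //; rewrite ler_piMl // ltW.
  have g2 : `|h.1 * h.2| <= enorm h.
    by rewrite normrM; apply: le_trans (ler_pM _ _ f1 f2) _ => //; rewrite ler_piMl // ltW.
  have g3 : `|h.2 ^+ 2| <= enorm h.
    by rewrite normrX expr2; apply: le_trans (ler_pM _ _ f2 f2) _ => //; rewrite ler_piMl // ltW.
  rewrite normrM [`|2^-1|]ger0_norm ?invr_ge0 // ler_pdivrMr // /qf.
  apply: le_trans (ler_normD _ _) _.
  rewrite (mulrDl _ _ (enorm h)) (mulrDl _ _ (enorm h)).
  apply: (@le_trans _ _ (`|A.1.1| * enorm h + 2 * `|A.1.2| * enorm h + `|A.2| * enorm h)); last first.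
    have := mulr_ge0 (normr_ge0 A.1.1) h0; have := mulr_ge0 (normr_ge0 A.1.2) h0.
    have := mulr_ge0 (normr_ge0 A.2) h0; (clear -R; lra).
  apply: lerD; last by rewrite normrM ler_wpM2l.
  apply: le_trans (ler_normD _ _) _; apply: lerD; first by rewrite normrM ler_wpM2l.
  by rewrite normrM [`|2 * _|]normrM (ger0_norm (_ : 0 <= 2)) // ler_wpM2l // mulr_ge0.
have hp : `|dot p h| <= enorm p * enorm h by exact: dot_abs_le.
move=> H.
have : `|f y - f x| <= C * enorm h.
  rewrite /C -(subrK (qf A h / 2) (f y - f x)) -(subrK (dot p h) (f y - f x - _)).
  rewrite (_ : f y - f x - qf A h / 2 - dot p h = f y - f x - dot p h - qf A h / 2); last by ring.
  apply: le_trans (ler_normD _ _) _.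
  rewrite (mulrDl (enorm p + _) 1) mul1r (mulrDl (enorm p)).
  by have := ler_normD (f y - f x - dot p h - qf A h / 2) (dot p h); (clear -hh hq hp H; lra).
move/le_lt_trans; apply.
by rewrite mulrC -ltr_pdivlMr //; apply: lt_le_trans yC _; rewrite ler_pdivrMr // ler_peMr ?divr_ge0 ?ltW //; (clear -R; lra).
Qed.

End jets.

(** * Second-order chain rule and the comparison principle *)

Section comparison.
Context {R : realType}.
Local Notation E := (R * R)%type.
Implicit Types (x y z p q h : E) (A : R * R * R) (f w : E -> R) (F : R -> R).

Definition jet1 F (t a b : R) : Prop := forall e, 0 < e -> exists2 d, 0 < d &
  forall s, `|s| < d -> `|F (t + s) - F t - a * s - b * s ^+ 2 / 2| <= e * s ^+ 2.

(** Chain rule: the Hessian of F o f is F' D^2 f + F'' (Df)(Df)^T, with [a] for F' and [b] for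
    F''. *)
Definition comp_hess (a b : R) p A : R * R * R :=
  (a * A.1.1 + b * p.1 ^+ 2, a * A.1.2 + b * (p.1 * p.2), a * A.2 + b * p.2 ^+ 2).

Lemma qf_comp_hess a b p A h :
  qf (comp_hess a b p A) h = a * qf A h + b * dot p h ^+ 2.
Proof. by rewrite /qf /comp_hess /dot /=; ring. Qed.

Definition qfC A := `|A.1.1| + 2 * `|A.1.2| + `|A.2|.

Lemma qfC_ge0 A : 0 <= qfC A.
Proof. by rewrite /qfC !addr_ge0 // mulr_ge0. Qed.

Lemma qf_le A h : `|qf A h| <= qfC A * dot h h.
Proof.
have g1 : `|h.1 ^+ 2| <= dot h h.
  by rewrite normrX real_normK ?num_real // /dot -!expr2 lerDl sqr_ge0.
have g3 : `|h.2 ^+ 2| <= dot h h.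
  by rewrite normrX real_normK ?num_real // /dot -!expr2 lerDr sqr_ge0.
have g2 : `|h.1 * h.2| <= dot h h.
  have f1 := fst_le_enorm h; have f2 := snd_le_enorm h.
  by rewrite normrM -enorm_sqr expr2; apply: ler_pM.
rewrite /qf /qfC (mulrDl _ _ (dot h h)) (mulrDl _ _ (dot h h)).
apply: le_trans (ler_normD _ _) _; apply: lerD; last by rewrite normrM ler_wpM2l.
apply: le_trans (ler_normD _ _) _; apply: lerD; first by rewrite normrM ler_wpM2l.
by rewrite normrM [`|2 * _|]normrM (ger0_norm (_ : 0 <= 2)) // ler_wpM2l // mulr_ge0.
Qed.

(** Inserting the increment s of [f] into the expansion of [F] leaves three remainders: that of [F],
    that of [f] times [a], and the replacement of s^2 by <p, h>^2. Since s = O(|h|) and s - <p, h> =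
    O(|h|^2), each is at most e / 4 |h|^2 for small [h]. *)
Lemma jet2_comp F f x (a b : R) p A : jet1 F (f x) a b -> jet2 f x p A ->
  jet2 (fun y => F (f y)) x (a *: p) (comp_hess a b p A).
Proof.
move=> jF jf e e0.
pose C := enorm p + qfC A + 1.
have C1 : 1 <= C by rewrite /C; have := enorm_ge0 p; have := qfC_ge0 A; lra.
have CC0 : 0 < C ^+ 2 by rewrite exprn_gt0 //; lra.
pose e1 := e / C ^+ 2 / 4.
have e10 : 0 < e1 by rewrite !divr_gt0.
pose e2 := Num.min 1 (e / (`|a| + 1) / 4).
have a1 : 0 < `|a| + 1 by have := normr_ge0 a; lra.
have e20 : 0 < e2 by rewrite lt_min ltr01 !divr_gt0.
have [d1 d10 H1] := jF _ e10; have [d2 d20 H2] := jf _ e20.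
have b1 : 0 < `|b| + 1 by have := normr_ge0 b; lra.
exists (Num.min (Num.min d2 1) (Num.min (d1 / C) (e / (`|b| + 1) / C ^+ 2 / 4))).
  by rewrite !lt_min d20 ltr01 !divr_gt0 //; (clear -C1; lra).
move=> h; rewrite !lt_min => /andP[/andP[hd2 h1] /andP[hd1 hb]].
have h0 := enorm_ge0 h; have hh := dotxx_ge0 h.
pose s := f (x + h) - f x.
have fE : f (x + h) = f x + s by rewrite /s addrCA subrr addr0.
have Hs := H2 _ hd2.
have q1 := qf_le A h; have p1 := dot_abs_le p h.
have hle : dot h h <= enorm h by rewrite -enorm_sqr expr2 ler_piMl // ltW.
have e21 : e2 <= 1 by rewrite ge_min lexx.
have e2a : e2 <= e / (`|a| + 1) / 4 by rewrite ge_min lexx orbT.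
have sp : `|s - dot p h| <= C * dot h h.
  have : `|s - dot p h| <= `|s - dot p h - qf A h / 2| + `|qf A h / 2|.
    by rewrite -{1}(subrK (qf A h / 2) (s - dot p h)) ler_normD.
  move/le_trans; apply; rewrite /C [in X in _ <= X](mulrDl _ 1) (mulrDl _ (qfC A)) mul1r.
  have q2 : `|qf A h / 2| <= qfC A * dot h h.
    rewrite normrM [`|2^-1|]ger0_norm ?invr_ge0 // ler_pdivrMr //.
    by have := mulr_ge0 (qfC_ge0 A) hh; (clear -q1; lra).
  have : e2 * dot h h <= dot h h by rewrite ler_piMl.
  have := mulr_ge0 (enorm_ge0 p) hh; move: Hs; rewrite -/s; (clear -q2; lra).
have sC : `|s| <= C * enorm h.
  have : `|s| <= `|s - dot p h - qf A h / 2| + `|qf A h / 2| + `|dot p h|.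
    rewrite -{1}(subrK (dot p h) s) -{1}(subrK (qf A h / 2) (s - dot p h)).
    by apply: le_trans (ler_normD _ _) _; rewrite lerD2r ler_normD.
  move/le_trans; apply; rewrite /C [in X in _ <= X](mulrDl _ 1) (mulrDl _ (qfC A)) mul1r.
  have q2 : `|qf A h / 2| <= qfC A * enorm h.
    rewrite normrM [`|2^-1|]ger0_norm ?invr_ge0 // ler_pdivrMr //.
    have := ler_wpM2l (qfC_ge0 A) hle; have := mulr_ge0 (qfC_ge0 A) h0; (clear -q1; lra).
  have : e2 * dot h h <= enorm h by apply: le_trans hle; rewrite ler_piMl.
  move: Hs; rewrite -/s; (clear -p1 q2; lra).
have sd1 : `|s| < d1.
  by apply: le_lt_trans sC _; rewrite mulrC -ltr_pdivlMr //; lra.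
have Fs := H1 _ sd1; rewrite -fE in Fs.
have s2 : s ^+ 2 <= C ^+ 2 * dot h h.
  rewrite -enorm_sqr -exprMn -[s ^+ 2]real_normK ?num_real //.
  by rewrite ler_pXn2r ?nnegrE // mulr_ge0 //; (clear -C1; lra).
have T1 : e1 * s ^+ 2 <= e / 4 * dot h h.
  apply: (@le_trans _ _ (e1 * (C ^+ 2 * dot h h))); first by rewrite ler_wpM2l // ltW.
  by rewrite /e1 le_eqVlt; apply/orP; left; apply/eqP; field; rewrite gt_eqF //; (clear -C1; lra).
have T2 : `|a * (s - dot p h - qf A h / 2)| <= e / 4 * dot h h.
  rewrite normrM; apply: (@le_trans _ _ (`|a| * (e2 * dot h h))); first by rewrite ler_wpM2l.
  apply: (@le_trans _ _ ((`|a| + 1) * (e / (`|a| + 1) / 4 * dot h h))); last first.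
    by rewrite le_eqVlt; apply/orP; left; apply/eqP; field; rewrite gt_eqF //; lra.
  by apply: ler_pM => //; [rewrite mulr_ge0 // ltW|(clear -R; lra)|rewrite ler_wpM2r].
have T3 : `|b * (s ^+ 2 - dot p h ^+ 2) / 2| <= e / 4 * dot h h.
  rewrite subr_sqr.
  have sp2 : `|s + dot p h| <= 2 * C * enorm h.
    apply: le_trans (ler_normD _ _) _.
    have : enorm p * enorm h <= C * enorm h.
      by rewrite ler_wpM2r // /C; have := qfC_ge0 A; (clear -R; lra).
    clear -p1 sC; lra.
  rewrite !normrM [`|2^-1|]ger0_norm ?invr_ge0 //.
  apply: (@le_trans _ _ (`|b| * ((C * dot h h) * (2 * C * enorm h)) / 2)).
    by rewrite ler_wpM2r ?invr_ge0 // ler_wpM2l // ler_pM.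
  rewrite (_ : _ / 2 = `|b| * C ^+ 2 * enorm h * dot h h); last by field.
  rewrite ler_wpM2r //.
  apply: (@le_trans _ _ ((`|b| + 1) * C ^+ 2 * (e / (`|b| + 1) / C ^+ 2 / 4))); last first.
    by rewrite le_eqVlt; apply/orP; left; apply/eqP; field; rewrite !gt_eqF //; (clear -C1; lra).
  apply: ler_pM => //; first by rewrite mulr_ge0 // ltW.
    by rewrite ler_wpM2r //; (clear -CC0; lra).
  exact: ltW.
rewrite qf_comp_hess dotZl.
rewrite (_ : _ - _ = (F (f (x + h)) - F (f x) - a * s - b * s ^+ 2 / 2)
   + a * (s - dot p h - qf A h / 2) + b * (s ^+ 2 - dot p h ^+ 2) / 2); last by field.
apply: le_trans (ler_normD _ _) _.
have := ler_normD (F (f (x + h)) - F (f x) - a * s - b * s ^+ 2 / 2) (a * (s - dot p h - qf A h / 2)).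
have := mulr_ge0 (ltW e0) hh; move: T1 T2 T3 Fs; (clear -R; lra).
Qed.

Lemma jet1_quadratic (c0 c1 c2 t : R) :
  jet1 (fun s => c0 + c1 * s + c2 * s ^+ 2) t (c1 + 2 * c2 * t) (2 * c2).
Proof.
move=> e e0; exists 1 => // s _.
rewrite [X in `|X|](_ : _ = 0); last by field.
by rewrite normr0 mulr_ge0 ?sqr_ge0 // ltW.
Qed.

(* The perturbation w + k (B^2 - w^2), a strictly concave increasing function
   of w, turns the barrier w into a strict supersolution. *)
Lemma comparison (O : set E) f w (S : set E) (B m : R) x :
  jsub O f -> compact S -> {within S, continuous f} -> {within S, continuous w} ->
  (forall z, S z -> `|w z| <= B) ->
  (forall z, S z -> m < f z - w z -> [/\ O z, \forall y \near z, S y &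
     exists p A, [/\ jet2 w z p A, p != 0 & qf A p <= 0]]) ->
  S x -> f x <= w x + m.
Proof.
move=> jf cS cf cw wB H Sx; rewrite leNgt; apply/negP => fx.
have B0 : 0 <= B by apply: le_trans (wB _ Sx).
(* The first bound keeps the derivative 1 - 2 k w of the perturbation positive for |w| <= B; the
   second keeps the added term, at most k B^2, below the excess of [f] at [x]. *)
pose k := Num.min ((B + 1)^-1 / 4) ((f x - w x - m) / (B + 1) ^+ 2 / 2).
have B1 : 0 < B + 1 by lra.
have k0 : 0 < k by rewrite lt_min !divr_gt0 ?invr_gt0 // ?exprn_gt0 //; lra.
have kB : k * B < 1 / 2.
  apply: (@le_lt_trans _ _ ((B + 1)^-1 / 4 * (B + 1))).
    by apply: ler_pM => //; [exact: ltW|rewrite ge_min lexx|lra].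
  by rewrite mulrAC mulVf ?gt_eqF //; lra.
have kM : k * B ^+ 2 < f x - w x - m.
  apply: (@le_lt_trans _ _ ((f x - w x - m) / (B + 1) ^+ 2 / 2 * (B + 1) ^+ 2)).
    apply: ler_pM; [exact: ltW|exact: sqr_ge0|by rewrite ge_min lexx orbT|].
    by rewrite ler_pXn2r ?nnegrE //; lra.
  rewrite (_ : _ * _ = (f x - w x - m) / 2); last by field; rewrite gt_eqF.
  by lra.
pose g y := f y - (k * B ^+ 2 + 1 * w y + (- k) * w y ^+ 2).
have cg : {within S, continuous g}.
  move=> y; apply: cvgB; first exact: cf.
  apply: cvgD; last first.
    apply: cvgM; first exact: cvg_cst.
    by rewrite expr2; under eq_fun do rewrite expr2; apply: cvgM; exact: cw.
  apply: cvgD; first exact: cvg_cst.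
  by apply: cvgM; [exact: cvg_cst|exact: cw].
have [z Sz zmax] := compact_max2 (ex_intro _ x Sx) cS cg.
have wz2 : w z ^+ 2 <= B ^+ 2.
  by rewrite -[w z ^+ 2]real_normK ?num_real // ler_pXn2r ?nnegrE //; exact: wB.
have gz : m < f z - w z.
  have := zmax _ Sx; rewrite /g.
  have := ler_wpM2l (ltW k0) wz2; have := mulr_ge0 (ltW k0) (sqr_ge0 (w x)); lra.
have [Oz nz [p [A [jw p0 qp]]]] := H _ Sz gz.
have jW := jet2_comp (jet1_quadratic (k * B ^+ 2) 1 (- k) (w z)) jw.
set a := 1 + _ in jW.
have a0 : 0 < a.
  rewrite /a; have := wB _ Sz; rewrite ler_norml => /andP[_ wzB].
  have := ler_wpM2l (ltW k0) wzB; (clear -kB; lra).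
have : 0 <= qf (comp_hess a (2 * - k) p A) (a *: p).
  apply: (jf z _ _ Oz) => e e0.
  have [d d0 Hd] := jW _ e0.
  move: nz => /nbhs_enormP[d' d'0 Hd'].
  exists (Num.min d d'); first by rewrite lt_min d0.
  move=> h; rewrite lt_min => /andP[hd hd'].
  have Sh : S (z + h) by apply: Hd'; rewrite [z + h]addrC addrK.
  have := zmax _ Sh; have := Hd _ hd; rewrite /g ler_norml => /andP[_]; (clear -R; lra).
(* The perturbed barrier has infinity-Laplacian a^3 [qf A p] - 2 k a^2 |p|^4, which is negative
   because [p] is nonzero. *)
apply/negP; rewrite -ltNge qf_comp_hess dotZr.
have pp : 0 < dot p p by rewrite -enorm_sqr exprn_gt0 // enorm_gt0.
rewrite (_ : qf A (a *: p) = a ^+ 2 * qf A p); last by rewrite /qf !vE; ring.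
have := mulr_ge0 (exprn_ge0 3 (ltW a0)) (_ : 0 <= - qf A p); rewrite oppr_ge0 => /(_ qp).
have : 0 < k * (a * dot p p) ^+ 2 by rewrite mulr_gt0 // exprn_gt0 // mulr_gt0.
by rewrite !exprS; (clear -R; lra).
Qed.

Lemma mvt_le (G g : R -> R) (t s r M : R) : `|s - t| < r ->
  (forall v : R, `|v - t| < r -> is_derive v (1 : R) G (g v)) ->
  (forall v : R, `|v - t| <= `|s - t| -> `|g v| <= M) ->
  `|G s - G t| <= M * `|s - t|.
Proof.
move=> sr dG gM.
have main (a b : R) : a <= b -> (forall v, a <= v <= b -> `|v - t| <= `|s - t|) ->
    `|G b - G a| <= M * `|b - a|.
  move=> ab H.
  have dGab v : a <= v <= b -> is_derive v (1 : R) G (g v).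
    by move=> /H vs; apply: dG; apply: le_lt_trans sr.
  have [||c cab ->] := @MVT_segment _ G g a b ab.
  - by move=> v; rewrite in_itv /= => /andP[av vb]; apply: dGab; rewrite !ltW.
  - apply: derivable_within_continuous => v; rewrite in_itv /= => vab.
    by have [] := dGab v vab.
  rewrite normrM ler_wpM2r //; apply: gM; apply: H.
  by move: cab; rewrite in_itv.
have [ts|/ltW st] := leP t s.
- apply: main => // v /andP[tv vs]; rewrite !ger0_norm; lra.
- rewrite distrC [X in _ * X]distrC; apply: main => // v /andP[tv vs].
  rewrite !ler0_norm; (clear -tv vs; lra).
Qed.

(** Peano form of Taylor's formula. The second derivative exists at [t] only, so the mean value
    theorem is applied to [F] minus its quadratic polynomial, whose derivative is o(s). *)
Lemma jet1_derive F (F1 : R -> R) (t b r : R) : 0 < r ->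
  (forall v : R, `|v - t| < r -> is_derive v (1 : R) F (F1 v)) ->
  is_derive t (1 : R) F1 b -> jet1 F t (F1 t) b.
Proof.
move=> r0 dF dF1 e e0.
have [d1 d10 Hd1] : exists2 d, 0 < d & forall s, `|s| < d ->
    `|F1 (t + s) - F1 t - b * s| <= e * `|s|.
  have cv : (fun s : R => s^-1 *: (F1 (s *: 1 + t) - F1 t)) @ 0^' --> b.
    by case: dF1 => /cvg_ex [l Hl] <-; rewrite /derive (cvg_lim _ Hl).
  have [d /= d0 dP] : \forall s \near 0^', `|b - s^-1 *: (F1 (s *: 1 + t) - F1 t)| <= e.
    by move/cvgrPdist_le : cv; apply.
  exists d => // s sd; have [->|s0] := eqVneq s 0.
    by rewrite addr0 mulr0 subrr subr0 normr0 mulr0.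
  have := dP s; rewrite /= sub0r normrN => /(_ sd s0).
  rewrite /GRing.scale /= mulr1 [s + t]addrC => H'.
  rewrite (_ : _ - _ = - (s * (b - s^-1 * (F1 (t + s) - F1 t)))); last by field.
  by rewrite normrN normrM mulrC ler_wpM2r.
exists (Num.min d1 r); first by rewrite lt_min d10.
move=> s; rewrite lt_min => /andP[sd1 sr].
pose H := fun v : R => F v - F1 t * v - b / 2 * (v - t) ^+ 2.
have dH v : `|v - t| < r -> is_derive v (1 : R) H (F1 v - F1 t - b * (v - t)).
  move=> vr; have dFv := dF v vr; rewrite /H; apply: is_derive_eq.
  by rewrite /GRing.scale /=; field.
have := @mvt_le H (fun v => F1 v - F1 t - b * (v - t)) t (t + s) r (e * `|s|).
rewrite [t + s - t]addrC addKr => /(_ sr dH) /(_ _).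
rewrite (_ : H (t + s) - H t = F (t + s) - F t - F1 t * s - b * s ^+ 2 / 2); last first.
  by rewrite /H; field.
rewrite (_ : e * `|s| * `|s| = e * s ^+ 2); last first.
  by rewrite -[s ^+ 2]real_normK ?num_real // expr2 mulrA.
apply=> v vs.
have := Hd1 (v - t); rewrite [t + _]addrC subrK => /(_ (le_lt_trans vs sd1)).
by move/le_trans; apply; rewrite ler_wpM2l // ltW.
Qed.

End comparison.

(** * Barriers: cones, tilted planes, quotients of affine functions *)

Section barriers.
Context {R : realType}.
Local Notation E := (R * R)%type.
Implicit Types (x y z p q h a b n d : E) (A : R * R * R) (f w : E -> R).

Lemma jet2_dotxx x z :
  jet2 (fun y => dot (y - x) (y - x)) z (2 *: (z - x)) (2, 0, 2).
Proof.
move=> e e0; exists 1 => // h _.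
rewrite [X in `|X|](_ : _ = 0) ?normr0 ?mulr_ge0 ?dotxx_ge0 ?ltW //.
by rewrite /dot /qf !vE /=; field.
Qed.

Lemma jet1_sqrt (c L t : R) : 0 < t ->
  jet1 (fun s => c + L * Num.sqrt s) t (L * (2 * Num.sqrt t)^-1)
    (- (L / 4 / (t * Num.sqrt t))).
Proof.
move=> t0.
have pos v : `|v - t| < t -> 0 < v by rewrite ltr_norml => /andP[]; lra.
apply: (@jet1_derive R (fun s => c + L * Num.sqrt s) (fun v => L * (2 * Num.sqrt v)^-1) t _ t) => //.
- move=> v /pos v0; have sv := is_derive1_sqrt v0.
  have D : is_derive v (1 : R) (cst c + L *: (@Num.sqrt R)) (0 + L *: (2 * Num.sqrt v)^-1).
    exact: (is_deriveD (is_derive_cst c v 1) (is_deriveZ L sv)).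
  by rewrite add0r in D.
- have sv := is_derive1_sqrt t0.
  have s0 : 0 < Num.sqrt t by rewrite sqrtr_gt0.
  have nz : 2 * Num.sqrt t != 0 by rewrite mulf_neq0 // gt_eqF.
  have dV : is_derive t (1 : R) (fun v => (2 * Num.sqrt v)^-1)
      (- (2 * Num.sqrt t) ^- 2 *: (2 *: (2 * Num.sqrt t)^-1)).
    by apply: is_deriveV.
  have D : is_derive t (1 : R) (L *: (fun v : R => (2 * Num.sqrt v)^-1))
      (L *: (- (2 * Num.sqrt t) ^- 2 *: (2 *: (2 * Num.sqrt t)^-1))) by exact: (is_deriveZ L dV).
  rewrite (_ : - (L / 4 / (t * Num.sqrt t)) =
    L *: (- (2 * Num.sqrt t) ^- 2 *: (2 *: (2 * Num.sqrt t)^-1))) //.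
  have tE : t = Num.sqrt t ^+ 2 by rewrite sqr_sqrtr // ltW.
  rewrite /GRing.scale /=; move: (Num.sqrt t) s0 tE => w w0 ->.
  by field; rewrite gt_eqF.
Qed.

(** The cone is [c + L * sqrt] composed with the squared distance; the chain rule gives its jet, and
    its infinity-Laplacian is exactly 0. *)
Lemma jet2_cone x z (c L : R) : z != x -> 0 < L -> exists p A,
  [/\ jet2 (fun y => c + L * enorm (y - x)) z p A, p != 0 & qf A p <= 0].
Proof.
move=> zx L0; have d0 : 0 < enorm (z - x) by rewrite enorm_gt0 // subr_eq0.
have dd0 : 0 < dot (z - x) (z - x) by rewrite -enorm_sqr exprn_gt0.
have := @jet2_comp R _ (fun y => dot (y - x) (y - x)) z _ _ _ _ (jet1_sqrt c L dd0) (jet2_dotxx x z).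
set a := L * _; set b := - (L / 4 / _) => j.
have a0 : 0 < a by rewrite mulr_gt0 // invr_gt0 mulr_gt0.
exists (a *: (2 *: (z - x))), (comp_hess a b (2 *: (z - x)) (2, 0, 2)); split => //.
  by rewrite scalerA scaler_eq0 negb_or subr_eq0 zx andbT mulf_neq0 // gt_eqF.
rewrite qf_comp_hess !dotZl !dotZr.
rewrite (_ : qf _ _ = 8 * a ^+ 2 * dot (z - x) (z - x)); last first.
  by rewrite /qf /dot !vE /=; ring.
rewrite le_eqVlt; apply/orP; left; apply/eqP.
rewrite /a /b -[Num.sqrt (dot _ _)]/(enorm (z - x)) -!enorm_sqr.
by field; rewrite gt_eqF.
Qed.

(** Comparison with cones. The vertex, where the cone is not smooth, is no contact point since [f]
    and the cone agree there. *)
Lemma cone_above (O : set E) f x (r L : R) : jsub O f -> continuous f ->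
  (forall y, enorm (y - x) <= r -> O y) -> 0 <= L ->
  (forall y, enorm (y - x) = r -> f y <= f x + L * r) ->
  forall y, enorm (y - x) <= r -> f y <= f x + L * enorm (y - x).
Proof.
move=> jf cf HO L0 fr y yr; apply/ler_addgt0Pr => e e0.
have r0 : 0 <= r by apply: le_trans yr; exact: enorm_ge0.
(* Raising the slope makes it positive even for [L] = 0, so that the gradient of the cone does not
   vanish; the cost is at most [e] on the ball. *)
pose M := L + e / (r + 1).
have r1 : 0 < r + 1 by lra.
have M0 : 0 < M by rewrite ltr_wpDl // divr_gt0.
have ML : L <= M by rewrite lerDl divr_ge0 // ltW.
have cw : continuous (fun z : E => f x + M * enorm (z - x)).
  apply: (@enorm_lipschitz_continuous _ _ M) => u v.
  rewrite [X in `|X|](_ : _ = M * (enorm (u - x) - enorm (v - x))); last by ring.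
  rewrite normrM gtr0_norm // ler_wpM2l ?(ltW M0) //.
  by apply: le_trans (enorm_dist _ _) _; rewrite opprB addrA subrK.
have := @comparison R O f (fun z => f x + M * enorm (z - x)) (cball x r)
  (`|f x| + M * r) 0 y jf (@cball_compact _ x r) (continuous_subspaceT cf) (continuous_subspaceT cw).
rewrite addr0 => /(_ _ _ yr) H.
apply: le_trans (H _ _) _.
- move=> z zr; apply: le_trans (ler_normD _ _) _; rewrite lerD2l ger0_norm.
    by rewrite ler_wpM2l // ltW.
  by rewrite mulr_ge0 ?enorm_ge0 // ltW.
- move=> z zr fz.
  have zx : z != x.
    by apply/eqP => zx; move: fz; rewrite zx subrr enorm0 mulr0 addr0 subrr ltxx.
  have zr' : enorm (z - x) < r.
    rewrite lt_neqAle zr andbT; apply/eqP => zE.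
    have := fr _ zE; have := ler_wpM2r r0 ML; move: fz; rewrite zE; (clear -R; lra).
  split; first exact: HO.
    apply/nbhs_enormP; exists (r - enorm (z - x)); first by rewrite subr_gt0.
    by move=> u uz; rewrite /cball /=; have := enorm_triangle3 u z x; (clear -uz; lra).
  exact: jet2_cone.
rewrite -addrA lerD2l /M mulrDl lerD2l -mulrA ger_pMr //.
by rewrite mulrC ler_pdivrMr // mul1r; lra.
Qed.

(** A constant has zero gradient and is no admissible barrier in [comparison]; it is tilted by
    [t * z.1], which is at most e / 2 in absolute value on the ball of radius M + 1. *)
Lemma max_principle (O : set E) f (M m : R) : jsub O f -> continuous f ->
  (forall z, O z -> enorm z <= M) -> (forall z, ~ O z -> f z <= m) ->
  forall x, f x <= m.
Proof.
move=> jf cf OM fm x; have [Ox|/fm//] := pselect (O x).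
apply/ler_addgt0Pr => e e0.
have M0 : 0 <= M by apply: le_trans (OM _ Ox); exact: enorm_ge0.
pose t := e / (M + 1) / 2.
have M1 : 0 < M + 1 by lra.
have t0 : 0 < t by rewrite !divr_gt0.
have tM : t * (M + 1) = e / 2 by rewrite /t; field; rewrite gt_eqF.
have cw : continuous (fun z : E => m + t * z.1).
  apply: (@enorm_lipschitz_continuous _ _ t) => u v.
  rewrite [X in `|X|](_ : _ = t * (u - v).1); last by rewrite !vE; ring.
  by rewrite normrM gtr0_norm // ler_wpM2l ?fst_le_enorm ?(ltW t0).
have b1 z : enorm z <= M + 1 -> `|t * z.1| <= e / 2.
  move=> zM; rewrite normrM gtr0_norm // -tM ler_wpM2l ?(ltW t0) //.
  exact: le_trans (fst_le_enorm z) zM.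
have := @comparison R O f (fun z => m + t * z.1) (cball 0 (M + 1))
  (`|m| + e / 2) (e / 2) x jf (@cball_compact _ 0 (M + 1)) (continuous_subspaceT cf) (continuous_subspaceT cw).
have xS : cball (0 : E) (M + 1) x.
  by rewrite /cball /= subr0; have := OM _ Ox; lra.
move=> /(_ _ _ xS) H; apply: le_trans (H _ _) _.
- move=> z; rewrite /cball /= subr0 => zr; apply: le_trans (ler_normD _ _) _.
  by rewrite lerD2l b1.
- move=> z; rewrite /cball /= subr0 => zr fz.
  have Oz : O z.
    apply: contrapT => /fm; have := b1 _ zr; rewrite ler_norml => /andP[]; (clear -fz; lra).
  split => //.
    apply/nbhs_enormP; exists 1 => // u uz; rewrite /cball /= subr0.
    have := enorm_triangle (u - z) z; rewrite subrK; have := OM _ Oz; (clear -uz; lra).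
  exists (t, 0), (0, 0, 0); split; last by rewrite /qf /=; (clear -R; lra).
  + move=> e' e'0; exists 1 => // h _.
    rewrite [X in `|X|](_ : _ = 0) ?normr0 ?mulr_ge0 ?dotxx_ge0 ?ltW //.
    by rewrite /dot /qf !vE /=; ring.
  + by apply/eqP => -[] /eqP; rewrite gt_eqF.
have := b1 x; rewrite ler_norml => /(_ _)/andP[|_]; first by have := OM _ Ox; (clear -R; lra).
by clear -R; lra.
Qed.

(** With s = <d, h> / D the increment of the quotient is exactly <q, h> / (1 + s). The geometric
    series gives the quadratic term - <q, h> s and the remainder <q, h> s^2 / (1 + s). *)
Lemma jet2_ratio n d (n0 d0 : R) z : 0 < d0 + dot d z ->
  let D := d0 + dot d z in let v := (n0 + dot n z) / D in
  let q := D^-1 *: (n - v *: d) in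
  jet2 (fun y => (n0 + dot n y) / (d0 + dot d y)) z q
    (- (2 * (q.1 * d.1) / D), - ((q.1 * d.2 + q.2 * d.1) / D), - (2 * (q.2 * d.2) / D)).
Proof.
move=> D0 D v q e e0.
pose C := (enorm q + 1) * (enorm d / D + 1) ^+ 2.
have C0 : 0 < C.
  by rewrite mulr_gt0 ?exprn_gt0 // ltr_wpDl ?divr_ge0 ?enorm_ge0 // ltW.
have dD : 0 <= enorm d / D by rewrite divr_ge0 ?enorm_ge0 // ltW.
exists (Num.min ((enorm d / D + 1)^-1 / 2) (e / C / 2)).
  by rewrite lt_min !divr_gt0 // invr_gt0; lra.
move=> h; rewrite lt_min => /andP[hd hC].
pose s := dot d h / D.
have h0 := enorm_ge0 h.
have s1 : `|s| <= (enorm d / D) * enorm h.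
  rewrite normrM normfV (gtr0_norm D0) mulrAC ler_wpM2r ?invr_ge0 ?(ltW D0) //.
  exact: dot_abs_le.
have s2 : `|s| <= 1 / 2.
  apply: le_trans s1 _.
  apply: (@le_trans _ _ ((enorm d / D + 1) * ((enorm d / D + 1)^-1 / 2))).
    by apply: ler_pM => //; [lra|exact: ltW].
  by rewrite mulrA divff ?gt_eqF //; lra.
have s3 : 1 / 2 <= 1 + s by move: s2; rewrite ler_norml => /andP[]; lra.
have D1 : d0 + dot d (z + h) = D * (1 + s).
  by rewrite /s /D dotDr; field; rewrite gt_eqF.
rewrite D1.
rewrite [X in `|X|](_ : _ = dot q h * s ^+ 2 / (1 + s)); last first.
  rewrite /qf /= (_ : dot n (z + h) = dot n z + dot n h) ?dotDr //.
  rewrite (_ : - (2 * (q.1 * d.1) / D) * h.1 ^+ 2 +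
    2 * - ((q.1 * d.2 + q.2 * d.1) / D) * (h.1 * h.2) +
    - (2 * (q.2 * d.2) / D) * h.2 ^+ 2 = - 2 * (dot q h * s)); last first.
    by rewrite /s /dot; field; rewrite gt_eqF.
  have -> : (n0 + dot n z) / (d0 + dot d z) = v by [].
  have -> : (n0 + (dot n z + dot n h)) / (D * (1 + s)) = v + dot q h / (1 + s).
    have -> : n0 + (dot n z + dot n h) = v * D + dot n h.
      by rewrite /v; field; rewrite gt_eqF.
    rewrite /q dotZl dotDl dotNl dotZl.
    have -> : dot d h = s * D by rewrite /s; field; rewrite gt_eqF.
    by field; rewrite !gt_eqF //; (clear -s3; lra).
  by field; rewrite gt_eqF //; (clear -s3; lra).
have qh : `|dot q h| <= enorm q * enorm h by exact: dot_abs_le.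
have i2 : (1 + s)^-1 <= 2.
  by rewrite -(invrK 2) lef_pV2 ?posrE ?invr_gt0 //; (clear -s3; lra).
have i0 : 0 <= (1 + s)^-1 by rewrite invr_ge0; (clear -s3; lra).
rewrite normrM normrM normfV (@ger0_norm _ (1 + s)); last by clear -s3; lra.
rewrite normrX.
have s4 : `|s| ^+ 2 <= (enorm d / D + 1) ^+ 2 * dot h h.
  rewrite -enorm_sqr -exprMn ler_pXn2r ?nnegrE ?mulr_ge0 //; last by clear -dD; lra.
  by apply: le_trans s1 _; rewrite ler_wpM2r //; (clear -R; lra).
apply: (@le_trans _ _ ((enorm q + 1) * enorm h * ((enorm d / D + 1) ^+ 2 * dot h h) * 2)).
  apply: ler_pM => //.
  apply: ler_pM => //.
  by apply: le_trans qh _; rewrite ler_wpM2r //; (clear -R; lra).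
rewrite (_ : _ * 2 = (C * enorm h * 2) * dot h h); last by rewrite /C; ring.
rewrite ler_wpM2r ?dotxx_ge0 //.
have := ler_wpM2l (ltW C0) (ltW hC).
rewrite (_ : C * (e / C / 2) = e / 2); last by field; rewrite gt_eqF.
by clear -R; lra.
Qed.

End barriers.

(** * Comparison in wedges *)

Section wedge.
Context {R : realType}.
Local Notation E := (R * R)%type.
Implicit Types (x y z a b : E) (U : E -> R) (k s t v : R).

(* In the wedge between two lines, wprof k v is the angle rescaled to [-1, 1];
   k = 0 is the degenerate case of two parallel lines. *)
Definition wprof k v : R := if k == 0 then v else atan (k * v) / atan k.

Lemma atan_mvt s t : s <= t -> exists2 c, s <= c <= t & atan t - atan s = (t - s) / (1 + c ^+ 2).
Proof.
move=> st; have [|c] := @MVT_segment R atan (fun u : R => (1 + u ^+ 2)^-1) s t st.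
  by apply: continuous_subspaceT => x; exact: continuous_atan.
by rewrite in_itv /= => cst ->; exists c => //; rewrite mulrC.
Qed.

Lemma atan_gt0 k : 0 < k -> 0 < atan k.
Proof. by move=> k0; rewrite -atan0; exact: lt_atan. Qed.

(** The last equation is the differential equation W'' (1 + k^2 v^2) + 2 k^2 v W' = 0 of the
    arctangent profile; in [wedge] it cancels the infinity-Laplacian. *)
Lemma wprof_jet k v : 0 <= k -> exists p q, [/\ jet1 (wprof k) v p q, 0 < p &
  2 * p * v * k ^+ 2 + q * (1 + k ^+ 2 * v ^+ 2) = 0].
Proof.
rewrite le_eqVlt => /orP[/eqP <-|k0].
  exists 1, 0; split => //; last by ring.
  have := @jet1_quadratic R 0 1 0 v.
  rewrite (_ : (fun s => _) = wprof 0); last first.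
    by apply/funext => s; rewrite /wprof eqxx; ring.
  by rewrite !(mulr0, mul0r, addr0).
have A0 := atan_gt0 k0.
have wE : wprof k = (atan k)^-1 *: (atan \o ( *%R k)).
  by apply/funext => s; rewrite /wprof gt_eqF //= [RHS]mulrC.
have sq (x : R) : 0 < 1 + (k * x) ^+ 2 by rewrite ltr_pwDl // sqr_ge0.
have dl (x : R) : is_derive x (1 : R) ( *%R k : R -> R) k.
  have : is_derive x (1 : R) (k *: (@id R)) (k *: (1 : R)).
    exact: (is_deriveZ k (is_derive_id x (1 : R))).
  by rewrite /GRing.scale /= mulr1.
pose F1 (x : R) := k / atan k * (1 + (k * x) ^+ 2)^-1.
exists (F1 v), (- (2 * k ^+ 3 * v / atan k / (1 + (k * v) ^+ 2) ^+ 2)); split.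
- apply: (@jet1_derive R (wprof k) F1 v _ 1) => //.
    move=> x _; rewrite wE.
    have := is_deriveZ (atan k)^-1 (@is_derive1_comp R atan ( *%R k) x _ _ (is_derive1_atan (k * x)) (dl x)).
    rewrite (_ : _ *: _ = F1 x) //.
    by rewrite /F1 /GRing.scale /=; field; rewrite !gt_eqF.
  have dX := @is_deriveX R R ( *%R k : R -> R) 2 v (1 : R) k (dl v).
  have dq := is_deriveD (is_derive_cst (1 : R) v (1 : R)) dX.
  have nz : (cst 1 + (( *%R k : R -> R) ^+ 2)) v != 0.
    by rewrite gt_eqF //; have := sq v.
  have dV := @is_deriveV R _ v _ (1 : R) nz dq.
  have dF : is_derive v (1 : R) F1 _ := is_deriveZ (k / atan k) dV.
  rewrite (_ : - _ = (k / atan k) *: (- (cst 1 + ( *%R k : R -> R) ^+ 2) v ^- 2 *: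
     (0 + (2 * (k * v) ^+ 2.-1) *: k))) //.
  rewrite /GRing.scale /= (_ : (cst 1 + (( *%R k : R -> R) ^+ 2)) v = 1 + (k * v) ^+ 2) //.
  by field; rewrite !gt_eqF.
- by rewrite mulr_gt0 ?divr_gt0 // invr_gt0.
- by rewrite /F1; field; rewrite !gt_eqF.
Qed.

Lemma wprof1 k : 0 <= k -> wprof k 1 = 1.
Proof.
rewrite le_eqVlt /wprof => /orP[/eqP <-|k0]; first by rewrite eqxx.
by rewrite gt_eqF // mulr1 divff // gt_eqF // atan_gt0.
Qed.

Lemma wprofN k v : wprof k (- v) = - wprof k v.
Proof. by rewrite /wprof; case: eqP => // _; rewrite mulrN atanN mulNr. Qed.

Lemma wprof_le k s t : 0 <= k -> s <= t -> wprof k s <= wprof k t.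
Proof.
rewrite le_eqVlt /wprof => /orP[/eqP <-|k0]; first by rewrite eqxx.
move=> st; rewrite gt_eqF // ler_wpM2r ?invr_ge0 ?(ltW (atan_gt0 k0)) //.
by apply: le_atan; rewrite ler_wpM2l // ltW.
Qed.

Lemma wprof_bound k v : 0 <= k -> -1 <= v <= 1 -> -1 <= wprof k v <= 1.
Proof.
move=> k0 /andP[v1 v2]; have := wprof_le k0 v1; have := wprof_le k0 v2.
by rewrite wprofN wprof1 // => -> ->.
Qed.

Lemma wprof_le0 k v : 0 <= k -> v <= 0 -> wprof k v <= 0.
Proof.
move=> k0 v0; apply: le_trans (wprof_le k0 v0) _.
by rewrite /wprof mulr0 atan0 mul0r; case: ifP.
Qed.

(** Concavity of [atan] on the positive axis: on [0, k] the graph lies above its chord. Together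
    with oddness this bounds how fast the profile leaves the value -1. *)
Lemma wprof_lo k s : 0 <= k -> 0 <= s <= 1 -> 1 - s <= wprof k (1 - s).
Proof.
rewrite le_eqVlt /wprof => /orP[/eqP <-|k0]; first by rewrite eqxx.
move=> /andP[s0 s1]; rewrite gt_eqF // ler_pdivlMr ?atan_gt0 //.
set t := 1 - s.
have t0 : 0 <= t by rewrite subr_ge0.
have t1 : t <= 1 by rewrite /t; lra.
have kt0 : 0 <= k * t by rewrite mulr_ge0 // ltW.
have [c /andP[c0 ck]] := atan_mvt kt0; rewrite atan0 !subr0 => E1.
have ktk : k * t <= k by rewrite ger_pMr.
have [d /andP[dk _] E2] := atan_mvt ktk.
have cd : (1 + d ^+ 2)^-1 <= (1 + c ^+ 2)^-1.
  rewrite lef_pV2 ?posrE ?ltr_pwDl ?sqr_ge0 // lerD2l ler_pXn2r ?nnegrE //; lra.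
have := ler_wpM2l (mulr_ge0 kt0 (_ : 0 <= 1 - t)) cd; rewrite subr_ge0 => /(_ t1).
rewrite (_ : k * t * (1 - t) / (1 + d ^+ 2) = t * (atan k - atan (k * t))); last by rewrite E2; ring.
rewrite (_ : k * t * (1 - t) / (1 + c ^+ 2) = (1 - t) * atan (k * t)); last by rewrite E1; ring.
lra.
Qed.

(** On [0, 1] the profile has slope at least (k / atan k) / (1 + k^2), and atan k <= k. *)
Lemma wprof_hi k s : 0 <= k -> 0 <= s <= 1 -> wprof k (1 - s) <= 1 - s / (1 + k ^+ 2).
Proof.
rewrite le_eqVlt /wprof => /orP[/eqP <-|k0 /andP[s0 s1]].
  by rewrite eqxx expr0n /= addr0 divr1.
have A0 := atan_gt0 k0.
rewrite gt_eqF // ler_pdivrMr //.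
have ktk : k * (1 - s) <= k by rewrite ger_pMr //; lra.
have [d /andP[dk dk'] E2] := atan_mvt ktk.
have [c _] := atan_mvt (ltW k0); rewrite atan0 !subr0 => E1.
have d0 : 0 <= d by apply: le_trans dk; rewrite mulr_ge0 ?subr_ge0 // ltW.
have Ak : atan k <= k.
  rewrite E1 ler_pdivrMr ?ltr_pwDl ?sqr_ge0 //.
  by rewrite mulrDr mulr1 lerDl mulr_ge0 ?sqr_ge0 // ltW.
have dk2 : (1 + k ^+ 2)^-1 <= (1 + d ^+ 2)^-1.
  by rewrite lef_pV2 ?posrE ?ltr_pwDl ?sqr_ge0 // lerD2l ler_pXn2r ?nnegrE // ltW.
have i0 : 0 <= (1 + k ^+ 2)^-1 by rewrite invr_ge0 addr_ge0 // sqr_ge0.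
have h1 : s / (1 + k ^+ 2) * atan k <= s / (1 + k ^+ 2) * k.
  by rewrite ler_wpM2l // mulr_ge0.
have h2 : s * k / (1 + k ^+ 2) <= s * k / (1 + d ^+ 2).
  by rewrite ler_wpM2l // mulr_ge0 // ltW.
have -> : atan (k * (1 - s)) = atan k - s * k / (1 + d ^+ 2).
  by rewrite (_ : s * k / _ = atan k - atan (k * (1 - s))) ?subKr // E2; ring.
by move: h1 h2; rewrite mulrAC; lra.
Qed.

(** The wedge is [0 <= dot a y - A], [0 <= B - dot b y]. The ratio is 1 on the first side and -1 on
    the second; for unit [a], [b] it is the tangent of the angle from the bisector divided by that
    of the half-opening. *)
Definition wratio a b (A B : R) y : R :=
  ((B - dot b y) - (dot a y - A)) / ((B - dot b y) + (dot a y - A)).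

(** For unit vectors, the tangent of half the angle between [a] and [b], which is the opening of the
    wedge. *)
Definition wslope a b : R := enorm (a - b) / enorm (a + b).

Lemma wslope_ge0 a b : 0 <= wslope a b.
Proof. by rewrite divr_ge0 ?enorm_ge0. Qed.

Lemma dot_subZ a b t : dot (a - t *: b) (a - t *: b) = dot a a - 2 * t * dot a b + t ^+ 2 * dot b b.
Proof. by rewrite /dot !vE; ring. Qed.

(** The barrier is the polar angle about the apex, rescaled to run from c - eta to c + eta between
    the two sides. The last hypothesis on [U] ensures that contact with the barrier inside the wedge
    happens only in [O]. *)
Lemma wedge (O : set E) U a b (A B c eta M : R) :
  jsub O U -> continuous U ->
  (forall e, 0 < e -> exists2 d, 0 < d & forall x y, enorm (x - y) < d -> U x <= U y + e) ->
  (forall z, O z -> enorm z <= M) ->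
  dot a a = 1 -> dot b b = 1 -> a + b != 0 -> 0 < eta ->
  (forall z, 0 <= dot a z - A -> U z <= c + eta) ->
  (forall z, B - dot b z <= 0 -> U z <= c - eta) ->
  (forall z, 0 < dot a z - A -> ~ O z -> U z <= c - eta) ->
  forall x, 0 <= dot a x - A -> 0 <= B - dot b x ->
    0 < (B - dot b x) + (dot a x - A) ->
    U x <= c + eta * wprof (wslope a b) (wratio a b A B x).
Proof.
move=> jU cU UC OM a1 b1 ab eta0 Ha Hb Hout x xa xb xD.
apply/ler_addgt0Pr => m m0.
have [d d0 Hd] := UC _ m0.
set k := wslope a b; have k0 : 0 <= k := wslope_ge0 a b.
pose da y := dot a y - A; pose db y := B - dot b y.
(* The barrier is discontinuous at the apex, so the wedge is truncated there. On the cut the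
   distance to the second side is below [d], and uniform continuity gives U <= c - eta + m. The
   bound by the value at [x] keeps [x] in the truncated wedge. *)
pose rho := Num.min (d / 2) (db x + da x).
have rho0 : 0 < rho by rewrite lt_min divr_gt0.
pose M' := Num.max M (enorm x) + 1.
have cda : continuous da.
  by move=> y; apply: cvgB; [exact: dot_continuous|exact: cvg_cst].
have cdb : continuous db.
  by move=> y; apply: cvgB; [exact: cvg_cst|exact: dot_continuous].
have cD : continuous (fun y => db y + da y).
  by move=> y; apply: cvgD; [exact: cdb|exact: cda].
pose S : set E := [set y | 0 <= da y] `&` [set y | 0 <= db y] `&`
  [set y | rho <= db y + da y] `&` cball 0 M'.
have cS : compact S.
  apply: (@subclosed_compact _ _ (cball 0 M')); [|exact: cball_compact|by move=> ? []].
  apply: closedI; last exact: cball_closed.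
  apply: closedI; last exact: closed_continuous_ge cD.
  by apply: closedI; [exact: closed_continuous_ge cda|exact: closed_continuous_ge cdb].
pose w y := c + eta * wprof k (wratio a b A B y).
have vb y : 0 <= da y -> 0 <= db y -> 0 < db y + da y -> -1 <= wratio a b A B y <= 1.
  move=> y1 y2 y3; rewrite /wratio ler_pdivlMr // ler_pdivrMr //.
  by move: y1 y2; rewrite /da /db; (clear -R; lra).
have wlb y : 0 <= da y -> 0 <= db y -> 0 < db y + da y -> c - eta <= w y <= c + eta.
  move=> y1 y2 y3; have /andP[p1 p2] := wprof_bound k0 (vb _ y1 y2 y3).
  have := ler_wpM2l (ltW eta0) p1; have := ler_wpM2l (ltW eta0) p2; rewrite /w; (clear -R; lra).
have nn0 : 0 < dot (a + b) (a + b) by rewrite -enorm_sqr exprn_gt0 // enorm_gt0.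
have jw z : 0 < db z + da z -> exists p A', [/\ jet2 w z p A', p != 0 & qf A' p <= 0].
  move=> Dz; pose n := - (a + b); pose dd := a - b.
  have Dz' : 0 < (B - A) + dot dd z.
    by move: Dz; rewrite /db /da /dd dotDl dotNl; (clear -R; lra).
  pose D := B - A + dot dd z; pose v := (B + A + dot n z) / D.
  pose q := D^-1 *: (n - v *: dd).
  have jr : jet2 (fun y => (B + A + dot n y) / (B - A + dot dd y)) z q
    (- (2 * (q.1 * dd.1) / D), - ((q.1 * dd.2 + q.2 * dd.1) / D), - (2 * (q.2 * dd.2) / D)).
    exact: jet2_ratio.
  have vrE : v = wratio a b A B z.
    by rewrite /v /D /wratio /n /dd; congr (_ / _); rewrite ?dotE; ring.
  have rE : (fun y => (B + A + dot n y) / (B - A + dot dd y)) = wratio a b A B.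
    by apply/funext => y; rewrite /wratio /n /dd; congr (_ / _); rewrite ?dotE; ring.
  have [p [p2 [j1 p0 ode]]] := wprof_jet v k0.
  have jp : jet1 (wprof k) (wratio a b A B z) p p2 by rewrite -vrE.
  rewrite rE in jr.
  (* Unit length makes the gradients of numerator and denominator orthogonal; hence |q|^2 is
     proportional to 1 + k^2 v^2, the form in which [wprof_jet] applies. *)
  have nd0 : dot n dd = 0 by rewrite /n /dd !dotE a1 b1 (dotC b a); ring.
  have nnE : dot n n = dot (a + b) (a + b) by rewrite /n dotNl dotNr opprK.
  have ddk : dot dd dd = k ^+ 2 * dot (a + b) (a + b).
    rewrite /k /wslope expr_div_n !enorm_sqr -/dd; field.
    by rewrite gt_eqF.
  clearbody n dd.
  have j2 := jet2_comp jp jr.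
  have j3 := @jet2_comp R _ _ _ _ _ _ _ (jet1_quadratic c eta 0 (wprof k (wratio a b A B z))) j2.
  have wE : (fun y => c + eta * wprof k (wratio a b A B y) + 0 * wprof k (wratio a b A B y) ^+ 2) = w.
    by apply/funext => y; rewrite /w mul0r addr0.
  rewrite wE in j3; do 2 eexists; split; first exact: j3.
  - rewrite !scaler_eq0 mulr0 mul0r addr0 !negb_or !gt_eqF //=.
      2: by rewrite invr_gt0.
    apply/eqP => q0; have : dot n (n - v *: dd) = 0 by rewrite q0 dot0r.
    rewrite dotDr (dotNr (v *: dd)) dotZr nd0 mulr0 subr0 nnE => nn.
    by move: nn0; rewrite nn ltxx.
  - have dq : dot dd q = - v * dot dd dd / D.
      rewrite /q dotZr dotDr (dotNr (v *: dd)) dotZr dotC nd0.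
      by field; rewrite gt_eqF.
    have qq : dot q q = (dot (a + b) (a + b) + v ^+ 2 * dot dd dd) / D ^+ 2.
      rewrite /q dotZl dotZr dot_subZ nd0 nnE.
      by field; rewrite gt_eqF.
    move: q dq qq {jr j2 j3} => q dq qq.
    rewrite !qf_comp_hess.
    set w1 := eta + _; set w2 := 2 * 0.
    have -> : w2 = 0 by rewrite /w2 mulr0.
    have -> : w1 = eta by rewrite /w1 mulr0 mul0r addr0.
    rewrite !dotZl !dotZr mul0r addr0.
    set Q := qf _ _.
    have -> : Q = (eta * p) ^+ 2 * (- 2 * dot q q * dot dd q / D).
      by rewrite /Q /qf /dot !vE /=; field; rewrite gt_eqF.
    rewrite dq (_ : _ * _ = eta ^+ 3 * p ^+ 2 * dot q q * (2 * p * v * dot dd dd / D ^+ 2 + p2 * dot q q)); last first.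
      by field; rewrite gt_eqF.
    rewrite {2}qq ddk (_ : 2 * p * v * _ / _ + _ = dot (a + b) (a + b) / D ^+ 2 *
       (2 * p * v * k ^+ 2 + p2 * (1 + k ^+ 2 * v ^+ 2))); last by field; rewrite gt_eqF.
    by rewrite ode !mulr0.
have := @comparison R O U w S (`|c| + eta) m x jU cS (continuous_subspaceT cU).
apply.
- apply: continuous_in_subspaceT => z /set_mem [[_ /= zr] _].
  have [p [A' [j _ _]]] := jw z (lt_le_trans rho0 zr).
  exact: jet2_cont j.
- move=> z [[[/= za zb] zr] _].
  have /andP[w1 w2] := wlb z za zb (lt_le_trans rho0 zr).
  have := ler_norm c; have := ler_norm (- c); rewrite normrN ler_norml; (clear -w1 w2; lra).
- move=> z [[[/= za zb] zr] zM] Uz.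
  have zD := lt_le_trans rho0 zr.
  have /andP[w1 w2] := wlb z za zb zD.
  have za' : 0 < da z.
    rewrite lt_neqAle za andbT; apply/eqP => a0.
    have := Ha z; rewrite -/(da z) -a0 lexx => /(_ isT).
    have : w z = c + eta.
      rewrite /w /wratio -/(da z) -/(db z) -a0 subr0 addr0 divff ?wprof1 ?mulr1 //.
      by rewrite gt_eqF //; move: zD; rewrite -a0 addr0.
    by move: Uz; lra.
  have zb' : 0 < db z.
    rewrite lt_neqAle zb andbT; apply/eqP => b0.
    by have := Hb z; rewrite -/(db z) -b0 lexx => /(_ isT); move: Uz; lra.
  have zr' : rho < db z + da z.
    rewrite lt_neqAle zr andbT; apply/eqP => rE.
    have dz : db z < d.
      have : rho <= d / 2 by rewrite ge_min lexx.
      by clear -za' zb' rE; lra.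
    have := Hb (z + db z *: b); rewrite dotDr dotZr b1 mulr1 opprD addrA -/(db z) subrr lexx => /(_ isT) Uy.
    have := Hd z (z + db z *: b).
    rewrite opprD addrA subrr add0r enormN enormZ (enorm_unit b1) mulr1 gtr0_norm // => /(_ dz).
    by move: Uz; lra.
  have Oz : O z by apply: contrapT => /(Hout _ za'); move: Uz; lra.
  split => //; last exact: jw.
  have o1 : \forall y \near z, 0 < da y by exact: cvgr_gt (cda z) _ za'.
  have o2 : \forall y \near z, 0 < db y by exact: cvgr_gt (cdb z) _ zb'.
  have o3 : \forall y \near z, rho < db y + da y by exact: cvgr_gt (cD z) _ zr'.
  have o4 : \forall y \near z, enorm y < M'.
    apply: cvgr_lt (@enorm_continuous R z) _ _.
    apply: le_lt_trans (OM _ Oz) _; rewrite /M'.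
    have : M <= Num.max M (enorm x) by rewrite le_max lexx.
    by clear -R; lra.
  near=> y; split; last by rewrite /cball /= subr0 ltW //; near: y.
  split; last by rewrite /= ltW //; near: y.
  by split; rewrite /= ltW //; near: y.
- split; last first.
    rewrite /cball /= subr0 /M'.
    have : enorm x <= Num.max M (enorm x) by rewrite le_max lexx orbT.
    by clear -R; lra.
  by split => //=; rewrite /rho ge_min lexx orbT.
Unshelve. all: by end_near. Qed.

End wedge.

(** * The potential as a function on the whole plane *)

Section ring_potential.
Context {R : realType}.
Local Notation E := (R * R)%type.
Implicit Types (x y z n q : E) (O K C : set E) (f u U : E -> R).

Lemma uniform_cont f (M : R) : continuous f -> (forall x, M < enorm x -> f x = 0) ->
  forall e, 0 < e -> exists2 d, 0 < d & forall x y, enorm (x - y) < d -> f x <= f y + e.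
Proof.
move=> cf f0 e e0.
pose S : set E := cball 0 (M + 1).
have /compact_near_coveringP cS : compact S by exact: cball_compact.
have H : \forall d \near (0 : R)^'+, S `<=` (fun x => forall y, enorm (x - y) < d -> `|f x - f y| <= e).
  apply: cS => x _.
  have /continuous_enormP /(_ (e / 2)) [|d d0 Hd] := cf x; first by lra.
  exists ([set y | enorm (y - x) < d / 2], [set t : R | t < d / 2]) => /=.
    split; last by apply: nbhs_right_lt; lra.
    by apply/nbhs_enormP; exists (d / 2) => //; lra.
  move=> [y t] /= [yd td] z yz.
  have h1 := Hd y; have h2 := Hd z; have tr := enorm_triangle3 z y x.
  have h1' : `|f y - f x| < e / 2 by apply: h1; lra.
  have h2' : `|f z - f x| < e / 2 by apply: h2; rewrite (enormB z y) in tr; lra.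
  rewrite -(subrKA (f x)); apply: le_trans (ler_normD _ _) _.
  by rewrite (distrC (f x)); (clear -h1' h2'; lra).
have [d [d0 d1 Hd]] : exists d : R, [/\ 0 < d, d < 1 &
    S `<=` (fun x => forall y, enorm (x - y) < d -> `|f x - f y| <= e)].
  near (0 : R)^'+ => d; exists d; split => //; near: d => //.
exists d => // x y xy.
have [xS|xS] := leP (enorm x) (M + 1).
  have := Hd x; rewrite /S /cball /= subr0 => /(_ xS y xy).
  by rewrite ler_norml => /andP[]; lra.
have := enorm_triangle (x - y) y; rewrite subrK => tr.
by rewrite !f0; (clear -e0 d1 xy xS tr; lra).
Unshelve. all: by end_near. Qed.

(** The extended potential: being defined and continuous everywhere, it can be evaluated on balls
    and half-planes that leave the ring. [M] bounds [O]. *)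
Definition ringpot O K U (M : R) : Prop :=
  [/\ [/\ open O, convex2 O & forall x, O x -> enorm x <= M],
      [/\ closed K, convex2 K, K !=set0 & K `<=` O],
      [/\ continuous U, forall x, K x -> U x = 1, forall x, ~ O x -> U x = 0 &
          forall x, 0 <= U x <= 1] &
      jsub (O `\` K) U /\ jsub (O `\` K) (fun x => - U x)].

Lemma open_ring O K : open O -> closed K -> open (O `\` K).
Proof. by move=> oO cK; apply: openI => //; exact: closed_openC. Qed.

Lemma eq_jsub O f g : open O -> (forall x, O x -> f x = g x) -> jsub O f -> jsub O g.
Proof.
move=> oO fg jf x p A Ox up; apply: (jf x p A Ox) => e e0.
have [d d0 Hd] := up _ e0.
have /open_enormP /(_ _ Ox) [d' d'0 Hd'] := oO.
exists (Num.min d d'); first by rewrite lt_min d0.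
move=> h; rewrite lt_min => /andP[hd hd'].
rewrite (fg x) // (fg (x + h)); first exact: Hd.
by apply: Hd'; rewrite [x + h]addrC addrK.
Qed.

(** [u] is continuous only relative to the closure of the ring and unconstrained inside [K] and away
    from the closure of [O]. At a point of [K], or off [O], either the ring stays away or the point
    lies on the boundary and [u] has the boundary value there; hence the extension is continuous.
    Its bounds are the maximum principle. *)
Lemma inf_potential_ringpot O K u : convex_ring O K -> inf_potential O K u ->
  exists U M, ringpot O K U M /\ forall x, (O `\` K) x -> U x = u x.
Proof.
move=> [[oO _ _ [M OM] cO] [kK cvK K0 KO]] [cu [vsub vsup] uO uK].
have cK : closed K by apply: compact_closed => //; exact: norm_hausdorff.
have oR : open (O `\` K) by exact: open_ring.
pose U x := if `[< K x >] then 1 else if `[< O x >] then u x else 0.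
have UK x : K x -> U x = 1 by move=> Kx; rewrite /U asboolT.
have UO x : ~ O x -> U x = 0.
  by move=> Ox; rewrite /U !asboolF // => /KO.
have UR x : (O `\` K) x -> U x = u x by move=> [Ox Kx]; rewrite /U asboolF // asboolT.
have cu' x : closure (O `\` K) x -> forall e, 0 < e -> exists2 d, 0 < d &
    forall y, enorm (y - x) < d -> (O `\` K) y -> `|u y - u x| < e.
  move=> cx e e0; move/subspace_continuousP : cu => /(_ x cx) /cvgrPdist_lt /(_ _ e0).
  move=> /nbhs_enormP [d d0 Hd]; exists d => // y yd Ry.
  by rewrite distrC; apply: Hd => //; exact: subset_closure.
have ncl x : ~ closure (O `\` K) x -> exists2 d, 0 < d &
    forall y, enorm (y - x) < d -> ~ (O `\` K) y.
  move=> ncx; have /open_enormP /(_ x ncx) [d d0 Hd] : open (~` closure (O `\` K)).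
    by apply: closed_openC; exact: closed_closure.
  by exists d => // y /Hd ny Ry; apply: ny; exact: subset_closure.
have nearO x e : 0 < e -> (closure (O `\` K) x -> u x = U x) -> exists2 d, 0 < d &
    forall y, enorm (y - x) < d -> (O `\` K) y -> `|U y - U x| < e.
  move=> e0 ux; have [cx|/ncl [d d0 Hd]] := pselect (closure (O `\` K) x); last first.
    by exists d => // y /Hd.
  have [d d0 Hd] := cu' x cx e e0; exists d => // y yd Ry.
  by rewrite (UR y Ry) -(ux cx); exact: Hd.
have cU : continuous U.
  move=> x; apply/continuous_enormP => e e0.
  have [Kx|Kx] := pselect (K x).
    have Ox := KO x Kx.
    have [|d d0 Hd] := nearO x e e0.
      move=> cx; rewrite UK // uK //; split; first exact: subset_closure.
      move=> /nbhs_enormP [d d0 Hd].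
      have [|y [Ry yd]] := cx [set y | enorm (y - x) < d].
        by apply/nbhs_enormP; exists d.
      by case: Ry => _; apply; exact: Hd.
    have /open_enormP /(_ _ Ox) [d' d'0 Hd'] := oO.
    exists (Num.min d d'); first by rewrite lt_min d0.
    move=> y; rewrite lt_min => /andP[yd yd'].
    have [Ky|Ky] := pselect (K y); first by rewrite !UK // subrr normr0.
    by apply: Hd => //; split => //; exact: Hd'.
  have /open_enormP /(_ x Kx) [d1 d10 Hd1] : open (~` K) by exact: closed_openC.
  have [Ox|Ox] := pselect (O x).
    have [|d d0 Hd] := nearO x e e0; first by rewrite UR.
    have /open_enormP /(_ _ Ox) [d' d'0 Hd'] := oO.
    exists (Num.min d (Num.min d1 d')); first by rewrite !lt_min d0 d10.
    move=> y; rewrite !lt_min => /andP[yd /andP[yd1 yd']].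
    by apply: Hd => //; split; [exact: Hd'|exact: Hd1].
  have [|d d0 Hd] := nearO x e e0.
    move=> cx; rewrite UO // uO //; split.
      by apply: closureS cx => y [].
    by move/interior_subset.
  exists (Num.min d d1); first by rewrite lt_min d0.
  move=> y; rewrite lt_min => /andP[yd yd1].
  have [Oy|Oy] := pselect (O y); last by rewrite !UO // subrr normr0.
  by apply: Hd => //; split => //; exact: Hd1.
have RM x : (O `\` K) x -> enorm x <= M by move=> [/OM].
have jU : jsub (O `\` K) U.
  by apply: eq_jsub (visc_sub_jsub vsub) => // x Rx; rewrite UR.
have jNU : jsub (O `\` K) (fun x => - U x).
  by apply: eq_jsub (visc_super_jsub vsup) => // x Rx; rewrite UR.
have offR x : ~ (O `\` K) x -> U x = 1 \/ U x = 0.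
  move=> nR; have [/UK|Kx] := pselect (K x); first by left.
  by right; apply: UO => Ox; apply: nR.
exists U, M; split => //; split => //; split => // x; apply/andP; split.
- rewrite -oppr_le0; apply: (max_principle jNU) RM _ x => //.
    by move=> y; apply: cvgN; exact: cU.
  by move=> y /offR [] ->; lra.
- by apply: (max_principle jU) RM _ x => // y /offR [] ->; lra.
Qed.

Lemma nearest_point C x : closed C -> convex2 C -> C !=set0 -> ~ C x ->
  exists n q, [/\ dot n n = 1, C q, 0 < enorm (x - q) &
    forall y, C y -> dot n (y - x) <= - enorm (x - q)].
Proof.
move=> cC vC [y0 Cy0] nCx.
have cx : continuous (fun y => enorm (y - x)).
  apply: (@enorm_lipschitz_continuous _ _ 1) => u v; rewrite mul1r.
  by apply: le_trans (enorm_dist _ _) _; rewrite opprB addrA subrK.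
have [||q [Cq qd] qmin] := @compact_min2 R (C `&` cball x (enorm (y0 - x)))
   (fun y => enorm (y - x)) _ _ (continuous_subspaceT cx).
- by exists y0; split => //; rewrite /cball /=.
- apply: (@subclosed_compact _ _ (cball x (enorm (y0 - x)))); last by move=> ? [].
    by apply: closedI => //; exact: cball_closed.
  exact: cball_compact.
have qmin' y : C y -> enorm (q - x) <= enorm (y - x).
  move=> Cy; have [h|/ltW h] := leP (enorm (y - x)) (enorm (y0 - x)); first exact: qmin.
  exact: le_trans qd h.
have xq : x - q != 0 by apply/eqP => /subr0_eq xq; apply: nCx; rewrite xq.
have d0 := enorm_gt0 xq.
exists ((enorm (x - q))^-1 *: (x - q)), q; split => //; first exact: dot_normalize.
move=> y Cy; rewrite dotZl.
suff H : dot (x - q) (y - q) <= 0.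
  rewrite mulrC ler_pdivrMr // mulNr -expr2 enorm_sqr.
  rewrite (_ : y - x = (y - q) - (x - q)); last by rewrite opprB addrA subrK.
  by rewrite dotDr dotNr; lra.
rewrite leNgt; apply/negP => H.
(* moving from q towards y would decrease the distance to x *)
pose a := dot (x - q) (y - q); pose b := dot (y - q) (y - q).
have b0 : 0 < b.
  rewrite lt_neqAle dotxx_ge0 andbT; apply/eqP => b0.
  by move: H; rewrite (dotxx_eq0 (esym b0)) dot0r ltxx.
pose t := Num.min 1 (a / b).
have t0 : 0 < t by rewrite lt_min ltr01 divr_gt0.
have t1 : t <= 1 by rewrite ge_min lexx.
have tb : t * b <= a by rewrite -ler_pdivlMr // ge_min lexx orbT.
have Cz : C (t *: y + (1 - t) *: q) by apply: vC => //; rewrite ltW.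
have := qmin' _ Cz; apply/negP; rewrite -ltNge enorm_ltP ?enorm_ge0 // enorm_sqr.
rewrite (_ : dot (t *: y + _ - x) _ = dot (q - x) (q - x) - 2 * t * a + t * (t * b)); last first.
  by rewrite /a /b /dot !vE; ring.
have := ler_wpM2l (ltW t0) tb; have : 0 < t * a by rewrite mulr_gt0.
lra.
Qed.

End ring_potential.

(** * Quasi-concavity of the potential *)

Lemma vec_ext {R : realType} (x y : R * R) : x.1 = y.1 -> x.2 = y.2 -> x = y.
Proof. by case: x y => ? ? [? ?] /= -> ->. Qed.

Ltac vring := apply: vec_ext; rewrite ?vE /=; ring.

(** * Suprema over balls *)

Section ball_sup.
Context {R : realType}.
Local Notation E := (R * R)%type.
Implicit Types (x y z n q : E) (f : E -> R).

Definition Bsup f (r : R) x : R := sup (f @` cball x r).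

Definition unifc f := forall e, 0 < e ->
  exists2 d, 0 < d & forall x y, enorm (x - y) < d -> f x <= f y + e.

Lemma unifc_continuous f : unifc f -> continuous f.
Proof.
move=> uf x; apply/continuous_enormP => e e0.
have [|d d0 Hd] := uf (e / 2); first by lra.
exists d => // y yx; have h1 := Hd _ _ yx; have := Hd x y; rewrite enormB => /(_ yx).
by rewrite ltr_norml; lra.
Qed.

Lemma cballxx x (r : R) : 0 <= r -> cball x r x.
Proof. by move=> r0; rewrite /cball /= subrr enorm0. Qed.

Lemma Bsup_max f (r : R) x : continuous f -> 0 <= r ->
  exists2 y, enorm (y - x) <= r &
    f y = Bsup f r x /\ forall z, enorm (z - x) <= r -> f z <= Bsup f r x.
Proof.
move=> cf r0; have [y yr ymax] := compact_max2 (ex_intro _ x (cballxx x r0))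
  (@cball_compact _ x r) (continuous_subspaceT cf).
suff -> : Bsup f r x = f y by exists y.
apply/eqP; rewrite eq_le; apply/andP; split.
  apply: ge_sup; first by exists (f y), y.
  by move=> _ [z zr <-]; exact: ymax.
apply: ub_le_sup; last by exists y.
by exists (f y) => _ [z zr <-]; exact: ymax.
Qed.

Lemma Bsup_ub f (r : R) x y : continuous f -> enorm (y - x) <= r -> f y <= Bsup f r x.
Proof.
move=> cf yr; have r0 : 0 <= r := le_trans (enorm_ge0 _) yr.
by have [_ _ [_ ]] := Bsup_max x cf r0; exact.
Qed.

Lemma Bsup_uc f (r : R) : unifc f -> 0 <= r -> unifc (Bsup f r).
Proof.
move=> uf r0 e e0; have cf := unifc_continuous uf.
have [d d0 Hd] := uf _ e0; exists d => // x x' xx.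
have [y yr [<- _]] := Bsup_max x cf r0.
have -> : y = (y + (x' - x)) - (x' - x) by rewrite addrK.
set z := y + (x' - x).
have zr : enorm (z - x') <= r.
  by rewrite (_ : z - x' = y - x) // /z; vring.
have := Bsup_ub cf zr.
have := Hd (z - (x' - x)) z; rewrite (_ : z - (x' - x) - z = x - x'); last first.
  by clearbody z; vring.
by move=> /(_ xx); lra.
Qed.

(** Comparison with the cone of vertex [x] that reaches the supremum at radius 2 r. *)
Lemma Bsup_half (O : set E) f x (r : R) : jsub O f -> continuous f -> 0 < r ->
  (forall z, enorm (z - x) <= 2 * r -> O z) ->
  Bsup f r x <= (f x + Bsup f (2 * r) x) / 2.
Proof.
move=> jf cf r0 HO.
have r20 : 0 <= 2 * r by lra.
pose L := (Bsup f (2 * r) x - f x) / (2 * r).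
have fx : f x <= Bsup f (2 * r) x by apply: Bsup_ub => //; rewrite subrr enorm0.
have L0 : 0 <= L by rewrite divr_ge0 // subr_ge0.
have Lr : L * (2 * r) = Bsup f (2 * r) x - f x by rewrite /L divfK // gt_eqF //; lra.
have cone : forall y, enorm (y - x) <= 2 * r -> f y <= f x + L * enorm (y - x).
  apply: (cone_above jf cf HO L0) => y yr; rewrite Lr.
  by have := @Bsup_ub f (2 * r) x y cf; rewrite yr lexx => /(_ isT); lra.
have [y yr [<- _]] := Bsup_max x cf (ltW r0).
have := cone y; have := ler_wpM2l L0 yr.
have yr2 : enorm (y - x) <= 2 * r by lra.
by move=> h /(_ yr2); lra.
Qed.

End ball_sup.

(** * The quasi-concave envelope *)

Section envelope.
Context {R : realType}.
Local Notation E := (R * R)%type.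
Implicit Types (x y z n q : E).
Context (O K : set E) (U : E -> R) (M : R) (rp : ringpot O K U M).

Lemma rp_cont : continuous U. Proof. by case: rp => _ _ []. Qed.
Lemma rp_K x : K x -> U x = 1. Proof. by case: rp => _ _ [_ +] _ _ _; exact. Qed.
Lemma rp_off x : ~ O x -> U x = 0. Proof. by case: rp => _ _ [_ _ +] _ _; exact. Qed.
Lemma rp_bd x : O x -> enorm x <= M. Proof. by case: rp => [[_ _ +]] _ _ _; exact. Qed.
Lemma rp_ge0 x : 0 <= U x. Proof. by case: rp => _ _ [_ _ _ H] _; case/andP: (H x). Qed.
Lemma rp_le1 x : U x <= 1. Proof. by case: rp => _ _ [_ _ _ H] _; case/andP: (H x). Qed.

Lemma rp_far x : M < enorm x -> U x = 0.
Proof. by move=> Mx; apply: rp_off => /rp_bd; rewrite leNgt Mx. Qed.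

Lemma rp_unifc : unifc U.
Proof. exact: uniform_cont rp_cont rp_far. Qed.

Lemma rp_unifcN : unifc (fun x => - U x).
Proof.
apply: (@uniform_cont _ _ M) => [x|x /rp_far ->]; last by rewrite oppr0.
by apply: cvgN; exact: rp_cont.
Qed.

Lemma rp_wedge n q (A B c eta : R) : dot n n = 1 -> dot q q = 1 -> n + q != 0 ->
  0 < eta -> 0 <= c - eta ->
  (forall z, 0 <= dot n z - A -> U z <= c + eta) ->
  (forall z, B - dot q z <= 0 -> U z <= c - eta) ->
  (forall z, K z -> dot n z <= A) ->
  forall x, 0 <= dot n x - A -> 0 <= B - dot q x ->
    0 < (B - dot q x) + (dot n x - A) ->
    U x <= c + eta * wprof (wslope n q) (wratio n q A B x).
Proof.
move=> n1 q1 nq eta0 ceta Ha Hb HK x xa xb xD.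
have [_ _ _ [jU _]] := rp.
apply: (@wedge R (O `\` K) U n q A B c eta M) => //; first exact: rp_cont.
- exact: rp_unifc.
- by move=> z [/rp_bd].
- move=> z zA nR; rewrite rp_off // => Oz; apply: nR; split => // /HK.
  by move: zA; lra.
Qed.

(** The degenerate wedge: between parallel lines [wslope] is 0 and the barrier is affine. *)
Lemma rp_strip n (A B c0 c1 : R) : dot n n = 1 -> 0 <= c0 -> c0 < c1 -> A < B ->
  (forall z, A <= dot n z -> U z <= c1) -> (forall z, B <= dot n z -> U z <= c0) ->
  (forall z, K z -> dot n z <= A) ->
  forall x, A <= dot n x <= B -> U x <= c1 - (c1 - c0) * (dot n x - A) / (B - A).
Proof.
move=> n1 c00 c01 AB Ha Hb HK x /andP[xA xB].
have n0 : n + n != 0.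
  rewrite -mulr2n -scaler_nat scaler_eq0 negb_or pnatr_eq0 /=.
  by apply/eqP => n0; move: n1; rewrite n0 dot0l => /eqP; rewrite eq_sym oner_eq0.
have := @rp_wedge n n A B ((c0 + c1) / 2) ((c1 - c0) / 2) n1 n1 n0.
rewrite /wslope subrr enorm0 mul0r /wprof eqxx /wratio => H.
apply: le_trans (H _ _ _ _ HK x _ _ _) _; try lra.
- by move=> z zA; apply: le_trans (Ha z _) _; lra.
- by move=> z zB; apply: le_trans (Hb z _) _; lra.
rewrite (_ : B - dot n x + (dot n x - A) = B - A); last by ring.
by rewrite le_eqVlt; apply/orP; left; apply/eqP; field; rewrite gt_eqF // subr_gt0.
Qed.

Definition halfplane_adm x (c : R) : Prop :=
  exists2 n, dot n n = 1 & forall y, 0 <= dot n (y - x) -> U y <= c.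

(* quasi-concave envelope: {qenv >= c} is the convex hull of {U >= c} *)
Definition qenv x : R := inf [set c | halfplane_adm x c].

Lemma e1_unit : dot (1, 0) (1, 0) = 1 :> R.
Proof. by rewrite /dot /=; lra. Qed.

Lemma qenv_lb x : has_lbound [set c | halfplane_adm x c].
Proof. by exists (U x) => c [n _]; apply; rewrite subrr dot0r. Qed.

Lemma qenv_nonempty x : [set c | halfplane_adm x c] !=set0.
Proof. by exists 1, (1, 0); [exact: e1_unit|move=> y _; exact: rp_le1]. Qed.

Lemma qenv_ge x : U x <= qenv x.
Proof.
by apply: lb_le_inf (qenv_nonempty x) _ => c [n _]; apply; rewrite subrr dot0r.
Qed.

Lemma qenv_adm x c : halfplane_adm x c -> qenv x <= c.
Proof. by move=> H; apply: ge_inf => //; exact: qenv_lb. Qed.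

Lemma qenv_lt x c : qenv x < c -> exists2 c', c' < c & halfplane_adm x c'.
Proof.
by move=> /(inf_lt (qenv_nonempty x)) [c' H cc]; exists c'.
Qed.

Lemma qenv_unifc : unifc qenv.
Proof.
move=> e e0; have [d d0 Hd] := rp_unifc e0; exists d => // x x' xx.
rewrite -lerBlDr; apply: lb_le_inf (qenv_nonempty x') _ => c [n n1 H].
rewrite lerBlDr; apply: qenv_adm; exists n => // y yn.
have := Hd y (y + (x' - x)); rewrite opprD addrA subrr add0r opprB => /(_ xx).
have := H (y + (x' - x)); rewrite (_ : y + (x' - x) - x' = y - x); last by vring.
by move=> /(_ yn); lra.
Qed.

Lemma qenv_K x : K x -> qenv x = 1.
Proof.
move=> Kx; apply/eqP; rewrite eq_le; apply/andP; split; last first.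
  by have := qenv_ge x; rewrite rp_K.
by apply: qenv_adm; exists (1, 0); [exact: e1_unit|move=> y _; exact: rp_le1].
Qed.

Lemma rp_far_halfplane x n z : dot n n = 1 -> M + enorm x + 1 <= dot n (z - x) -> U z = 0.
Proof.
move=> n1 H; apply: rp_far; have := dot_le n z; have := dot_ge n x.
by rewrite (enorm_unit n1) !mul1r; move: H; rewrite dotDr dotNr; lra.
Qed.

Lemma M_ge0 : 0 <= M.
Proof.
have [_ [_ _ [k Kk] KO] _ _] := rp.
exact: le_trans (enorm_ge0 k) (rp_bd (KO _ Kk)).
Qed.

(** A line separates [x] from [K]; in the strip between it and a line beyond [O], where [U]
    vanishes, the affine barrier is below 1 from [x] on. *)
Lemma qenv_lt1 x : ~ K x -> qenv x < 1.
Proof.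
move=> nK; have [_ [cK vK K0 KO] _ _] := rp.
have [n [q [n1 Kq s0 Hn]]] := nearest_point cK vK K0 nK.
set s := enorm (x - q) in s0 Hn.
have L0 : 0 < M + enorm x + 1 by have := M_ge0; have := enorm_ge0 x; lra.
have sL : 0 < s + (M + enorm x + 1) by lra.
apply: (@le_lt_trans _ _ (1 - s / (s + (M + enorm x + 1)))); last first.
  by rewrite ltrBlDr ltrDl divr_gt0.
apply: qenv_adm; exists n => // y yn.
have [yL|/ltW yL] := leP (M + enorm x + 1) (dot n (y - x)).
  rewrite (rp_far_halfplane n1 yL) subr_ge0 ler_pdivrMr //; lra.
have := @rp_strip n (dot n x - s) (dot n x + (M + enorm x + 1)) 0 1 n1.
move=> /(_ (lexx _) ltr01 _ (fun z _ => rp_le1 z)) H.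
move: yL yn; rewrite dotDr dotNr => yL yn.
apply: le_trans (H _ _ _ y _) _; try lra.
- move=> z zL; rewrite (@rp_far_halfplane x n z) // dotDr dotNr; lra.
- by move=> z /Hn; rewrite dotDr dotNr; lra.
rewrite subr0 mul1r lerD2l lerN2 (_ : dot n x + _ - (_ - s) = s + (M + enorm x + 1)); last by ring.
by rewrite ler_wpM2r ?invr_ge0 ?(ltW sL) //; lra.
Qed.

Lemma closure_enormP (A : set E) x :
  closure A x <-> forall d, 0 < d -> exists2 y, enorm (y - x) < d & A y.
Proof.
split.
  move=> cx d d0; have [|y [Ay yd]] := cx [set y | enorm (y - x) < d].
    by apply/nbhs_enormP; exists d.
  by exists y.
move=> H B /nbhs_enormP [d d0 dB]; have [y yd Ay] := H _ d0.
by exists y; split => //; exact: dB.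
Qed.

Lemma closure_convex (A : set E) : convex2 A -> convex2 (closure A).
Proof.
move=> vA x y t /closure_enormP cx /closure_enormP cy /andP[t0 t1].
apply/closure_enormP => d d0; have [x' xd Ax'] := cx _ d0; have [y' yd Ay'] := cy _ d0.
exists (t *: x' + (1 - t) *: y'); last by apply: vA => //; rewrite t0.
rewrite (_ : _ - _ = t *: (x' - x) + (1 - t) *: (y' - y)); last first.
  by rewrite !scalerBr opprD addrACA.
apply: le_lt_trans (enorm_triangle _ _) _.
rewrite !enormZ !ger0_norm ?subr_ge0 //.
have [->|tn0] := eqVneq t 0; first by rewrite mul0r subr0 mul1r add0r.
have tp : 0 < t by rewrite lt_neqAle eq_sym tn0.
have h1 : t * enorm (x' - x) < t * d by rewrite ltr_pM2l.
have h2 : (1 - t) * enorm (y' - y) <= (1 - t) * d by rewrite ler_wpM2l ?subr_ge0 // ltW.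
lra.
Qed.

Lemma qenv_off x : ~ O x -> qenv x = 0.
Proof.
move=> nO; have [[oO vO _] [_ _ [k Kk] KO] _ _] := rp.
apply/eqP; rewrite eq_le (le_trans (rp_ge0 x) (qenv_ge x)) andbT.
apply/ler_addgt0Pr => e e0; rewrite add0r.
have /open_enormP /(_ k (KO _ Kk)) [rho rho0 Hrho] := oO.
have [d d0 Hd] := qenv_unifc e0.
have xk1 : 0 < enorm (x - k) + 1 by have := enorm_ge0 (x - k); lra.
pose t := d / (enorm (x - k) + 1) / 2.
have t0 : 0 < t by rewrite !divr_gt0.
have td : t * enorm (x - k) < d.
  apply: (@le_lt_trans _ _ (t * (enorm (x - k) + 1))); first by rewrite ler_wpM2l ?(ltW t0) //; lra.
  by rewrite /t (_ : _ * _ = d / 2); [lra|field; rewrite gt_eqF].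
(* [x] may lie on the boundary of [O], so it is pushed slightly away from [k]. If [x'] were in the
   closure of [O], then [x] would be a convex combination of a point of [O] and a point of a ball
   about [k], hence in [O]. *)
pose x' := x + t *: (x - k).
have ncl : ~ closure O x'.
  move=> /closure_enormP /(_ (t * rho)) [|w wd Ow]; first by rewrite mulr_gt0.
  apply: nO; pose k' := k + t^-1 *: (x' - w).
  have Ok' : O k'.
    apply: Hrho; rewrite /k' addrC addKr enormZ gtr0_norm ?invr_gt0 //.
    by rewrite enormB mulrC ltr_pdivrMr // mulrC.
  have t1 : 0 < 1 + t by lra.
  have := vO k' w (t / (1 + t)) Ok' Ow.
  rewrite (_ : _ *: k' + _ = x).
    by apply; rewrite divr_ge0 ?(ltW t0) ?(ltW t1) //= ler_pdivrMr //; lra.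
  by apply: vec_ext; rewrite /k' /x' !vE; field; rewrite !gt_eqF.
have [n [q [n1 Cq s0 Hn]]] := nearest_point (@closed_closure _ O) (closure_convex vO)
  (ex_intro _ k (subset_closure (KO _ Kk))) ncl.
have qx' : qenv x' <= 0.
  apply: qenv_adm; exists n => // y yn; rewrite rp_off // => /subset_closure/Hn.
  by move: yn; lra.
have := Hd x x'; rewrite /x' opprD addrA subrr add0r enormN enormZ gtr0_norm //.
by move=> /(_ td); rewrite -/x'; lra.
Qed.

(** The superlevel set of the envelope is closed and convex and lies at distance more than [r] from
    [x]; the normal at its nearest point separates. *)
Lemma qenv_separate x (r c : R) : 0 <= r -> (forall z, enorm (z - x) <= r -> qenv z < c) ->
  exists2 n, dot n n = 1 & forall y, - r <= dot n (y - x) -> U y < c.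
Proof.
move=> r0 H.
pose C : set E := [set z | c <= qenv z].
have [C0|C0] := pselect (C !=set0); last first.
  exists (1, 0); first exact: e1_unit.
  move=> y _; rewrite ltNge; apply/negP => cy; apply: C0; exists y.
  exact: le_trans cy (qenv_ge y).
have cC : closed C by apply: closed_continuous_ge; exact: unifc_continuous qenv_unifc.
have vC : convex2 C.
  move=> z1 z2 t c1 c2 /andP[t0 t1]; rewrite /C /= leNgt; apply/negP => /qenv_lt.
  move=> [c' cc [n n1 Hn]]; set z := t *: z1 + _ in Hn.
  have zE : t * dot n (z1 - z) + (1 - t) * dot n (z2 - z) = 0.
    by rewrite -!dotZr -dotDr /z !scalerBr addrACA -opprD -scalerDl subrKC scale1r subrr dot0r.
  have half w : c <= qenv w -> 0 <= dot n (w - z) -> False.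
    move=> cw wz; suff : qenv w <= c' by lra.
    apply: qenv_adm; exists n => // y yw; apply: Hn.
    by rewrite -(subrKA w) dotDr; exact: addr_ge0.
  have [h1|h1] := leP 0 (dot n (z1 - z)); first exact: (half z1).
  have [h2|h2] := leP 0 (dot n (z2 - z)); first exact: (half z2).
  have := ler_wpM2l t0 (ltW h1); rewrite mulr0.
  have [t1'|t1'] := eqVneq t 1; first by move: zE h1; rewrite t1'; lra.
  have : 0 < (1 - t) by rewrite subr_gt0 lt_neqAle t1' t1.
  move=> /(ltr_pM2l) /(_ (dot n (z2 - z)) 0); rewrite h2 mulr0; lra.
have nx : ~ C x.
  by move=> cx; have := H x; rewrite subrr enorm0 => /(_ r0); move: cx; rewrite /C /=; lra.
have [n [q [n1 Cq s0 Hn]]] := nearest_point cC vC C0 nx.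
have qr : r < enorm (x - q).
  by rewrite enormB ltNge; apply/negP => /H; move: Cq; rewrite /C /=; lra.
exists n => // y yn; rewrite ltNge; apply/negP => cy.
by have := Hn y (le_trans cy (qenv_ge y)); lra.
Qed.

(** The inequality of [Bsup_half], obtained without an equation for the envelope. A line with normal
    [b] through [x] has U below about [qenv x] beyond it; a line with normal [a], shifted back by 2
    r, has U below about the supremum over the ball of radius 2 r. The wedge between these two lines
    gives the mean of the two levels. *)
Lemma qenv_half x (r : R) : 0 < r -> (forall z, enorm (z - x) <= 2 * r -> (O `\` K) z) ->
  Bsup qenv r x <= (qenv x + Bsup qenv (2 * r) x) / 2.
Proof.
move=> r0 HO; have cV := unifc_continuous qenv_unifc.
have r20 : 0 <= 2 * r by lra.
have [y2 y2r [y2E V2]] := Bsup_max x cV r20.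
set c2 := Bsup qenv (2 * r) x in y2E V2 *.
have c21 : c2 < 1 by rewrite -y2E; apply: qenv_lt1; case: (HO _ y2r).
have V0 : qenv x <= c2 by apply: V2; rewrite subrr enorm0.
have Vx0 : 0 <= qenv x := le_trans (rp_ge0 x) (qenv_ge x).
have [_ [_ _ [k Kk] _] _ _] := rp.
suff H t : 0 < t -> c2 + 2 * t <= 1 -> Bsup qenv r x <= (qenv x + c2) / 2 + 2 * t.
  apply/ler_addgt0Pr => e e0; pose t := Num.min (e / 2) ((1 - c2) / 2).
  have t0 : 0 < t by rewrite lt_min !divr_gt0 //; lra.
  have t1 : t <= e / 2 by rewrite ge_min lexx.
  have t2 : t <= (1 - c2) / 2 by rewrite ge_min lexx orbT.
  by have := H t t0; lra.
move=> t0 ct; pose c' := qenv x + t; pose c'' := c2 + 2 * t.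
have [q' qc [b b1 Hb]] : exists2 c0, c0 < c' & halfplane_adm x c0.
  by apply: qenv_lt; rewrite /c'; lra.
have [a a1 Ha] : exists2 n, dot n n = 1 & forall y, - (2 * r) <= dot n (y - x) -> U y < c''.
  by apply: qenv_separate => // z /V2; rewrite /c''; lra.
have Kk1 := rp_K Kk.
(* Opposite normals would make the two half-planes cover the plane, including a point of [K], where
   U = 1. *)
have ab : a + b != 0.
  apply/eqP => ab; have := Ha k; have := Hb k.
  rewrite (_ : b = - a) ?dotNl; last by apply/eqP; rewrite -addr_eq0 addrC ab.
  rewrite Kk1; have [h|h] := leP (- (2 * r)) (dot a (k - x)).
    by move=> _ /(_ isT); rewrite /c''; lra.
  have h' : 0 <= - dot a (k - x) by lra.
  by move=> /(_ h') + _; rewrite /c' in qc *; lra.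
have [z zr [<- _]] := Bsup_max x cV (ltW r0).
apply: (@le_trans _ _ ((c' + c'') / 2)); last by rewrite /c' /c''; lra.
(* The half-plane through [z] normal to [a + b] lies on the side of the bisector where the profile
   is nonpositive: |z - x| <= r and |a + b| <= 2 are balanced by the shift 2 r. *)
apply: qenv_adm; exists ((enorm (a + b))^-1 *: (a + b)); first exact: dot_normalize.
have ab0 := enorm_gt0 ab.
move=> y; rewrite dotZl pmulr_rge0 ?invr_gt0 // => yn.
have ab2 : enorm (a + b) <= 2.
  by apply: le_trans (enorm_triangle _ _) _; rewrite !enorm_unit.
have dab : 0 <= (dot a y - (dot a x - 2 * r)) - (dot b x - dot b y).
  rewrite (_ : _ - _ = dot (a + b) (y - z) + dot (a + b) (z - x) + 2 * r); last first.
    by rewrite !dotE; ring.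
  have := dot_ge (a + b) (z - x); have := ler_pM (enorm_ge0 _) (enorm_ge0 _) ab2 zr; lra.
have [db|db] := leP (dot b x - dot b y) 0.
  apply: le_trans (Hb y _) _; first by rewrite dotDr dotNr; lra.
  by rewrite /c' /c'' in qc *; lra.
have := @rp_wedge a b (dot a x - 2 * r) (dot b x) ((c' + c'') / 2) ((c'' - c') / 2) a1 b1 ab.
move=> W; apply: le_trans (W _ _ _ _ _ y _ _ _) _; rewrite /c' /c'' in qc *; try lra.
- by move=> w wA; apply: le_trans (ltW (Ha w _)) _; rewrite ?dotDr ?dotNr /c''; lra.
- by move=> w wB; apply: le_trans (Hb w _) _; rewrite ?dotDr ?dotNr; lra.
- move=> w Kw; rewrite leNgt; apply/negP => wA; have := Ha w; rewrite rp_K // dotDr dotNr.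
  have h : - (2 * r) <= dot a w - dot a x by lra.
  by move=> /(_ h); rewrite /c''; lra.
rewrite gerDl pmulr_rle0; last by lra.
apply: wprof_le0; first exact: wslope_ge0.
rewrite /wratio pmulr_lle0 ?invr_gt0; lra.
Qed.

End envelope.

(** * Support half-planes and positivity *)

Section support.
Context {R : realType}.
Local Notation E := (R * R)%type.
Implicit Types (x y z n q : E) (f : E -> R).
Context (O K : set E) (U : E -> R) (M : R) (rp : ringpot O K U M).

Local Notation V := (qenv U).
Local Notation NU := (fun x => - U x).

Lemma midpoint_close x y (r : R) : enorm (y - x) <= 2 * r ->
  enorm ((2^-1 *: (x + y)) - x) <= r /\ enorm (y - (2^-1 *: (x + y))) <= r.
Proof.
have -> : 2^-1 *: (x + y) - x = 2^-1 *: (y - x) by apply: vec_ext; rewrite !vE; field.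
have -> : y - 2^-1 *: (x + y) = 2^-1 *: (y - x) by apply: vec_ext; rewrite !vE; field.
by move=> h; rewrite enormZ ger0_norm ?invr_ge0 //; split; lra.
Qed.

(* Armstrong and Smart: compare the upper and lower envelopes on small balls,
   at a maximum point of their difference that is extremal among such points. *)
Lemma qenv_eq x : V x = U x.
Proof.
apply/eqP; rewrite eq_le (qenv_ge rp) andbT leNgt; apply/negP => Ux1.
pose m := V x - U x; have m0 : 0 < m by rewrite subr_gt0.
have uV := qenv_unifc rp; have uN := rp_unifcN rp.
have cV := unifc_continuous uV; have cN := unifc_continuous uN.
have [|d1 d10 Hd1] := uV (m / 4); first by lra.
have [|d2 d20 Hd2] := uN (m / 4); first by lra.
(* At this scale [V] and [- U] vary by at most m / 4 each. As [V] and [U] agree off the ring, a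
   maximum point of [D], where [D] is at least m, has its ball of radius 2 e inside the ring. *)
pose e := Num.min (Num.min d1 d2) 1 / 4.
have e0 : 0 < e by rewrite divr_gt0 // !lt_min d10 d20 ltr01.
have ed1 : 4 * e <= d1 by rewrite /e mulrC divfK // !ge_min lexx.
have ed2 : 4 * e <= d2 by rewrite /e mulrC divfK // !ge_min lexx orbT.
have ed3 : 4 * e <= 1 by rewrite /e mulrC divfK // !ge_min lexx orbT.
pose P := Bsup V e; pose Q := Bsup NU e; pose D y := P y + Q y.
have cP : continuous P by apply/unifc_continuous/Bsup_uc => //; exact: ltW.
have cQ : continuous Q by apply/unifc_continuous/Bsup_uc => //; exact: ltW.
have cD : continuous D by move=> y; apply: cvgD; [exact: cP|exact: cQ].
have M0 := M_ge0 rp.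
pose S : set E := cball 0 (M + 1).
have Doff y : ~ S y -> D y <= 0.
  move=> nS; have yM : M + 1 < enorm y.
    by rewrite ltNge; apply/negP => yM; apply: nS; rewrite /S /cball /= subr0.
  have far z : enorm (z - y) <= e -> V z = 0 /\ U z = 0.
    move=> zy; have zM : M < enorm z.
      by have := enorm_triangle (y - z) z; rewrite subrK enormB; lra.
    split; last exact: rp_far rp _ zM.
    by apply: (qenv_off rp) => /(rp_bd rp); lra.
  rewrite /D /P /Q; have [z /far [Vz _] [<- _]] := Bsup_max y cV (ltW e0).
  by have [w /far [_ Uw] [<- _]] := Bsup_max y cN (ltW e0); rewrite Vz Uw; lra.
have Dge y : V y - U y <= D y.
  rewrite /D /P /Q; have := @Bsup_ub R V e y y cV; have := @Bsup_ub R NU e y y cN.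
  by rewrite subrr enorm0 => /(_ (ltW e0)) + /(_ (ltW e0)); lra.
have cS : compact S by exact: cball_compact.
have S0 : S !=set0 by exists 0; rewrite /S /cball /= subrr enorm0; lra.
have [xm Sxm xmax] := compact_max2 S0 cS (continuous_subspaceT cD).
have xSx : S x by apply: contrapT => /Doff; have := Dge x; rewrite /m in m0; lra.
have Dm : m <= D xm by apply: le_trans (Dge x) (xmax _ xSx).
have gmax y : D y <= D xm.
  by have [/xmax//|/Doff] := pselect (S y); (clear -m0 Dm; lra).
have inS y : D xm <= D y -> S y by move=> yD; apply: contrapT => /Doff; (clear -m0 Dm yD; lra).
pose EE : set E := S `&` [set y | D xm <= D y].
have cE : compact EE.
  apply: (@subclosed_compact _ _ S) => //; last by move=> ? [].
  by apply: closedI; [exact: cball_closed|exact: closed_continuous_ge].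
have [xp [Sxp Exp] pmax] := compact_max2 (ex_intro _ xm (conj Sxm (lexx _)) : EE !=set0)
  cE (continuous_subspaceT cP).
pose E2 : set E := EE `&` [set y | P xp <= P y].
have cE2 : compact E2.
  apply: (@subclosed_compact _ _ EE) => //; last by move=> ? [].
  apply: closedI; last exact: closed_continuous_ge.
  by apply: compact_closed => //; exact: norm_hausdorff.
have [x0 [[Sx0 Ex0] Px0] x0max] :=
  compact_max2 (ex_intro _ xp (conj (conj Sxp Exp) (lexx _)) : E2 !=set0)
  cE2 (continuous_subspaceT (@fst_continuous R)).
have Dx0 : D x0 = D xm by apply/eqP; rewrite eq_le gmax.
have Pmax y : D xm <= D y -> P y <= P x0.
  by move=> yD; apply: le_trans (pmax y _) Px0; split => //; exact: inS.
have HO z : enorm (z - x0) <= 2 * e -> (O `\` K) z.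
  move=> zx; apply: contrapT => nR.
  have VUz : V z = U z.
    have [Kz|Kz] := pselect (K z); first by rewrite (qenv_K rp Kz) (rp_K rp Kz).
    have nO : ~ O z by move=> Oz; apply: nR.
    by rewrite (qenv_off rp nO) (rp_off rp nO).
  have [y yx [yE _]] := Bsup_max x0 cV (ltW e0).
  have [w wx [wE _]] := Bsup_max x0 cN (ltW e0).
  have h1 := Hd1 y z; have h2 := Hd2 w z.
  have t1 := enorm_triangle3 y x0 z; have t2 := enorm_triangle3 w x0 z.
  rewrite (enormB x0 z) in t1 t2.
  have y1 : enorm (y - z) < d1 by clear -e0 ed1 zx yx t1; lra.
  have w1 : enorm (w - z) < d2 by clear -e0 ed2 zx wx t2; lra.
  have := h1 y1; have := h2 w1; rewrite yE wE -/(P x0) -/(Q x0).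
  by move: Dm; rewrite -Dx0 /D VUz; lra.
have e20 : 0 <= 2 * e by clear -e0; lra.
have half1 := qenv_half rp e0 HO; rewrite -/(P x0) in half1.
have [_ _ _ [_ jN]] := rp.
have half2 := Bsup_half jN cN e0 HO; rewrite -/(Q x0) in half2.
have [y yx [yE _]] := Bsup_max x0 cV e20.
have [y' y'x [y'E _]] := Bsup_max x0 cN e20.
set P2 := Bsup V (2 * e) x0 in half1 yE; set Q2 := Bsup NU (2 * e) x0 in half2 y'E.
have [z1 z2] := midpoint_close yx; have [z1' z2'] := midpoint_close y'x.
set z := _ *: _ in z1 z2; set z' := _ *: _ in z1' z2'.
have Pz : P2 <= P z by rewrite -yE; apply: Bsup_ub.
have Qz' : Q2 <= Q z' by rewrite -y'E; apply: (@Bsup_ub R NU).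
have Qz : - U x0 <= Q z by apply: (@Bsup_ub R NU) => //; rewrite enormB.
have Pz' : V x0 <= P z' by apply: Bsup_ub => //; rewrite enormB.
have Px : V x0 <= P x0 by apply: Bsup_ub => //; rewrite subrr enorm0 ltW.
have Qx : - U x0 <= Q x0 by apply: (@Bsup_ub R NU) => //; rewrite subrr enorm0 ltW.
have Dz := gmax z; have Dz' := gmax z'; rewrite -Dx0 /D in Dz Dz'.
(* The midpoints [z] and [z'] towards the points attaining the suprema over radius 2 e see both
   those suprema and [x0]. Adding the two halving inequalities gives D z + D z' >= 2 D x0, so [z] is
   a maximum point of [D] too and [P z] is at most [P x0]. *)
have zE : D xm <= D z by rewrite -Dx0 /D; (clear -half1 half2 Pz Qz' Qz Pz' Dz'; lra).
have zP := Pmax _ zE.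
have P0 : P x0 = V x0 by clear -half1 Pz Px zP; lra.
have Q0 : Q x0 = - U x0 by clear -half2 Qz' Pz' Qx Dz' P0; lra.
(* Now [P] and [Q] take at [x0] the values of [V] and [- U]; neither decreases on moving by e, so
   [x2] is as extremal as [x0] but has a larger first coordinate. *)
pose x2 : E := x0 + e *: (1, 0).
have x2x : enorm (x0 - x2) <= e.
  by rewrite /x2 opprD addrA subrr add0r enormN enormZ (enorm_unit e1_unit) mulr1 gtr0_norm.
have P2' : P x0 <= P x2 by rewrite P0; apply: Bsup_ub.
have Q2' : Q x0 <= Q x2 by rewrite Q0; apply: (@Bsup_ub R NU).
have x2E : D xm <= D x2 by rewrite -Dx0 /D; (clear -P2' Q2'; lra).
have := x0max x2; rewrite /x2 !vE mulr1 gerDl => H.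
suff : e <= 0 by clear -e0; lra.
by apply: H; split; [split => //; exact: inS|exact: le_trans Px0 P2'].
Qed.

Lemma circle_compact : compact [set n : E | dot n n = 1].
Proof.
apply: (@bounded_closed_compact2 _ _ 1); last by move=> n /enorm_unit ->.
rewrite (_ : [set n : E | dot n n = 1] = [set n | enorm n <= 1] `&` [set n | 1 <= enorm n]).
  by apply: closedI; [apply: closed_continuous_le|apply: closed_continuous_ge];
    exact: enorm_continuous.
apply/seteqP; split => n /=; first by move=> /enorm_unit ->.
move=> [h1 h2]; have n1 : enorm n = 1 by apply/eqP; rewrite eq_le h1.
by rewrite -enorm_sqr n1 expr1n.
Qed.

(** Normals admissible at level U x + 1 / (k + 1) cluster on the unit circle. The limit normal works
    on the open half-plane, and by uniform continuity on its boundary line. *)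
Lemma support x : exists2 n, dot n n = 1 & forall y, 0 <= dot n (y - x) -> U y <= U x.
Proof.
have H k : exists n, dot n n = 1 /\
    forall y, 0 <= dot n (y - x) -> U y <= U x + k.+1%:R^-1.
  have [|c cU [n n1 Hn]] := @qenv_lt R O K U M rp x (U x + k.+1%:R^-1).
    by rewrite qenv_eq ltrDl invr_gt0.
  by exists n; split => // y /Hn /le_trans; apply; exact: ltW.
pose nk k := sval (cid (H k)).
have nk1 k : dot (nk k) (nk k) = 1 by rewrite /nk; case: cid => n [].
have nkP k y : 0 <= dot (nk k) (y - x) -> U y <= U x + k.+1%:R^-1.
  by rewrite /nk; case: cid => n /= [_]; exact.
have [|n [n1 cl]] := @circle_compact (nk @ \oo) _; first by exists 0%N => // k _; exact: nk1.
have open_half y : 0 < dot n (y - x) -> U y <= U x.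
  move=> ny; apply/ler_addgt0Pr => e e0.
  have A : nbhs n [set q | 0 < dot q (y - x)].
    have c : continuous (fun q : E => dot q (y - x)).
      have -> : (dot^~ (y - x)) = dot (y - x) :> (E -> R) by apply: funext => w; exact: dotC.
      exact: dot_continuous.
    exact: cvgr_gt (c n) _ ny.
  have B : \forall k \near \oo, exists2 j : nat, nk k = nk j & j.+1%:R^-1 < e.
    near=> k; exists k => //; near: k; exact: near_infty_natSinv_lt (PosNum e0).
  have [q [[k qE ke] q0]] := cl [set q | exists2 j : nat, q = nk j & j.+1%:R^-1 < e] _ B A.
  have := nkP k y; rewrite -qE => /(_ (ltW q0)) /le_trans; apply.
  by rewrite lerD2l ltW.
exists n => // y; rewrite le_eqVlt => /orP[/eqP ny|/open_half//].
apply/ler_addgt0Pr => e e0; have [d d0 Hd] := rp_unifc rp e0.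
have := Hd y (y + (d / 2) *: n).
rewrite opprD addrA subrr add0r enormN enormZ (enorm_unit n1) mulr1 gtr0_norm ?divr_gt0 //.
have d2 : d / 2 < d by lra.
have := open_half (y + (d / 2) *: n).
rewrite (_ : y + _ - x = (y - x) + (d / 2) *: n); last by vring.
rewrite dotDr -ny add0r dotZr n1 mulr1 divr_gt0 // => /(_ isT) + /(_ d2); lra.
Unshelve. all: by end_near. Qed.

Lemma rp_lt1 x : ~ K x -> U x < 1.
Proof. by rewrite -qenv_eq; exact: qenv_lt1 rp x. Qed.

Lemma ball_in x : (O `\` K) x -> exists2 r, 0 < r & forall y, enorm (y - x) <= r -> (O `\` K) y.
Proof.
move=> Rx; have [[oO _ _] [cK _ _ _] _ _] := rp.
have /open_enormP /(_ x Rx) [d d0 Hd] := open_ring oO cK.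
by exists (d / 2); [lra|move=> y yd; apply: Hd; lra].
Qed.

(** Consider a first zero on the segment from a point of [K] to [x]. Comparison of [- U] with a cone
    whose vertex lies just before it, where [U] is positive, bounds [U] at the zero below by half
    the value at the vertex. *)
Lemma rp_gt0 x : O x -> 0 < U x.
Proof.
move=> Ox; have [[oO vO _] [cK _ [k Kk] KO] _ _] := rp.
have Ok := KO _ Kk.
pose g (t : R) : E := t *: x + (1 - t) *: k.
have gO t : 0 <= t <= 1 -> O (g t) by move=> t01; apply: vO.
have gE s t : g s - g t = (s - t) *: (x - k) by rewrite /g; vring.
have cg : continuous (U \o g).
  move=> t; apply/cvgrPdist_lt => e e0.
  have /continuous_enormP /(_ _ e0) [d d0 Hd] := @rp_cont _ _ _ _ _ rp (g t).
  have xk1 : 0 < enorm (x - k) + 1 by have := enorm_ge0 (x - k); lra.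
  apply/nbhs_normP; exists (d / (enorm (x - k) + 1)) => /=; first by rewrite divr_gt0.
  move=> s /=; rewrite /ball_ /= ltr_pdivlMr // => st.
  rewrite distrC; apply: Hd; rewrite gE enormZ distrC; apply: le_lt_trans st.
  by rewrite ler_wpM2l //; lra.
pose Z : set R := `[0, 1] `&` [set t | U (g t) <= 0].
have [Z0|Z0] := pselect (Z !=set0); last first.
  rewrite ltNge; apply/negP => Ux; apply: Z0; exists 1.
  split; first by rewrite /= in_itv /= ler01 lexx.
  by rewrite /= /g scale1r subrr scale0r addr0.
have cZ : compact Z.
  apply: (@subclosed_compact _ Z (`[0, 1]%classic : set R)); [|exact: segment_compact|by move=> ? []].
  apply: closedI; first exact: interval_closed.
  by have /continuous_closedP /(_ [set y | y <= 0] (@closed_le _ 0)) := cg.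
have cidZ : {within Z, continuous (fun t : R => t)}.
  by apply: continuous_subspaceT => ?; exact: cvg_id.
have [t /set_mem [t01 Ut] tmin] := compact_EVT_min Z0 cZ cidZ.
rewrite /= in_itv /= in t01.
exfalso.
have Ut0 : U (g t) = 0 by apply/eqP; rewrite eq_le Ut (rp_ge0 rp).
have Ot := gO _ t01.
have Rt : (O `\` K) (g t).
  by split => // /(rp_K rp); rewrite Ut0 => /eqP; rewrite eq_sym oner_eq0.
have [r r0 Hr] := ball_in Rt.
have t0 : 0 < t.
  move: t01 => /andP[+ _]; rewrite le_eqVlt => /orP[/eqP t0|//].
  by move: Ut0; rewrite -t0 /g scale0r add0r subr0 scale1r (rp_K rp) // => /eqP; rewrite oner_eq0.
have xk1 : 0 < enorm (x - k) + 1 by have := enorm_ge0 (x - k); lra.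
pose s := Num.max 0 (t - r / 4 / (enorm (x - k) + 1)).
have rx : 0 < r / 4 / (enorm (x - k) + 1) by rewrite !divr_gt0.
have st : s < t by rewrite gt_max t0 /=; lra.
have s0 : 0 <= s by rewrite le_max lexx.
have Us : 0 < U (g s).
  rewrite ltNge; apply/negP => Us.
  have Zs : Z s by split => //; rewrite /= in_itv /= s0 /=; move: t01 => /andP[]; (clear -st; lra).
  by have := tmin s (mem_set Zs); (clear -st; lra).
have sr : enorm (g t - g s) <= r / 4.
  rewrite gE enormZ ger0_norm; last by clear -st; lra.
  apply: (@le_trans _ _ (r / 4 / (enorm (x - k) + 1) * (enorm (x - k) + 1))).
    apply: ler_pM => //; [(clear -st; lra)|exact: enorm_ge0| |(clear -st; lra)].
    have : t - r / 4 / (enorm (x - k) + 1) <= s by rewrite le_max lexx orbT.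
    by clear -R; lra.
  by rewrite divfK // gt_eqF.
have [_ _ _ [_ jN]] := rp.
have cN := unifc_continuous (rp_unifcN rp).
have L0 : 0 <= U (g s) / (r / 2) by rewrite divr_ge0 //; (clear -r0 Us; lra).
have Lr : U (g s) / (r / 2) * (r / 2) = U (g s) by rewrite divfK // gt_eqF //; (clear -Ut0 r0; lra).
have := @cone_above R (O `\` K) NU (g s) (r / 2) (U (g s) / (r / 2)) jN cN _ L0.
move=> /(_ _ _ (g t)) H.
have /H : forall y, enorm (y - g s) <= r / 2 -> (O `\` K) y.
  move=> y ys; apply: Hr; have := enorm_triangle3 y (g s) (g t).
  by rewrite (enormB (g s)); (clear -r0 sr ys; lra).
move=> /(_ _ _)H2.
have : - U (g t) <= - U (g s) + U (g s) / (r / 2) * enorm (g t - g s).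
  apply: H2; last by lra.
  by move=> y _; rewrite Lr; have := rp_ge0 rp y; (clear -R; lra).
rewrite Ut0; have := ler_wpM2l L0 sr.
by rewrite (_ : U (g s) / (r / 2) * (r / 4) = U (g s) / 2); [(clear -Us; lra)|field; rewrite gt_eqF].
Qed.

(** The affine barrier in the strip between the support line and a parallel line at distance M + |x|
    + 1, beyond which [U] vanishes. *)
Lemma support_strip x n y : O x -> ~ K x -> dot n n = 1 ->
  (forall y, 0 <= dot n (y - x) -> U y <= U x) ->
  0 <= dot n (y - x) <= M + enorm x + 1 ->
  U y <= U x * (1 - dot n (y - x) / (M + enorm x + 1)).
Proof.
move=> Ox nK n1 Hn /andP[y0 yL]; have Ux := rp_gt0 Ox.
have L0 : 0 < M + enorm x + 1 by have := M_ge0 rp; have := enorm_ge0 x; lra.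
have := @rp_strip R O K U M rp n (dot n x) (dot n x + (M + enorm x + 1)) 0 (U x) n1
  (lexx _) Ux.
move: y0 yL; rewrite dotDr dotNr => y0 yL H.
apply: le_trans (H _ _ _ _ y _) _; try lra.
- by move=> z zx; apply: Hn; rewrite dotDr dotNr; lra.
- by move=> z zL; rewrite (rp_far_halfplane rp (x := x) n1) // dotDr dotNr; lra.
- move=> z Kz; rewrite leNgt; apply/negP => zx.
  by have := Hn z; rewrite (rp_K rp) // dotDr dotNr; have := rp_lt1 nK; lra.
rewrite subr0 (_ : dot n x + _ - dot n x = M + enorm x + 1); last by ring.
by rewrite le_eqVlt; apply/orP; left; apply/eqP; ring.
Qed.

Lemma support_strict x n y : O x -> ~ K x -> dot n n = 1 ->
  (forall y, 0 <= dot n (y - x) -> U y <= U x) -> 0 < dot n (y - x) -> U y < U x.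
Proof.
move=> Ox nK n1 Hn ny; have Ux := rp_gt0 Ox.
have L0 : 0 < M + enorm x + 1 by have := M_ge0 rp; have := enorm_ge0 x; lra.
have [yL|yL] := leP (dot n (y - x)) (M + enorm x + 1).
  have := support_strip Ox nK n1 Hn (y := y); rewrite (ltW ny) yL => /(_ isT) /le_lt_trans.
  by apply; rewrite gtr_pMr // ltrBlDr ltrDl divr_gt0.
by rewrite (rp_far_halfplane rp (x := x) n1) // ltW.
Qed.

End support.

(** * The gradient and the Gauss map *)

Section differentiability.
Context {R : realType}.
Local Notation E := (R * R)%type.
Implicit Types (x y z n h p : E) (f : E -> R).

Definition locLip f x (L : R) : Prop := exists2 d, 0 < d &
  forall y z, enorm (y - x) < d -> enorm (z - x) < d -> f z <= f y + L * enorm (z - y).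

Lemma locLipN f x L : locLip f x L -> locLip (fun y => - f y) x L.
Proof.
move=> [d d0 H]; exists d => // y z yd zd.
by have := H _ _ zd yd; rewrite enormB; lra.
Qed.

(** If the supremum over the ball stayed below f x + T r, then cones with vertices near [x],
    compared on slightly smaller balls, would give a local Lipschitz constant below [T]. *)
Lemma slope_attained (O : set E) f x (r T : R) : jsub O f -> continuous f -> 0 < r ->
  (forall y, enorm (y - x) <= r -> O y) ->
  (forall L, 0 <= L -> locLip f x L -> T <= L) ->
  exists2 y, enorm (y - x) <= r & f x + T * r <= f y.
Proof.
move=> jf cf r0 HO HT.
have [T0|T0] := leP T 0.
  by exists x; [rewrite subrr enorm0 ltW|rewrite gerDl pmulr_lle0].
have [y yr [yE ymax]] := Bsup_max x cf (ltW r0).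
exists y => //; rewrite yE leNgt; apply/negP; set m := Bsup f r x in yE ymax * => Hm.
have mx : f x <= m by apply: ymax; rewrite subrr enorm0 ltW.
pose eps := (f x + T * r - m) / 4; have eps0 : 0 < eps by rewrite divr_gt0 // subr_gt0.
have /continuous_enormP /(_ _ eps0) [d1 d10 Hd1] := cf x.
pose d := Num.min d1 (Num.min (r / 4) (eps / (T + 1))).
have T1 : 0 < T + 1 by lra.
have d0 : 0 < d by rewrite !lt_min d10 /= divr_gt0 //= divr_gt0.
have dd1 : d <= d1 by rewrite ge_min lexx.
have dr : d <= r / 4 by rewrite /d !ge_min lexx orbT.
have de : d * T <= eps.
  have : d <= eps / (T + 1) by rewrite /d !ge_min lexx !orbT.
  rewrite ler_pdivlMr //; have : 0 <= d by exact: ltW.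
  lra.
have rd0 : 0 < r - d by lra.
pose L := T - eps / (r - d).
suff LL : locLip f x (Num.max L 0).
  have : T <= Num.max L 0 by apply: HT => //; rewrite le_max lexx orbT.
  rewrite le_max => /orP[|]; last (clear -T0; lra).
  have : 0 < eps / (r - d) by rewrite divr_gt0.
  by rewrite /L; (clear -R; lra).
have Lrd : L * (r - d) = T * r - d * T - eps.
  by rewrite /L mulrBl divfK ?gt_eqF //; ring.
have LM : L <= Num.max L 0 by rewrite le_max lexx.
exists d => // w w' wd w'd.
apply: (@cone_above R O f w (r - d) (Num.max L 0) jf cf) => //.
- by move=> v vw; apply: HO; have := enorm_triangle3 v w x; (clear -wd vw; lra).
- by rewrite le_max lexx orbT.
- move=> v vw.
  have vr : enorm (v - x) <= r by have := enorm_triangle3 v w x; (clear -wd vw; lra).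
  apply: le_trans (ymax _ vr) _.
  have := Hd1 w (lt_le_trans wd dd1); rewrite ltr_norml => /andP[h1 _].
  have := ler_wpM2r (ltW rd0) LM; rewrite Lrd.
  by move: h1 de; rewrite /eps; lra.
- by have := enorm_triangle3 w' x w; rewrite (enormB x w); (clear -d0 dr wd w'd; lra).
Qed.

(** Meant for [p] near the sphere of radius [d] and [h] much smaller: the distance drops by the
    component of [h] along [p], up to the curvature term r^2 / (2 d). *)
Lemma enorm_sub_le p h (d r : R) : 0 < d -> enorm p <= d -> enorm h <= r -> r <= d ->
  enorm (p - h) <= d - dot (d^-1 *: p) h + r ^+ 2 / (2 * d).
Proof.
move=> d0 pd hr rd; have r0 : 0 <= r := le_trans (enorm_ge0 _) hr.
rewrite dotZl; set a := dot p h.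
have ad : a <= d * r.
  by apply: le_trans (dot_le p h) _; apply: ler_pM => //; exact: enorm_ge0.
have ad' : d^-1 * a <= r by rewrite mulrC ler_pdivrMr // mulrC.
have b0 : 0 <= r ^+ 2 / (2 * d) by rewrite divr_ge0 ?sqr_ge0 // mulr_ge0 // ltW.
rewrite enorm_leP; last by lra.
have -> : dot (p - h) (p - h) = enorm p ^+ 2 - 2 * a + enorm h ^+ 2.
  by rewrite !enorm_sqr /a /dot !vE; ring.
have p2 : enorm p ^+ 2 <= d ^+ 2 by rewrite ler_pXn2r ?nnegrE ?enorm_ge0 // ltW.
have h2 : enorm h ^+ 2 <= r ^+ 2 by rewrite ler_pXn2r ?nnegrE ?enorm_ge0.
apply: (@le_trans _ _ (d ^+ 2 - 2 * a + r ^+ 2)); first by lra.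
rewrite -subr_ge0 (_ : _ - _ = (d^-1 * a - r ^+ 2 / (2 * d)) ^+ 2) ?sqr_ge0 //.
by field; rewrite gt_eqF.
Qed.

Context (O K : set E) (U : E -> R) (M : R) (rp : ringpot O K U M).

Definition slope x : R := inf [set L | 0 <= L /\ locLip U x L].

Lemma slope_lb x : has_lbound [set L | 0 <= L /\ locLip U x L].
Proof. by exists 0 => L []. Qed.

Lemma slope_nonempty x : (O `\` K) x -> [set L | 0 <= L /\ locLip U x L] !=set0.
Proof.
move=> /(ball_in rp) [r r0 Hr]; have [_ _ _ [jU _]] := rp.
have cU := @rp_cont _ _ _ _ _ rp.
exists (2 / r); split; first by rewrite divr_ge0 // ltW.
exists (r / 4); first by rewrite divr_gt0.
move=> y z yr zr.
apply: (@cone_above R (O `\` K) U y (r / 2) (2 / r) jU cU).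
- by move=> w wy; apply: Hr; have := enorm_triangle3 w y x; lra.
- by rewrite divr_ge0 // ltW.
- move=> w _; rewrite (_ : 2 / r * (r / 2) = 1); last by field; rewrite gt_eqF.
  by have := rp_le1 rp w; have := rp_ge0 rp y; lra.
- by have := enorm_triangle3 z x y; rewrite (enormB x y); lra.
Qed.

Lemma slope_le x L : 0 <= L -> locLip U x L -> slope x <= L.
Proof. by move=> L0 HL; apply: ge_inf; [exact: slope_lb|split]. Qed.

Lemma slope_near x e : (O `\` K) x -> 0 < e -> locLip U x (slope x + e).
Proof.
move=> Rx e0.
have : slope x < slope x + e by rewrite ltrDl.
move=> /(inf_lt (slope_nonempty Rx)) [L [L0 [d d0 Hd]] Le].
exists d => // y z yd zd; apply: le_trans (Hd _ _ yd zd) _.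
by rewrite lerD2l ler_wpM2r ?enorm_ge0 // ltW.
Qed.

Lemma slope_usc x e : (O `\` K) x -> 0 < e -> exists2 d, 0 < d &
  forall y, enorm (y - x) < d -> slope y <= slope x + e.
Proof.
move=> Rx e0; have [d d0 Hd] := slope_near Rx e0.
have T0 : 0 <= slope x by apply: lb_le_inf (slope_nonempty Rx) _ => L [].
exists d => // y yd; apply: slope_le; first by lra.
exists (d - enorm (y - x)); first by rewrite subr_gt0.
move=> u v uy vy; apply: Hd.
  by have := enorm_triangle3 u y x; lra.
by have := enorm_triangle3 v y x; lra.
Qed.

Lemma slope_ge x : (O `\` K) x -> U x / (M + enorm x + 1) <= slope x.
Proof.
move=> [Ox nK]; have [n n1 Hn] := support rp x.
have L0 : 0 < M + enorm x + 1 by have := M_ge0 rp; have := enorm_ge0 x; lra.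
apply: lb_le_inf (slope_nonempty (conj Ox nK)) _ => L [L00 [d d0 Hd]].
pose t := Num.min (d / 2) (M + enorm x + 1).
have t0 : 0 < t by rewrite lt_min L0 divr_gt0.
have td : t <= d / 2 by rewrite ge_min lexx.
have tL : t <= M + enorm x + 1 by rewrite ge_min lexx orbT.
have yx : (x + t *: n) - x = t *: n by rewrite addrC addKr.
have := @support_strip R O K U M rp x n (x + t *: n) Ox nK n1 Hn.
rewrite yx dotZr n1 mulr1 (ltW t0) tL => /(_ isT) h1.
have := Hd (x + t *: n) x; rewrite yx subrr enorm0 -opprB yx enormN enormZ (enorm_unit n1).
rewrite mulr1 gtr0_norm // => /(_ _ d0) h2.
have {}h2 : U x <= U (x + t *: n) + L * t by apply: h2; lra.
rewrite -(ler_pM2r t0).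
have : U x * t / (M + enorm x + 1) <= L * t by move: h1 h2; rewrite mulrBr mulr1 mulrA; lra.
by rewrite mulrAC.
Qed.

Lemma slope_gt0 x : (O `\` K) x -> 0 < slope x.
Proof.
move=> Rx; apply: lt_le_trans (slope_ge Rx); rewrite divr_gt0 //.
  by apply: (rp_gt0 rp); case: Rx.
by have := M_ge0 rp; have := enorm_ge0 x; lra.
Qed.

(** At a scale [d] much larger than |h| the slope is attained upwards at [y] and downwards at [z].
    The local Lipschitz bound from [y] and [z] confines [U] near [x] between two almost affine
    functions, with gradients [T *: P] below and [- (T *: Q)] above; the support half-plane forces
    [P] to be close to [- n]. *)
Lemma potential_diff x n : (O `\` K) x -> dot n n = 1 ->
  (forall y, 0 <= dot n (y - x) -> U y <= U x) ->
  forall e, 0 < e -> exists2 d, 0 < d &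
    forall h, enorm h < d -> `|U (x + h) - U x + slope x * dot n h| <= e * enorm h.
Proof.
move=> Rx n1 Hn e e0; set T := slope x; have T0 : 0 < T := slope_gt0 Rx.
have [_ _ _ [jU jN]] := rp; have cU := @rp_cont _ _ _ _ _ rp.
have cN := unifc_continuous (rp_unifcN rp).
pose C := T / 2 + 2.
have C0 : 0 < C by rewrite /C; lra.
pose D := 4 * C + 1 + C ^+ 2 / T.
have D0 : 0 < D by rewrite /D; have := divr_ge0 (sqr_ge0 C) (ltW T0); lra.
(* [s] is the ratio of |h| to the larger scale [d]. The error [C * (s * r)] gathers the curvature of
   spheres of radius [d] and the excess s^2 of the Lipschitz constant; [D] gathers the final
   errors. *)
pose s := Num.min (Num.min (1 / 2) (e / D)) (Num.min (T / C / 8) (T / 8)).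
have s0 : 0 < s by rewrite !lt_min !divr_gt0.
have s1 : s <= 1 / 2 by rewrite !ge_min lexx.
have s2 : s * D <= e by rewrite -ler_pdivlMr // !ge_min lexx orbT.
have s3 : C * s / T <= 1 / 8.
  rewrite ler_pdivrMr // mulrC -ler_pdivlMr //.
  have : s <= T / C / 8 by rewrite !ge_min lexx !orbT.
  by rewrite (_ : 1 / 8 * T / C = T / C / 8); last by field; rewrite gt_eqF.
have s4 : s / T <= 1 / 8.
  rewrite ler_pdivrMr //; have : s <= T / 8 by rewrite !ge_min lexx !orbT.
  clear -R; lra.
have ss0 : 0 < s ^+ 2 by rewrite exprn_gt0.
have [d0 d00 Hd0] := slope_near Rx ss0; rewrite -/T in Hd0.
have [r0 r00 Hr0] := ball_in rp Rx.
pose dm := Num.min d0 r0; have dm0 : 0 < dm by rewrite lt_min d00.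
exists (s * dm / 2); first by rewrite divr_gt0 // mulr_gt0.
move=> h hd; have [->|h0] := eqVneq h 0.
  by rewrite addr0 subrr dot0r mulr0 addr0 normr0 enorm0 mulr0.
set r := enorm h in hd *; have rp0 : 0 < r := enorm_gt0 h0.
pose d := r / s; have dpos : 0 < d by rewrite divr_gt0.
have dlt : d < dm / 2 by rewrite /d ltr_pdivrMr //; (clear -hd; lra).
have dm_d0 : dm <= d0 by rewrite ge_min lexx.
have dm_r0 : dm <= r0 by rewrite ge_min lexx orbT.
have rd : r = s * d by rewrite /d mulrC divfK // gt_eqF.
have rled : r <= d by rewrite rd ger_pMl //; (clear -s1; lra).
have HO y : enorm (y - x) <= d -> (O `\` K) y by move=> yd; apply: Hr0; (clear -dpos dlt dm_r0 yd; lra).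
have [y yd Uy] := @slope_attained (O `\` K) U x d T jU cU dpos HO (@slope_le x).
have [z zd Uz] : exists2 z, enorm (z - x) <= d & - U x + T * d <= - U z.
  apply: (slope_attained jN cN dpos HO) => L L00 /locLipN HL; apply: slope_le => //.
  by rewrite (_ : U = (fun y => - - U y)) //; apply: funext => w; rewrite opprK.
pose p := y - x; pose q := z - x; pose P := d^-1 *: p; pose Q := d^-1 *: q.
have P1 : enorm P <= 1 by rewrite /P enormZ gtr0_norm ?invr_gt0 // mulrC ler_pdivrMr // mul1r.
pose b := r ^+ 2 / (2 * d).
have bE : b = s * r / 2 by rewrite /b rd; field; rewrite gt_eqF.
have lip k : enorm k <= r -> enorm (x + k - x) < d0.
  by move=> kr; rewrite [x + k]addrC addrK; (clear -dpos dlt dm_d0 rled kr; lra).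
have err : T * b + s ^+ 2 * (d + r + b) <= C * (s * r).
  rewrite bE (_ : s ^+ 2 * (d + r + s * r / 2) = s * r * (1 + s + s ^+ 2 / 2)); last first.
    by rewrite rd; field.
  have sr0 : 0 < s * r by rewrite mulr_gt0.
  have : 1 + s + s ^+ 2 / 2 <= 2.
    have : s ^+ 2 <= 1 / 4 by rewrite expr2; have := ler_pM (ltW s0) (ltW s0) s1 s1; (clear -R; lra).
    clear -s1; lra.
  by move=> /(ler_wpM2l (ltW sr0)); rewrite /C; (clear -R; lra).
have Pk k : enorm k <= r -> `|dot P k| <= r.
  move=> kr; apply: le_trans (dot_abs_le _ _) _.
  by rewrite -[r]mul1r; apply: ler_pM => //; exact: enorm_ge0.
have Q1 : enorm Q <= 1 by rewrite /Q enormZ gtr0_norm ?invr_gt0 // mulrC ler_pdivrMr // mul1r.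
have Qk k : enorm k <= r -> `|dot Q k| <= r.
  move=> kr; apply: le_trans (dot_abs_le _ _) _.
  by rewrite -[r]mul1r; apply: ler_pM => //; exact: enorm_ge0.
have Ts : 0 <= T + s ^+ 2 by clear -T0 ss0; lra.
have low k : enorm k <= r -> T * dot P k - C * (s * r) <= U (x + k) - U x.
  move=> kr; have yd0 : enorm (y - x) < d0 by clear -dpos dlt dm_d0 yd; lra.
  have := Hd0 _ _ (lip _ kr) yd0.
  rewrite (_ : y - (x + k) = p - k); last by rewrite /p; vring.
  have := enorm_sub_le dpos yd kr rled; rewrite -/p -/P -/b.
  move=> /(ler_wpM2l Ts) h1 h2.
  have := Pk _ kr; rewrite ler_norml => /andP[h3 h4].
  have := ler_wpM2l (ltW ss0) h3.
  by move: h1 h2 Uy err; clearbody T d b p P; (clear -R; lra).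
have upp k : enorm k <= r -> U (x + k) - U x <= - (T * dot Q k) + C * (s * r).
  move=> kr; have zd0 : enorm (z - x) < d0 by clear -dpos dlt dm_d0 zd; lra.
  have := Hd0 _ _ zd0 (lip _ kr); rewrite enormB.
  rewrite (_ : z - (x + k) = q - k); last by rewrite /q; vring.
  have := enorm_sub_le dpos zd kr rled; rewrite -/q -/Q -/b.
  move=> /(ler_wpM2l Ts) h1 h2.
  have := Qk _ kr; rewrite ler_norml => /andP[h3 h4].
  have := ler_wpM2l (ltW ss0) h3.
  by move: h1 h2 Uz err; clearbody T d b q Q; (clear -R; lra).
pose de := C * s / T.
have de0 : 0 < de by rewrite divr_gt0 // mulr_gt0.
(* [U] does not exceed [U x] beyond the support line, so [P] has almost no positive component in
   such directions. Since |P| is almost 1, [P] is close to [- n]. *)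
have sup k : dot k k = 1 -> 0 <= dot n k -> dot P k <= de.
  move=> k1 nk; have kr : enorm (r *: k) <= r by rewrite enormZ (enorm_unit k1) mulr1 gtr0_norm.
  have := low _ kr; have := Hn (x + r *: k); rewrite [x + _]addrC addrK !dotZr.
  rewrite mulr_ge0 ?(ltW rp0) // => /(_ isT) h1 h2.
  rewrite /de ler_pdivlMr // -(ler_pM2r rp0).
  by move: h1 h2; (clear -R; lra).
have pn := sup _ n1; rewrite n1 in pn; have {}pn := pn ler01.
have t1 := perp_unit n1.
have pt1 := sup _ t1; rewrite dot_perp in pt1; have {}pt1 := pt1 (lexx _).
have pt2 : - dot P (perp n) <= de.
  by rewrite -dotNr; apply: sup; rewrite ?dotNl ?dotNr ?opprK ?dot_perp ?oppr0.
have PP : 1 - 2 * (s ^+ 2 / T) <= dot P P.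
  have xd0 : enorm (x - x) < d0 by rewrite subrr enorm0.
  have yd0 : enorm (y - x) < d0 by clear -dpos dlt dm_d0 yd; lra.
  have := Hd0 _ _ xd0 yd0; rewrite -/p => h1.
  have pP : enorm p = d * enorm P.
    by rewrite /P enormZ gtr0_norm ?invr_gt0 // mulrA divff ?mul1r // gt_eqF.
  have h2 : T <= (T + s ^+ 2) * enorm P.
    by rewrite -(ler_pM2l dpos); move: h1 Uy; rewrite pP; (clear -R; lra).
  have h3 : s ^+ 2 * enorm P <= s ^+ 2 by rewrite ger_pMr.
  have h4 : 1 - s ^+ 2 / T <= enorm P.
    rewrite -(ler_pM2l T0) mulrBr mulr1 mulrCA divff ?mulr1 ?gt_eqF //.
    by move: h2 h3; rewrite mulrDl; (clear -R; lra).
  rewrite -enorm_sqr.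
  have [h5|h5] := leP (1 - s ^+ 2 / T) 0.
    by have := sqr_ge0 (enorm P); (clear -h5; lra).
  have := ler_pM (ltW h5) (ltW h5) h4 h4; move: (s ^+ 2 / T) => t.
  by have := sqr_ge0 t; (clear -R; lra).
pose a := dot P n; pose c := dot P (perp n).
have PPE : dot P P = a ^+ 2 + c ^+ 2 by rewrite (dot_perp2 P P n1) -!expr2.
have c2 : c ^+ 2 <= de ^+ 2.
  by rewrite -[c ^+ 2]real_normK ?num_real // ler_pXn2r ?nnegrE ?(ltW de0) // ler_norml; apply/andP; split; rewrite /c; (clear -pt1 pt2; lra).
pose th := 2 * (s ^+ 2 / T) + de ^+ 2.
have de8 : de <= 1 / 8 by [].
have de2 : de ^+ 2 <= 1 / 64.
  by rewrite expr2; have := ler_pM (ltW de0) (ltW de0) de8 de8; (clear -R; lra).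
have sT0 : 0 <= s / T by rewrite divr_ge0 // ltW.
have th4 : th <= 1 / 4.
  rewrite /th (_ : s ^+ 2 / T = s * (s / T)); last by ring.
  have := ler_pM (ltW s0) sT0 s1 s4; (clear -de2; lra).
have th0 : 0 <= th by rewrite /th addr_ge0 ?sqr_ge0 // mulr_ge0 // divr_ge0 ?sqr_ge0 // ltW.
have a2 : 1 - th <= a ^+ 2 by rewrite /th; (clear -PP PPE c2; lra).
have a_lt0 : a < 0.
  rewrite ltNge; apply/negP => a0; have := ler_pM a0 a0 pn pn; rewrite -!expr2 -/a; (clear -de2 th4 a2; lra).
have a_ge : -1 <= a.
  have := dot_ge P n; rewrite (enorm_unit n1) mulr1 -/a; (clear -P1; lra).
have a1 : 1 + a <= th.
  have := mulr_ge0 (_ : 0 <= 1 + a) (_ : 0 <= - a) => /(_ _ _)H.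
  have : 0 <= (1 + a) * - a by apply: mulr_ge0; (clear -a_lt0 a_ge; lra).
  by move: a2; rewrite expr2; (clear -R; lra).
have Pn : enorm (P + n) <= th + de.
  have thde : 0 <= th + de by clear -pt1 pt2 a_ge a1; lra.
  rewrite enorm_leP //.
  rewrite (_ : dot (P + n) (P + n) = dot P P + 2 * a + dot n n); last by rewrite /a /dot !vE; ring.
  rewrite PPE n1 (_ : _ + 1 = (1 + a) ^+ 2 + c ^+ 2); last by ring.
  have h1 : (1 + a) ^+ 2 <= th ^+ 2 by rewrite ler_pXn2r ?nnegrE //; (clear -a_ge; lra).
  rewrite sqrrD; have := mulr_ge0 th0 (ltW de0); rewrite mulr2n; (clear -c2 h1; lra).
have Pnh : `|dot (P + n) h| <= (th + de) * r.
  by apply: le_trans (dot_abs_le _ _) _; rewrite ler_wpM2r // ltW.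
have hr : enorm h <= r by [].
have hNr : enorm (- h) <= r by rewrite enormN.
(* Comparing the lower and upper bounds at [- h] bounds [- <Q, h>] by [<P, h>]; the upper bound at
   [h] then becomes one in terms of [P], with three errors C s r in all. *)
have l1 := low _ hr; have u1 := upp _ hr; have l2 := low _ hNr; have u2 := upp _ hNr.
have fin : T * (th + de) + 3 * (C * s) <= e.
  apply: le_trans s2.
  have -> : T * (th + de) + 3 * (C * s) = 2 * s ^+ 2 + C ^+ 2 * s ^+ 2 / T + 4 * (C * s).
    by rewrite /th /de; field; rewrite gt_eqF.
  have h1 : s ^+ 2 <= s * (1 / 2) by rewrite expr2 ler_wpM2l // ltW.
  have h2 : C ^+ 2 / T * s ^+ 2 <= C ^+ 2 / T * (s * (1 / 2)).
    by rewrite ler_wpM2l // divr_ge0 ?sqr_ge0 // ltW.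
  have h3 : 0 <= C ^+ 2 / T * s by rewrite mulr_ge0 ?divr_ge0 ?sqr_ge0 // ltW.
  by rewrite /D; (clear -h1 h2 h3; lra).
have := ler_wpM2r (ltW rp0) fin.
have := ler_wpM2l (ltW T0) Pnh.
move: Pnh; rewrite dotDl ler_norml => /andP[g1 g2].
have := ler_wpM2l (ltW T0) g1; have := ler_wpM2l (ltW T0) g2.
by move: l1 u1 l2 u2; rewrite !dotNr ler_norml; (clear -R; lra).
Qed.

End differentiability.

(** * The Gauss map and the monotonicity inequalities *)

Section gauss_map.
Context {R : realType}.
Local Notation E := (R * R)%type.
Implicit Types (x y z n h p a b : E) (f : E -> R).
Context (O K : set E) (U : E -> R) (M : R) (rp : ringpot O K U M).
Local Notation T := (slope U).

(** A choice of support normal. In the ring it is unique, since [potential_diff] makes the gradient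
    a negative multiple of it. *)
Definition nrm x : E :=
  xget 0 [set n | dot n n = 1 /\ forall y, 0 <= dot n (y - x) -> U y <= U x].

Lemma nrmP x : dot (nrm x) (nrm x) = 1 /\ forall y, 0 <= dot (nrm x) (y - x) -> U y <= U x.
Proof.
rewrite /nrm; case: xgetP => [n _ //|H]; have [n n1 Hn] := support rp x.
by case: (H n).
Qed.

Lemma nrm1 x : dot (nrm x) (nrm x) = 1. Proof. by case: (nrmP x). Qed.
Lemma nrm_supp x y : 0 <= dot (nrm x) (y - x) -> U y <= U x.
Proof. by case: (nrmP x) => _; apply. Qed.

Lemma dot_unit_le1 a n : dot a a = 1 -> dot n n = 1 -> dot a n <= 1.
Proof. by move=> /enorm_unit a1 /enorm_unit n1; have := dot_le a n; rewrite a1 n1 mulr1. Qed.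

Lemma dot_unit_geN1 a n : dot a a = 1 -> dot n n = 1 -> -1 <= dot a n.
Proof. by move=> /enorm_unit a1 /enorm_unit n1; have := dot_ge a n; rewrite a1 n1 mulr1. Qed.

Lemma nrm_strict x y : (O `\` K) x -> 0 < dot (nrm x) (y - x) -> U y < U x.
Proof.
by move=> [Ox nK]; apply: (support_strict rp Ox nK (nrm1 x)); exact: nrm_supp.
Qed.

Lemma nrm_K x k : (O `\` K) x -> K k -> dot (nrm x) k <= dot (nrm x) x.
Proof.
move=> [Ox nK] Kk; rewrite leNgt; apply/negP => H.
have : 0 <= dot (nrm x) (k - x) by rewrite dotDr dotNr; lra.
move=> /nrm_supp; rewrite (rp_K rp Kk) leNgt.
by rewrite (rp_lt1 rp nK).
Qed.

Lemma nrm_wedge x x' : (O `\` K) x' -> U x < U x' -> nrm x' + nrm x != 0 ->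
  forall y, 0 <= dot (nrm x') (y - x') -> 0 <= dot (nrm x) (x - y) ->
  0 < dot (nrm x) (x - y) + dot (nrm x') (y - x') ->
  U y <= (U x + U x') / 2 + (U x' - U x) / 2 *
    wprof (wslope (nrm x') (nrm x))
     ((dot (nrm x) (x - y) - dot (nrm x') (y - x')) /
      (dot (nrm x) (x - y) + dot (nrm x') (y - x'))).
Proof.
move=> Rx' xx' nn y.
have eB p q : dot (nrm x) p - dot (nrm x) q = dot (nrm x) (p - q) by rewrite dotDr dotNr.
have eA p q : dot (nrm x') p - dot (nrm x') q = dot (nrm x') (p - q) by rewrite dotDr dotNr.
have := @rp_wedge R O K U M rp (nrm x') (nrm x) (dot (nrm x') x') (dot (nrm x) x)
  ((U x + U x') / 2) ((U x' - U x) / 2) (nrm1 _) (nrm1 _) nn.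
rewrite /wratio => H ya yb yab.
have e2 : (U x + U x') / 2 - (U x' - U x) / 2 = U x by lra.
have e1 : (U x + U x') / 2 + (U x' - U x) / 2 = U x' by lra.
have {}H := H _ _ _ _ _ y; rewrite !eA !eB in H; apply: H => //.
- by rewrite divr_gt0 // subr_gt0.
- by rewrite e2 (rp_ge0 rp).
- by move=> z; rewrite eA e1; exact: nrm_supp.
- move=> z; rewrite eB e2 => zB; apply: nrm_supp.
  by move: zB; rewrite -opprB dotNr; lra.
- by move=> z; exact: nrm_K.
Qed.

Lemma nrm_opp_far x x' : U x < U x' -> 0 < dot (nrm x') (x - x') -> nrm x' + nrm x != 0.
Proof.
move=> xx' D0; apply/eqP => /eqP; rewrite addr_eq0 => /eqP e.
have : 0 <= dot (nrm x) (x' - x) by move: D0; rewrite e dotNl -dotNr opprB => /ltW.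
by move=> /nrm_supp; rewrite leNgt xx'.
Qed.

(** The wedge between the two support lines is tested at x - t [nrm x], as t tends to 0. There [U]
    has grown by about T x t, while by [wprof_lo] the barrier has grown by at most t (U x' - U x) /
    D. *)
Lemma slope_nrm_le x x' : (O `\` K) x -> (O `\` K) x' -> U x <= U x' ->
  T x * dot (nrm x') (x - x') <= U x' - U x.
Proof.
move=> Rx Rx' xx'; have T0 := slope_gt0 rp Rx.
have [D0|D0] := leP (dot (nrm x') (x - x')) 0.
  by apply: (@le_trans _ _ 0); [rewrite pmulr_rle0|rewrite subr_ge0].
have xlt := nrm_strict Rx' D0.
have nn := nrm_opp_far xlt D0.
set D := dot _ _ in D0 *; apply/ler_addgt0Pr => e e0.
have e10 : 0 < e / D by rewrite divr_gt0.
have [d d0 Hd] := potential_diff rp Rx (nrm1 x) (@nrm_supp x) e10.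
pose t := Num.min (d / 2) (D / 2).
have t0 : 0 < t by rewrite lt_min !divr_gt0.
have td : t <= d / 2 by rewrite ge_min lexx.
have tD : t <= D / 2 by rewrite ge_min lexx orbT.
have hE : enorm (- (t *: nrm x)) = t.
  by rewrite enormN enormZ (enorm_unit (nrm1 x)) mulr1 gtr0_norm.
have hd : enorm (- (t *: nrm x)) < d by rewrite hE; lra.
have := Hd _ hd; rewrite hE dotNr dotZr nrm1 mulr1 ler_norml => /andP[h1 _].
set g := dot (nrm x') (nrm x).
have g1 : g <= 1 := dot_unit_le1 (nrm1 _) (nrm1 _).
have gt1 : t * g <= t by rewrite ger_pMr.
have ea : dot (nrm x') ((x - t *: nrm x) - x') = D - t * g.
  by rewrite addrAC dotDr dotNr dotZr.
have eb : dot (nrm x) (x - (x - t *: nrm x)) = t.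
  by rewrite opprB addrC subrK dotZr nrm1 mulr1.
have := @nrm_wedge x x' Rx' xlt nn (x - t *: nrm x); rewrite ea eb.
have q0 : 0 < t + (D - t * g) by clear -t0 tD gt1; lra.
have q1 : 0 <= D - t * g by clear -tD gt1 q0; lra.
move=> /(_ q1 (ltW t0) q0).
pose s := 2 * t / (t + (D - t * g)).
have s01 : 0 <= s <= 1.
  by rewrite divr_ge0 ?mulr_ge0 ?(ltW t0) ?(ltW q0) //= ler_pdivrMr // mul1r; (clear -tD gt1; lra).
have -> : (t - (D - t * g)) / (t + (D - t * g)) = - (1 - s).
  by rewrite /s; field; rewrite gt_eqF.
rewrite wprofN => h2.
have := wprof_lo (wslope_ge0 (nrm x') (nrm x)) s01.
have c0 : 0 < (U x' - U x) / 2 by rewrite divr_gt0 // subr_gt0.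
move=> /(ler_wpM2l (ltW c0)) h3.
have h4 : (U x' - U x) / 2 * s <= (U x' - U x) * (t / D).
  rewrite /s (_ : _ / 2 * _ = (U x' - U x) * (t / (t + (D - t * g)))); last first.
    by field; rewrite gt_eqF.
  rewrite ler_wpM2l ?subr_ge0 // ler_wpM2l ?(ltW t0) // lef_pV2 ?posrE //; (clear -gt1; lra).
have h5 : T x * t <= ((U x' - U x) / D + e / D) * t.
  have -> : ((U x' - U x) / D + e / D) * t = (U x' - U x) * (t / D) + e / D * t by ring.
  by move: h1 h2 h3 h4; move: (wprof _ _) => w; (clear -R; lra).
by move: h5; rewrite ler_pM2r // -mulrDl ler_pdivlMr.
Qed.

(** Half-angle formula: cos^2 (theta / 2) = (1 + cos theta) / 2. *)
Lemma wslope_unit a b : dot a a = 1 -> dot b b = 1 -> a + b != 0 ->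
  (1 + wslope a b ^+ 2)^-1 = (1 + dot a b) / 2.
Proof.
move=> a1 b1 ab; have := enorm_gt0 ab => ab0.
rewrite /wslope exprMn exprVn !enorm_sqr.
have e1 : dot (a + b) (a + b) = 2 + 2 * dot a b.
  by rewrite !dotDl !dotDr a1 b1 (dotC b a); ring.
have e2 : dot (a - b) (a - b) = 2 - 2 * dot a b.
  by rewrite !dotDl !dotDr !dotNl !dotNr a1 b1 (dotC b a); ring.
have : 0 < dot (a + b) (a + b) by rewrite -enorm_sqr exprn_gt0.
rewrite e2 e1 => H; field; apply/andP; split; apply: lt0r_neq0; lra.
Qed.

(** The same wedge tested at the other side, at x' + t [nrm x']: there [U] has fallen by about T x'
    t, and the barrier by at least the rate of [wprof_hi]. The factor 1 / (1 + k^2) is the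
    half-angle term of the statement. *)
Lemma slope_nrm_ge x x' : (O `\` K) x -> (O `\` K) x' -> U x <= U x' ->
  (U x' - U x) * ((1 + dot (nrm x) (nrm x')) / 2) <= T x' * dot (nrm x) (x - x').
Proof.
move=> Rx Rx'; have T0 := slope_gt0 rp Rx'; rewrite le_eqVlt => /orP[/eqP xx'|xx'].
  rewrite xx' subrr mul0r mulr_ge0 ?(ltW T0) // -opprB dotNr oppr_ge0 leNgt; apply/negP.
  by move=> /(nrm_strict Rx); rewrite xx' ltxx.
set D := dot _ (x - x').
have D0 : 0 < D.
  rewrite /D -opprB dotNr oppr_gt0 ltNge; apply/negP => /nrm_supp.
  by rewrite leNgt xx'.
have [nn|nn] := eqVneq (nrm x' + nrm x) 0.
  move: nn => /eqP; rewrite addr_eq0 => /eqP ->.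
  by rewrite dotNr nrm1 subrr mul0r mulr0 mulr_ge0 // ltW.
rewrite [dot (nrm x) _]dotC -(wslope_unit (nrm1 _) (nrm1 _) nn).
set k := wslope _ _; have k0 : 0 <= k := wslope_ge0 _ _.
have k20 : 0 < 1 + k ^+ 2 by have := sqr_ge0 k; lra.
set g := dot (nrm x) (nrm x').
have g1 : g <= 1 := dot_unit_le1 (nrm1 _) (nrm1 _).
have gN1 : -1 <= g := dot_unit_geN1 (nrm1 _) (nrm1 _).
apply/ler_addgt0Pr => e e0.
pose e1 := Num.min 1 (e / (D + 2 * T x' + 2)).
have DT : 0 < D + 2 * T x' + 2 by lra.
have e10 : 0 < e1 by rewrite lt_min ltr01 divr_gt0.
have e11 : e1 <= 1 by rewrite ge_min lexx.
have e1e : e1 * (D + 2 * T x' + 2) <= e by rewrite -ler_pdivlMr // ge_min lexx orbT.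
clearbody e1.
have [d d0 Hd] := potential_diff rp Rx' (nrm1 x') (@nrm_supp x') e10.
pose t := Num.min (d / 2) (Num.min (D / 2) e1).
have t0 : 0 < t by rewrite !lt_min !divr_gt0.
have td : t <= d / 2 by rewrite ge_min lexx.
have tD : t <= D / 2 by rewrite !ge_min lexx orbT.
have te : t <= e1 by rewrite !ge_min lexx !orbT.
have hE : enorm (t *: nrm x') = t.
  by rewrite enormZ (enorm_unit (nrm1 x')) mulr1 gtr0_norm.
have hd : enorm (t *: nrm x') < d by rewrite hE; (clear -t0 td; lra).
have := Hd _ hd; rewrite hE dotZr nrm1 mulr1 ler_norml => /andP[h1 _].
have gt1 : t * g <= t by rewrite ger_pMr.
have gt2 : - t <= t * g by rewrite -{1}[t]mulr1 -mulrN ler_pM2l.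
have ea : dot (nrm x') ((x' + t *: nrm x') - x') = t.
  by rewrite addrC addKr dotZr nrm1 mulr1.
have eb : dot (nrm x) (x - (x' + t *: nrm x')) = D - t * g.
  by rewrite opprD addrA dotDr dotNr dotZr.
have := @nrm_wedge x x' Rx' xx' nn (x' + t *: nrm x'); rewrite ea eb -/k.
have q0 : 0 < D - t * g + t by clear -t0 tD gt1; lra.
have q1 : 0 <= D - t * g by clear -tD gt1 gt2; lra.
move=> /(_ (ltW t0) q1 q0).
pose s := 2 * t / (D - t * g + t).
have s01 : 0 <= s <= 1.
  by rewrite divr_ge0 ?mulr_ge0 ?(ltW t0) ?(ltW q0) //= ler_pdivrMr // mul1r; (clear -tD gt1; lra).
have -> : (D - t * g - t) / (D - t * g + t) = 1 - s.
  by rewrite /s; field; rewrite gt_eqF.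
move=> h2; have := wprof_hi k0 s01.
have c0 : 0 < (U x' - U x) / 2 by rewrite divr_gt0 // subr_gt0.
move=> /(ler_wpM2l (ltW c0)) h3.
have h4 : (U x' - U x) / 2 * (s / (1 + k ^+ 2)) <= (T x' + e1) * t.
  by move: h1 h2 h3; move: (wprof _ _) (s / _) => w v; (clear -R; lra).
have h5 : (U x' - U x) / (1 + k ^+ 2) <= (T x' + e1) * (D - t * g + t).
  rewrite -(ler_pM2r t0) -[leRHS]mulrAC -ler_pdivrMr //; apply: le_trans h4.
  rewrite (_ : _ / 2 * _ = (U x' - U x) / (1 + k ^+ 2) * t / (D - t * g + t)) //.
  by rewrite /s; field; rewrite !gt_eqF.
apply: (le_trans h5).
have h6 : (T x' + e1) * (D - t * g + t) <= (T x' + e1) * (D + 2 * e1).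
  by rewrite ler_wpM2l //; (clear -T0 te gt1 gt2; lra).
apply: (le_trans h6); rewrite mulrDr !mulrDl.
have h7 : e1 * (2 * e1) <= 2 * e1 by rewrite ger_pMl ?mulr_gt0 //; lra.
by move: e1e; rewrite !mulrDr; (clear -h7; lra).
Qed.

(** The point x + r ([nrm y] - [nrm x]) lies beyond the support line at [y], where [U] is at most
    [U y]. By the expansion at [x] it would lie higher than [x] by about r T x (1 - <nrm y, nrm x>),
    a contradiction if the normals differ by more than [e]. *)
Lemma nrm_cont x e : (O `\` K) x -> 0 < e -> exists2 d, 0 < d &
  forall y, enorm (y - x) < d -> enorm (nrm y - nrm x) <= e.
Proof.
move=> Rx e0; have T0 := slope_gt0 rp Rx.
have e10 : 0 < T x * e / 8 by rewrite !mulr_gt0.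
have [d d0 Hd] := potential_diff rp Rx (nrm1 x) (@nrm_supp x) e10.
pose r := d / 4; have r0 : 0 < r by rewrite divr_gt0.
have e20 : 0 < r * T x * e ^+ 2 / 8 by rewrite !mulr_gt0.
have /continuous_enormP /(_ _ e20) [d1 d10 Hd1] := @rp_cont _ _ _ _ _ rp x.
exists (Num.min d1 (r * e ^+ 2 / 2)).
  by rewrite lt_min d10 divr_gt0 // mulr_gt0 // exprn_gt0.
move=> y; rewrite lt_min => /andP[yd1 yr]; rewrite leNgt; apply/negP => H.
set w := enorm (nrm y - nrm x) in H.
have w2 : w <= 2.
  by have := enorm_triangle (nrm y) (- nrm x); rewrite enormN !(enorm_unit (nrm1 _)) -/w; (clear -R; lra).
have wE : w ^+ 2 = 2 - 2 * dot (nrm y) (nrm x).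
  rewrite enorm_sqr !dotDl !dotDr !dotNl !dotNr !nrm1 (dotC (nrm x)); ring.
have we : e * w <= w ^+ 2 by rewrite expr2 ler_pM2r //; [exact: ltW|(clear -e0 H; lra)].
have we2 : e ^+ 2 <= w ^+ 2 by rewrite ler_pXn2r ?nnegrE ?(ltW e0) ?enorm_ge0 // ltW.
have hE : enorm (r *: (nrm y - nrm x)) = r * w by rewrite enormZ gtr0_norm.
have hd : enorm (r *: (nrm y - nrm x)) < d.
  by rewrite hE; have := ler_wpM2l (ltW r0) w2; rewrite /r; (clear -d0; lra).
have := Hd _ hd; rewrite hE dotZr dotDr dotNr nrm1 [dot (nrm x) _]dotC ler_norml => /andP[h1 _].
have h2 : U (x + r *: (nrm y - nrm x)) <= U y.
  apply: nrm_supp; rewrite addrAC dotDr dotZr dotDr dotNr nrm1.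
  have := dot_ge (nrm y) (x - y); rewrite (enorm_unit (nrm1 _)) mul1r enormB => h3.
  have := ler_wpM2l (ltW r0) we2; rewrite wE; (clear -yr h3; lra).
have := Hd1 _ yd1; rewrite ltr_norml => /andP[_ h3].
have rT : 0 < r * T x by rewrite mulr_gt0.
have := ler_wpM2l (ltW rT) we; have := ler_wpM2l (ltW rT) we2.
move: h1 h2 h3; rewrite wE.
have -> : T x * (r * (dot (nrm y) (nrm x) - 1)) = r * T x * dot (nrm y) (nrm x) - r * T x by ring.
have -> : T x * e / 8 * (r * w) = r * T x * (e * w) / 8 by ring.
have : 0 < r * T x * (e * w) by rewrite !mulr_gt0 //; (clear -e0 H; lra).
clear -R; lra.
Qed.

(** [slope_nrm_ge] between the lower point z = x + t [nrm x] and [y] near [x]: the left side is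
    about T x t, the right side about T y t. *)
Lemma slope_lsc x e : (O `\` K) x -> 0 < e -> exists2 d, 0 < d &
  forall y, enorm (y - x) < d -> T x - e <= T y.
Proof.
move=> Rx e0; have T0 := slope_gt0 rp Rx.
pose e1 := Num.min (1 / 2) (e / (2 * T x + 3)).
have T3 : 0 < 2 * T x + 3 by lra.
have e10 : 0 < e1 by rewrite lt_min !divr_gt0.
have e1h : e1 <= 1 / 2 by rewrite ge_min lexx.
have e1e : e1 * (2 * T x + 3) <= e by rewrite -ler_pdivlMr // ge_min lexx orbT.
have [Te|Te] := leP (T x - 2 * e1) 0.
  have [r r0 Hr] := ball_in rp Rx; exists r => // y /ltW /Hr /(slope_gt0 rp).
  have := mulr_gt0 e10 T0; lra.
have [d1 d10 Hd1] := nrm_cont Rx e10.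
have [d2 d20 Hd2] := potential_diff rp Rx (nrm1 x) (@nrm_supp x) e10.
have [r r0 Hr] := ball_in rp Rx.
pose m := Num.min d1 (Num.min d2 r); have m0 : 0 < m by rewrite !lt_min d10 d20.
have md1 : m <= d1 by rewrite ge_min lexx.
have md2 : m <= d2 by rewrite !ge_min lexx orbT.
have mr : m <= r by rewrite !ge_min lexx !orbT.
clearbody m; pose t := m / 2; have t0 : 0 < t by rewrite divr_gt0.
have tm : t < m by rewrite /t; (clear -r0 m0; lra).
have hE : enorm (t *: nrm x) = t by rewrite enormZ (enorm_unit (nrm1 x)) mulr1 gtr0_norm.
pose z := x + t *: nrm x.
have zx : z - x = t *: nrm x by rewrite /z addrC addKr.
have Rz : (O `\` K) z by apply: Hr; rewrite zx hE; (clear -mr tm; lra).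
have nz : enorm (nrm z - nrm x) <= e1 by apply: Hd1; rewrite zx hE; (clear -md1 tm; lra).
have hd : enorm (t *: nrm x) < d2 by rewrite hE; (clear -md2 tm; lra).
have := Hd2 _ hd; rewrite -/z hE dotZr nrm1 mulr1 ler_norml => /andP[_ Uz].
have et0 : 0 < e1 * t by rewrite mulr_gt0.
have /continuous_enormP /(_ _ et0) [d3 d30 Hd3] := @rp_cont _ _ _ _ _ rp x.
exists (Num.min m (Num.min d3 (e1 * t))); first by rewrite !lt_min m0 d30.
move=> y; rewrite !lt_min => /andP[ym /andP[yd3 yt]].
have Ry : (O `\` K) y by apply: Hr; (clear -mr ym; lra).
have ny : enorm (nrm y - nrm x) <= e1 by apply: Hd1; (clear -md1 ym; lra).
have nzy : enorm (nrm z - nrm y) <= 2 * e1.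
  by have := enorm_triangle3 (nrm z) (nrm x) (nrm y); rewrite (enormB (nrm x) (nrm y)); (clear -nz ny; lra).
have := Hd3 _ yd3; rewrite ltr_norml => /andP[Uy _].
have Uzy : (T x - 2 * e1) * t <= U y - U z by move: Uz Uy; rewrite mulrBl; (clear -R; lra).
have Uzy0 : 0 < (T x - 2 * e1) * t by rewrite mulr_gt0.
have zy : U z <= U y by clear -Uzy Uzy0; lra.
have := slope_nrm_ge Rz Ry zy.
have Ty := slope_gt0 rp Ry.
have h1 : dot (nrm z) (z - y) <= t * (1 + e1).
  apply: le_trans (dot_le _ _) _; rewrite (enorm_unit (nrm1 _)) mul1r.
  have := enorm_triangle3 z x y; rewrite zx hE (enormB x y); (clear -yt; lra).
have h2 : 1 - e1 <= (1 + dot (nrm z) (nrm y)) / 2.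
  have : enorm (nrm z - nrm y) ^+ 2 <= (2 * e1) ^+ 2.
    by rewrite ler_pXn2r ?nnegrE ?enorm_ge0 //; (clear -e10; lra).
  rewrite enorm_sqr !dotDl !dotDr !dotNl !dotNr !nrm1 (dotC (nrm y)) exprMn.
  have : e1 ^+ 2 <= e1 * (1 / 2) by rewrite expr2 ler_wpM2l // ltW.
  clear -e10; lra.
move=> h3.
have h4 : (T x - 2 * e1) * t * (1 - e1) <= T y * (t * (1 + e1)).
  apply: (@le_trans _ _ ((U y - U z) * ((1 + dot (nrm z) (nrm y)) / 2))).
    by apply: ler_pM => //; [exact: ltW|(clear -e1h; lra)].
  by apply: le_trans h3 _; rewrite ler_wpM2l // ltW.
have h5 : (T x - 2 * e1) * (1 - e1) <= T y * (1 + e1).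
  by rewrite -(ler_pM2r t0); move: h4; clearbody t e1; (clear -R; lra).
rewrite leNgt; apply/negP => h6.
have h7 : T y * (1 + e1) <= (T x - e) * (1 + e1) by rewrite ler_wpM2r ?(ltW h6) //; (clear -e10; lra).
have h8 : e1 * (2 * T x + 3) * (1 + e1) <= e * (1 + e1) by rewrite ler_wpM2r //; (clear -e10; lra).
have := sqr_ge0 e1; have := mulr_gt0 T0 (exprn_gt0 2 e10).
move: h5 h7 h8; rewrite !mulrDr !mulrDl.
have := mulr_gt0 T0 e10.
clear -e0 T0 T3 e10; lra.
Qed.

End gauss_map.

(** * Local charts with Lipschitz inverse *)

Section expanding_chart.
Context {R : realType}.
Local Notation E := (R * R)%type.
Implicit Types (x y z n h p : E) (f : E -> R).

(* The monotonicity inequality makes (X, N, C, Z) controlled by the two combinations X + A N and Z - B C. *)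
Lemma expanding_core (i X N Xe Ne C Z q : R) : 0 < i -> 0 <= C ->
  `|Ne| <= `|N| / 3 -> `|Xe| <= `|X| / 3 + 4 / 3 * (C * i) -> q <= 3 / 5 * `|N| ->
  - (C * i * q / 4) <= N * X + Ne * Xe - C * Z ->
  `|N| + C <= 4 * (`|X + (4 + 4 * i) * N| + `|Z - (2 + i) * C|).
Proof.
move=> i0 C0 hNe hXe hq H.
set Y1 := X + _; set Y2 := Z - _; set S := `|Y1| + `|Y2|.
have Ci : 0 <= C * i by rewrite mulr_ge0 // ltW.
have N2 : `|N| * `|N| = N * N by rewrite -normrM ger0_norm // -expr2 sqr_ge0.
have hX : `|X| <= `|Y1| + (4 + 4 * i) * `|N|.
  have -> : X = Y1 - (4 + 4 * i) * N by rewrite /Y1; ring.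
  apply: le_trans (ler_normB _ _) _; rewrite lerD2l normrM ger0_norm //; (clear -i0; lra).
have h1 : Ne * Xe <= (`|N| / 3) * (`|X| / 3 + 4 / 3 * (C * i)).
  by apply: le_trans (ler_norm _) _; rewrite normrM; apply: ler_pM.
have h2 : C * i * q <= C * i * (3 / 5 * `|N|) by rewrite ler_wpM2l.
have h3 : Y1 * N <= `|Y1| * `|N| by rewrite -normrM ler_norm.
have h4 : - Y2 * C <= `|Y2| * C.
  by rewrite ler_wpM2r // -normrN ler_norm.
have h5 := ler_wpM2l (normr_ge0 N) hX.
have h6 : 0 <= i * (`|N| - C) ^+ 2 by rewrite mulr_ge0 ?sqr_ge0 // ltW.
have h6' : 0 <= (`|N| - C) ^+ 2 by rewrite sqr_ge0.
have h7 : 0 <= i * `|N| ^+ 2 by rewrite mulr_ge0 ?sqr_ge0 // ltW.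
have h8 : 0 <= i * C ^+ 2 by rewrite mulr_ge0 ?sqr_ge0 // ltW.
have YE : Y1 * N - Y2 * C = N * X - C * Z + (4 + 4 * i) * (`|N| * `|N|) + (2 + i) * (C * C).
  by rewrite N2 /Y1 /Y2; ring.
have hfin : (`|N| + C) * (`|N| + C) <= 4 * S * (`|N| + C).
  have g1 : 0 <= `|Y1| * C by rewrite mulr_ge0.
  have g2 : 0 <= `|Y2| * `|N| by rewrite mulr_ge0.
  have g3 : 0 <= `|Y1| * `|N| by rewrite mulr_ge0.
  have g4 : 0 <= `|Y2| * C by rewrite mulr_ge0.
  have g5 : 0 <= `|N| ^+ 2 by rewrite sqr_ge0.
  have g6 : 0 <= C ^+ 2 by rewrite sqr_ge0.
  move: H h1 h2 h3 h4 h5 h6 h6' h7 h8 YE g1 g2 g3 g4 g5 g6; rewrite /S.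
  clearbody Y1 Y2; move: (normr_ge0 N) => a0.
  move: (`|N|) (`|X|) (`|Y1|) (`|Y2|) a0 => a b y1 y2 a0.
  rewrite !expr2; move: (N * X) (C * Z) (Ne * Xe) (Y1 * N) => u1 u2 u3 u4.
  by clear -R; lra.
have [w0|w0] := leP (`|N| + C) 0.
  by apply: le_trans w0 _; rewrite mulr_ge0 // addr_ge0.
by move: hfin; rewrite ler_pM2r.
Qed.

Context (O K : set E) (U : E -> R) (M : R) (rp : ringpot O K U M).
Local Notation T := (slope U).
Local Notation nrm := (nrm U).

(** The gradient of the potential, by [potential_diff]. *)
Definition pgrad x : E := - (T x *: nrm x).

Lemma unit_diff_sqr a b : dot a a = 1 -> dot b b = 1 ->
  (1 + dot a b) / 2 = 1 - dot (a - b) (a - b) / 4 :> R.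
Proof.
by move=> a1 b1; rewrite !dotDl !dotDr !dotNl !dotNr a1 b1 (dotC b); lra.
Qed.

Lemma near_unit_coord e n : dot e e = 1 -> enorm (n - e) <= 1 / 4 ->
  3 / 4 <= dot n e /\ `|dot n (perp e)| <= 1 / 4.
Proof.
move=> e1 ne; split.
  have := dot_ge (n - e) e; rewrite (enorm_unit e1) mulr1 dotDl dotNl e1; lra.
have := dot_abs_le (n - e) (perp e).
rewrite (enorm_unit (perp_unit e1)) mulr1 dotDl dotNl dot_perp subr0; lra.
Qed.

(** Subtracting the two monotonicity inequalities, divided by [T x] and [T x'], gives the
    near-monotonicity required by [expanding_core], where N and X are the components of n - n' and x
    - x' tangential to the level line, and Z, C the increments of - 1 / T and of [U]. The normal
    components are controlled by these. *)
Lemma chart_expanding (e x x' : E) (m S : R) : (O `\` K) x -> (O `\` K) x' -> U x <= U x' ->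
  dot e e = 1 -> enorm (nrm x - e) <= 1 / 4 -> enorm (nrm x' - e) <= 1 / 4 ->
  0 < m -> m <= T x -> m <= T x' ->
  S = `|dot (x - x') (perp e) + (4 + 4 * m^-1) * dot (nrm x - nrm x') (perp e)|
    + `|- (T x)^-1 - - (T x')^-1 - (2 + m^-1) * (U x' - U x)| ->
  [/\ enorm (x - x') <= (70 + 30 * m^-1) * S, enorm (nrm x - nrm x') <= 6 * S &
    `|(T x)^-1 - (T x')^-1| <= (9 + 4 * m^-1) * S].
Proof.
move=> Rx Rx' xx' e1 ne ne' m0 mT mT' SE.
have T0 := slope_gt0 rp Rx; have T0' := slope_gt0 rp Rx'.
have m1 := slope_nrm_le rp Rx Rx' xx'; have m2 := slope_nrm_ge rp Rx Rx' xx'.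
have [n_e n_f] := near_unit_coord e1 ne; have [n_e' n_f'] := near_unit_coord e1 ne'.
have n1 := nrm1 rp x; have n1' := nrm1 rp x'.
set n := nrm x in SE n_e n_f n1 ne m2 *; set n' := nrm x' in SE n_e' n_f' n1' ne' m1 m2 *.
set f := perp e in SE n_f n_f' *.
rewrite (unit_diff_sqr n1 n1') in m2.
set q := dot (n - n') (n - n') in m2.
pose C := U x' - U x; have C0 : 0 <= C by rewrite subr_ge0.
pose i := m^-1; have i0 : 0 < i by rewrite invr_gt0.
pose X := dot (x - x') f; pose Xe := dot (x - x') e.
pose N := dot (n - n') f; pose Ne := dot (n - n') e.
pose Z := - (T x)^-1 - - (T x')^-1.
have dp a b : dot a b = dot a e * dot b e + dot a f * dot b f := dot_perp2 a b e1.
have qE : q = Ne * Ne + N * N by rewrite /q dp.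
have q0 : 0 <= q by exact: dotxx_ge0.
(* Both normals are unit vectors, so n - n' is orthogonal to n + n', which is nearly parallel to
   [e]: along [e] its component is at least 3 / 2, across at most 1 / 2. *)
have hNe : `|Ne| <= `|N| / 3.
  have : Ne * (dot n e + dot n' e) = - (N * (dot n f + dot n' f)).
    have : dot (n - n') (n + n') = 0 by rewrite !dotDl !dotDr !dotNl n1 n1' (dotC n' n); ring.
    rewrite dp -/N -/Ne !dotDl; (clear -R; lra).
  move=> /(congr1 (fun a : R => `|a|)); rewrite normrN !normrM => h.
  have h1 : `|Ne| * (3 / 2) <= `|Ne| * `|dot n e + dot n' e|.
    by rewrite ler_wpM2l // ler_normr; apply/orP; left; (clear -n_e n_e'; lra).
  have h2 : `|N| * `|dot n f + dot n' f| <= `|N| * (1 / 2).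
    by rewrite ler_wpM2l // (le_trans (ler_normD _ _)) //; (clear -n_f n_f'; lra).
  clear -h h1 h2; lra.
have iT : (T x)^-1 <= i by rewrite lef_pV2 ?posrE.
have iT' : (T x')^-1 <= i by rewrite lef_pV2 ?posrE.
have d1 : dot n' (x - x') <= C * (T x)^-1 by rewrite ler_pdivlMr // mulrC.
have d2 : C * (T x')^-1 * (1 - q / 4) <= dot n (x - x').
  by rewrite mulrAC ler_pdivrMr // [leRHS]mulrC.
have N4 : `|N| <= 1 / 2.
  rewrite /N dotDl dotNl; apply: le_trans (ler_normB _ _) _; (clear -n_f n_f'; lra).
have N2 : N * N <= 1 / 2 * `|N|.
  have -> : N * N = `|N| * `|N| by rewrite -normrM ger0_norm // -expr2 sqr_ge0.
  by rewrite ler_wpM2r.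
have Ne2 : Ne * Ne <= 1 / 18 * `|N|.
  have -> : Ne * Ne = `|Ne| * `|Ne| by rewrite -normrM ger0_norm // -expr2 sqr_ge0.
  have := ler_pM (normr_ge0 _) (normr_ge0 _) hNe hNe.
  have := ler_wpM2r (normr_ge0 N) N4; (clear -R; lra).
have hq : q <= 3 / 5 * `|N| by rewrite qE; have := normr_ge0 N; (clear -N2 Ne2; lra).
have d20 : 0 <= dot n (x - x').
  apply: le_trans d2; rewrite !mulr_ge0 ?invr_ge0 ?(ltW T0') //.
  clear -N4 hq; lra.
have Ci : C * (T x)^-1 <= C * i by rewrite ler_wpM2l.
have Ci' : C * (T x')^-1 <= C * i by rewrite ler_wpM2l.
have X0 : 0 <= `|X| by [].
have Xn : `|dot n f * X| <= 1 / 4 * `|X| by rewrite normrM ler_wpM2r.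
have Xn' : `|dot n' f * X| <= 1 / 4 * `|X| by rewrite normrM ler_wpM2r.
have Ci0 : 0 <= C * i by rewrite mulr_ge0 // ltW.
have hXe : `|Xe| <= `|X| / 3 + 4 / 3 * (C * i).
  move: d20 d1; rewrite (dp n) (dp n') -/X -/Xe => g1 g2.
  move: Xn Xn'; rewrite !ler_norml => /andP[x1 x2] /andP[x3 x4].
  have [Xe0|Xe0] := leP 0 Xe.
    have h := ler_wpM2r Xe0 n_e'; apply/andP; split; (clear -Ci g2 x3 Xe0 h; lra).
  have h := ler_wnM2r (ltW Xe0) n_e; apply/andP; split; (clear -Ci0 g1 x2 Xe0 h; lra).
have H : - (C * i * q / 4) <= N * X + Ne * Xe - C * Z.
  have e2 : N * X + Ne * Xe = dot n (x - x') - dot n' (x - x').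
    by rewrite -dotNl -dotDl dp -/N -/Ne -/X -/Xe; ring.
  rewrite e2 /Z.
  have := ler_wpM2r q0 Ci'; (clear -d1 d2; lra).
have := expanding_core i0 C0 hNe hXe hq H.
have -> : `|X + (4 + 4 * i) * N| + `|Z - (2 + i) * C| = S by rewrite SE.
move=> NC.
have S0 : 0 <= S by rewrite SE addr_ge0.
have N0 : 0 <= `|N| by [].
have hN : `|N| <= 4 * S by clear -C0 NC; lra.
have hC : C <= 4 * S by clear -NC N0; lra.
have iN := ler_wpM2l (ltW i0) hN; have iC := ler_wpM2l (ltW i0) hC.
have S1 : `|X + (4 + 4 * i) * N| <= S by rewrite SE lerDl.
have S2 : `|Z - (2 + i) * C| <= S by rewrite SE lerDr.
have hX : `|X| <= S + (4 + 4 * i) * `|N|.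
  have -> : X = (X + (4 + 4 * i) * N) - (4 + 4 * i) * N by ring.
  apply: le_trans (ler_normB _ _) _; rewrite normrM [`|4 + _|]ger0_norm ?lerD2r //; (clear -C0 i0; lra).
have hZ : `|Z| <= S + (2 + i) * C.
  have -> : Z = (Z - (2 + i) * C) + (2 + i) * C by ring.
  apply: le_trans (ler_normD _ _) _; rewrite normrM [`|2 + _|]ger0_norm ?[`|C|]ger0_norm ?lerD2r //; (clear -C0 i0 S2; lra).
have l1 v : enorm v <= `|dot v e| + `|dot v f|.
  rewrite enorm_leP ?addr_ge0 // dp -!expr2 -[dot v e ^+ 2]real_normK ?num_real //.
  rewrite -[dot v f ^+ 2]real_normK ?num_real // sqrrD.
  have : 0 <= `|dot v e| * `|dot v f| by rewrite mulr_ge0.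
  rewrite mulr2n; (clear -hZ; lra).
have iS : 0 <= i * S by rewrite mulr_ge0 // ltW.
rewrite -/i; split.
- apply: le_trans (l1 _) _; rewrite -/X -/Xe; (clear -hXe N0 hN iN iC hX iS; lra).
- apply: le_trans (l1 _) _; rewrite -/N -/Ne; (clear -hNe N0 hN; lra).
- have -> : (T x)^-1 - (T x')^-1 = - Z by rewrite /Z; ring.
  rewrite normrN; (clear -hC iC hZ; lra).
Qed.

Lemma slope_cont x : (O `\` K) x -> {for x, continuous T}.
Proof.
move=> Rx; apply/continuous_enormP => e e0; have e20 : 0 < e / 2 by rewrite divr_gt0.
have [d1 d10 H1] := slope_lsc rp Rx e20; have [d2 d20 H2] := slope_usc rp Rx e20.
exists (Num.min d1 d2); first by rewrite lt_min d10.
move=> y; rewrite lt_min => /andP[/H1 h1 /H2 h2]; rewrite ltr_norml; apply/andP; split; lra.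
Qed.

Lemma dot_nrm_cont p x : (O `\` K) x -> {for x, continuous (fun y => dot p (nrm y))}.
Proof.
move=> Rx; apply/continuous_enormP => e e0.
have e20 : 0 < e / (enorm p + 1) by rewrite divr_gt0 // ltr_wpDl ?enorm_ge0.
have [d d0 H] := nrm_cont rp Rx e20; exists d => // y /H.
rewrite ler_pdivlMr ?ltr_wpDl ?enorm_ge0 // => h.
have [->|ny] := eqVneq (nrm y) (nrm x); first by rewrite subrr normr0.
have : 0 < enorm (nrm y - nrm x) by rewrite enorm_gt0 // subr_eq0.
rewrite -dotNr -dotDr; have := dot_abs_le p (nrm y - nrm x); lra.
Qed.

Lemma gauss_chart x0 : (O `\` K) x0 -> exists (d L : R) (Y : E -> E), [/\ 0 < d, 0 <= L,
  (forall x, enorm (x - x0) < d -> (O `\` K) x /\ {for x, continuous Y}),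
  (forall x x', enorm (x - x0) < d -> enorm (x' - x0) < d ->
    enorm (x - x') <= L * enorm (Y x - Y x')) &
  (forall x x', enorm (x - x0) < d -> enorm (x' - x0) < d ->
    enorm (pgrad x - pgrad x') <= L * enorm (Y x - Y x'))].
Proof.
move=> Rx0; have T0 := slope_gt0 rp Rx0.
pose e := nrm x0; have e1 : dot e e = 1 := nrm1 rp x0.
have h4 : 0 < 1 / 4 :> R by rewrite divr_gt0.
have [d1 d10 H1] := nrm_cont rp Rx0 h4.
have T20 : 0 < T x0 / 2 by rewrite divr_gt0.
have [d2 d20 H2] := slope_lsc rp Rx0 T20.
have [d3 d30 H3] := slope_usc rp Rx0 T0.
have [r r0 Hr] := ball_in rp Rx0.
pose m := T x0 / 2; pose Lm := T x0 + T x0; pose i := m^-1.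
have m0 : 0 < m by [].
have i0 : 0 < i by rewrite invr_gt0.
have cU := @rp_cont _ _ _ _ _ rp.
(* The increments of the two components are the two combinations that [expanding_core] bounds from
   below. *)
pose Y x : E := (dot (perp e) x + (4 + 4 * i) * dot (perp e) (nrm x),
  - (T x)^-1 + (2 + i) * U x).
pose d := Num.min (Num.min d1 d2) (Num.min d3 r).
have Hd x : enorm (x - x0) < d -> [/\ (O `\` K) x, enorm (nrm x - e) <= 1 / 4,
   m <= T x & T x <= Lm].
  rewrite !lt_min => /andP[/andP[x1 x2] /andP[x3 /ltW x4]]; split.
  - exact: Hr.
  - exact: H1.
  - by have := H2 _ x2; rewrite /m; (clear -x4; lra).
  - exact: H3.
pose La := 2 * (70 + 30 * i); pose Lb := 2 * (Lm ^+ 2 * (9 + 4 * i) + Lm * 6).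
have Lm0 : 0 < Lm by rewrite addr_gt0.
have La0 : 0 <= La by rewrite mulr_ge0 // addr_ge0 // mulr_ge0 // ltW.
have Lb0 : 0 <= Lb.
  by rewrite mulr_ge0 // addr_ge0 // mulr_ge0 ?sqr_ge0 ?(ltW Lm0) // addr_ge0 // mulr_ge0 // ltW.
have key x x' : enorm (x - x0) < d -> enorm (x' - x0) < d -> U x <= U x' ->
    enorm (x - x') <= La * enorm (Y x - Y x') /\
    enorm (pgrad x - pgrad x') <= Lb * enorm (Y x - Y x').
  move=> /Hd[Rx nx mx lx] /Hd[Rx' nx' mx' lx'] xx'.
  have Tx := slope_gt0 rp Rx; have Tx' := slope_gt0 rp Rx'.
  have := chart_expanding Rx Rx' xx' e1 nx nx' m0 mx mx' erefl; rewrite -/i.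
  set S := `|_ + _| + `|_|.
  have SY : S <= 2 * enorm (Y x - Y x').
    have -> : S = `|(Y x - Y x').1| + `|(Y x - Y x').2|.
      rewrite /S; congr (_ + _); congr (`|_|); rewrite /Y !vE /=; last by ring.
      by rewrite !(dotC _ (perp e)) !dotDr !dotNr; ring.
    by have := fst_le_enorm (Y x - Y x'); have := snd_le_enorm (Y x - Y x'); (clear -R; lra).
  have S0 : 0 <= S by rewrite /S addr_ge0.
  case=> g1 g2 g3; split.
    apply: le_trans g1 _; rewrite /La -mulrA mulrCA ler_wpM2l //.
    by rewrite addr_ge0 // mulr_ge0 // ltW.
  have -> : pgrad x - pgrad x' = - ((T x - T x') *: nrm x + T x' *: (nrm x - nrm x')).
    by rewrite /pgrad; vring.
  rewrite enormN; apply: le_trans (enorm_triangle _ _) _.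
  rewrite !enormZ (enorm_unit (nrm1 rp x)) mulr1 [`|T x'|]gtr0_norm //.
  have -> : T x - T x' = - (T x * T x' * ((T x)^-1 - (T x')^-1)).
    by field; rewrite !gt_eqF.
  rewrite normrN normrM [`|_ * _|]gtr0_norm ?mulr_gt0 //.
  have TT : T x * T x' <= Lm ^+ 2 by rewrite expr2 ler_pM // ltW.
  have k1 : T x * T x' * `|(T x)^-1 - (T x')^-1| <= Lm ^+ 2 * ((9 + 4 * i) * S).
    by rewrite ler_pM // mulr_ge0 // ltW.
  have k2 : T x' * enorm (nrm x - nrm x') <= Lm * (6 * S).
    by rewrite ler_pM ?enorm_ge0 // ltW.
  apply: le_trans (lerD k1 k2) _.
  have -> : Lm ^+ 2 * ((9 + 4 * i) * S) + Lm * (6 * S) = (Lm ^+ 2 * (9 + 4 * i) + Lm * 6) * S by ring.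
  rewrite /Lb -mulrA mulrCA ler_wpM2l //.
  by move: Lb0; rewrite /Lb pmulr_rge0.
have key2 x x' : enorm (x - x0) < d -> enorm (x' - x0) < d ->
    enorm (x - x') <= La * enorm (Y x - Y x') /\
    enorm (pgrad x - pgrad x') <= Lb * enorm (Y x - Y x').
  move=> xd xd'; have [xx'|/ltW xx'] := leP (U x) (U x'); first exact: key.
  rewrite [enorm (x - x')]enormB [enorm (Y x - _)]enormB [enorm (pgrad x - _)]enormB.
  exact: key.
exists d, (La + Lb), Y; split.
- by rewrite !lt_min d10 d20 d30.
- by rewrite addr_ge0.
- move=> x /Hd[Rx _ mx _]; split => //.
  have Tx := slope_gt0 rp Rx.
  apply: (@cvg_pair _ _ _ (nbhs x) (nbhs (Y x).1) (nbhs (Y x).2) _ _ _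
    (fun z => (Y z).1) (fun z => (Y z).2)).
    apply: cvgD; first exact: dot_continuous.
    by apply: cvgM; [exact: cvg_cst|exact: dot_nrm_cont].
  apply: cvgD; first by apply: cvgN; apply: cvgV; [rewrite gt_eqF|exact: slope_cont].
  by apply: cvgM; [exact: cvg_cst|exact: cU].
- move=> x x' xd xd'; have [h _] := key2 _ _ xd xd'; apply: le_trans h _.
  by rewrite ler_wpM2r ?enorm_ge0 // lerDl.
- move=> x x' xd xd'; have [_ h] := key2 _ _ xd xd'; apply: le_trans h _.
  by rewrite ler_wpM2r ?enorm_ge0 // lerDr.
Qed.

End expanding_chart.

(** * Borel sets of the plane and Rademacher's theorem *)

Section borel_plane.
Context {R : realType}.
Local Notation E := (R * R)%type.

Lemma rect_measurable (A B : set R) : measurable A -> measurable B ->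
  measurable (A `*` B : set E).
Proof. exact: measurableX. Qed.

Lemma countable_bigcup_measurable (I : countType) (P : set I) (F : I -> set E) :
  (forall i, P i -> measurable (F i)) -> measurable (\bigcup_(i in P) F i).
Proof.
move=> mF; rewrite bigcup_mkcond; apply: countable_bigcupT_measurable => [|i].
  exact: countableP.
by case: ifPn => // /set_mem; exact: mF.
Qed.

Lemma open_measurable2 (O : set E) : open O -> measurable O.
Proof.
move=> oO.
pose box (p : rat * rat * rat) : set E :=
  `](ratr p.1.1 : R) - ratr p.2, ratr p.1.1 + ratr p.2[%classic `*`
  `](ratr p.1.2 : R) - ratr p.2, ratr p.1.2 + ratr p.2[%classic.
pose I : set (rat * rat * rat) := [set p | box p `<=` O].
have -> : O = \bigcup_(p in I) box p.
  apply/seteqP; split => [x Ox|x [p Ip] bx]; last exact: Ip.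
  have /open_enormP /(_ x Ox) [d d0 Hd] := oO.
  have d40 : 0 < d / 4 by rewrite divr_gt0.
  have [r /andP[r0 r1]] : exists r : rat, 0 < (ratr r : R) < d / 4.
    have /rat_in_itvoo[r] := d40; rewrite in_itv /= => rr; by exists r.
  have q x1 : exists q : rat, x1 - ratr r < (ratr q : R) < x1 + ratr r.
    have /rat_in_itvoo[q] : x1 - ratr r < x1 + ratr r :> R by lra.
    by rewrite in_itv /= => qq; exists q.
  have [q1 /andP[q11 q12]] := q x.1; have [q2 /andP[q21 q22]] := q x.2.
  exists (q1, q2, r); last by split; rewrite /= in_itv /=; (clear -q11 q12 q21 q22; lra).
  move=> y [/=]; rewrite !in_itv /= => /andP[a1 a2] /andP[a3 a4]; apply: Hd.
  apply: le_lt_trans (enorm_le_l1 _) _; rewrite !vE.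
  have : `|y.1 - x.1| < d / 2 by rewrite ltr_norml; apply/andP; split; (clear -r1 q11 q12 a1 a2; lra).
  have : `|y.2 - x.2| < d / 2 by rewrite ltr_norml; apply/andP; split; (clear -r1 q21 q22 a3 a4; lra).
  clear -R; lra.
apply: countable_bigcup_measurable => p _; apply: rect_measurable; exact: measurable_itv.
Qed.

Lemma closed_measurable2 (C : set E) : closed C -> measurable C.
Proof.
move=> cC; rewrite -[C]setCK; apply: measurableC; apply: open_measurable2.
by rewrite openC.
Qed.

(** The product sigma-algebra is generated by preimages, under the two coordinates, of half-open
    intervals, and these are differences of closed sets. *)
Lemma measurable2_ind (S : set (set E)) : sigma_algebra setT S ->
  (forall C : set E, closed C -> S C) -> forall A, measurable A -> S A.
Proof.
move=> [S0 SD SU] SC A.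
have SCo B : S B -> S (~` B) by rewrite -setTD; exact: SD.
have SI B C : S B -> S C -> S (B `&` C).
  move=> sB sC; rewrite -[B `&` C]setCK setCI; apply: (SCo).
  rewrite -bigcup2E; apply: SU => i; rewrite /bigcup2.
  by case: i => [|[|i]] /=; [exact: SCo|exact: SCo|].
have SO B : open B -> S B.
  by move=> oB; rewrite -[B]setCK; apply: (SCo); apply: SC; rewrite closedC.
have pre (g : E -> R) : continuous g -> forall B : set R, measurable B -> S (g @^-1` B).
  move=> cg B mB; suff : <<s R.-ocitv.-measurable >> `<=` [set B | S (g @^-1` B)] by apply.
  apply: smallest_sub.
    split => /=; first by rewrite preimage_set0.
    - by move=> C sC; rewrite setTD preimage_setC; exact: SCo.
    - by move=> F SF; rewrite preimage_bigcup; exact: SU.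
  move=> C [[a b] _ <-] /=.
  rewrite (_ : _ @^-1` _ = [set x | g x <= b] `&` ~` [set x | g x <= a]).
    by apply: SI; [|apply: SCo]; apply: SC; exact: closed_continuous_le.
  apply/seteqP; split => x /=; rewrite in_itv /=.
    by move=> /andP[xa xb]; split => //; apply/negP; rewrite -ltNge.
  by move=> [-> /negP]; rewrite -ltNge => ->.
rewrite measurable_prod_measurableType; apply: smallest_sub; first by split.
move=> _ [B mB [C mC <-]].
rewrite (_ : B `*` C = (fun x : E => x.1) @^-1` B `&` (fun x : E => x.2) @^-1` C) //.
by apply: SI; apply: pre => //; [exact: fst_continuous|exact: snd_continuous].
Qed.

Lemma cvg_mu_bigcap_lt (mu : {measure set E -> \bar R}) (F : (set E)^nat) (e : R) :
  (mu setT < +oo)%E -> (forall n, measurable (F n)) -> (forall n, F n.+1 `<=` F n) ->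
  \bigcap_n F n = set0 -> 0 < e -> exists n, (mu (F n) < e%:E)%E.
Proof.
move=> muT mF dF F0 e0.
have fin : (mu (F 0%N) < +oo)%E.
  by apply: le_lt_trans muT; apply: le_measure; rewrite ?inE.
have := @nonincreasing_cvg_mu _ _ _ mu F fin mF.
rewrite F0 measure0 => /(_ measurable0) H.
have {}H : mu \o F @ \oo --> 0%E.
  apply: H; apply/nonincreasing_seqP => n; apply/subsetPset; exact: dF.
have /fine_cvgP[fF cF] := H.
have /cvgrPdist_lt /(_ _ e0) cF' := cF.
near \oo => n; exists n.
have : `|0 - (fine \o (mu \o F)) n| < e by near: n.
rewrite sub0r normrN => /(le_lt_trans (ler_norm _)).
have : mu (F n) \is a fin_num by near: n.
by move=> fn; rewrite /= -{2}[mu (F n)]fineK // lte_fin.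
Unshelve. all: by end_near. Qed.

(* [lam2] is a measure on the product of [measurableTypeR R] with itself, which
   carries another display than the product of [R] with itself *)
Definition lamE : set E -> \bar R := lam2 R.

Let lamE0 : lamE set0 = 0%E. Proof. exact: measure0. Qed.
Let lamE_ge0 A : (0 <= lamE A)%E. Proof. exact: measure_ge0. Qed.
Let lamE_sigma_additive : semi_sigma_additive lamE.
Proof. exact: (@measure_semi_sigma_additive _ _ _
  [the {measure set (measurableTypeR R * measurableTypeR R) -> \bar R} of
    ((@lebesgue_measure R) \x (@lebesgue_measure R))%E]). Qed.

HB.instance Definition _ := isMeasure.Build _ E R lamE lamE0 lamE_ge0 lamE_sigma_additive.

Context (mu : {measure set E -> \bar R}) (muT : (mu setT < +oo)%E).

(** Stating regularity through the gap between [G] and [F] makes the class stable under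
    complements. *)
Definition approximable (A : set E) := measurable A /\ forall e : R, 0 < e ->
  exists F G, [/\ closed F, open G, F `<=` A, A `<=` G & (mu (G `\` F) < e%:E)%E].

Lemma approximable_closed (C : set E) : closed C -> approximable C.
Proof.
move=> cC; split; first exact: closed_measurable2.
move=> e e0.
pose G n : set E := [set x | exists2 c, C c & enorm (x - c) < n.+1%:R^-1].
have oG n : open (G n).
  apply/open_enormP => x [c Cc xc]; exists (n.+1%:R^-1 - enorm (x - c)).
    by rewrite subr_gt0.
  move=> y yx; exists c => //; apply: le_lt_trans (enorm_triangle3 y x c) _.
  by rewrite -ltrBrDr.
have CG n : C `<=` G n by move=> x Cx; exists x => //; rewrite subrr enorm0 invr_gt0.
have [n|n x [[c Cc xc] nC]| |n Hn] := @cvg_mu_bigcap_lt mu (fun n => G n `\` C) e muT _ _ _ e0.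
- by apply: measurableD; [exact: open_measurable2|exact: closed_measurable2].
- split => //; exists c => //; apply: lt_le_trans xc _.
  by rewrite lef_pV2 ?posrE // ler_nat.
- apply/seteqP; split => // x xG; have [_ nC] := xG 0%N I; apply: nC.
  move/closed_enormP: cC; apply => d d0.
  have [n nd] : exists n, n.+1%:R^-1 < d.
    have [n _ Hn] := near_infty_natSinv_lt (PosNum d0).
    by exists n; apply: (Hn n) => /=.
  have [[c Cc xc] _] := xG n I; exists c => //.
  by rewrite enormB; exact: lt_trans xc nd.
- by exists C, (G n); split.
Qed.

Lemma approximable_sigma : sigma_algebra setT approximable.
Proof.
split.
- by apply: approximable_closed; exact: closed0.
- move=> A [mA H]; rewrite setTD; split; first exact: measurableC.
  move=> e e0; have [F [G [cF oG FA AG FG]]] := H _ e0.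
  exists (~` G), (~` F); split.
  + by rewrite closedC.
  + by rewrite openC.
  + exact: subsetC.
  + exact: subsetC.
  + by rewrite (_ : ~` F `\` ~` G = G `\` F) // !setDE setCK setIC.
- move=> A HA; split; first by apply: bigcupT_measurable => n; case: (HA n).
  move=> e e0; have e20 : 0 < e / 2 by rewrite divr_gt0.
  have H n : exists FG : set E * set E, [/\ closed FG.1, open FG.2, FG.1 `<=` A n,
     A n `<=` FG.2 & (mu (FG.2 `\` FG.1) < (e / 2 / (2 ^ n.+1)%:R)%:E)%E].
    have en : 0 < e / 2 / (2 ^ n.+1)%:R by rewrite divr_gt0 // ltr0n expn_gt0.
    have [_ /(_ _ en) [F [G HFG]]] := HA n.
    by exists (F, G).
  have [FG HFG] := choice H.
  pose F n := (FG n).1; pose G n := (FG n).2.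
  have cF n : closed (F n) by case: (HFG n).
  have oG n : open (G n) by case: (HFG n).
  have FA n : F n `<=` A n by case: (HFG n).
  have AG n : A n `<=` G n by case: (HFG n).
  have FGn n : (mu (G n `\` F n) < (e / 2 / (2 ^ n.+1)%:R)%:E)%E by case: (HFG n).
  have mF n : measurable (F n) by exact: closed_measurable2.
  have mG n : measurable (G n) by exact: open_measurable2.
  pose F' := \bigcup_n F n; pose G' := \bigcup_n G n.
  have mF' : measurable F' by exact: bigcupT_measurable.
  have mG' : measurable G' by exact: bigcupT_measurable.
  pose P N := \big[setU/set0]_(i < N) F i.
  have mP N : measurable (P N) by exact: bigsetU_measurable.
  have cP N : closed (P N) by apply: closed_bigsetU => i _; exact: cF.
  have [N|N| |N HN] := @cvg_mu_bigcap_lt mu (fun N => F' `\` P N) (e / 2) muT _ _ _ e20.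
  + exact: measurableD.
  + by apply: setDS; rewrite /P big_ord_recr; exact: subsetUl.
  + apply/seteqP; split => // x H'; have [[n _ Fn] _] := H' 0%N I.
    have [_] := H' n.+1 I; apply; rewrite /P big_ord_recr; by right.
  exists (P N), G'; split => //.
  + by apply: bigcup_open.
  + by move=> x; rewrite /P -bigcup_mkord => -[n _ /FA]; exists n.
  + by move=> x [n _ /AG]; exists n.
  have sub : G' `\` P N `<=` (\bigcup_n (G n `\` F n)) `|` (F' `\` P N).
    move=> x [[n _ Gn] nP]; have [Fx|nF] := pselect (F' x); first by right.
    by left; exists n => //; split => // Fn; apply: nF; exists n.
  have mGF n : measurable (G n `\` F n) by exact: measurableD.
  have mU : measurable (\bigcup_n (G n `\` F n)) by exact: bigcupT_measurable.
  apply: (@le_lt_trans _ _ (mu (\bigcup_n (G n `\` F n)) + mu (F' `\` P N)))%E.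
    apply: le_trans (measureU2 _ _ _) => //; last exact: measurableD.
    apply: le_measure; rewrite ?inE //; first exact: measurableD.
    by apply: measurableU => //; exact: measurableD.
  have -> : e%:E = ((e / 2)%:E + (e / 2)%:E)%E by rewrite -EFinD; congr EFin; lra.
  apply: lee_ltD => //.
    by rewrite ge0_fin_numE // (le_lt_trans _ muT) // le_measure ?inE.
  apply: le_trans (@measure_sigma_subadditive _ _ _ mu _ _ mGF mU (@subset_refl _ _)) _.
  apply: le_trans (epsilon_trick0 xpredT (ltW e20)).
  by apply: lee_nneseries => // n _; exact: ltW.
Qed.

Lemma measure_regular (A : set E) (e : R) : measurable A -> 0 < e ->
  exists F G, [/\ closed F, open G, F `<=` A, A `<=` G & (mu (G `\` F) < e%:E)%E].
Proof.
move=> mA; have [_ H] := measurable2_ind approximable_sigma approximable_closed mA.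
exact: H.
Qed.

End borel_plane.

(** * Lipschitz functions of one variable *)

Section lipschitz_line.
Context {R : realType}.
Local Notation lam := (@lebesgue_measure R).

Lemma lebesgue_stieltjes_itv (g : cumulative R R) (a b : R) : a <= b ->
  lebesgue_stieltjes_measure g `]a, b]%classic = (g b - g a)%:E.
Proof.
move=> ab; rewrite /lebesgue_stieltjes_measure /measure_extension/= measurable_mu_extE.
  exact: (wlength_itv_bnd g false false ab).
exact: is_ocitv.
Qed.

(** Both measures are infima over coverings by half-open intervals, and the [g]-length of an
    interval is at most [C] times its length. *)
Lemma lebesgue_stieltjes_null (g : cumulative R R) (C : R) (N : set R) : 0 < C ->
  (forall x y, x <= y -> g y - g x <= C * (y - x)) ->
  lam N = 0%E -> lebesgue_stieltjes_measure g N = 0%E.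
Proof.
have le_wl (I : set (ocitv_type R)) : 0 < C ->
    (forall x y, x <= y -> g y - g x <= C * (y - x)) -> ocitv I ->
    (wlength (g : R -> R) I <= C%:E * wlength (idfun : R -> R) I)%E.
  move=> C0 HC /ocitvP[->|[x x12 ->]]; first by rewrite !wlength0 mule0.
  by rewrite !wlength_itv_bnd ?(ltW x12) //= -EFinM lee_fin HC // ltW.
move=> C0 HC N0; apply/eqP; rewrite -measure_le0; apply/lee_addgt0Pr => e e0.
rewrite add0e; have eC : (lam N < (e / C)%:E)%E by rewrite N0 lte_fin divr_gt0.
have [_ [A covA <-] HA] := ereal_inf_lt eC.
apply: le_trans (ereal_inf_lbound _) _; first by exists A; [exact: covA|reflexivity].
apply: (@le_trans _ _ (C%:E * (\sum_(k <oo) wlength idfun (A k)))%E); last first.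
  have C0e : (0 <= C%:E)%E by rewrite lee_fin ltW.
  have := lee_wpmul2l C0e (ltW HA).
  by rewrite -EFinM mulrCA divff ?gt_eqF // mulr1.
have w0 k : (0 <= wlength (idfun : R -> R) (A k))%E by exact: (wlength_ge0 idfun).
rewrite -nneseriesZl //; apply: lee_nneseries => [k _|k _].
  by move=> _; exact: (wlength_ge0 g).
by have [mA _] := covA; exact: (le_wl _ C0 HC (mA k)).
Qed.

(** The Stieltjes measure of [g] is absolutely continuous, so by Radon and Nikodym [g] is, up to a
    constant, the integral of a density, and Lebesgue's differentiation theorem applies. *)
Lemma monotone_lipschitz_ae_derivable (g : R -> R) (C : R) : 0 < C ->
  (forall x y, x <= y -> 0 <= g y - g x <= C * (y - x)) ->
  {ae lam, forall x, derivable g x 1}.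
Proof.
move=> C0 HC.
have ndg : {homo g : x y / x <= y} by move=> x y /HC /andP[]; rewrite subr_ge0.
have rcg : right_continuous g.
  apply: right_continuousW => x; apply/cvgrPdist_lt => e e0.
  near=> y; have yx : `|x - y| < e / C.
    by near: y; apply: cvgr_dist_lt; rewrite ?divr_gt0 //; exact: cvg_id.
  move: yx; rewrite ltr_pdivlMr // => yx; apply: le_lt_trans yx; rewrite mulrC.
  have [xy|/ltW xy] := leP x y; have /andP[h1 h2] := HC _ _ xy.
    by rewrite distrC [`|x - y|]distrC !ger0_norm // subr_ge0.
  by rewrite !ger0_norm // subr_ge0.
pose G : cumulative R R := HB.pack g (isCumulative.Build R _ R g ndg rcg).
pose LS : {measure set (measurableTypeR R) -> \bar R} := lebesgue_stieltjes_measure G.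
have LSE a b : a <= b -> LS `]a, b]%classic = (g b - g a)%:E by exact: lebesgue_stieltjes_itv.
suff H n : {ae lam, forall x, - n%:R < x < n%:R -> derivable g x 1}.
  have : {ae lam, forall x n, - n%:R < x < n%:R -> derivable g x 1} by apply/ae_foralln.
  apply: filterS; first exact: (ae_filter_ringOfSetsType lam).
  move=> x Hx; apply: (Hx (Num.bound `|x|)).
  by rewrite -ltr_norml archi_boundP.
(* Restriction to a bounded interval makes the measure finite, as the Radon-Nikodym density
   requires. *)
pose D := `]- n%:R, n%:R]%classic : set (measurableTypeR R).
have mD : measurable D by exact: measurable_itv.
have nn : - n%:R <= n%:R :> R by rewrite (@le_trans _ _ 0) // oppr_le0.
have fD : (LS D < +oo)%E by rewrite LSE // ltry.
pose nu : {finite_measure set (measurableTypeR R) -> \bar R} := @mfrestr _ (measurableTypeR R) R D LS mD fD.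
have nulam : charge_of_finite_measure nu `<< lam.
  move=> N N0 A mA AN; rewrite /= /charge_of_finite_measure /nu /mfrestr /mrestr.
  apply: (@lebesgue_stieltjes_null G C) => //.
    by move=> x y /HC /andP[].
  by apply: (N0); [exact: measurableI|move=> x [/AN]].
pose F := Radon_Nikodym (charge_of_finite_measure nu) lam.
have Ffin x : F x \is a fin_num by exact: Radon_Nikodym_fin_num.
have FE : EFin \o (fine \o F) = F by apply/funext => x /=; rewrite fineK.
have Fint : lam.-integrable setT F by exact: Radon_Nikodym_integrable.
have Floc : locally_integrable setT (fine \o F).
  by apply: open_integrable_locally; [exact: openT|rewrite FE].
have Fitv (y : R) : lam.-integrable [set` Interval (BRight (- n%:R)) (BRight y)] (EFin \o (fine \o F)).
  by rewrite FE; apply: integrableS Fint => //; exact: measurable_itv.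
have := FTC1 Fitv Floc; apply: filterS; first exact: (ae_filter_ringOfSetsType lam).
move=> x Hx /andP[x1 x2]; have [|dF _] := Hx; first by rewrite lte_fin.
set Phi := fun y : R => _ in dF.
have -> : g = (fun y => (g y - g (- n%:R)) + g (- n%:R)) by apply/funext => y; rewrite subrK.
apply: derivableD; last exact: derivable_cst.
apply: near_eq_derivable dF.
near=> y.
have y1 : - n%:R < y by near: y; exact: (cvgr_gt x (@cvg_id _ _)).
have y2 : y < n%:R by near: y; exact: (cvgr_lt x (@cvg_id _ _)).
rewrite /Phi /Rintegral.
under eq_integral => t _ do rewrite /= fineK //.
have := @Radon_Nikodym_integral _ _ _ (charge_of_finite_measure nu) lam
  `]- n%:R, y]%classic nulam (measurable_itv _).
rewrite -/F => <-.
rewrite /= /charge_of_finite_measure /nu /mfrestr /mrestr /= (_ : _ `&` D = `]- n%:R, y]%classic).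
  by rewrite LSE // ltW.
apply/seteqP; split => z /=; rewrite /D /= !in_itv /=; first by case.
move=> /andP[z1 z2]; rewrite z1 z2; split => //=.
by apply: le_trans z2 _; exact: ltW.
Unshelve. all: by end_near. Qed.

(** Adding (L + 1) x makes the function increasing. *)
Lemma lipschitz_ae_derivable (f : R -> R) (L : R) :
  (forall x y, `|f x - f y| <= L * `|x - y|) -> {ae lam, forall x, derivable f x 1}.
Proof.
move=> fL; have L0 : 0 <= L.
  by have := le_trans (normr_ge0 _) (fL 1 0); rewrite subr0 normr1 mulr1.
have h : {ae lam, forall x, derivable (fun x => f x + (L + 1) * x) x 1}.
  apply: (@monotone_lipschitz_ae_derivable _ (2 * L + 1)); first lra.
  move=> x y xy; have := fL y x; rewrite [`|y - x|]ger0_norm ?subr_ge0 // ler_norml.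
  move=> /andP[h1 h2]; apply/andP; split; lra.
apply: filterS h; first exact: (ae_filter_ringOfSetsType lam).
move=> x dx.
have -> : f = (fun x => f x + (L + 1) * x) - (fun x => (L + 1) * x).
  by apply/funext => y /=; rewrite /= addrK.
apply: derivableB; first exact: dx.
by apply: (@derivableM _ _ (cst (L + 1)) id); [exact: derivable_cst|exact: derivable_id].
Qed.

End lipschitz_line.

(** * Partial derivatives and density along lines *)

Section rademacher.
Context {R : realType}.
Local Notation E := (R * R)%type.
Local Notation lam := (@lebesgue_measure R).
Implicit Types (x y z p h : E) (f : E -> R) (b : bool) (t s : R).

(** Fubini: [b] selects vertical (true) or horizontal (false) lines. *)
Lemma null_lines b (A : set E) : measurable A ->
  (forall x, {ae lam, forall t, ~ A (x + t *: e_ b)}) -> lamE A = 0%E.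
Proof.
move=> mA HA.
have sec x (B : set R) : measurable B -> B = [set t | A (x + t *: e_ b)] -> lam B = 0%E.
  move=> mB BE; apply: measure_negligible => //; have [N [mN N0 HN]] := HA x.
  by exists N; split => // t; rewrite BE /= => At; apply: HN => /=; exact.
case: b HA sec => HA sec.
  rewrite /lamE /lam2 /product_measure1; apply: integral0_eq => x _ /=.
  apply: (sec (x, 0)); first exact: measurable_xsection.
  apply/seteqP; split => t; rewrite /xsection /= inE.
    by congr A; congr (_, _); rewrite /e_ /= /GRing.scale /=; ring.
  by congr A; congr (_, _); rewrite /e_ /= /GRing.scale /=; ring.
(* Horizontal sections call for the iterated integral in the other order; uniqueness identifies it
   with the same product measure. *)
rewrite /lamE /lam2 (@product_measure_unique _ _ _ _ R lam lam (lam \x^ lam)%E) //; last first.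
  by move=> B C mB mC; rewrite /= product_measure2E.
rewrite /= /product_measure2; apply: integral0_eq => y _ /=.
apply: (sec (0, y)); first exact: measurable_ysection.
apply/seteqP; split => t; rewrite /ysection /= inE.
  by congr A; congr (_, _); rewrite /e_ /= /GRing.scale /=; ring.
by congr A; congr (_, _); rewrite /e_ /= /GRing.scale /=; ring.
Qed.

Lemma derivable_approx (g : R -> R) t : derivable g t 1 -> exists l, forall e, 0 < e ->
  exists2 d, 0 < d & forall s, `|s| < d -> `|g (t + s) - g t - s * l| <= e * `|s|.
Proof.
move=> /cvg_ex[l /cvgrPdist_le Hl]; exists l => e e0.
have [d /= d0 Hd] := Hl _ e0; exists d => // s sd.
have [->|s0] := eqVneq s 0; first by rewrite addr0 subrr mul0r subrr normr0 mulr0.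
have := Hd s; rewrite /ball_ /= sub0r normrN => /(_ sd s0).
rewrite -(ler_pM2r (_ : 0 < `|s|)) ?normr_gt0 // -normrM.
rewrite distrC mulrBl [s *: 1]mulr1 [s + t]addrC /GRing.scale /= mulrAC mulVf // mul1r.
by rewrite [l * s]mulrC.
Qed.

Lemma e_unit b : dot (e_ b) (e_ b) = 1 :> R.
Proof. by case: b; rewrite /dot /e_ /=; ring. Qed.

Lemma enorm_e b t : enorm (t *: e_ b : E) = `|t|.
Proof. by rewrite enormZ (enorm_unit (e_unit b)) mulr1. Qed.

Context (f : E -> R) (L : R) (fL : forall x y, `|f x - f y| <= L * enorm (x - y)).

Lemma lip_ge0 : 0 <= L.
Proof.
have := le_trans (normr_ge0 _) (fL (e_ true) 0).
by rewrite subr0 (enorm_unit (e_unit true)) mulr1.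
Qed.

Definition approx_dir b (c d q : R) : set E :=
  [set x | forall t, `|t| < d -> `|f (x + t *: e_ b) - f x - t * q| <= c * `|t|].

Lemma approx_dir_closed b c d q : closed (approx_dir b c d q).
Proof.
rewrite (_ : approx_dir b c d q = \bigcap_(t in [set t | `|t| < d])
   [set x | `|f (x + t *: e_ b) - f x - t * q| <= c * `|t|]) //.
apply: closed_bigI => t _; apply: closed_continuous_le.
apply: (@enorm_lipschitz_continuous _ _ (2 * L)) => x y.
have h1 := fL (x + t *: e_ b) (y + t *: e_ b); have h2 := fL y x.
move: h1 h2; rewrite opprD addrACA subrr addr0 [enorm (y - x)]enormB => h1 h2.
apply: le_trans (ler_dist_dist _ _) _.
rewrite (_ : _ - _ = (f (x + t *: e_ b) - f (y + t *: e_ b)) + (f y - f x)); last by ring.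
by apply: le_trans (ler_normD _ _) _; lra.
Qed.

(** Differentiability in direction [e_ b], with rational slopes and reciprocals of integers so that
    only countable operations on the closed sets [approx_dir] occur. *)
Definition diff_dir b : set E := \bigcap_(m in setT) \bigcup_(qk in [set: rat * nat])
  approx_dir b m.+1%:R^-1 qk.2.+1%:R^-1 (ratr qk.1).

Lemma diff_dir_measurable b : measurable (diff_dir b).
Proof.
apply: bigcapT_measurable => m; apply: countable_bigcup_measurable => qk _.
by apply: closed_measurable2; exact: approx_dir_closed.
Qed.

Lemma diff_dir_null b : lamE (~` diff_dir b) = 0%E.
Proof.
apply: (@null_lines b); first by apply: measurableC; exact: diff_dir_measurable.
move=> x; have gL t s : `|f (x + t *: e_ b) - f (x + s *: e_ b)| <= L * `|t - s|.
  by apply: le_trans (fL _ _) _; rewrite opprD addrACA subrr add0r -scalerBl enorm_e.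
have := lipschitz_ae_derivable gL; apply: filterS; first exact: (ae_filter_ringOfSetsType lam).
move=> t /derivable_approx[l Hl]; apply => m _.
have m0 : 0 < (m.+1%:R^-1 : R) by rewrite invr_gt0.
move: (m.+1%:R^-1 : R) m0 => c c0.
have c20 : 0 < c / 2 by rewrite divr_gt0.
have [d d0 Hd] := Hl _ c20.
have [q] : exists q : rat, (ratr q : R) \in `]l - c / 2, l + c / 2[.
  apply: rat_in_itvoo; lra.
rewrite in_itv /= => /andP[q1 q2].
have [k kd] : exists k, k.+1%:R^-1 < d.
  by have [k _ Hk] := near_infty_natSinv_lt (PosNum d0); exists k; apply: (Hk k) => /=.
exists (q, k) => //= s sk; have := Hd _ (lt_trans sk kd).
rewrite -(addrA x (t *: e_ b)) -scalerDl => h.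
rewrite (_ : _ - _ - _ = (f (x + (t + s) *: e_ b) - f (x + t *: e_ b) - s * l) + s * (l - ratr q)); last by ring.
apply: le_trans (ler_normD _ _) _; rewrite normrM.
have : `|s| * `|l - ratr q| <= `|s| * (c / 2).
  by rewrite ler_wpM2l // ler_norml; apply/andP; split; (clear -q1 q2; lra).
clear -h; lra.
Qed.

(** A weak form of density along the horizontal line: no point at distance |t| is further than eta
    |t| from [F]. For closed [F] it defines a closed set, which spares a separate measurability
    argument. *)
Definition horizontally_dense (F : set E) (eta d : R) : set E :=
  [set x | forall t, `|t| <= d -> exists2 s, `|s - t| <= eta * `|t| & F (x + s *: e_ false)].

Lemma horizontally_dense_closed (F : set E) eta d : closed F -> closed (horizontally_dense F eta d).
Proof.
move=> cF; apply/closed_enormP => x Hx t td.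
pose I := `[t - eta * `|t|, t + eta * `|t|]%classic : set R.
have cI : compact I by exact: segment_compact.
have H k : exists s, I s /\ exists2 y, enorm (y - x) < k.+1%:R^-1 & F (y + s *: e_ false).
  have k0 : 0 < (k.+1%:R^-1 : R) by rewrite invr_gt0.
  have [y yx Hy] := Hx _ k0; have [s st Fs] := Hy _ td.
  exists s; split; last by exists y.
  by rewrite /I /= in_itv /=; move: st; rewrite ler_norml => /andP[h1 h2]; apply/andP; split; lra.
have [s Hs] := choice H.
have [|r [Ir cl]] := cI (s @ \oo) _; first by exists 0%N => // k _; case: (Hs k).
exists r.
  by move: Ir; rewrite /I /= in_itv /= ler_norml => /andP[h1 h2]; apply/andP; split; lra.
move/closed_enormP: cF; apply => d' d0.
have d20 : 0 < d' / 2 by rewrite divr_gt0.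
have A : nbhs r [set v | `|v - r| < d' / 2].
  by apply/nbhs_normP; exists (d' / 2) => // v /=; rewrite distrC.
have B : \forall k \near \oo, exists2 j : nat, s k = s j & j.+1%:R^-1 < d' / 2.
  near=> k; exists k => //; near: k; exact: near_infty_natSinv_lt (PosNum d20).
have [v [[k vE ke] vr]] := cl [set v | exists2 j : nat, v = s j & j.+1%:R^-1 < d' / 2] _ B A.
have [_ [y yx Fy]] := Hs k; exists (y + s k *: e_ false) => //.
rewrite opprD addrACA -scalerBl; apply: le_lt_trans (enorm_triangle _ _) _.
by move: vr; rewrite enorm_e vE /=; have := lt_trans yx ke; (clear -R; lra).
Unshelve. all: by end_near. Qed.

(** A gap of half-width eta |t| about x + t fills the fraction eta / (1 + eta) of the ball of radius
    (1 + eta) |t| about [x]; this exceeds eta / 4, against Lebesgue density. *)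
Lemma density_gap (A : set R) (eta : R) : measurable A -> 0 < eta < 1 ->
  {ae lam, forall x : R, A x -> exists k, forall t, `|t| <= k.+1%:R^-1 ->
     exists2 s, `|s - t| <= eta * `|t| & A (x + s)}.
Proof.
move=> mA /andP[eta0 eta1]; have := lebesgue_density mA.
apply: filterS; first exact: (ae_filter_ringOfSetsType lam).
move=> x + Ax; rewrite indicE mem_set //= => H.
pose c := 1 - eta / 4; have c1 : c < 1 by rewrite /c; lra.
have : \forall r \near 0^'+, (c%:E < lam (A `&` ball x r) / lam (ball x r))%E.
  have U : nbhs (1%:E : \bar R) [set v | (c%:E < v)%E].
    by apply: open_nbhs_nbhs; split; [exact: open_ereal_gt_ereal|rewrite /= lte_fin].
  exact: H U.
move=> [d /= d0 Hd].
have [k kd] : exists k, k.+1%:R^-1 < d / 2.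
  have d20 : 0 < d / 2 by rewrite divr_gt0.
  by have [k _ Hk] := near_infty_natSinv_lt (PosNum d20); exists k; apply: (Hk k) => /=.
exists k => t tk; have [->|t0] := eqVneq t 0.
  by exists 0; rewrite ?subrr ?normr0 ?mulr0 ?addr0.
apply: contrapT => nex.
have at0 : 0 < `|t| by rewrite normr_gt0.
pose r := (1 + eta) * `|t|.
have r0 : 0 < r by rewrite mulr_gt0 // addr_gt0.
have et : eta * `|t| < `|t| by rewrite gtr_pMl.
have td := le_lt_trans tk kd.
have rd : `|0 - r| < d by rewrite sub0r normrN gtr0_norm // /r mulrDl; (clear -et td; lra).
have := Hd r rd r0.
have mb : measurable (ball x r) by apply: measurable_realfun.open_measurable; exact: ball_open.
have eat0 : 0 < eta * `|t| by rewrite mulr_gt0.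
have mb' : measurable (ball (x + t) (eta * `|t|)) by apply: measurable_realfun.open_measurable; exact: ball_open.
have sub : A `&` ball x r `<=` ball x r `\` ball (x + t) (eta * `|t|).
  move=> y [Ay yr]; split => //; rewrite /ball /= => yt; apply: nex.
  exists (y - x); last by rewrite addrC subrK.
  by rewrite -opprB normrN opprB addrA [t + x]addrC; exact: ltW.
have sub2 : ball (x + t) (eta * `|t|) `<=` ball x r.
  move=> y; rewrite /ball /= => yt.
  rewrite (_ : x - y = (x + t - y) - t); last by ring.
  by apply: le_lt_trans (ler_normB _ _) _; rewrite /r mulrDl; (clear -yt; lra).
have fb : (lam (ball x r) < +oo)%E by rewrite lebesgue_measure_ball ?ltry // ltW.
have : (lam (A `&` ball x r) <= lam (ball x r) - lam (ball (x + t)%R (eta * `|t|)%R))%E.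
  have mAb : measurable (A `&` ball x r) by exact: measurableI.
  have mD : measurable (ball x r `\` ball (x + t)%R (eta * `|t|)%R) by exact: measurableD.
  apply: le_trans (_ : lam (ball x r `\` ball (x + t)%R (eta * `|t|)%R) <= _)%E.
    by apply: le_measure; rewrite ?inE.
  by rewrite measureD // (setIidr sub2).
rewrite !lebesgue_measure_ball ?(ltW r0) ?(ltW (mulr_gt0 eta0 at0)) // -EFinB => le1 lt1.
have rn : (0 < r *+ 2) by rewrite mulrn_wgt0.
have : (c%:E < ((r *+ 2 - (eta * `|t|) *+ 2) / (r *+ 2))%:E)%E.
  apply: lt_le_trans lt1 _; rewrite EFinM.
  have -> : ((r *+ 2)%:E^-1 = ((r *+ 2)^-1)%:E)%E by rewrite inver gt_eqF.
  by apply: lee_wpmul2r => //; rewrite lee_fin invr_ge0 ltW.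
rewrite lte_fin ltr_pdivlMr // /c /r !mulr2n.
have : eta * eta * `|t| <= eta * `|t| by rewrite ler_wpM2r // ger_pMl // ltW.
rewrite ltNge => h; apply/negP; rewrite negbK.
have e0 : 0 < eta * `|t| by rewrite mulr_gt0.
move: h e0; rewrite !(mulrDl, mulrDr, mulrBl, mulrBr); (clear -R; lra).
Qed.

Lemma horizontally_dense_ae (F : set E) (eta : R) : closed F -> 0 < eta < 1 ->
  lamE (F `\` \bigcup_(k in setT) horizontally_dense F eta k.+1%:R^-1) = 0%E.
Proof.
move=> cF etaP; apply: (@null_lines false).
  apply: measurableD; first exact: closed_measurable2.
  apply: bigcupT_measurable => k; apply: closed_measurable2.
  exact: horizontally_dense_closed.
move=> x; pose A := [set t : R | F (x + t *: e_ false)].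
have mA : measurable A.
  rewrite -[A]setCK; apply: measurableC; apply: measurable_realfun.open_measurable; rewrite openC.
  have cg : continuous (fun t : R => x + t *: e_ false : E).
    by move=> t; apply: cvgD; [exact: cvg_cst|apply: cvgZr_tmp; exact: cvg_id].
  by move/continuous_closedP : cg; apply.
have := density_gap mA etaP; apply: filterS; first exact: (ae_filter_ringOfSetsType lam).
move=> t H [Ft]; apply; have [k Hk] := H Ft; exists k => // v vk.
by have [s sv As] := Hk _ vk; exists s => //; rewrite -addrA -scalerDl.
Qed.

End rademacher.

(** * Rademacher's theorem in the plane *)

Section rademacher_plane.
Context {R : realType}.
Local Notation E := (R * R)%type.
Implicit Types (x y z p q h : E) (f : E -> R).

Definition lindiff f x p := forall e, 0 < e -> exists2 d, 0 < d &
  forall h, enorm h < d -> `|f (x + h) - f x - dot p h| <= e * enorm h.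

Lemma lin_approx_close f x p q (a b d1 d2 : R) : 0 <= a -> 0 <= b -> 0 < d1 -> 0 < d2 ->
  (forall h, enorm h < d1 -> `|f (x + h) - f x - dot p h| <= a * enorm h) ->
  (forall h, enorm h < d2 -> `|f (x + h) - f x - dot q h| <= b * enorm h) ->
  enorm (p - q) <= a + b.
Proof.
move=> a0 b0 d10 d20 Hp Hq; have [->|pq] := eqVneq p q; first by rewrite subrr enorm0 addr_ge0.
have w0 : 0 < enorm (p - q) by rewrite enorm_gt0 // subr_eq0.
pose m := Num.min d1 d2; have m0 : 0 < m by rewrite lt_min d10.
pose t := m / 2 / enorm (p - q); have t0 : 0 < t by rewrite !divr_gt0.
have hE : enorm (t *: (p - q)) = m / 2.
  by rewrite enormZ gtr0_norm // /t divfK // gt_eqF.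
have md1 : m <= d1 by rewrite ge_min lexx.
have md2 : m <= d2 by rewrite ge_min lexx orbT.
clearbody m.
have h1 := Hp (t *: (p - q)); have h2 := Hq (t *: (p - q)); rewrite hE in h1 h2.
have {}h1 : `|f (x + t *: (p - q)) - f x - dot p (t *: (p - q))| <= a * (m / 2) by apply: h1; lra.
have {}h2 : `|f (x + t *: (p - q)) - f x - dot q (t *: (p - q))| <= b * (m / 2) by apply: h2; lra.
have h3 : dot (p - q) (t *: (p - q)) = m / 2 * enorm (p - q).
  by rewrite dotZr -enorm_sqr expr2 mulrA /t divfK // gt_eqF.
have m20 : 0 < m / 2 by rewrite divr_gt0.
rewrite -(ler_pM2l m20) -h3 dotDl dotNl.
move: h1 h2; rewrite !ler_norml => /andP[g1 g2] /andP[g3 g4]; lra.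
Qed.

(** Two approximate gradients differ by at most the sum of their accuracies; hence those of accuracy
    1 / (n + 1) stay in a ball, and a cluster point is the gradient. *)
Lemma lindiff_approx f x :
  (forall e, 0 < e -> exists p, exists2 d, 0 < d &
    forall h, enorm h < d -> `|f (x + h) - f x - dot p h| <= e * enorm h) ->
  exists p, lindiff f x p.
Proof.
move=> H.
have Hn n : exists p, exists2 d, 0 < d &
    forall h, enorm h < d -> `|f (x + h) - f x - dot p h| <= n.+1%:R^-1 * enorm h.
  by apply: H; rewrite invr_gt0.
have [p Hp] := choice Hn.
have n0 n : 0 <= n.+1%:R^-1 :> R by rewrite invr_ge0.
have n1 n : n.+1%:R^-1 <= 1 :> R by rewrite invf_le1 // ler1n.
have [|q [_ cl]] := @cball_compact R (p 0%N) 2 (p @ \oo) _.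
  exists 0%N => // n _; have [d d0 Hd] := Hp n; have [d' d0' Hd'] := Hp 0%N.
  apply: le_trans (lin_approx_close (n0 _) (n0 _) d0 d0' Hd Hd') _.
  by rewrite (_ : 2 = 1 + 1) // lerD.
exists q => e e0; have e20 : 0 < e / 2 by rewrite divr_gt0.
have A : nbhs q [set v | enorm (v - q) < e / 2] by apply/nbhs_enormP; exists (e / 2).
have B : \forall k \near \oo, exists2 j : nat, p k = p j & j.+1%:R^-1 < e / 2.
  near=> k; exists k => //; near: k; exact: near_infty_natSinv_lt (PosNum e20).
have [v [[k vE ke] vq]] := cl [set v | exists2 j : nat, v = p j & j.+1%:R^-1 < e / 2] _ B A.
have [d d0 Hd] := Hp k; exists d => // h hd.
rewrite (_ : _ - _ - _ = (f (x + h) - f x - dot (p k) h) + dot (p k - q) h); last first.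
  by rewrite dotDl dotNl; ring.
apply: le_trans (ler_normD _ _) _.
have h1 := Hd _ hd; have h2 := dot_abs_le (p k - q) h.
rewrite /= vE in vq.
have := ler_wpM2r (enorm_ge0 h) (ltW vq); have := ler_wpM2r (enorm_ge0 h) (ltW ke).
move: h1 h2; move: (k.+1%:R^-1) => c; (clear -R; lra).
Unshelve. all: by end_near. Qed.

Lemma countable_null (I : countType) (F : I -> set E) :
  (forall i, measurable (F i)) -> (forall i, lamE (F i) = 0%E) ->
  measurable (\bigcup_(i in setT) F i) /\ lamE (\bigcup_(i in setT) F i) = 0%E.
Proof.
move=> mF F0; have mU : measurable (\bigcup_(i in setT) F i).
  by apply: countable_bigcup_measurable => i _; exact: mF.
split => //; apply: measure_negligible => //.
pose G n := if @unpickle I n is Some i then F i else set0.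
have -> : \bigcup_(i in setT) F i = \bigcup_n G n.
  apply/seteqP; split=> [x [i _ Fx]|x [n _]].
    by exists (pickle i) => //; rewrite /G pickleK.
  by rewrite /G; case: unpickle => [i Fx|//]; exists i.
apply: negligible_bigcup => n; rewrite /G; case: unpickle => [i|].
  by apply/negligibleP; [exact: mF|exact: F0].
exact: negligible_set0.
Qed.

Lemma null_setU2 (A B : set E) : measurable A -> measurable B ->
  lamE A = 0%E -> lamE B = 0%E -> lamE (A `|` B) = 0%E.
Proof.
by move=> mA mB A0 B0; rewrite measureU0.
Qed.

Context (f : E -> R) (L : R) (fL : forall x y, `|f x - f y| <= L * enorm (x - y)).

(** The point x + h is approached by a horizontal step s close to [h.1] that lands in the set where
    the vertical difference quotients have the same slope [ratr q2] at the same scale, followed by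
    the vertical step [h.2]. The Lipschitz bound absorbs s - [h.1]. *)
Lemma rademacher_point x : diff_dir f false x -> diff_dir f true x ->
  (forall m k (q : rat), approx_dir f true m.+1%:R^-1 k.+1%:R^-1 (ratr q) x ->
    exists j, horizontally_dense (approx_dir f true m.+1%:R^-1 k.+1%:R^-1 (ratr q))
      m.+2%:R^-1 j.+1%:R^-1 x) ->
  exists p, lindiff f x p.
Proof.
move=> D1 D2 G; apply: lindiff_approx => e e0.
have L0 : 0 <= L := lip_ge0 fL.
have e10 : 0 < e / (2 * L + 4) by rewrite divr_gt0 //; lra.
have [m me] : exists m, m.+1%:R^-1 < e / (2 * L + 4).
  by have [k _ Hk] := near_infty_natSinv_lt (PosNum e10); exists k; apply: (Hk k) => /=.
have [[q1 k1] _ /= H1] := D1 m I; have [[q2 k2] _ /= H2] := D2 m I.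
have [j Hj] := G _ _ _ H2.
have c0 : 0 < m.+1%:R^-1 :> R by rewrite invr_gt0.
have eta0 : 0 < m.+2%:R^-1 :> R by rewrite invr_gt0.
have etac : m.+2%:R^-1 <= m.+1%:R^-1 :> R by rewrite lef_pV2 ?posrE // ler_nat.
have c1 : m.+1%:R^-1 <= 1 :> R by rewrite invf_le1 // ler1n.
move: Hj me c0 eta0 etac c1 H1 H2 {G}; move: (m.+1%:R^-1) (m.+2%:R^-1) => c eta.
have: 0 < k1.+1%:R^-1 :> R by rewrite invr_gt0.
have: 0 < k2.+1%:R^-1 :> R by rewrite invr_gt0.
have: 0 < j.+1%:R^-1 :> R by rewrite invr_gt0.
move: (k1.+1%:R^-1) (k2.+1%:R^-1) (j.+1%:R^-1) => d1 d2 d3 d30 d20 d10.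
move=> Hj me c0 eta0 etac c1 H1 H2.
exists (ratr q1, ratr q2); set p1 : R := ratr q1 in H1 *; set p2 : R := ratr q2 in H2 Hj *.
have p1L : `|p1| <= L + 1.
  have d120 : 0 < d1 / 2 by rewrite divr_gt0.
  have := H1 (d1 / 2); rewrite gtr0_norm // => /(_ _).
  have -> : d1 / 2 < d1 by lra.
  move=> /(_ isT) h1; have := fL (x + (d1 / 2) *: e_ false) x.
  rewrite (_ : x + _ - x = (d1 / 2) *: e_ false); last by rewrite [x + _]addrC addrK.
  rewrite enorm_e [`|d1 / 2|]gtr0_norm // => h2.
  have : `|d1 / 2 * p1| <= (L + 1) * (d1 / 2).
    rewrite (_ : d1 / 2 * p1 = (f (x + (d1 / 2) *: e_ false) - f x) -
      (f (x + (d1 / 2) *: e_ false) - f x - d1 / 2 * p1)); last by ring.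
    apply: le_trans (ler_normB _ _) _; have := ler_wpM2r (ltW d120) c1; (clear -h1 h2; lra).
  by rewrite normrM gtr0_norm // mulrC ler_pM2r.
exists (Num.min (d1 / 2) (Num.min d2 d3)); first by rewrite !lt_min d20 d30 divr_gt0.
move=> h; rewrite !lt_min => /andP[hd1 /andP[hd2 hd3]].
have h1 := fst_le_enorm h; have h2 := snd_le_enorm h.
have [s st Fs] := Hj h.1 (ltW (le_lt_trans h1 hd3)).
have es : `|s - h.1| <= c * enorm h.
  by apply: le_trans st _; apply: ler_pM => //; exact: ltW.
have ec : c * enorm h <= enorm h by rewrite ler_piMl // enorm_ge0.
have sh : `|s| <= 2 * enorm h.
  rewrite (_ : s = (s - h.1) + h.1); last by ring.
  apply: le_trans (ler_normD _ _) _; (clear -h1 es ec; lra).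
have sd1 : `|s| < d1 by clear -hd1 sh; lra.
have g1 := H1 _ sd1; have g2 := Fs _ (le_lt_trans h2 hd2).
have g3 := fL (x + h) (x + s *: e_ false + h.2 *: e_ true).
rewrite (_ : x + h - _ = (h.1 - s) *: e_ false) in g3; last by rewrite /e_; vring.
rewrite enorm_e distrC in g3.
rewrite (_ : _ - _ - _ = (f (x + h) - f (x + s *: e_ false + h.2 *: e_ true))
  + (f (x + s *: e_ false + h.2 *: e_ true) - f (x + s *: e_ false) - h.2 * p2)
  + (f (x + s *: e_ false) - f x - s * p1) + (s - h.1) * p1); last by rewrite /dot /=; ring.
apply: le_trans (ler_normD _ _) _; apply: le_trans (lerD (ler_normD _ _) (lexx _)) _.
apply: le_trans (lerD (lerD (ler_normD _ _) (lexx _)) (lexx _)) _.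
rewrite [`|_ * p1|]normrM distrC.
have k1' := ler_wpM2l L0 es.
have k2' : `|s - h.1| * `|p1| <= c * enorm h * (L + 1) by exact: ler_pM.
have k3' := ler_wpM2l (ltW c0) sh; have k4' := ler_wpM2l (ltW c0) h2.
move: me; rewrite ltr_pdivlMr; last lra.
move=> /ltW /(ler_wpM2r (enorm_ge0 h)).
move: g1 g2 g3 k1' k2' k3' k4'; rewrite ?[`|h.1 - s|]distrC; move: (`|_ - s * p1|) (`|_ - h.2 * p2|) (`|_ - f _|) => a b c'; (clear -R; lra).
Qed.

Theorem rademacher : exists N : set E, [/\ measurable N, lamE N = 0%E &
  forall x, ~ N x -> exists p, lindiff f x p].
Proof.
pose F (i : nat * nat * rat) := approx_dir f true i.1.1.+1%:R^-1 i.1.2.+1%:R^-1 (ratr i.2).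
pose G (i : nat * nat * rat) : set E :=
  F i `\` \bigcup_(k in setT) horizontally_dense (F i) i.1.1.+2%:R^-1 k.+1%:R^-1.
have cF i : closed (F i) by exact: approx_dir_closed.
have mG i : measurable (G i).
  apply: measurableD; first exact: closed_measurable2.
  apply: bigcupT_measurable => k; apply: closed_measurable2.
  exact: horizontally_dense_closed.
have G0 i : lamE (G i) = 0%E.
  apply: horizontally_dense_ae => //.
  by rewrite invr_gt0 ltr0n /= invf_lt1 // ltr1n.
have [mN N0] := countable_null mG G0.
pose N1 b := ~` diff_dir f b.
have mN1 b : measurable (N1 b) by apply: measurableC; exact: (diff_dir_measurable fL).
have N10 b : lamE (N1 b) = 0%E by exact: (diff_dir_null fL).
exists (\bigcup_(i in setT) G i `|` (N1 false `|` N1 true)); split.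
- by apply: measurableU => //; exact: measurableU.
- by rewrite !null_setU2 //; exact: measurableU.
- move=> x /not_orP[nG /not_orP[/contrapT d1 /contrapT d2]].
  apply: rademacher_point => // m k q Fx; apply: contrapT => nj; apply: nG.
  by exists (m, k, q) => //; split => // -[j _ Hj]; apply: nj; exists j.
Qed.

End rademacher_plane.

(** * Expanding maps *)

Section grid.
Context {R : realType}.
Local Notation E := (R * R)%type.
Implicit Types (x y z : E) (s c : R) (p : int * int).

Definition cell s p : set E :=
  `[p.1%:~R * s, (p.1 + 1)%:~R * s[%classic `*` `[p.2%:~R * s, (p.2 + 1)%:~R * s[%classic.

Definition cell_of s y : int * int := (Num.floor (y.1 / s), Num.floor (y.2 / s)).

Lemma cellP s p y : 0 < s -> cell s p y <-> p = cell_of s y.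
Proof.
move=> s0.
have H (i : int) (t : R) : (t \in `[i%:~R * s, (i + 1)%:~R * s[) = (Num.floor (t / s) == i).
  by rewrite in_itv /= floor_eq ler_pdivlMr // ltr_pdivrMr.
split; last first.
  by move=> ->; split; rewrite /= -/(is_true _) H eqxx.
move=> [/=]; rewrite !H => /eqP h1 /eqP h2.
by rewrite /cell_of h1 h2; case: p {h1 h2}.
Qed.

Lemma cell_measurable s p : measurable (cell s p).
Proof. by apply: rect_measurable; exact: measurable_itv. Qed.

Lemma cell_close s p y z : 0 < s -> cell s p y -> cell s p z -> enorm (y - z) <= 2 * s.
Proof.
move=> s0 [/= + +] [/= + +]; rewrite !in_itv /= !intrD !mulrDl !mul1r.
move=> /andP[a1 a2] /andP[b1 b2] /andP[c1 c2] /andP[d1 d2].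
apply: le_trans (enorm_le_l1 _) _; rewrite !vE.
have : `|y.1 - z.1| <= s by rewrite ler_norml; apply/andP; split; lra.
have : `|y.2 - z.2| <= s by rewrite ler_norml; apply/andP; split; lra.
lra.
Qed.

Lemma lamE_rect (a b c d : R) : a <= b -> c <= d ->
  lamE (`[a, b[%classic `*` `[c, d[%classic) = ((b - a) * (d - c))%:E.
Proof.
move=> ab cd; rewrite /lamE /lam2 product_measure1E; try exact: measurable_itv.
rewrite [X in (X * _)%E]lebesgue_measure_itv [X in (_ * X)%E]lebesgue_measure_itv /=.
rewrite !lte_fin EFinM; congr (_ * _)%E.
  by case: ltP => // ba; rewrite (_ : a = b) ?subrr //; apply/eqP; rewrite eq_le ab.
by case: ltP => // ba; rewrite (_ : c = d) ?subrr //; apply/eqP; rewrite eq_le cd.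
Qed.

Lemma lamE_cell s p : 0 < s -> lamE (cell s p) = (s ^+ 2)%:E.
Proof.
move=> s0; rewrite /cell lamE_rect ?ler_wpM2r ?ler_int ?lerDl // ?(ltW s0) //.
by congr EFin; rewrite !intrD; ring.
Qed.

Context (kappa mu : {measure set E -> \bar R}).

Lemma grid_le s c (P : set (int * int)) : 0 < s -> 0 <= c ->
  (forall p, P p -> (kappa (cell s p) <= c%:E * mu (cell s p))%E) ->
  (kappa (\bigcup_(p in P) cell s p) <= c%:E * mu (\bigcup_(p in P) cell s p))%E.
Proof.
move=> s0 c0 H.
pose F k : set E := if @pickle_inv (int * int)%type k is Some p then
  (if p \in P then cell s p else set0) else set0.
have FE : \bigcup_(p in P) cell s p = \bigcup_k F k.
  apply/seteqP; split => [y [p Pp cy]|y [k _]].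
    by exists (pickle p); [exact: I|rewrite /F pickleK_inv (mem_set Pp)].
  by rewrite /F; case: pickle_inv => // p; case: ifPn => // /set_mem Pp cy; exists p.
have mF k : measurable (F k).
  by rewrite /F; case: pickle_inv => // p; case: ifP => // _; exact: cell_measurable.
have tF : trivIset setT F.
  apply/trivIsetP => i j _ _ ij; apply/seteqP; split => // y []; rewrite /F.
  case Ei : (pickle_inv i) => [p|//]; case: ifP => // _ /(cellP _ _ s0) pE.
  case Ej : (pickle_inv j) => [q|//]; case: ifP => // _ /(cellP _ _ s0) qE.
  have := @pickle_invK (int * int)%type i; have := @pickle_invK (int * int)%type j.
  by rewrite Ei Ej /= qE pE => jE iE; move: ij; rewrite -iE -jE eqxx.
have mU : measurable (\bigcup_k F k) by exact: bigcupT_measurable.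
rewrite FE (measure_semi_bigcup _ mF tF mU) (measure_semi_bigcup _ mF tF mU).
rewrite -nneseriesZl //; apply: lee_nneseries => [k _|k _]; first by move=> _; exact: measure_ge0.
rewrite /F; case: pickle_inv => [p|]; last by rewrite !measure0 mule0.
by case: ifPn => [/set_mem /H //|_]; rewrite !measure0 mule0.
Qed.

Lemma liminf_measure_le (W : (set E)^nat) (a : \bar R) : (forall n, measurable (W n)) ->
  (forall n, (kappa (W n) <= a)%E) ->
  let S := \bigcup_m \bigcap_(n in [set n | (m <= n)%N]) W n in
  measurable S /\ (kappa S <= a)%E.
Proof.
move=> mW Wa; pose V m := \bigcap_(n in [set n | (m <= n)%N]) W n.
have mV m : measurable (V m) by apply: bigcap_measurable; [exists m => /=|move=> n _; exact: mW].
have mS : measurable (\bigcup_m V m) by exact: bigcupT_measurable.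
split => //; have ndV : nondecreasing_seq V.
  move=> m n mn; apply/subsetPset => y Vy k /= nk; apply: Vy => /=.
  exact: leq_trans mn nk.
have cv := @nondecreasing_cvg_mu _ _ _ kappa _ mV mS ndV.
rewrite -(cvg_lim _ cv) //; apply: lime_le; first by apply/cvg_ex; eexists; exact: cv.
apply: nearW => n /=; apply: le_trans (Wa n); apply: le_measure; rewrite ?inE //.
by move=> y; apply; rewrite /=.
Qed.

(* Fatou along the grids of mesh 1/(n+1). *)
Lemma grid_liminf c (G S : set E) : 0 <= c -> measurable G ->
  (forall y, S y -> exists n0, forall n, (n0 <= n)%N ->
     let Q := cell n.+1%:R^-1 (cell_of n.+1%:R^-1 y) in
     Q `<=` G /\ (kappa Q <= c%:E * mu Q)%E) ->
  exists S', [/\ measurable S', S `<=` S' & (kappa S' <= c%:E * mu G)%E].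
Proof.
move=> c0 mG H.
pose P n : set (int * int) := [set p | cell n.+1%:R^-1 p `<=` G /\
  (kappa (cell n.+1%:R^-1 p) <= c%:E * mu (cell n.+1%:R^-1 p))%E].
pose W n := \bigcup_(p in P n) cell (n.+1%:R^-1) p.
have s0 n : 0 < n.+1%:R^-1 :> R by rewrite invr_gt0.
have mW n : measurable (W n).
  by apply: countable_bigcup_measurable => p _; exact: cell_measurable.
have Wa n : (kappa (W n) <= c%:E * mu G)%E.
  apply: (@le_trans _ _ (c%:E * mu (W n))%E).
    by apply: grid_le => // p [].
  apply: lee_wpmul2l; first by rewrite lee_fin.
  apply: le_measure; rewrite ?inE //.
  by move=> y [p [pG _]]; exact: pG.
have [mS' S'a] := liminf_measure_le mW Wa.
eexists; split; [exact: mS'| |exact: S'a].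
move=> y /H[n0 Hn0]; exists n0 => // n /= nn; exists (cell_of n.+1%:R^-1 y).
  exact: Hn0.
exact/cellP.
Qed.

End grid.

(** * Null sets and critical values for maps with Lipschitz inverse *)

Section expanding_map.
Context {R : realType}.
Local Notation E := (R * R)%type.
Local Notation lam := (@lebesgue_measure R).
Implicit Types (x y z p q v h : E).

Lemma lamE_mono (A B : set E) : measurable A -> measurable B -> A `<=` B ->
  (lamE A <= lamE B)%E.
Proof. by move=> mA mB AB; apply: le_measure; rewrite ?inE. Qed.

Lemma lebesgue_near_le (A : set R) (r h : R) : measurable A -> 0 <= h ->
  (forall t, A t -> `|t - r| <= h) -> (lam A <= (2 * h)%:E)%E.
Proof.
move=> mA h0 H; apply: (@le_trans _ _ (lam `[r - h, r + h]%classic)).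
  apply: le_measure; rewrite ?inE //.
  by move=> t /H; rewrite /= in_itv /= ler_norml => /andP[h1 h2]; apply/andP; split; lra.
rewrite lebesgue_measure_itv /=; case: ifP => _; last by rewrite lee_fin mulr_ge0.
by rewrite lee_fin; lra.
Qed.

Let meas_indicE (i : interval R) :
  measurable_fun setT (fun t : measurableTypeR R => (\1_([set` i] : set R) t)%:E : \bar R).
Proof.
apply/measurable_EFinP; apply: measurable_realfun.measurable_indic.
exact: measurable_itv.
Qed.

Lemma integral_indic_cst (c b k : R) : 0 <= b -> 0 <= k ->
  (\int[lam]_t (k%:E * (\1_(`[c - b, c + b]%classic) t)%:E) = (k * (2 * b))%:E)%E.
Proof.
move=> b0 k0; rewrite ge0_integralZl //.
rewrite integral_indic //.
rewrite setIT [X in (_ * X)%E]lebesgue_measure_itv /= lte_fin.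
case: ltP => cb; first by rewrite -EFinD -EFinM; congr EFin; lra.
by rewrite mule0; congr EFin; rewrite (_ : b = 0) ?mulr0 //; lra.
Qed.

Lemma area_xsections (S : set E) (c b k : R) : measurable S -> 0 <= b -> 0 <= k ->
  (forall z, S z -> `|z.1 - c| <= b) ->
  (forall t, exists r, forall w, S (t, w) -> `|w - r| <= k) ->
  (lamE S <= (2 * k * (2 * b))%:E)%E.
Proof.
move=> mS b0 k0 Hb Hk; have k20 : 0 <= 2 * k by rewrite mulr_ge0.
rewrite -(integral_indic_cst c b0 k20) /lamE /lam2 /product_measure1.
apply: ge0_le_integral => //.
- exact: measurable_fun_xsection.
- by apply: measurable_funeM; exact: meas_indicE.
move=> t _ /=; rewrite indicE.
have [tI|tI] := boolP (t \in _).
  rewrite mule1; have [r Hr] := Hk t; apply: (@lebesgue_near_le _ r) => //.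
    exact: measurable_xsection.
  by move=> w; rewrite /xsection /= inE; exact: Hr.
rewrite mule0 (_ : xsection S t = set0) ?measure0 //.
apply/seteqP; split => // w; rewrite /xsection /= inE => /Hb /=.
rewrite ler_norml => /andP[h1 h2]; move: tI; rewrite notin_setE /= in_itv /=; apply.
by apply/andP; split; lra.
Qed.

Lemma area_ysections (S : set E) (c b k : R) : measurable S -> 0 <= b -> 0 <= k ->
  (forall z, S z -> `|z.2 - c| <= b) ->
  (forall t, exists r, forall w, S (w, t) -> `|w - r| <= k) ->
  (lamE S <= (2 * k * (2 * b))%:E)%E.
Proof.
move=> mS b0 k0 Hb Hk; have k20 : 0 <= 2 * k by rewrite mulr_ge0.
rewrite -(integral_indic_cst c b0 k20) /lamE /lam2.
rewrite (@product_measure_unique _ _ _ _ R lam lam (lam \x^ lam)%E) //; last first.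
  by move=> B C mB mC; rewrite /= product_measure2E.
rewrite /= /product_measure2; apply: ge0_le_integral => //.
- exact: measurable_fun_ysection.
- by apply: measurable_funeM; exact: meas_indicE.
move=> t _ /=; rewrite indicE.
have [tI|tI] := boolP (t \in _).
  rewrite mule1; have [r Hr] := Hk t; apply: (@lebesgue_near_le _ r) => //.
    exact: measurable_ysection.
  by move=> w; rewrite /ysection /= inE; exact: Hr.
rewrite mule0 (_ : ysection S t = set0) ?measure0 //.
apply/seteqP; split => // w; rewrite /ysection /= inE => /Hb /=.
rewrite ler_norml => /andP[h1 h2]; move: tI; rewrite notin_setE /= in_itv /=; apply.
by apply/andP; split; lra.
Qed.

(** One component of the unit vector [v] is at least 1 / 2 in absolute value; the lines in that
    coordinate direction meet the strip |<v, z - x>| <= a in segments of half-length 2 a. *)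
Lemma thin_area (S : set E) x v (a b : R) : measurable S -> dot v v = 1 -> 0 <= a -> 0 <= b ->
  (forall z, S z -> `|dot v (z - x)| <= a /\ enorm (z - x) <= b) ->
  (lamE S <= (8 * a * b)%:E)%E.
Proof.
move=> mS v1 a0 b0 H.
have a20 : 0 <= 2 * a by rewrite mulr_ge0.
have half (t d e : R) : 1 / 2 <= `|t| -> `|e + t * d| <= a -> `|d + e / t| <= 2 * a.
  move=> t2 h; have t0 : 0 < `|t| by lra.
  rewrite -(ler_pM2l t0) -normrM (_ : t * (d + e / t) = e + t * d); last first.
    by field; rewrite -normr_gt0.
  by apply: le_trans h _; have := ler_wpM2r a20 t2; lra.
have -> : 8 * a * b = 2 * (2 * a) * (2 * b) by ring.
have [v2|v2] := leP (1 / 2) `|v.2|.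
  apply: (@area_xsections S x.1) => //.
    by move=> z /H[_]; apply: le_trans; have := fst_le_enorm (z - x); rewrite !vE.
  move=> t; exists (x.2 - v.1 * (t - x.1) / v.2) => w /H[+ _].
  rewrite /dot !vE /= => /(half _ _ _ v2) h.
  by rewrite (_ : w - _ = w - x.2 + v.1 * (t - x.1) / v.2) //; ring.
have v1' : 1 / 2 <= `|v.1|.
  rewrite leNgt; apply/negP => v1'.
  move: v1; rewrite /dot => v1.
  have := ler_pM (normr_ge0 _) (normr_ge0 _) (ltW v2) (ltW v2).
  have := ler_pM (normr_ge0 _) (normr_ge0 _) (ltW v1') (ltW v1').
  rewrite -!normrM !ger0_norm -?expr2 ?sqr_ge0 // !expr2; lra.
apply: (@area_ysections S x.2) => //.
  by move=> z /H[_]; apply: le_trans; have := snd_le_enorm (z - x); rewrite !vE.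
move=> t; exists (x.1 - v.2 * (t - x.2) / v.1) => w /H[+ _].
rewrite /dot !vE /= addrC => /(half _ _ _ v1') h.
by rewrite (_ : w - _ = w - x.1 + v.2 * (t - x.2) / v.1) //; ring.
Qed.

Lemma square_area (S : set E) x (b : R) : measurable S -> 0 <= b ->
  (forall z, S z -> enorm (z - x) <= b) -> (lamE S <= (4 * b ^+ 2)%:E)%E.
Proof.
move=> mS b0 H; rewrite (_ : 4 * b ^+ 2 = 2 * b * (2 * b)); last by ring.
apply: (@area_xsections S x.1) => //.
  by move=> z /H; apply: le_trans; have := fst_le_enorm (z - x); rewrite !vE.
move=> t; exists x.2 => w /H; apply: le_trans.
by have := snd_le_enorm ((t, w) - x); rewrite !vE.
Qed.

Lemma singular_annihilator p q : p.1 * q.2 - p.2 * q.1 = 0 ->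
  exists2 v, dot v v = 1 & v.1 *: p + v.2 *: q = 0.
Proof.
move=> d0.
have norm w : w != 0 -> w.1 *: p + w.2 *: q = 0 ->
    exists2 v, dot v v = 1 & v.1 *: p + v.2 *: q = 0.
  move=> w0 wE; exists ((enorm w)^-1 *: w); first exact: dot_normalize.
  by rewrite !vE -!scalerA -scalerDr wE scaler0.
have [h1|] := eqVneq ((- q.1, p.1) : E) 0; last first.
  by move=> /norm; apply; apply: vec_ext; rewrite !vE /=; [ring|move: d0; lra].
have [h2|] := eqVneq ((- q.2, p.2) : E) 0; last first.
  by move=> /norm; apply; apply: vec_ext; rewrite !vE /=; [move: d0; lra|ring].
have [/eqP/[!oppr_eq0]/eqP q10 p10] : - q.1 = 0 /\ p.1 = 0 by case: h1.
have [/eqP/[!oppr_eq0]/eqP q20 p20] : - q.2 = 0 /\ p.2 = 0 by case: h2.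
exists (1, 0); first exact: e1_unit.
by apply: vec_ext; rewrite !vE /= ?p10 ?p20 ?q10 ?q20 !mulr0 addr0.
Qed.

Context (D : set E) (Y : E -> E) (L M : R).
Hypothesis (mY : forall B, measurable B -> measurable (D `&` Y @^-1` B)).
Hypotheses (L0 : 0 <= L) (YM : forall x, D x -> enorm (Y x) <= M).
Hypothesis YL : forall x x', D x -> D x' -> enorm (x - x') <= L * enorm (Y x - Y x').

(** The image under [Y] of Lebesgue measure on [D]; areas of preimages are estimated cell by cell in
    the target. *)
Let kap (B : set E) : \bar R := lamE (D `&` Y @^-1` B).
Let kap0 : kap set0 = 0%E.
Proof. by rewrite /kap preimage_set0 setI0 measure0. Qed.
Let kap_ge0 B : (0 <= kap B)%E. Proof. exact: measure_ge0. Qed.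
Let kap_sigma_additive : semi_sigma_additive kap.
Proof.
move=> F mF tF mU; rewrite /kap preimage_bigcup setI_bigcupr.
apply: measure_semi_sigma_additive.
- by move=> n; exact: mY.
- apply/trivIsetP => i j _ _ ij; rewrite setIACA setIid -preimage_setI.
  by move/trivIsetP : tF => /(_ _ _ I I ij) ->; rewrite preimage_set0 setI0.
- by rewrite -setI_bigcupr -preimage_bigcup; exact: mY.
Qed.
Let kappa : {measure set E -> \bar R} := HB.pack kap
  (isMeasure.Build _ E R kap kap0 kap_ge0 kap_sigma_additive).

Let cell_preim (s : R) y x : 0 < s -> D x -> cell s (cell_of s y) (Y x) ->
  enorm (Y x - y) <= 2 * s.
Proof. by move=> s0 Dx cx; apply: (cell_close s0 cx); apply/cellP. Qed.

(** An open ball of finite area that contains the values of [Y], so that [measure_regular] applies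
    to the restricted measure. *)
Let far : set E := [set y | enorm y < M + 3].

Let far_open : open far.
Proof.
apply/open_enormP => y yM; exists (M + 3 - enorm y); first by rewrite subr_gt0.
by move=> z zy; rewrite /far /=; have := enorm_triangle3 z y 0; rewrite !subr0; lra.
Qed.

Let far_fin : (lamE far < +oo)%E.
Proof.
have [M0|M0] := leP 0 (M + 3); last first.
  rewrite (_ : far = set0) ?measure0 ?ltry //; apply/seteqP; split => // y.
  by rewrite /far /=; have := enorm_ge0 y; lra.
apply: le_lt_trans (ltry (4 * (M + 3) ^+ 2)); apply: (@square_area _ 0) => //.
  exact: open_measurable2.
by move=> z; rewrite subr0 => /ltW.
Qed.

Let kappa_near (s : R) y (b : R) : 0 < s -> 0 <= b ->
  (forall x x', D x -> D x' -> cell s (cell_of s y) (Y x) -> cell s (cell_of s y) (Y x') ->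
     enorm (x - x') <= b) ->
  (kappa (cell s (cell_of s y)) <= (4 * b ^+ 2)%:E)%E.
Proof.
move=> s0 b0 H; set Q := cell _ _; rewrite /= /kap.
have [->|/set0P[x [Dx Qx]]] := eqVneq (D `&` Y @^-1` Q) set0.
  by rewrite measure0 lee_fin mulr_ge0 // sqr_ge0.
apply: (@square_area _ x) => //; first by apply: mY; exact: cell_measurable.
by move=> z [Dz Qz]; exact: H.
Qed.

Lemma cell_eventually (G : set E) y : open G -> G y ->
  exists n0, forall n, (n0 <= n)%N -> cell n.+1%:R^-1 (cell_of n.+1%:R^-1 y) `<=` G.
Proof.
move=> oG Gy; have [d d0 Hd] := (open_enormP G).1 oG y Gy.
have d20 : 0 < d / 2 by rewrite divr_gt0.
have [n0 _ Hn] := near_infty_natSinv_lt (PosNum d20); exists n0 => n nn z cz.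
apply: Hd; have s0 : 0 < n.+1%:R^-1 :> R by rewrite invr_gt0.
have cy : cell n.+1%:R^-1 (cell_of n.+1%:R^-1 y) y by exact/cellP.
have := cell_close s0 cz cy; have := Hn n nn => /=; move: (n.+1%:R^-1) => s; lra.
Qed.

(** Points mapped to one cell of side s are at distance at most 2 L s, so the preimage of the cell
    has area at most 16 L^2 s^2. Summed over the cells inside an open neighbourhood of [N] of small
    area, this is small. *)
Lemma null_preimage (N : set E) : measurable N -> lamE N = 0%E ->
  lamE (D `&` Y @^-1` N) = 0%E.
Proof.
move=> mN N0; pose c := 16 * L ^+ 2.
have c0 : 0 <= c by rewrite mulr_ge0 // sqr_ge0.
apply/eqP; rewrite -measure_le0; apply/lee_addgt0Pr => e e0; rewrite add0e.
have mfar := open_measurable2 far_open.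
pose mu : {measure set E -> \bar R} := mrestr lamE mfar.
have muT : (mu setT < +oo)%E by rewrite /mu /= /mrestr setTI.
have e10 : 0 < e / (c + 1) by rewrite divr_gt0 // ltr_wpDl.
have [F [G [cF oG FN NG muG]]] := measure_regular muT mN e10.
have mF := closed_measurable2 cF; have mG := open_measurable2 oG.
have oG' : open (G `&` far) by exact: openI.
have mG' := open_measurable2 oG'.
have muN : mu N = 0%E.
  by apply: (@subset_measure0 _ _ _ lamE _ N) => //; first [exact: measurableI|exact: subIsetl].
have G'e : (lamE (G `&` far) <= (e / (c + 1))%:E)%E.
  have -> : lamE (G `&` far) = mu G by [].
  have -> : (mu G = mu (G `\` F) + mu (G `&` F))%E by exact: measureDI.
  have -> : mu (G `&` F) = 0%E.
    by apply: (subset_measure0 _ mN) muN; [exact: measurableI|move=> y [_ /FN]].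
  by rewrite adde0; exact: ltW.
have [|S' [mS' SS' S'e]] := @grid_liminf R kappa lamE c (G `&` far) (N `&` far) c0 mG'.
  move=> y [Ny fy]; have [n0 Hn0] := cell_eventually oG' (conj (NG _ Ny) fy).
  exists n0 => n /Hn0 cG; split => //.
  have s0 : 0 < n.+1%:R^-1 :> R by rewrite invr_gt0.
  rewrite [X in (_ <= _ * X)%E](lamE_cell _ s0) -EFinM (_ : c * _ = 4 * (L * (2 * n.+1%:R^-1)) ^+ 2); last by rewrite /c; ring.
  apply: kappa_near => //; first by rewrite mulr_ge0 // mulr_ge0 // ltW.
  move=> x x' Dx Dx' cx cx'; apply: le_trans (YL Dx Dx') _.
  by rewrite ler_wpM2l // (cell_close s0 cx cx').
apply: (@le_trans _ _ (kappa S')).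
  apply: lamE_mono; [exact: mY|exact: mY|].
  move=> x [Dx Nx]; split => //; apply: SS'; split => //.
  by rewrite /far /=; have := YM Dx; lra.
apply: (le_trans S'e); apply: (@le_trans _ _ (c%:E * (e / (c + 1))%:E)%E).
  by apply: lee_wpmul2l => //; rewrite lee_fin.
rewrite -EFinM lee_fin mulrCA ger_pMr // ler_pdivrMr ?mul1r; (clear -c0 G'e SS' S'e; lra).
Qed.

(** Sard's argument: where the differential of the inverse map is singular, the points mapped to a
    small cell of side s lie in a strip of width O(e s) and length O(L s). The constant 64 L e is 8
    (4 e s) (2 L s) / s^2, from [thin_area]. *)
Lemma expanding_nonsingular (g1 g2 : E -> R) :
  (forall x, D x -> g1 (Y x) = x.1 /\ g2 (Y x) = x.2) ->
  exists N, [/\ measurable N, lamE N = 0%E & forall x p q, D x -> ~ N x ->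
    lindiff g1 (Y x) p -> lindiff g2 (Y x) q -> p.1 * q.2 - p.2 * q.1 != 0].
Proof.
move=> gY.
pose Z := [set x | D x /\ exists p q, [/\ lindiff g1 (Y x) p, lindiff g2 (Y x) q &
  p.1 * q.2 - p.2 * q.1 = 0]].
have mfar := open_measurable2 far_open.
have H j : exists S', [/\ measurable S', Y @` Z `<=` S' &
    (kappa S' <= (64 * L * j.+1%:R^-1)%:E * lamE far)%E].
  have : 0 < j.+1%:R^-1 :> R by rewrite invr_gt0.
  move: (j.+1%:R^-1) => e e0; apply: grid_liminf => //.
    by rewrite !mulr_ge0 // ltW.
  move=> _ [x [Dx [p [q [dp dq pq]]]] <-]; set y := Y x.
  have fy : far y by rewrite /far /= /y; have := YM Dx; lra.
  have [n1 Hn1] := cell_eventually far_open fy.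
  have [d1 d10 Hd1] := dp _ e0; have [d2 d20 Hd2] := dq _ e0.
  have d0 : 0 < Num.min d1 d2 / 2 by rewrite divr_gt0 // lt_min d10.
  have [n2 _ Hn2] := near_infty_natSinv_lt (PosNum d0).
  have [v v1 vpq] := singular_annihilator pq.
  exists (maxn n1 n2) => n; rewrite geq_max => /andP[/Hn1 cG /Hn2 /= nd]; split => //.
  have : 0 < n.+1%:R^-1 :> R by rewrite invr_gt0.
  move: (n.+1%:R^-1) nd {cG} => s sd s0.
  have sd1 : 2 * s < d1.
    have : Num.min d1 d2 <= d1 by rewrite ge_min lexx.
    by move: sd; move: (Num.min _ _) => m; lra.
  have sd2 : 2 * s < d2.
    have : Num.min d1 d2 <= d2 by rewrite ge_min lexx orbT.
    by move: sd; move: (Num.min _ _) => m; lra.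
  rewrite [X in (_ <= _ * X)%E](lamE_cell _ s0) -EFinM.
  rewrite (_ : 64 * L * e * s ^+ 2 = 8 * (e * (4 * s)) * (L * (2 * s))); last by ring.
  apply: (@thin_area _ x v) => //.
  - by apply: mY; exact: cell_measurable.
  - by rewrite !mulr_ge0 // ltW.
  - by rewrite !mulr_ge0 // ltW.
  move=> z [Dz cz]; have zy := cell_preim s0 Dz cz; split; last first.
    by apply: le_trans (YL Dz Dx) _; rewrite ler_wpM2l.
  have [gz1 gz2] := gY _ Dz; have [gx1 gx2] := gY _ Dx.
  have yz : y + (Y z - y) = Y z by rewrite addrC subrK.
  have := Hd1 (Y z - y) (le_lt_trans zy sd1); have := Hd2 (Y z - y) (le_lt_trans zy sd2).
  rewrite yz gz1 gz2 gx1 gx2; set k := Y z - y in zy * => h2 h1.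
  have -> : dot v (z - x) = v.1 * (z.1 - x.1 - dot p k) + v.2 * (z.2 - x.2 - dot q k).
    have h : v.1 * dot p k + v.2 * dot q k = 0 by rewrite -!dotZl -dotDl vpq dot0l.
    rewrite [dot v _]/dot !vE; (clear -sd2 gz2 gx1 h1 h; lra).
  have nv1 : `|v.1| <= 1 by rewrite -(enorm_unit v1) fst_le_enorm.
  have nv2 : `|v.2| <= 1 by rewrite -(enorm_unit v1) snd_le_enorm.
  apply: le_trans (ler_normD _ _) _; rewrite !normrM.
  have := ler_pM (normr_ge0 _) (normr_ge0 _) nv1 h1.
  have := ler_pM (normr_ge0 _) (normr_ge0 _) nv2 h2.
  have := ler_wpM2l (ltW e0) zy; (clear -gz1 gz2 gx1 gx2 nv1 nv2; lra).
have [S HS] := choice H.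
pose N := \bigcap_j (D `&` Y @^-1` S j).
have mDS j : measurable (D `&` Y @^-1` S j) by apply: mY; case: (HS j).
have mN : measurable N by apply: bigcapT_measurable.
exists N; split => //.
- apply/eqP; rewrite -measure_le0; apply/lee_addgt0Pr => e e0; rewrite add0e.
  have ff : lamE far \is a fin_num by rewrite ge0_fin_numE.
  pose A := fine (lamE far); have A0 : 0 <= A by rewrite fine_ge0.
  have e10 : 0 < e / (64 * L * A + 1) by rewrite divr_gt0 // ltr_wpDl // !mulr_ge0.
  have [j _ Hj] := near_infty_natSinv_lt (PosNum e10).
  have /= jd := Hj j (leqnn j).
  apply: (@le_trans _ _ (kappa (S j))); first by apply: lamE_mono => // x; apply.
  have [_ _ h] := HS j; apply: (le_trans h).
  rewrite -[lamE far]fineK // -EFinM lee_fin -/A.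
  have LA : 0 < 64 * L * A + 1 by rewrite ltr_wpDl // !mulr_ge0.
  move: jd; rewrite ltr_pdivlMr //.
  have : 0 < j.+1%:R^-1 :> R by rewrite invr_gt0.
  move: (j.+1%:R^-1) => s; (clear -Hj h; lra).
- move=> x p q Dx nN dp dq; apply/negP => /eqP pq; apply: nN => j _; split => //.
  by have [_ sub _] := HS j; apply: sub; exists x => //; split => //; exists p, q.
Qed.

End expanding_map.

(** * Differentiability through a chart *)

Section expanding_differentiable.
Context {R : realType}.
Local Notation E := (R * R)%type.
Implicit Types (x y z p q v h : E).

(** On the image of [D], [phi] is a Lipschitz function of [Y]; the infimum of the cones with
    vertices on its graph extends it to the plane. *)
Lemma mcshane (D : set E) (Y : E -> E) (phi : E -> R) (L : R) : 0 <= L ->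
  (forall x x', D x -> D x' -> `|phi x - phi x'| <= L * enorm (Y x - Y x')) ->
  exists2 g : E -> R, (forall y y', `|g y - g y'| <= L * enorm (y - y')) &
    forall x, D x -> g (Y x) = phi x.
Proof.
move=> L0 H; have [->|/set0P[x1 Dx1]] := eqVneq D set0.
  by exists (fun=> 0) => // y y'; rewrite subrr normr0 mulr_ge0 // enorm_ge0.
pose V y := [set phi x + L * enorm (y - Y x) | x in D].
pose g y := inf (V y).
have V0 y : V y !=set0 by exists (phi x1 + L * enorm (y - Y x1)), x1.
have Vlb y : lbound (V y) (phi x1 - L * enorm (y - Y x1)).
  move=> _ [x Dx <-]; have := H _ _ Dx1 Dx; rewrite ler_norml => /andP[_ h].
  have := ler_wpM2l L0 (enorm_triangle3 (Y x1) y (Y x)).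
  rewrite (enormB (Y x1) y) mulrDr; lra.
have hV y : has_lbound (V y) by eexists; exact: Vlb.
have gle y y' : g y <= g y' + L * enorm (y - y').
  rewrite -lerBlDr; apply: lb_le_inf (V0 y') _ => _ [x Dx <-].
  rewrite lerBlDr; apply: le_trans (ge_inf (hV y) (_ : V y _)) _; first by exists x.
  have := ler_wpM2l L0 (enorm_triangle3 y y' (Y x)); rewrite mulrDr; lra.
exists g.
  move=> y y'; have := gle y y'; have := gle y' y; rewrite (enormB y' y) ler_norml => h1 h2.
  by apply/andP; split; (clear -h1 h2; lra).
move=> x Dx; apply/eqP; rewrite eq_le; apply/andP; split.
  apply: le_trans (ge_inf (hV _) (_ : V (Y x) _)) _; first by exists x.
  by rewrite subrr enorm0 mulr0 addr0.
apply: lb_le_inf (V0 _) _ => _ [z Dz <-].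
by have := H _ _ Dx Dz; rewrite ler_norml => /andP[_ h]; lra.
Qed.

Lemma preim_measurable (D : set E) (Y : E -> E) : open D ->
  (forall x, D x -> {for x, continuous Y}) ->
  forall B, measurable B -> measurable (D `&` Y @^-1` B).
Proof.
move=> oD cY; have mD := open_measurable2 oD.
have op (O : set E) : open O -> measurable (D `&` Y @^-1` O).
  move=> oO; apply: open_measurable2; apply/open_enormP => x [Dx Ox].
  have [d1 d10 Hd1] := (open_enormP D).1 oD x Dx.
  have /nbhs_enormP[d2 d20 Hd2] : \forall z \near x, O (Y z).
    by apply: (cY x Dx); exact: open_nbhs_nbhs.
  exists (Num.min d1 d2); first by rewrite lt_min d10.
  by move=> z; rewrite lt_min => /andP[/Hd1 ? /Hd2 ?]; split.
apply: measurable2_ind.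
  split.
  - by rewrite preimage_set0 setI0.
  - move=> B mB; rewrite (_ : _ `&` _ = D `\` (D `&` Y @^-1` B)); first exact: measurableD.
    by apply/seteqP; split => x [Dx H]; split => //; [case=> _ ?; case: H|split=> // ?; exact: H].
  - by move=> F mF; rewrite preimage_bigcup setI_bigcupr; exact: bigcupT_measurable.
move=> C cC; rewrite (_ : _ `&` _ = D `\` (D `&` Y @^-1` (~` C))).
  by apply: measurableD => //; apply: op; rewrite openC.
apply/seteqP; split => x [Dx H]; split => //; first by case.
by apply: contrapT => nC; apply: H.
Qed.

(* If x' = x + A k + o(k) with A invertible and k = Y x' - Y x, then k is of the order of x' - x. *)
Lemma chain_differentiable (D : set E) (Y : E -> E) (g1 g2 g phi : E -> R) x p q v :
  open D -> D x -> {for x, continuous Y} ->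
  (forall x, D x -> [/\ g1 (Y x) = x.1, g2 (Y x) = x.2 & g (Y x) = phi x]) ->
  lindiff g1 (Y x) p -> lindiff g2 (Y x) q -> lindiff g (Y x) v ->
  p.1 * q.2 - p.2 * q.1 != 0 -> exists w, lindiff phi x w.
Proof.
move=> oD Dx cY gY dp dq dv; set dt := _ - _ => dt0.
pose a : E := (q.2 / dt, - p.2 / dt); pose b : E := (- q.1 / dt, p.1 / dt).
have inv k : k = (dot a (dot p k, dot q k), dot b (dot p k, dot q k)) :> E.
  by apply: vec_ext; rewrite /a /b /dot /dt /=; field.
pose w := v.1 *: a + v.2 *: b.
have wk k : dot v k = dot w (dot p k, dot q k).
  by rewrite /w dotDl !dotZl {1}(inv k) /dot /=; ring.
exists w => e e0.
pose c := enorm a + enorm b + 1; pose W := enorm w.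
have W0 : 0 <= W := enorm_ge0 _.
have c0 : 1 <= c by rewrite /c lerDr addr_ge0 // enorm_ge0.
have cW : 0 < 2 * c * (1 + 2 * W) by rewrite !mulr_gt0 //; (clear -W0 c0; lra).
pose e1 := Num.min (1 / (4 * c)) (e / (2 * c * (1 + 2 * W))).
have e10 : 0 < e1 by rewrite lt_min !divr_gt0 // mulr_gt0 //; lra.
have e1c : e1 * (4 * c) <= 1 by rewrite -ler_pdivlMr; [rewrite ge_min lexx|lra].
have e1e : e1 * (2 * c * (1 + 2 * W)) <= e by rewrite -ler_pdivlMr // ge_min lexx orbT.
clearbody e1.
have [d1 d10 Hd1] := dp _ e10; have [d2 d20 Hd2] := dq _ e10; have [d3 d30 Hd3] := dv _ e10.
have [d4 d40 Hd4] := (open_enormP D).1 oD x Dx.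
have m0 : 0 < Num.min d1 (Num.min d2 d3) by rewrite !lt_min d10 d20.
have nY : nbhs (Y x) [set z | enorm (z - Y x) < Num.min d1 (Num.min d2 d3)].
  by apply/nbhs_enormP; exists (Num.min d1 (Num.min d2 d3)).
have /nbhs_enormP[d5 d50 /= Hd5] := cY _ nY.
exists (Num.min d4 d5); first by rewrite lt_min d40.
move=> h; rewrite lt_min => /andP[h4 h5].
have xh : x + h - x = h by rewrite addrC addKr.
have Dz : D (x + h) by apply: Hd4; rewrite xh.
have := Hd5 (x + h); rewrite xh => /(_ h5); set k := Y (x + h) - Y x.
rewrite !lt_min => /andP[k1 /andP[k2 k3]].
have Yk : Y x + k = Y (x + h) by rewrite /k addrC subrK.
have := Hd1 _ k1; have := Hd2 _ k2; have := Hd3 _ k3; rewrite Yk.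
have [-> -> ->] := gY _ Dz; have [-> -> ->] := gY _ Dx; rewrite !vE.
have -> : x.1 + h.1 - x.1 = h.1 by ring.
have -> : x.2 + h.2 - x.2 = h.2 by ring.
move=> r3 r2 r1.
pose Ak : E := (dot p k, dot q k).
have hAk : enorm (h - Ak) <= 2 * e1 * enorm k.
  by apply: le_trans (enorm_le_l1 _) _; rewrite !vE /=; (clear -r2 r1; lra).
have kc : enorm k <= c * enorm Ak.
  rewrite {1}(inv k) -/Ak; apply: le_trans (enorm_le_l1 _) _ => /=.
  have := dot_abs_le a Ak; have := dot_abs_le b Ak; have := enorm_ge0 Ak.
  rewrite /c mulrDl mul1r mulrDl; (clear -R; lra).
have Akh : enorm Ak <= enorm h + 2 * e1 * enorm k.
  have := enorm_triangle h (Ak - h); rewrite addrC subrK (enormB Ak h); (clear -hAk; lra).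
have k0 := enorm_ge0 k.
have kh : enorm k <= 2 * c * enorm h.
  have h1 := ler_wpM2l (_ : 0 <= c) Akh; have {}h1 := h1 (le_trans ler01 c0).
  have h2 := ler_wpM2r k0 e1c; (clear -kc h1 h2; lra).
have r4 : `|dot w (h - Ak)| <= W * (2 * e1 * enorm k).
  by apply: le_trans (dot_abs_le _ _) _; rewrite ler_wpM2l.
rewrite (_ : _ - _ - _ = (phi (x + h) - phi x - dot v k) - dot w (h - Ak)); last first.
  by rewrite (wk k) -/Ak dotDr dotNr; ring.
apply: le_trans (ler_normB _ _) _.
have e1W : 0 <= e1 * (1 + 2 * W) by rewrite mulr_ge0 ?(ltW e10) //; (clear -W0; lra).
have := ler_wpM2l e1W kh; have := ler_wpM2r (enorm_ge0 h) e1e; (clear -r3 r4; lra).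
Qed.

(** Coordinates and [P] are written as Lipschitz functions g_i of [Y]. The points of the target
    where some g_i is not differentiable pull back to a null set by [null_preimage];
    [expanding_nonsingular] removes those where the inverse map is singular. *)
Lemma expanding_differentiable (D : set E) (Y P : E -> E) (L M : R) : open D -> 0 <= L ->
  (forall x, D x -> {for x, continuous Y}) -> (forall x, D x -> enorm (Y x) <= M) ->
  (forall x x', D x -> D x' -> enorm (x - x') <= L * enorm (Y x - Y x')) ->
  (forall x x', D x -> D x' -> enorm (P x - P x') <= L * enorm (Y x - Y x')) ->
  exists N, [/\ measurable N, lamE N = 0%E & forall x, D x -> ~ N x ->
    exists p q, lindiff (fun y => (P y).1) x p /\ lindiff (fun y => (P y).2) x q].
Proof.
move=> oD L0 cY YM YL PL.
have mc (phi : E -> R) (F : E -> E) : (forall x x', `|phi x - phi x'| <= enorm (F x - F x')) ->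
    (forall x x', D x -> D x' -> enorm (F x - F x') <= L * enorm (Y x - Y x')) ->
    exists2 g : E -> R, (forall y y', `|g y - g y'| <= L * enorm (y - y')) &
      forall x, D x -> g (Y x) = phi x.
  by move=> h1 h2; apply: mcshane => // x x' Dx Dx'; apply: le_trans (h1 _ _) (h2 _ _ Dx Dx').
have f1 (F : E -> E) x x' : `|(F x).1 - (F x').1| <= enorm (F x - F x').
  by have := fst_le_enorm (F x - F x'); rewrite !vE.
have f2 (F : E -> E) x x' : `|(F x).2 - (F x').2| <= enorm (F x - F x').
  by have := snd_le_enorm (F x - F x'); rewrite !vE.
have [g1 Lg1 g1Y] := mc (fun x => x.1) id (f1 id) YL.
have [g2 Lg2 g2Y] := mc (fun x => x.2) id (f2 id) YL.
have [g3 Lg3 g3Y] := mc (fun x => (P x).1) P (f1 P) PL.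
have [g4 Lg4 g4Y] := mc (fun x => (P x).2) P (f2 P) PL.
have [N1 [mN1 N10 H1]] := rademacher Lg1; have [N2 [mN2 N20 H2]] := rademacher Lg2.
have [N3 [mN3 N30 H3]] := rademacher Lg3; have [N4 [mN4 N40 H4]] := rademacher Lg4.
have mY := preim_measurable oD cY.
have [N5 [mN5 N50 H5]] := expanding_nonsingular mY L0 YM YL
  (fun x Dx => conj (g1Y x Dx) (g2Y x Dx)).
pose N6 := (N1 `|` N2) `|` (N3 `|` N4).
have mN6 : measurable N6 by apply: measurableU; exact: measurableU.
have N60 : lamE N6 = 0%E.
  by apply: null_setU2; [exact: measurableU|exact: measurableU|exact: null_setU2|exact: null_setU2].
have N70 := null_preimage mY L0 YM YL mN6 N60.
exists (N5 `|` (D `&` Y @^-1` N6)); split.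
- by apply: measurableU => //; exact: mY.
- by rewrite null_setU2 //; exact: mY.
- move=> x Dx /not_orP[nN5 nN7].
  have /not_orP[/not_orP[n1 n2] /not_orP[n3 n4]] : ~ N6 (Y x) by move=> H; apply: nN7.
  have [p dp] := H1 _ n1; have [q dq] := H2 _ n2.
  have [v dv] := H3 _ n3; have [w dw] := H4 _ n4.
  have dt := H5 _ _ _ Dx nN5 dp dq.
  have [p' dp'] := chain_differentiable (phi := fun y => (P y).1) oD Dx (cY _ Dx)
    (fun x Dx => And3 (g1Y x Dx) (g2Y x Dx) (g3Y x Dx)) dp dq dv dt.
  have [q' dq'] := chain_differentiable (phi := fun y => (P y).2) oD Dx (cY _ Dx)
    (fun x Dx => And3 (g1Y x Dx) (g2Y x Dx) (g4Y x Dx)) dp dq dw dt.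
  by exists p', q'.
Qed.

(** Each point lies in a small rational ball for which an exceptional null set exists; one such set
    is chosen for each of the countably many balls. *)
Lemma ae_local (O : set E) (Q : E -> Prop) : (forall x0, O x0 -> exists d N,
    [/\ 0 < d, measurable N, lamE N = 0%E & forall x, enorm (x - x0) < d -> ~ N x -> Q x]) ->
  exists N, [/\ measurable N, lamE N = 0%E & forall x, O x -> ~ N x -> Q x].
Proof.
move=> H; pose B (i : rat * rat * rat) : set E :=
  [set x | enorm (x - (ratr i.1.1, ratr i.1.2)) < ratr i.2].
have HN (i : rat * rat * rat) : exists N, [/\ measurable N, lamE N = 0%E &
    (exists N', [/\ measurable N', lamE N' = 0%E & forall x, B i x -> ~ N' x -> Q x]) ->
    forall x, B i x -> ~ N x -> Q x].
  have [[N [mN N0 HN]]|nN] := pselect (exists N', [/\ measurable N', lamE N' = 0%E &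
    forall x, B i x -> ~ N' x -> Q x]); first by exists N.
  by exists set0; rewrite measure0.
have [N HNi] := choice HN.
have mN i : measurable (N i) by case: (HNi i).
have N0 i : lamE (N i) = 0%E by case: (HNi i).
have [mU U0] := countable_null mN N0.
exists (\bigcup_(i in setT) N i); split => // x Ox nN.
have [d [N' [d0 mN' N'0 HN']]] := H _ Ox.
have d40 : 0 < d / 4 by rewrite divr_gt0.
have rr (a b : R) : a < b -> exists q : rat, a < (ratr q : R) < b.
  by move=> /rat_in_itvoo[q]; rewrite in_itv /= => qq; exists q.
have [r /andP[r1 r2]] : exists q : rat, d / 4 < (ratr q : R) < d / 2 by apply: rr; lra.
have [q1 /andP[a1 a2]] : exists q : rat, x.1 - d / 8 < (ratr q : R) < x.1 + d / 8 by apply: rr; lra.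
have [q2 /andP[b1 b2]] : exists q : rat, x.2 - d / 8 < (ratr q : R) < x.2 + d / 8 by apply: rr; (clear -a1 a2; lra).
pose i := (q1, q2, r).
have Bx : B i x.
  rewrite /B /=; apply: le_lt_trans (enorm_le_l1 _) _; rewrite !vE /=.
  have : `|x.1 - ratr q1| < d / 8 by rewrite ltr_norml; apply/andP; split; (clear -a1 a2; lra).
  have : `|x.2 - ratr q2| < d / 8 by rewrite ltr_norml; apply/andP; split; (clear -b1 b2; lra).
  clear -r1; lra.
have [_ _ Hi] := HNi i; apply: (Hi _ x Bx); last by move=> Nx; apply: nN; exists i.
exists N'; split => // z Bz; apply: HN'.
move: Bx Bz; rewrite /B /= => Bx Bz.
have := enorm_triangle3 z (ratr q1, ratr q2) x; rewrite (enormB (ratr q1, ratr q2) x); (clear -r2 Bx Bz; lra).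
Qed.

End expanding_differentiable.

(** * Second-order expansions *)

Section second_order.
Context {R : realType}.
Local Notation E := (R * R)%type.
Implicit Types (x y z p q v h k a b : E) (f : E -> R) (P : E -> E).

Definition dotf p : E -> R := fun h => dot p h.
Lemma dotf_is_linear p : linear (dotf p).
Proof. by move=> t h k; rewrite /dotf dotDr dotZr. Qed.
HB.instance Definition _ p := GRing.isLinear.Build R E R _ (dotf p) (dotf_is_linear p).

Definition lin2 a b : E -> E := fun h => (dot a h, dot b h).
Lemma lin2_is_linear a b : linear (lin2 a b).
Proof. by move=> t h k; apply: vec_ext; rewrite /lin2 !vE /= dotDr dotZr. Qed.
HB.instance Definition _ a b := GRing.isLinear.Build R E E _ (lin2 a b) (lin2_is_linear a b).

Lemma lin2D a b h k : lin2 a b (h + k) = lin2 a b h + lin2 a b k.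
Proof. exact: linearD. Qed.
Lemma lin2Z a b (t : R) h : lin2 a b (t *: h) = t *: lin2 a b h.
Proof. exact: linearZ. Qed.

Lemma lin2_continuous a b : continuous (lin2 a b).
Proof.
move=> x; apply: (@cvg_pair _ _ _ (nbhs x) (nbhs (dot a x)) (nbhs (dot b x)) _ _ _
  (fun z => dot a z) (fun z => dot b z)); exact: dot_continuous.
Qed.

Lemma near_differentiable (V W : normedModType R) (F : V -> W) (df : {linear V -> W}) (x : V) :
  continuous df ->
  (forall e, 0 < e -> \forall h \near (0 : V), `|F (x + h) - F x - df h| <= e * `|h|) ->
  differentiable F x /\ 'd F x = df :> (V -> W).
Proof.
move=> cdf H.
have o : F \o shift x = cst (F x) + df +o_ 0 id.
  apply/eqaddoP => e e0; have := H _ e0; apply: filterS => h.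
  by rewrite /= !fctE /= [x + h]addrC opprD addrA.
have dE := diff_unique cdf o.
by split => //; apply/diff_locallyP; rewrite dE.
Qed.

Lemma eps_differentiable (W : normedModType R) (F : E -> W) (df : {linear E -> W}) x :
  continuous df ->
  (forall e, 0 < e -> exists2 d, 0 < d &
     forall h, enorm h < d -> `|F (x + h) - F x - df h| <= e * enorm h) ->
  differentiable F x /\ 'd F x = df :> (E -> W).
Proof.
move=> cdf H; apply: near_differentiable => // e e0; have e20 : 0 < e / 2 by rewrite divr_gt0.
have [d d0 Hd] := H _ e20; apply/nbhs_enormP; exists d => // h; rewrite subr0 => hd.
apply: le_trans (Hd _ hd) _.
by have := ler_wpM2l (ltW e20) (enorm_le_norm h); lra.
Qed.

Lemma lindiff_grad f x p : lindiff f x p -> differentiable f x /\ grad f x = p.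
Proof.
move=> H; have [||df dE] := @eps_differentiable R f (dotf p) x.
- exact: dot_continuous.
- exact: H.
- split => //; have gE i : 'd f x (e_ i) = dot p (e_ i) by rewrite dE.
  by rewrite /grad !gE; apply: vec_ext; rewrite /dot /e_ /=; ring.
Qed.

Lemma lin2_approx P x a b (e : R) : lindiff (fun y => (P y).1) x a ->
  lindiff (fun y => (P y).2) x b -> 0 < e -> exists2 d, 0 < d &
  forall h, enorm h < d -> enorm (P (x + h) - P x - lin2 a b h) <= e * enorm h.
Proof.
move=> da db e0; have e20 : 0 < e / 2 by rewrite divr_gt0.
have [d1 d10 H1] := da _ e20; have [d2 d20 H2] := db _ e20.
exists (Num.min d1 d2); first by rewrite lt_min d10.
move=> h; rewrite lt_min => /andP[/H1 h1 /H2 h2].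
by apply: le_trans (enorm_le_l1 _) _; rewrite !vE /=; lra.
Qed.

Lemma lindiff2_diff P x a b : lindiff (fun y => (P y).1) x a ->
  lindiff (fun y => (P y).2) x b -> differentiable P x /\ 'd P x = lin2 a b :> (E -> E).
Proof.
move=> da db; apply: eps_differentiable; first exact: lin2_continuous.
move=> e e0; have [d d0 Hd] := lin2_approx da db e0; exists d => // h /Hd.
by apply: le_trans; exact: norm_le_enorm.
Qed.

Lemma is_derive_eps (F : R -> R) (t l : R) :
  (forall e, 0 < e -> exists2 d, 0 < d &
     forall s : R, `|s| < d -> `|F (t + s) - F t - l * s| <= e * `|s|) ->
  is_derive t (1 : R) F l.
Proof.
move=> H.
have cv : (fun s : R => s^-1 *: (F (s *: 1 + t) - F t)) @ 0^' --> l.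
  apply/cvgrPdist_le => e e0; have [d d0 Hd] := H _ e0.
  exists d => // s; rewrite /= sub0r normrN => sd s0; have := Hd _ sd.
  rewrite /GRing.scale /= mulr1 [s + t]addrC => h.
  rewrite -(ler_pM2r (_ : 0 < `|s|)) ?normr_gt0 // -normrM mulrBl mulrAC mulVf // mul1r.
  by rewrite distrC.
by apply: DeriveDef; [apply/cvg_ex; exists l|apply/cvg_lim].
Qed.

Lemma line_derive f x h p (t : R) : lindiff f (x + t *: h) p ->
  is_derive t (1 : R) (fun s => f (x + s *: h)) (dot p h).
Proof.
move=> H; apply: is_derive_eps => e e0.
have e10 : 0 < e / (enorm h + 1) by rewrite divr_gt0 // ltr_wpDl // enorm_ge0.
have [d d0 Hd] := H _ e10; exists (d / (enorm h + 1)).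
  by rewrite divr_gt0 // ltr_wpDl // enorm_ge0.
have h0 := enorm_ge0 h; have h1 : 0 < enorm h + 1 by lra.
move=> s; rewrite ltr_pdivlMr // => sd.
have shE : enorm (s *: h) = `|s| * enorm h by rewrite enormZ.
have shd : enorm (s *: h) < d by rewrite shE; have := normr_ge0 s; lra.
have := Hd _ shd; rewrite -(addrA x (t *: h)) -scalerDl dotZr [dot p h * s]mulrC => h2.
apply: le_trans h2 _; rewrite shE.
have h3 : e / (enorm h + 1) * enorm h <= e.
  by rewrite mulrAC ler_pdivrMr // ler_wpM2l ?(ltW e0) //; lra.
by have := ler_wpM2l (normr_ge0 s) h3; move: (e / _) => c; lra.
Qed.

Section at_point.
Variables (f : E -> R) (P : E -> E) (x : E) (r : R).
Hypotheses (r0 : 0 < r) (fP : forall y, enorm (y - x) < r -> lindiff f y (P y)).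
Variables (a b : E).
Hypotheses (da : lindiff (fun y => (P y).1) x a) (db : lindiff (fun y => (P y).2) x b).

(** The gradient is differentiable at [x] only, so the mean value theorem is applied along the
    segment to [f] minus the quadratic polynomial. *)
Lemma taylor2 (e : R) : 0 < e -> exists2 d, 0 < d & forall h, enorm h < d ->
  `|f (x + h) - f x - dot (P x) h - dot (lin2 a b h) h / 2| <= e * enorm h ^+ 2.
Proof.
move=> e0; have [d d0 Hd] := lin2_approx da db e0.
exists (Num.min (d / 2) (r / 2)); first by rewrite lt_min !divr_gt0.
move=> h; rewrite lt_min => /andP[hd hr]; have h0 := enorm_ge0 h.
pose G (v : R) := f (x + v *: h) - v * dot (P x) h - v ^+ 2 * (dot (lin2 a b h) h / 2).
pose g (v : R) := dot (P (x + v *: h) - P x - lin2 a b (v *: h)) h.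
have vh (v : R) : `|v| < 2 -> enorm (v *: h) < d /\ enorm (v *: h) < r.
  by move=> v2; rewrite enormZ; have := ler_wpM2r h0 (ltW v2); split; lra.
have dG (v : R) : `|v - 0| < 2 -> is_derive v (1 : R) G (g v).
  rewrite subr0 => /vh[vd vr].
  have dv := line_derive (fP (_ : enorm (x + v *: h - x) < r)).
  have {}dv := dv (_ : _); rewrite [x + _]addrC addrK [_ + x]addrC in dv; have {}dv := dv vr.
  rewrite /G; apply: is_derive_eq.
  by rewrite /g lin2Z !dotDl !dotNl dotZl /GRing.scale /=; field.
have gM (v : R) : `|v - 0| <= `|1 - 0 : R| -> `|g v| <= e * enorm h ^+ 2.
  rewrite !subr0 normr1 => v1; have [vd _] := vh v (le_lt_trans v1 (ltr1n _ 2)).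
  apply: le_trans (dot_abs_le _ _) _; have := Hd _ vd; rewrite enormZ => h1.
  have := ler_wpM2r h0 h1; have := ler_wpM2r h0 v1; rewrite expr2 => h2 h3.
  apply: le_trans h3 _; rewrite -mulrA ler_wpM2l ?(ltW e0) // ler_wpM2r //; lra.
have H : `|G 1 - G 0| <= e * enorm h ^+ 2 * `|1 - 0|.
  by apply: (@mvt_le R G g 0 1 2) => //; rewrite subr0 normr1 ltr1n.
rewrite subr0 normr1 mulr1 in H; apply: le_trans H.
rewrite (_ : G 1 - G 0 = f (x + h) - f x - dot (P x) h - dot (lin2 a b h) h / 2) //.
by rewrite /G scale1r scale0r addr0; ring.
Qed.

(** Mean value theorem along [h] for the increment of [f] by [k]. It yields the symmetry of the
    Hessian and later exhibits the Hessian as a limit of continuous functions. *)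
Lemma second_difference (e : R) : 0 < e -> exists2 d, 0 < d &
  forall h k, enorm h < d -> enorm k < d ->
  `|f (x + h + k) - f (x + h) - f (x + k) + f x - dot (lin2 a b k) h|
     <= e * (4 * enorm h + 2 * enorm k) * enorm h.
Proof.
move=> e0; have [d d0 Hd] := lin2_approx da db e0.
exists (Num.min (d / 4) (r / 4)); first by rewrite lt_min !divr_gt0.
move=> h k; rewrite !lt_min => /andP[hd hr] /andP[kd kr].
have h0 := enorm_ge0 h; have k0 := enorm_ge0 k.
pose G (v : R) := f (x + k + v *: h) - f (x + v *: h) - v * dot (lin2 a b k) h.
pose g (v : R) := dot (P (x + k + v *: h) - P (x + v *: h) - lin2 a b k) h.
have vh (v : R) : `|v| < 2 -> [/\ enorm (k + v *: h) < d, enorm (k + v *: h) < r,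
    enorm (v *: h) < d & enorm (v *: h) < r].
  move=> v2; have := enorm_triangle k (v *: h).
  by rewrite enormZ; have := ler_wpM2r h0 (ltW v2); split; lra.
have dG (v : R) : `|v - 0| < 2 -> is_derive v (1 : R) G (g v).
  rewrite subr0 => /vh[vd vr wd wr].
  have d1 : is_derive v (1 : R) (fun s => f (x + k + s *: h)) (dot (P (x + k + v *: h)) h).
    by apply: line_derive; apply: fP; rewrite (_ : _ - x = k + v *: h) //; vring.
  have d2 : is_derive v (1 : R) (fun s => f (x + s *: h)) (dot (P (x + v *: h)) h).
    by apply: line_derive; apply: fP; rewrite [x + _]addrC addrK.
  rewrite /G; apply: is_derive_eq.
  by rewrite /g !dotDl !dotNl /GRing.scale /=; ring.
have gM (v : R) : `|v - 0| <= `|1 - 0 : R| -> `|g v| <= e * (4 * enorm h + 2 * enorm k) * enorm h.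
  rewrite !subr0 normr1 => v1; have [vd _ wd _] := vh v (le_lt_trans v1 (ltr1n _ 2)).
  apply: le_trans (dot_abs_le _ _) _; rewrite ler_wpM2r //.
  have h1 := Hd _ vd; have h2 := Hd _ wd; rewrite addrA in h1.
  rewrite (_ : _ - _ - _ = (P (x + k + v *: h) - P x - lin2 a b (k + v *: h)) -
     (P (x + v *: h) - P x - lin2 a b (v *: h))); last by rewrite lin2D; vring.
  apply: le_trans (enorm_triangle _ _) _; rewrite enormN.
  have h3 := enorm_triangle k (v *: h); rewrite enormZ in h2 h3.
  have := ler_wpM2l (ltW e0) h3; have := ler_wpM2r h0 v1.
  move=> h4; have := ler_wpM2l (ltW e0) h4; have := mulr_ge0 (ltW e0) h0; have := mulr_ge0 (ltW e0) k0; (clear -h1 h2; lra).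
have H : `|G 1 - G 0| <= e * (4 * enorm h + 2 * enorm k) * enorm h * `|1 - 0|.
  by apply: (@mvt_le R G g 0 1 2) => //; rewrite subr0 normr1 ltr1n.
rewrite subr0 normr1 mulr1 in H; apply: le_trans H.
rewrite (_ : G 1 - G 0 = f (x + h + k) - f (x + h) - f (x + k) + f x - dot (lin2 a b k) h) //.
by rewrite /G !scale1r !scale0r !addr0 [x + k + h]addrAC; ring.
Qed.

(** The second difference is unchanged when the two steps t e_1 and t e_2 are swapped. Each estimate
    costs (e / 12) (4 t + 2 t) t, half of e t^2. *)
Lemma hessian_symmetric : a.2 = b.1.
Proof.
apply/eqP; rewrite -subr_eq0 -normr_le0; apply/ler_addgt0Pr => e e0; rewrite add0r.
have e10 : 0 < e / 12 by rewrite divr_gt0.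
have [d d0 Hd] := second_difference e10.
pose t := d / 2; have t0 : 0 < t by rewrite divr_gt0.
have E1 i : enorm (t *: e_ i : E) = t by rewrite enorm_e gtr0_norm.
have td i : enorm (t *: e_ i : E) < d by rewrite E1 /t; lra.
have h1 := Hd _ _ (td false) (td true); have h2 := Hd _ _ (td true) (td false).
rewrite !E1 in h1 h2; rewrite [x + _ + t *: e_ false]addrAC in h2.
set D := f _ in h1 h2.
have q1 : dot (lin2 a b (t *: e_ true)) (t *: e_ false) = t ^+ 2 * a.2.
  by rewrite /lin2 /dot /e_ !vE /=; ring.
have q2 : dot (lin2 a b (t *: e_ false)) (t *: e_ true) = t ^+ 2 * b.1.
  by rewrite /lin2 /dot /e_ !vE /=; ring.
rewrite q1 in h1; rewrite q2 in h2.
have tt : 0 < t ^+ 2 by rewrite exprn_gt0.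
rewrite -(ler_pM2l tt) -{1}[t ^+ 2]gtr0_norm // -normrM mulrBr.
move: h1 h2; rewrite !ler_norml => /andP[g1 g2] /andP[g3 g4].
rewrite expr2 in g1 g2 g3 g4 *; apply/andP; split; (clear -g1 g2 g3 g4; lra).
Qed.

Lemma twice_diff_local u : (forall y, enorm (y - x) < r -> f y = u y) ->
  [/\ twice_diff u x, grad u x = P x & forall h, hessv u x h = lin2 a b h].
Proof.
move=> fu.
have lu y : enorm (y - x) < r -> lindiff u y (P y).
  move=> yr e e0; have [d d0 Hd] := fP yr e0.
  exists (Num.min d (r - enorm (y - x))); first by rewrite lt_min d0 subr_gt0.
  move=> h; rewrite lt_min => /andP[hd hr]; rewrite -!fu //; first exact: Hd.
  have := enorm_triangle h (y - x); rewrite addrA [h + y]addrC; lra.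
have gP y : enorm (y - x) < r -> grad u y = P y by move=> /lu /lindiff_grad[].
have xr : enorm (x - x) < r by rewrite subrr enorm0.
have lg (c : E -> R) v : lindiff (fun y => c (P y)) x v -> lindiff (fun y => c (grad u y)) x v.
  move=> H e e0; have [d d0 Hd] := H _ e0.
  exists (Num.min d r); first by rewrite lt_min d0.
  move=> h; rewrite lt_min => /andP[hd hr]; rewrite !gP //; first exact: Hd.
  by rewrite [x + h]addrC addrK.
have [dg hE] := lindiff2_diff (lg (fun y => y.1) _ da) (lg (fun y => y.2) _ db).
have hv h : hessv u x h = lin2 a b h by rewrite /hessv hE.
split => //; last exact: gP.
split => //; first by have [] := lindiff_grad (lu _ xr).
apply/cvgrPdist_le => e e0; have [d d0 Hd] := taylor2 e0.
have : nbhs (0 : E) [set h | enorm h < Num.min d r].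
  apply/nbhs_enormP; exists (Num.min d r); first by rewrite lt_min d0.
  by move=> y; rewrite subr0.
apply: filterS => h /=; rewrite lt_min => /andP[hd hr] h0.
have xhr : enorm (x + h - x) < r by rewrite [x + h]addrC addrK.
have n0 : 0 < enorm h ^+ 2 by rewrite exprn_gt0 // enorm_gt0.
rewrite sub0r normrN normrM normfV [`|enorm h ^+ 2|]gtr0_norm // ler_pdivrMr //.
by rewrite gP // hv -!fu //; exact: Hd.
Qed.

End at_point.

End second_order.

(** * Asymptotic mean value formulas *)

Section asymptotic_mean_value.
Context {R : realType}.
Local Notation E := (R * R)%type.
Implicit Types (x y z p q v h k a b n : E) (f u : E -> R).

Definition taylor f x p a b := forall e, 0 < e -> exists2 d, 0 < d & forall h, enorm h < d ->
  `|f (x + h) - f x - dot p h - dot (lin2 a b h) h / 2| <= e * enorm h ^+ 2.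

Lemma lin2N a b h : lin2 (- a) (- b) h = - lin2 a b h.
Proof. by apply: vec_ext; rewrite /lin2 !vE /= dotNl. Qed.

Lemma taylorN f x p a b : taylor f x p a b -> taylor (fun y => - f y) x (- p) (- a) (- b).
Proof.
move=> H e e0; have [d d0 Hd] := H _ e0; exists d => // h /Hd.
rewrite lin2N !dotNl -normrN; congr (`|_| <= _); lra.
Qed.

Lemma taylor_ext f g x p a b (r : R) : 0 < r -> (forall y, enorm (y - x) < r -> f y = g y) ->
  taylor f x p a b -> taylor g x p a b.
Proof.
move=> r0 fg H e e0; have [d d0 Hd] := H _ e0.
exists (Num.min d r); first by rewrite lt_min d0.
move=> h; rewrite lt_min => /andP[hd hr]; rewrite -!fg; [exact: Hd| |].
- by rewrite subrr enorm0.
- by rewrite [x + h]addrC addrK.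
Qed.

Lemma second_quotient f x p a b : taylor f x p a b -> dot (lin2 a b p) p = 0 ->
  (fun h : R => (f x - (f (x + h *: p) + f (x - h *: p)) / 2) / h ^+ 2) @ 0^' --> (0 : R).
Proof.
move=> H A0; apply/cvgrPdist_le => e e0.
have P0 : 0 < enorm p ^+ 2 + 1 by rewrite ltr_wpDl ?sqr_ge0.
have e10 : 0 < e / (enorm p ^+ 2 + 1) by rewrite divr_gt0.
have [d d0 Hd] := H _ e10; have p0 := enorm_ge0 p.
exists (d / (enorm p + 1)) => /=; first by rewrite divr_gt0 // ltr_wpDl.
move=> h; rewrite /ball_ /= sub0r normrN ltr_pdivlMr; last lra.
move=> hd h0; have ah0 := normr_ge0 h.
have hpE (s : R) : `|s| = `|h| -> enorm (s *: p) < d /\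
    `|f (x + s *: p) - f x - s * dot p p| <= e * h ^+ 2.
  move=> sh; have spE : enorm (s *: p) = `|h| * enorm p by rewrite enormZ sh.
  have sd : enorm (s *: p) < d by rewrite spE; lra.
  split => //; have := Hd _ sd.
  rewrite lin2Z dotZl !dotZr A0 !mulr0 mul0r subr0 spE => /le_trans; apply.
  have h3 : e / (enorm p ^+ 2 + 1) * enorm p ^+ 2 <= e.
    by rewrite mulrAC ler_pdivrMr // ler_wpM2l ?(ltW e0) //; (clear -R; lra).
  have := ler_wpM2l (sqr_ge0 h) h3; rewrite exprMn real_normK ?num_real //.
  by move: (e / _) => c; lra.
have [_ h1] := hpE h erefl; have [_ h2] := hpE (- h) (normrN h).
have hh : 0 < h ^+ 2 by rewrite lt0r sqrf_eq0 h0 sqr_ge0.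
rewrite sub0r normrN normrM normfV [`|h ^+ 2|]gtr0_norm // ler_pdivrMr //.
move: h1 h2; rewrite scaleNr !ler_norml => /andP[g1 g2] /andP[g3 g4].
by apply/andP; split; (clear -g1 g2 g3 g4; lra).
Qed.

Lemma orth_decomp h n : dot n n = 1 -> h = dot h n *: n + dot h (perp n) *: perp n.
Proof.
move=> n1; apply: vec_ext; rewrite !vE /perp.
  by rewrite -[LHS]mulr1 -n1 /dot /=; ring.
by rewrite -[LHS]mulr1 -n1 /dot /=; ring.
Qed.

(* In the ball of radius t, the tangential deviation s from the direction of p costs
   |p| s^2 / (2 t) to first order, which absorbs the mixed second-order terms. *)
Lemma ball_sup_expansion f x p a b : taylor f x p a b -> a.2 = b.1 -> p != 0 ->
  dot (lin2 a b p) p = 0 -> forall e, 0 < e -> exists2 d, 0 < d & forall t, 0 < t < d ->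
    `|sup (f @` cball x t) - f x - enorm p * t| <= e * t ^+ 2.
Proof.
move=> H sym p0 A0 e e0; set T := enorm p; have T0 : 0 < T := enorm_gt0 p0.
pose n := T^-1 *: p; have n1 : dot n n = 1 := dot_normalize p0.
have pn : p = T *: n by rewrite /n scalerA divff ?scale1r // gt_eqF.
have An : dot (lin2 a b n) n = 0 by rewrite /n lin2Z dotZl dotZr A0 !mulr0.
pose m := perp n; have m1 : dot m m = 1 := perp_unit n1.
have hE' h : h = dot h n *: n + dot h m *: m := orth_decomp h n1.
have sr' h : dot h n ^+ 2 + dot h m ^+ 2 = enorm h ^+ 2.
  by rewrite !expr2 -(dot_perp2 h h n1) -enorm_sqr -expr2.
clearbody n m.
pose al := dot (lin2 a b n) m; pose be := dot (lin2 a b m) m.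
have symA : dot (lin2 a b m) n = al by rewrite /al /lin2 /dot /= sym; ring.
pose C := `|al| + `|be| + 1.
have C0 : 0 < C by rewrite /C ltr_wpDl // addr_ge0.
have e20 : 0 < e / 2 by rewrite divr_gt0.
have [d d0 Hd] := H _ e20.
(* The second bound lets the gain T r^2 / (2 t) dominate the term [be] in r^2; the third is what
   remains after completing the square in the mixed term [al]. *)
pose D := Num.min d (Num.min (T / (4 * C)) (e / 2 * T / C ^+ 2)).
have D0 : 0 < D by rewrite !lt_min d0 !divr_gt0 ?mulr_gt0 // exprn_gt0.
exists D => // t /andP[t0]; rewrite !lt_min => /andP[td /andP[tC te]].
have tn h : enorm h <= t -> enorm h < d by move=> /le_lt_trans; apply.
have up h : enorm h <= t -> f (x + h) <= f x + T * t + e * t ^+ 2.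
  move=> ht; have := Hd _ (tn _ ht); rewrite ler_norml => /andP[_ h1].
  have h2 : e / 2 * enorm h ^+ 2 <= e / 2 * t ^+ 2.
    by rewrite ler_wpM2l ?(ltW e20) // ler_pXn2r ?nnegrE ?enorm_ge0 // ltW.
  have hE := hE' h; have sr := sr' h; set s := dot h n in hE sr; set r := dot h m in hE sr.
  have {}sr : s ^+ 2 + r ^+ 2 <= t ^+ 2.
    by rewrite sr ler_pXn2r ?nnegrE ?enorm_ge0 // ltW.
  have ph : dot p h = T * s by rewrite pn dotZl dotC.
  have qE : dot (lin2 a b h) h = 2 * (s * r * al) + r ^+ 2 * be.
    rewrite {1 2}hE; move: (s) (r) => s' r'.
    rewrite lin2D !lin2Z !dotDl !dotDr !dotZl !dotZr An symA -/al -/be; ring.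
  have st : s <= t.
    rewrite leNgt; apply/negP => ts; have : t ^+ 2 < s ^+ 2.
      by rewrite ltr_pXn2r // nnegrE ltW // (lt_trans t0).
    have := sqr_ge0 r; (clear -sr; lra).
  have sNt : - t <= s.
    rewrite leNgt; apply/negP => ts; have : t ^+ 2 < (- s) ^+ 2.
      by rewrite ltr_pXn2r // ?nnegrE; (clear -t0 ts; lra).
    rewrite sqrrN; have := sqr_ge0 r; (clear -sr; lra).
  have s2 : 2 * t * s <= 2 * t ^+ 2 - r ^+ 2.
    by have := sqr_ge0 (t - s); rewrite sqrrB mulr2n; (clear -sr; lra).
  have q1 : s * r * al <= t * `|r| * C.
    apply: le_trans (ler_norm _) _; rewrite !normrM; apply: ler_pM => //.
    - by apply: ler_pM => //; rewrite ler_norml sNt.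
    - by rewrite /C -addrA lerDl addr_ge0.
  have q2 : r ^+ 2 * be <= r ^+ 2 * C.
    rewrite ler_wpM2l ?sqr_ge0 //; apply: le_trans (ler_norm _) _.
    by rewrite /C [`|al| + _]addrC -addrA lerDl addr_ge0.
  have r2 : `|r| ^+ 2 = r ^+ 2 by rewrite real_normK // num_real.
  have tC' : t * (4 * C) <= T by rewrite -ler_pdivlMr ?mulr_gt0 // ltW.
  have te' : t * C ^+ 2 <= e / 2 * T by rewrite -ler_pdivlMr ?exprn_gt0 // ltW.
  have key : T * s + dot (lin2 a b h) h / 2 <= T * t + e / 2 * t ^+ 2.
    rewrite -(ler_pM2l (mulr_gt0 T0 t0)) qE.
    have k1 := ler_wpM2l (ltW (mulr_gt0 T0 T0)) s2.
    have k2 := ler_wpM2l (ltW (mulr_gt0 T0 t0)) q1.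
    have k3 := ler_wpM2l (ltW (mulr_gt0 T0 t0)) q2.
    have Tr : 0 <= T * r ^+ 2 by rewrite mulr_ge0 ?sqr_ge0 // ltW.
    have k4 := ler_wpM2l Tr tC'.
    (* Multiplied by T t, the mixed term is at most T t^2 |r| C, hence at most T^2 r^2 / 4 + t^4 C^2
       by this square; [te'] turns the last summand into (e / 2) t^2, again times T t. *)
    have k5 := sqr_ge0 (T * `|r| - 2 * t ^+ 2 * C).
    have t30 : 0 <= t ^+ 3 by rewrite exprn_ge0 // ltW.
    have k6 := ler_wpM2l t30 te'.
    have k7 := mulr_ge0 (ltW T0) Tr.
    move: k1 k2 k3 k4 k5 k6 k7; rewrite -r2; move: (`|r|) => w; clearbody s r al be C T; (clear -R; lra).
  move: h1 key h2; rewrite ph; (clear -R; lra).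
have lo : f x + T * t - e * t ^+ 2 <= f (x + t *: n).
  have tE : enorm (t *: n) = t by rewrite enormZ (enorm_unit n1) mulr1 gtr0_norm.
  have := Hd (t *: n); rewrite tE => /(_ td).
  rewrite lin2Z dotZl !dotZr An !mulr0 mul0r subr0 ler_norml => /andP[h1 _].
  have pnT : dot p n = T by rewrite pn dotZl n1 mulr1.
  have := mulr_gt0 e0 (exprn_gt0 2 t0); move: h1; rewrite pnT; (clear -R; lra).
have S0 : (f @` cball x t) !=set0 by exists (f x), x => //; rewrite /cball /= subrr enorm0 ltW.
have Sub : ubound (f @` cball x t) (f x + T * t + e * t ^+ 2).
  move=> _ [y yt <-]; have := up (y - x) yt; by rewrite addrC subrK.
have s1 : sup (f @` cball x t) <= f x + T * t + e * t ^+ 2 by apply: ge_sup.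
have s2 : f (x + t *: n) <= sup (f @` cball x t).
  apply: ub_le_sup; first by eexists; exact: Sub.
  exists (x + t *: n) => //; rewrite /cball /= [x + _]addrC addrK.
  by rewrite enormZ (enorm_unit n1) mulr1 gtr0_norm.
rewrite ler_norml; apply/andP; split; (clear -lo s1 s2; lra).
Qed.

Lemma ball_mean_value f x p a b : taylor f x p a b -> a.2 = b.1 -> p != 0 ->
  dot (lin2 a b p) p = 0 ->
  (fun e : R => (f x - (sup (f @` cball x e) + inf (f @` cball x e)) / 2) / e ^+ 2)
    @ 0^'+ --> (0 : R).
Proof.
move=> H sym p0 A0; apply/cvgrPdist_le => e e0.
have [d1 d10 H1] := ball_sup_expansion H sym p0 A0 e0.
have [|||d2 d20 H2] := ball_sup_expansion (taylorN H) _ _ _ e0.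
- by rewrite !vE sym.
- by rewrite oppr_eq0.
- have -> : lin2 (- a) (- b) (- p) = lin2 a b p by rewrite lin2N linearN opprK.
  by rewrite dotNr A0 oppr0.
exists (Num.min d1 d2) => /=; first by rewrite lt_min d10.
move=> t; rewrite /ball_ /= sub0r normrN => td t0.
move: td; rewrite gtr0_norm // lt_min => /andP[td1 td2].
have {}H1 := H1 t; have {}H2 := H2 t; rewrite t0 td1 td2 enormN in H1 H2.
have {}H1 := H1 isT; have {}H2 := H2 isT.
rewrite sub0r normrN normrM normfV [`|t ^+ 2|]gtr0_norm ?exprn_gt0 // ler_pdivrMr ?exprn_gt0 //.
have -> : inf (f @` cball x t) = - sup ((fun y => - f y) @` cball x t).
  by rewrite /inf image_comp.
move: H1 H2; rewrite !ler_norml => /andP[g1 g2] /andP[g3 g4].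
by apply/andP; split; (clear -g1 g2 g3 g4; lra).
Qed.

End asymptotic_mean_value.

(** * Second-order differentiability of the potential *)

Section almost_everywhere_twice_differentiable.
Context {R : realType}.
Local Notation E := (R * R)%type.
Implicit Types (x y z p q v h k a b n : E) (f u : E -> R).
Context (O K : set E) (U : E -> R) (M : R) (rp : ringpot O K U M).

Lemma pgrad_lindiff x : (O `\` K) x -> lindiff U x (pgrad U x).
Proof.
move=> Rx e e0.
have [d d0 Hd] := potential_diff rp Rx (nrm1 rp x) (@nrm_supp _ _ _ _ _ rp x) e0.
exists d => // h /Hd; congr (`|_| <= _).
by rewrite /pgrad dotNl dotZl opprK.
Qed.

Lemma pgrad_neq0 x : (O `\` K) x -> pgrad U x != 0.
Proof.
move=> Rx; have T0 := slope_gt0 rp Rx.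
rewrite /pgrad oppr_eq0 scaler_eq0 negb_or gt_eqF //=.
by apply/eqP => n0; have := nrm1 rp x; rewrite n0 dot0l => /eqP; rewrite eq_sym oner_eq0.
Qed.

Lemma pgrad_ae_differentiable : exists N, [/\ measurable N, lamE N = 0%E &
  forall x, (O `\` K) x -> ~ N x -> exists a b,
    lindiff (fun y => (pgrad U y).1) x a /\ lindiff (fun y => (pgrad U y).2) x b].
Proof.
apply: ae_local => x0 Rx0; have [d [L [Y [d0 L0 H1 H2 H3]]]] := gauss_chart rp Rx0.
have xx0 : enorm (x0 - x0) < d by rewrite subrr enorm0.
have cY : {for x0, continuous Y} by case: (H1 _ xx0).
(* Shrinking the chart makes [Y] bounded on it. *)
have nY : nbhs (Y x0) [set z | enorm (z - Y x0) < 1] by apply/nbhs_enormP; exists 1.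
have /nbhs_enormP[d' d'0 /= Hd'] := cY _ nY.
pose m := Num.min d d'; have m0 : 0 < m by rewrite lt_min d0.
have md : m <= d by rewrite ge_min lexx.
have md' : m <= d' by rewrite ge_min lexx orbT.
clearbody m; pose D := [set x | enorm (x - x0) < m].
have oD : open D.
  apply/open_enormP => x xm; exists (m - enorm (x - x0)); first by rewrite subr_gt0.
  by move=> y yx; rewrite /D /=; have := enorm_triangle3 y x x0; lra.
have Dd x : D x -> enorm (x - x0) < d by rewrite /D /=; lra.
have [||||N [mN N0 HN]] := @expanding_differentiable R D Y (pgrad U) L (enorm (Y x0) + 1) oD L0.
- by move=> x /Dd /H1[].
- move=> x Dx; have := Hd' x; have := enorm_triangle3 (Y x) (Y x0) 0; rewrite !subr0.
  move=> h1 h2; have := h2 (lt_le_trans Dx md'); lra.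
- by move=> x x' /Dd Dx /Dd Dx'; exact: H2.
- by move=> x x' /Dd Dx /Dd Dx'; exact: H3.
by exists m, N.
Qed.

(** A two-sided expansion is a Taylor bound from above for [U] and for [- U], so both viscosity
    inequalities apply at [x]. *)
Lemma jet_equation x p a b : (O `\` K) x -> taylor U x p a b -> a.2 = b.1 ->
  dot (lin2 a b p) p = 0.
Proof.
move=> Rx H sym; have [_ _ _ [jU jN]] := rp.
pose A : R * R * R := (a.1, a.2, b.2).
have qE h : dot (lin2 a b h) h = qf A h.
  by rewrite /lin2 /dot /qf /A /= -sym; ring.
apply/eqP; rewrite eq_le qE; apply/andP; split.
  have : 0 <= qf (- a.1, - a.2, - b.2) (- p).
    apply: (jN x (- p) _ Rx) => e e0; have [d d0 Hd] := H _ e0; exists d => // h /Hd.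
    rewrite qE -enorm_sqr ler_norml => /andP[h1 _].
    have -> : qf (- a.1, - a.2, - b.2) h = - qf A h by rewrite /qf /A /=; ring.
    rewrite dotNl; lra.
  by rewrite (_ : qf _ (- p) = - qf A p) ?oppr_ge0 // /qf /A !vE /=; ring.
apply: (jU x p _ Rx) => e e0; have [d d0 Hd] := H _ e0; exists d => // h /Hd.
by rewrite qE -enorm_sqr ler_norml => /andP[_ h1]; lra.
Qed.

Lemma ae_second_order u : (forall x, (O `\` K) x -> U x = u x) ->
  exists N, [/\ measurable N, lamE N = 0%E & forall x, (O `\` K) x -> ~ N x ->
    exists a b, [/\ twice_diff u x, taylor u x (grad u x) a b,
      forall h, hessv u x h = lin2 a b h, a.2 = b.1 &
      grad u x != 0 /\ dot (lin2 a b (grad u x)) (grad u x) = 0]].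
Proof.
move=> Uu; have [N [mN N0 HN]] := pgrad_ae_differentiable.
exists N; split => // x Rx nN; have [a [b [da db]]] := HN _ Rx nN.
have [r r0 Hr] := ball_in rp Rx.
have fP y : enorm (y - x) < r -> lindiff U y (pgrad U y).
  by move=> yr; apply: pgrad_lindiff; apply: Hr; exact: ltW.
have fu y : enorm (y - x) < r -> U y = u y by move=> yr; apply: Uu; apply: Hr; exact: ltW.
have [td gP hE] := twice_diff_local r0 fP da db fu.
have ty := taylor2 r0 fP da db.
have sym := hessian_symmetric r0 fP da db.
exists a, b; rewrite gP; split => //; first exact: taylor_ext fu ty.
by split; [exact: pgrad_neq0|exact: (jet_equation Rx ty)].
Qed.

End almost_everywhere_twice_differentiable.


(** * Smooth bumps *)

Section smooth_step.
Context {R : realType}.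
Implicit Types (f g : R -> R) (t : R).

Lemma is_derive_val f t (d d' : R) : is_derive t (1 : R) f d -> d = d' -> is_derive t (1 : R) f d'.
Proof. by move=> ? <-. Qed.

(** The derivative enters as a witness instead of an iterated operator, so closure under sums,
    products and inverses follows by induction on [n]. *)
Fixpoint differentiable_upto (n : nat) f : Prop :=
  if n is n'.+1 then exists2 f', (forall t, is_derive t (1 : R) f (f' t)) & differentiable_upto n' f'
  else True.

Lemma differentiable_uptoW n f : differentiable_upto n.+1 f -> differentiable_upto n f.
Proof.
by elim: n f => // n IH f [f' df /IH ?]; exists f'.
Qed.

Lemma differentiable_upto_cst n (c : R) : differentiable_upto n (fun=> c).
Proof.
elim: n c => // n IH c; exists (fun=> 0) => // t; exact: is_derive_cst.
Qed.

Lemma differentiable_uptoD n f g : differentiable_upto n f -> differentiable_upto n g ->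
  differentiable_upto n (fun t => f t + g t).
Proof.
elim: n f g => // n IH f g [f' df Hf] [g' dg Hg].
exists (fun t => f' t + g' t); last exact: IH.
by move=> t; have := df t; have := dg t => dgt dft; exact: is_deriveD.
Qed.

Lemma differentiable_uptoM n f g : differentiable_upto n f -> differentiable_upto n g ->
  differentiable_upto n (fun t => f t * g t).
Proof.
elim: n f g => // n IH f g Hf Hg.
have [f' df Hf'] := Hf; have [g' dg Hg'] := Hg.
exists (fun t => f t * g' t + g t * f' t).
  by move=> t; have := df t; have := dg t => dgt dft; exact: is_deriveM.
by apply: differentiable_uptoD; apply: IH => //; exact: differentiable_uptoW.
Qed.

Lemma differentiable_upto_opp n f : differentiable_upto n f ->
  differentiable_upto n (fun t => - f t).
Proof.
move=> H; rewrite (_ : (fun t => - f t) = (fun t => -1 * f t)).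
  by apply: differentiable_uptoM => //; exact: differentiable_upto_cst.
by apply/funext => t; rewrite mulN1r.
Qed.

Lemma differentiable_uptoV n f : (forall t, f t != 0) -> differentiable_upto n f ->
  differentiable_upto n (fun t => (f t)^-1).
Proof.
move=> f0; elim: n => // n IH Hf; have [f' df Hf'] := Hf.
have IHf := IH (differentiable_uptoW Hf).
exists (fun t => - (((f t)^-1 * (f t)^-1) * f' t)).
  move=> t; have dft := df t; apply: (is_derive_val (@is_deriveV R _ t _ (1 : R) (f0 t) dft)).
  by rewrite /GRing.scale /= expr2 invfM mulNr.
apply: differentiable_upto_opp; apply: differentiable_uptoM => //.
exact: differentiable_uptoM.
Qed.

Lemma is_derive_affine f (a b t d : R) : is_derive (a * t + b) (1 : R) f d ->
  is_derive t (1 : R) (fun s => f (a * s + b)) (a * d).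
Proof.
move=> df; have da : is_derive t (1 : R) (fun s : R => a * s + b) a.
  by apply: is_derive_eq; rewrite /GRing.scale /=; ring.
have -> : (fun s => f (a * s + b)) = f \o (fun s => a * s + b) by [].
by apply: (is_derive_val (@is_derive1_comp R f (fun s => a * s + b) t d a df da)); rewrite mulrC.
Qed.

Lemma differentiable_upto_affine n f (a b : R) : differentiable_upto n f ->
  differentiable_upto n (fun t => f (a * t + b)).
Proof.
elim: n f => // n IH f [f' df Hf].
exists (fun t => a * f' (a * t + b)); first by move=> t; exact: is_derive_affine.
by apply: differentiable_uptoM; [exact: differentiable_upto_cst|exact: IH].
Qed.

Lemma expR_ge_pow (n : nat) (y : R) : 0 <= y -> (y / n.+1%:R) ^+ n.+1 <= expR y.
Proof.
move=> y0; have n0 : 0 < n.+1%:R :> R by [].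
have -> : expR y = expR (y / n.+1%:R) ^+ n.+1.
  by rewrite -expRM_natl mulrC divfK // gt_eqF.
rewrite ler_pXn2r // ?nnegrE ?expR_ge0 ?divr_ge0 //.
by apply: le_trans (expR_ge1Dx _); rewrite lerDr.
Qed.

(** The functions t^(-m) exp(- 1 / t) for t > 0, extended by 0. The derivative of one is a
    combination of two others, so the whole family is smooth by one induction. *)
Definition flat (m : nat) t : R := if 0 < t then t^-1 ^+ m * expR (- t^-1) else 0.

(** The exponential beats the power m + 2; the quadratic bound gives derivative 0 at the origin. *)
Lemma flat_le (m : nat) t : 0 < t -> flat m t <= m.+2%:R ^+ m.+2 * t ^+ 2.
Proof.
move=> t0; rewrite /flat t0; have v0 : 0 < t^-1 by rewrite invr_gt0.
rewrite -[X in _ * X ^+ 2]invrK; move: (t^-1) v0 => v v0.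
rewrite expRN ler_pdivrMr ?expR_gt0 //.
have := expR_ge_pow m.+1 (ltW v0); rewrite expr_div_n ler_pdivrMr ?exprn_gt0 // => h.
rewrite exprVn mulrAC ler_pdivlMr ?exprn_gt0 // -exprD addn2.
by rewrite (mulrC _ (expR v)).
Qed.

Lemma is_derive_flat (m : nat) t : is_derive t (1 : R) (flat m) (flat m.+2 t - m%:R * flat m.+1 t).
Proof.
have [t0|t0|t0e] := ltgtP 0 t; last first.
- rewrite -t0e /flat ltxx mulr0 subrr; apply: is_derive_eps => e e0.
  pose C : R := m.+2%:R ^+ m.+2 + 1; have C0 : 0 < C by rewrite ltr_wpDl // exprn_ge0.
  exists (e / C); first by rewrite divr_gt0.
  move=> s; rewrite ltr_pdivlMr // => sC; rewrite add0r ltxx subr0 mul0r subr0.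
  case: ifPn => [s0|_]; last by rewrite normr0 mulr_ge0 // ltW.
  have f0 : 0 <= s^-1 ^+ m * expR (- s^-1) by rewrite mulr_ge0 ?expR_ge0 // exprn_ge0 // invr_ge0 ltW.
  have := flat_le m s0; rewrite /flat s0 => h; rewrite ger0_norm //; apply: le_trans h _.
  rewrite gtr0_norm // in sC *; rewrite expr2 mulrA ler_pM2r //.
  by move: sC; rewrite /C; lra.
- have near0 : \forall s \near t, (cst 0 : R -> R) s = flat m s.
    near=> s; rewrite /flat ifN // -leNgt ltW //; near: s.
    by exact: (cvgr_lt t (@cvg_id _ _)).
  rewrite /flat !ifN; try by rewrite -leNgt ltW.
  rewrite mulr0 subrr; apply: near_eq_is_derive near0 _; exact: is_derive_cst.
have near1 : \forall s \near t, s^-1 ^+ m * expR (- s^-1) = flat m s.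
  near=> s; rewrite /flat ifT //; near: s; exact: (cvgr_gt t (@cvg_id _ _)).
rewrite /flat t0.
apply: (near_eq_is_derive near1).
have tn0 : t != 0 by rewrite gt_eqF.
have d0 : is_derive t (1 : R) (id : R -> R) 1 by exact: is_derive_id.
have d1 : is_derive t (1 : R) (fun s : R => s^-1) (- t^-1 ^+ 2).
  apply: (is_derive_val (@is_deriveV R _ t _ (1 : R) tn0 d0)).
  by rewrite /GRing.scale /= mulr1 exprVn.
have d2 : is_derive t (1 : R) (fun s : R => expR (- s^-1)) (t^-1 ^+ 2 * expR (- t^-1)).
  have dN : is_derive t (1 : R) (fun s : R => - s^-1) (t^-1 ^+ 2).
    by apply: (is_derive_val (is_deriveN d1)); rewrite opprK.
  by apply: (is_derive_val (@is_derive1_comp R expR (fun s : R => - s^-1) t _ _ (is_derive_expR _) dN)); rewrite mulrC.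
have d3 : is_derive t (1 : R) (fun s : R => s^-1 ^+ m) (- (m%:R * t^-1 ^+ m.+1)).
  rewrite (_ : (fun s => _) = (fun s : R => s^-1) ^+ m); last by rewrite exprfctE.
  apply: (is_derive_val (@is_deriveX R R (fun s : R => s^-1) m t (1 : R) _ d1)).
  rewrite [LHS](_ : _ = (m%:R * t^-1 ^+ m.-1) * - t^-1 ^+ 2) //.
  by case: m {near1} => [|k] /=; rewrite ?exprS; ring.
apply: (is_derive_val (is_deriveM d3 d2)); rewrite /GRing.scale /=.
by rewrite !exprS; ring.
Unshelve. all: by end_near. Qed.

Lemma differentiable_upto_flat n m : differentiable_upto n (flat m).
Proof.
elim: n m => // n IH m; exists (fun t => flat m.+2 t - m%:R * flat m.+1 t).
  exact: is_derive_flat.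
apply: differentiable_uptoD => //; apply: differentiable_upto_opp.
by apply: differentiable_uptoM => //; exact: differentiable_upto_cst.
Qed.

Definition step01 t := flat 0 t / (flat 0 t + flat 0 (1 - t)).

Lemma flat0_ge0 t : 0 <= flat 0 t.
Proof. by rewrite /flat; case: ifP => // _; rewrite expr0 mul1r expR_ge0. Qed.

Lemma flat0_gt0 t : 0 < t -> 0 < flat 0 t.
Proof. by rewrite /flat => ->; rewrite expr0 mul1r expR_gt0. Qed.

Lemma flat0_eq0 t : t <= 0 -> flat 0 t = 0.
Proof. by rewrite /flat => t0; rewrite ifN // -leNgt. Qed.

Lemma step01_den t : 0 < flat 0 t + flat 0 (1 - t).
Proof.
have [t0|t0] := leP t 0; last by rewrite ltr_pwDl ?flat0_gt0 ?flat0_ge0.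
by rewrite ltr_wpDl ?flat0_ge0 // flat0_gt0 //; lra.
Qed.

Lemma step01_le0 t : t <= 0 -> step01 t = 0.
Proof. by move=> t0; rewrite /step01 flat0_eq0 // mul0r. Qed.

Lemma step01_ge1 t : 1 <= t -> step01 t = 1.
Proof.
move=> t1; have := step01_den t; rewrite /step01 (@flat0_eq0 (1 - t)) ?subr_le0 // addr0 => f0.
by rewrite divff // gt_eqF.
Qed.

Lemma step01_ge0 t : 0 <= step01 t.
Proof. by rewrite divr_ge0 ?flat0_ge0 // ltW ?step01_den. Qed.

Lemma step01_le1 t : step01 t <= 1.
Proof. by rewrite ler_pdivrMr ?step01_den // mul1r lerDl flat0_ge0. Qed.

Lemma differentiable_upto_step01 n : differentiable_upto n step01.
Proof.
apply: differentiable_uptoM; first exact: differentiable_upto_flat.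
apply: differentiable_uptoV; first by move=> t; rewrite gt_eqF ?step01_den.
apply: differentiable_uptoD; first exact: differentiable_upto_flat.
rewrite (_ : (fun t => _) = (fun t => flat 0 (-1 * t + 1))).
  exact/differentiable_upto_affine/differentiable_upto_flat.
by apply/funext => t; congr flat; ring.
Qed.

(** As a difference of two consecutive steps, its integer translates telescope to a partition of
    unity; it vanishes off (0, 2). *)
Definition bump t := step01 t - step01 (t - 1).

Lemma bump_ge0 t : 0 <= bump t.
Proof.
rewrite /bump; have [t1|t1] := leP t 1; first by rewrite (@step01_le0 (t - 1)) ?subr0 ?step01_ge0 // subr_le0.
by rewrite step01_ge1 ?subr_ge0 ?step01_le1 // ltW.
Qed.

Lemma bump_out t : ~ (0 < t < 2) -> bump t = 0.
Proof.
move=> H; rewrite /bump; have [t0|t0] := leP t 0.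
  by rewrite !step01_le0 ?subrr //; lra.
have [t2|t2] := leP 2 t; last by case: H; rewrite t0 t2.
by rewrite !step01_ge1 ?subrr //; lra.
Qed.

Definition smooth1 f := forall n, differentiable_upto n f.

Lemma smooth1_bump : smooth1 bump.
Proof.
move=> n; apply: differentiable_uptoD; first exact: differentiable_upto_step01.
apply: differentiable_upto_opp.
rewrite (_ : (fun t => _) = (fun t => step01 (1 * t + -1))).
  exact/differentiable_upto_affine/differentiable_upto_step01.
by apply/funext => t; rewrite mul1r.
Qed.

Lemma smooth1_affine f (a b : R) : smooth1 f -> smooth1 (fun t => f (a * t + b)).
Proof. by move=> Hf n; exact: differentiable_upto_affine. Qed.

Lemma smooth1_is_derive f t : smooth1 f -> is_derive t (1 : R) f (derive1 f t).
Proof. by move=> /(_ 1) [f' df _]; have [? d] := df t; rewrite derive1E. Qed.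

Lemma smooth1_derive f : smooth1 f -> smooth1 (derive1 f).
Proof.
move=> Hf n; have [f' df Hf'] := Hf n.+1.
rewrite (_ : derive1 f = f') //; apply/funext => t; rewrite derive1E.
by have [_ ->] := df t.
Qed.

Lemma smooth1_continuous f : smooth1 f -> continuous f.
Proof.
by move=> Hf t; apply: differentiable_continuous; apply/derivable1_diffP; have [] := smooth1_is_derive t Hf.
Qed.

Lemma derive1_affine f (a b : R) : smooth1 f ->
  derive1 (fun t => f (a * t + b)) = (fun t => a * derive1 f (a * t + b)).
Proof.
move=> Hf; apply/funext => t; rewrite derive1E.
by have [_ ->] := is_derive_affine (smooth1_is_derive (a * t + b) Hf).
Qed.

Lemma derive1_scale (c : R) f : smooth1 f -> derive1 (fun t => c * f t) = (fun t => c * derive1 f t).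
Proof.
move=> Hf; apply/funext => t; rewrite derive1E.
by have [_ ->] := is_deriveZ c (smooth1_is_derive t Hf).
Qed.

Lemma sum_bump (n : nat) t : \sum_(i < n + n) bump (t - (i%:R - n%:R)) = step01 (t + n%:R) - step01 (t - n%:R).
Proof.
have H (m : nat) : \sum_(i < m) bump (t - (i%:R - n%:R)) = step01 (t + n%:R) - step01 (t - (m%:R - n%:R)).
  elim: m => [|m IH]; first by rewrite big_ord0 sub0r opprK subrr.
  rewrite big_ord_recr /= IH /bump -(@natr1 R m).
  rewrite (_ : t - (m%:R + 1 - n%:R) = t - (m%:R - n%:R) - 1); last by ring.
  by ring.
by rewrite H natrD addrK.
Qed.

Lemma bounded_compact_support f (a b : R) : continuous f -> (forall t, ~ (a <= t <= b) -> f t = 0) ->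
  exists2 C, 0 < C & forall t, `|f t| <= C.
Proof.
move=> cf H; have [ba|ab] := ltP b a.
  exists 1 => // t; rewrite H ?normr0 //; lra.
have cN : {within `[a, b], continuous (fun t => `|f t|)}.
  apply: continuous_subspaceT => t; apply: continuous_comp; [exact: cf|exact: norm_continuous].
have [c _ Hc] := EVT_max ab cN.
exists (`|f c| + 1) => [|t]; first by rewrite ltr_wpDl.
have [tab|tab] := pselect (a <= t <= b); last by rewrite H // normr0 addr_ge0.
by apply: le_trans (Hc t _) _; rewrite ?in_itv //= lerDl.
Qed.

End smooth_step.

(** * Test functions in product form and their moments *)

Section test_functions.
Context {R : realType}.
Local Notation E := (R * R)%type.
Implicit Types (F G H : R -> R) (f g : E -> R) (t : R).

Definition cc (V : normedModType R) (f : V -> R) :=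
  continuous f /\ exists M : R, forall x, M < `|x| -> f x = 0.

Lemma ccM (V : normedModType R) (f g : V -> R) : continuous f -> cc g -> cc (fun x => f x * g x).
Proof.
move=> cf [cg [M HM]]; split; first by move=> x; apply: continuousM; [exact: cf|exact: cg].
by exists M => x /HM ->; rewrite mulr0.
Qed.

Lemma ccD (V : normedModType R) (f g : V -> R) : cc f -> cc g -> cc (fun x => f x + g x).
Proof.
move=> [cf [M HM]] [cg [N HN]]; split; first by move=> x; apply: continuousD; [exact: cf|exact: cg].
by exists (Num.max M N) => x; rewrite gt_max => /andP[/HM -> /HN ->]; rewrite addr0.
Qed.

Lemma cc_derive1 H : smooth1 H -> cc H -> cc (derive1 H).
Proof.
move=> sH [_ [M HM]]; split; first exact/smooth1_continuous/smooth1_derive.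
exists M => t tM; rewrite derive1E; apply: derive_val.
have : \forall s \near t, (cst 0 : R -> R) s = H s.
  near=> s; rewrite HM //; near: s.
  have := @cvgr_gt R R (nbhs t) _ (fun s : R => `|s|) `|t| (@norm_continuous _ _ t) M tM; exact.
move=> /near_eq_is_derive; apply; exact: is_derive_cst.
Unshelve. all: by end_near. Qed.

Definition tens F G : E -> R := fun x => F x.1 * G x.2.

Lemma tens_continuous F G : continuous F -> continuous G -> continuous (tens F G).
Proof.
move=> cF cG x; apply: continuousM.
  by apply: continuous_comp; [exact: fst_continuous|exact: cF].
by apply: continuous_comp; [exact: snd_continuous|exact: cG].
Qed.

Lemma cc_tens F G : cc F -> cc G -> cc (tens F G).
Proof.
move=> [cF [M HM]] [cG [N HN]]; split; first exact: tens_continuous.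
exists (Num.max M N) => x; rewrite /tens prod_normE => H.
have [h|h] := ltP M `|x.1|; first by rewrite HM ?mul0r.
have [k|k] := ltP N `|x.2|; first by rewrite HN ?mulr0.
move: H; rewrite gt_max !lt_max => /andP[/orP[|] + /orP[|]]; lra.
Qed.

Lemma tens_derive1 F G (x : E) : smooth1 F -> derivable (tens F G) x (e_ false) /\
  'D_(e_ false) (tens F G) x = tens (derive1 F) G x.
Proof.
move=> sF; have [d v] := is_deriveM (smooth1_is_derive x.1 sF) (is_derive_cst (G x.2) x.1 (1 : R)).
have E0 : (fun h : R => h^-1 *: ((tens F G \o shift x) (h *: e_ false) - tens F G x)) =
   (fun h : R => h^-1 *: (((F * cst (G x.2)) \o shift x.1) (h *: (1 : R)) - (F * cst (G x.2)) x.1)).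
  apply/funext => h.
  change (h^-1 * (F (h * 1 + x.1) * G (h * 0 + x.2) - F x.1 * G x.2) =
          h^-1 * (F (h * 1 + x.1) * G x.2 - F x.1 * G x.2)).
  by rewrite mulr0 add0r.
split; first by rewrite /derivable E0.
by rewrite /derive E0 -[LHS]/('D_1 (F * cst (G x.2)) x.1) v /GRing.scale /= /tens; ring.
Qed.

Lemma tens_derive2 F G (x : E) : smooth1 G -> derivable (tens F G) x (e_ true) /\
  'D_(e_ true) (tens F G) x = tens F (derive1 G) x.
Proof.
move=> sG; have [d v] := is_deriveM (smooth1_is_derive x.2 sG) (is_derive_cst (F x.1) x.2 (1 : R)).
have E0 : (fun h : R => h^-1 *: ((tens F G \o shift x) (h *: e_ true) - tens F G x)) =
   (fun h : R => h^-1 *: (((G * cst (F x.1)) \o shift x.2) (h *: (1 : R)) - (G * cst (F x.1)) x.2)).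
  apply/funext => h.
  change (h^-1 * (F (h * 0 + x.1) * G (h * 1 + x.2) - F x.1 * G x.2) =
          h^-1 * (G (h * 1 + x.2) * F x.1 - G x.2 * F x.1)).
  by rewrite mulr0 add0r; congr (_ * _); ring.
split; first by rewrite /derivable E0.
by rewrite /derive E0 -[LHS]/('D_1 (G * cst (F x.1)) x.2) v /GRing.scale /= /tens; ring.
Qed.

Definition der (b : bool) F := if b then derive1 F else F.

Lemma smooth1_der b F : smooth1 F -> smooth1 (der b F).
Proof. by case: b => //; exact: smooth1_derive. Qed.

Lemma cc_der b F : smooth1 F -> cc F -> cc (der b F).
Proof. by case: b => //; exact: cc_derive1. Qed.

Lemma tens_derive b F G : smooth1 F -> smooth1 G ->
  (fun x => 'D_(e_ b) (tens F G) x) = tens (der (~~ b) F) (der b G).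
Proof.
by move=> sF sG; apply/funext => x; case: b; [case: (tens_derive2 F x sG)|case: (tens_derive1 G x sF)].
Qed.

Lemma tens_dpart2 i j F G : smooth1 F -> smooth1 G ->
  dpart [:: i; j] (tens F G) = tens (der (~~ i) (der (~~ j) F)) (der i (der j G)).
Proof.
move=> sF sG; rewrite -(tens_derive i (smooth1_der _ sF) (smooth1_der _ sG)).
by rewrite -(tens_derive j sF sG).
Qed.

Lemma smooth_tens F G : smooth1 F -> smooth1 G -> smooth (tens F G).
Proof.
move=> sF sG k s _.
have [F' [G' [sF' sG' ->]]] : exists F' G', [/\ smooth1 F', smooth1 G' & dpart s (tens F G) = tens F' G'].
  elim: s => [|b s [F' [G' [sF' sG' /= ->]]]]; first by exists F, G.
  exists (der (~~ b) F'), (der b G'); split; [exact: smooth1_der|exact: smooth1_der|exact: tens_derive].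
split=> [|_ b x]; first by apply: tens_continuous; exact: smooth1_continuous.
by case: b; [case: (tens_derive2 F' x sG')|case: (tens_derive1 G' x sF')].
Qed.

(** Reduced to [preim_measurable] by regarding [f] as a map into the plane with second coordinate
    0. *)
Lemma continuous_measurable2 f : continuous f -> measurable_fun setT f.
Proof.
move=> cf _ B mB.
have cY : forall x, setT x -> {for x, continuous (fun y : E => (f y, 0 : R))}.
  move=> x _; apply: (@cvg_pair _ _ _ (nbhs x) (nbhs (f x)) (nbhs (0 : R)) _ _ _ f (cst 0)).
    exact: cf.
  exact: cvg_cst.
have := preim_measurable openT cY (rect_measurable mB (@measurableT _ _)).
by congr (measurable _); apply/seteqP; split => x /=; [move=> [_ []]|move=> [_ Bx]].
Qed.

Lemma cc_integrable f : cc f -> (lam2 R).-integrable setT (EFin \o f).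
Proof.
move=> [cf [M HM]]; pose B : set E := cball 0 (2 * `|M|).
have fB : EFin \o f = (EFin \o f) \_ B.
  apply/funext => x; rewrite patchE; case: ifPn => // /negP xB /=; rewrite HM //.
  rewrite ltNge; apply/negP => h; apply: xB; rewrite inE /B /cball /= subr0.
  by apply: le_trans (enorm_le_norm _) _; rewrite ler_wpM2l // (le_trans h) // ler_norm.
have mB : measurable B by apply: closed_measurable2; exact: cball_closed.
rewrite fB; apply: (@integrable_mkcond _ _ R (lam2 R) B (EFin \o f) mB).1.
have B0 : 0 <= 2 * `|M| by rewrite mulr_ge0.
apply: measurable_bounded_integrable => //.
- apply: (le_lt_trans (@square_area R B 0 _ mB B0 _)) => //; first by rewrite ltry.
- exact: measurable_funS (continuous_measurable2 cf).
have BB : B !=set0 by exists 0; rewrite /B /cball /= subrr enorm0.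
have cn : {within B, continuous (fun x => `|f x|)}.
  by apply: continuous_subspaceT => x; apply: continuous_comp; [exact: cf|exact: norm_continuous].
have [c _ Hc] := compact_max2 BB (@cball_compact _ _ _) cn.
exists `|f c|; split; first exact: num_real.
by move=> r cr x /Hc h; apply: le_trans h _; exact: ltW.
Qed.

Lemma cc1_restrict F (M : R) : (forall t, M < `|t| -> F t = 0) -> F = F \_ `[- `|M|, `|M|].
Proof.
move=> HM; apply/funext => t; rewrite patchE; case: ifPn => // /negP tM; rewrite HM //.
rewrite ltNge; apply/negP => h; apply: tM; rewrite inE /= in_itv /=.
by rewrite -ler_norml (le_trans h) // ler_norm.
Qed.

Lemma cc1_integrable F : cc F -> (@lebesgue_measure R).-integrable setT (EFin \o F).
Proof.
move=> [cF [M HM]]; rewrite (cc1_restrict HM).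
have -> : EFin \o (F \_ `[- `|M|, `|M|]) = (EFin \o F) \_ `[- `|M|, `|M|].
  by apply/funext => t /=; rewrite !patchE; case: ifP.
apply: (@integrable_mkcond _ _ R lebesgue_measure _ (EFin \o F) (measurable_itv _)).1.
apply: continuous_compact_integrable; first exact: segment_compact.
exact: continuous_subspaceT.
Qed.

Definition int1 F : R := \int[@lebesgue_measure R]_t F t.
Definition int2 f : R := \int[lam2 R]_x f x.

Lemma int1_derive H : smooth1 H -> cc H -> int1 (derive1 H) = 0.
Proof.
move=> sH cH; have [cH' [M HM]] := cc_derive1 sH cH; have [_ [N HN]] := cH.
pose L := Num.max `|M| `|N| + 1.
have [ML NL] : `|M| < L /\ `|N| < L.
  by rewrite /L; split; rewrite ltr_pwDr // le_max lexx ?orbT.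
have L0 : 0 < L by apply: le_lt_trans ML.
have HL t : L - 1 < `|t| -> derive1 H t = 0.
  move=> h; apply: HM; apply: le_lt_trans h; rewrite /L addrK le_max; apply/orP; left; exact: ler_norm.
rewrite /int1 (cc1_restrict (_ : forall t, L < `|t| -> derive1 H t = 0)); last first.
  by move=> t h; apply: HL; apply: lt_trans h; lra.
rewrite -Rintegral_mkcond /Rintegral (ger0_norm (ltW L0)).
have HN' t : `|t| = L -> H t = 0.
  by move=> tL; apply: HN; rewrite tL; apply: le_lt_trans NL; exact: ler_norm.
rewrite (@continuous_FTC2 R (derive1 H) H (- L) L).
- by rewrite !HN' ?normrN ?gtr0_norm // subee.
- lra.
- exact: continuous_subspaceT.
- split => [t _||].
  + by case: (smooth1_is_derive t sH).
  + by apply: cvg_at_right_filter; exact: smooth1_continuous.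
  + by apply: cvg_at_left_filter; exact: smooth1_continuous.
- by move=> t _.
Qed.

Lemma int2_tens F G : cc F -> cc G -> int2 (tens F G) = int1 F * int1 G.
Proof.
move=> cF cG; rewrite /int2 /Rintegral -(integral12_prod_meas1 (cc_integrable (cc_tens cF cG))).
transitivity (fine (\int[@lebesgue_measure R]_t ((int1 G)%:E * (F t)%:E))%E).
  congr fine; apply: eq_integral => t _; rewrite /fubini_F /tens /=.
  under eq_integral do rewrite EFinM.
  rewrite integralZl //; last exact: cc1_integrable.
  rewrite muleC /int1 /Rintegral fineK //.
  by apply: integrable_fin_num => //; exact: cc1_integrable.
rewrite integralZl //; last exact: cc1_integrable.
by rewrite fineM ?integrable_fin_num //; [rewrite /= mulrC|exact: cc1_integrable].
Qed.

Definition moment (c : R) (a : nat) F : R -> R := fun t => (t - c) ^+ a * F t.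

Lemma smooth1_pow c (a : nat) : smooth1 (fun t => (t - c) ^+ a).
Proof.
move=> n; elim: a => [|a IH].
  by rewrite (_ : (fun t => _) = fun=> 1) //; exact: differentiable_upto_cst.
rewrite (_ : (fun t => _) = (fun t => (t - c) * (t - c) ^+ a)); last by apply/funext => t; rewrite exprS.
apply: differentiable_uptoM => //; case: n {IH} => // n; exists (fun=> 1).
  by move=> t; apply: is_derive_val (is_deriveB (is_derive_id _ _) (is_derive_cst _ _ _)) _; rewrite subr0.
exact: differentiable_upto_cst.
Qed.

Lemma cc_moment c a F : cc F -> cc (moment c a F).
Proof.
by move=> cF; apply: ccM => //; apply: smooth1_continuous; exact: smooth1_pow.
Qed.

Lemma int1Z (k : R) F : cc F -> int1 (fun t => k * F t) = k * int1 F.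
Proof. by move=> cF; apply: RintegralZl => //; exact: cc1_integrable. Qed.

Lemma int1D F G : cc F -> cc G -> int1 (fun t => F t + G t) = int1 F + int1 G.
Proof. by move=> cF cG; apply: RintegralD => //; exact: cc1_integrable. Qed.

Lemma int2Z (k : R) f : cc f -> int2 (fun x => k * f x) = k * int2 f.
Proof. by move=> cf; apply: RintegralZl => //; exact: cc_integrable. Qed.

Lemma int2D f g : cc f -> cc g -> int2 (fun x => f x + g x) = int2 f + int2 g.
Proof. by move=> cf cg; apply: RintegralD => //; exact: cc_integrable. Qed.

(** Integration by parts. For a = 0 the factor a%:R kills the meaningless lower moment. *)
Lemma moment_derive c (a : nat) F : smooth1 F -> cc F ->
  int1 (moment c a (derive1 F)) = - (a%:R * int1 (moment c a.-1 F)).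
Proof.
move=> sF cF; have cF' := cc_derive1 sF cF.
have sM : smooth1 (moment c a F) by move=> n; apply: differentiable_uptoM => //; exact: smooth1_pow.
have dM : derive1 (moment c a F) = (fun t => moment c a (derive1 F) t + a%:R * moment c a.-1 F t).
  apply/funext => t; rewrite derive1E.
  have dp : is_derive t (1 : R) (fun s : R => (s - c) ^+ a) (a%:R * (t - c) ^+ a.-1).
    rewrite (_ : (fun s => _) = (fun s : R => s - c) ^+ a); last by rewrite exprfctE.
    have d1 : is_derive t (1 : R) (fun s : R => s - c) 1.
      by apply: is_derive_val (is_deriveB (is_derive_id _ _) (is_derive_cst _ _ _)) _; rewrite subr0.
    apply: (is_derive_val (@is_deriveX R R (fun s : R => s - c) a t (1 : R) _ d1)).
    exact: mulr1.
  have [_ ->] := is_deriveM dp (smooth1_is_derive t sF).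
  by rewrite /GRing.scale /= /moment; ring.
have := int1_derive sM (cc_moment c a cF); rewrite dM int1D ?int1Z; [|exact: cc_moment..|].
  lra.
by apply: ccM; [exact: cst_continuous|exact: cc_moment].
Qed.

End test_functions.

(** * Pairing second derivatives of bumps with quadratic polynomials *)

Section bump_pairing.
Context {R : realType}.
Local Notation E := (R * R)%type.
Implicit Types (F G H : R -> R) (f g : E -> R) (t : R) (Q : R * R * R).

Lemma continuous_add f g : continuous f -> continuous g -> continuous (fun x => f x + g x).
Proof. by move=> cf cg x; apply: continuousD; [exact: cf|exact: cg]. Qed.

Lemma derive1_near0 F t : smooth1 F -> (\forall s \near t, F s = 0) -> derive1 F t = 0.
Proof.
move=> sF F0; rewrite derive1E; apply: derive_val.
have : \forall s \near t, (cst 0 : R -> R) s = F s by apply: filterS F0 => s ->.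
move=> /near_eq_is_derive; apply; exact: is_derive_cst.
Qed.

Lemma derive1_out F (a b : R) : smooth1 F -> (forall t, ~ (a <= t <= b) -> F t = 0) ->
  forall t, ~ (a <= t <= b) -> derive1 F t = 0.
Proof.
move=> sF H t tab; apply: derive1_near0 => //.
have [ta|ta] := ltP t a.
  near=> s; apply: H => /andP[sa _]; have : s < a by near: s; exact: (cvgr_lt t (@cvg_id _ _)).
  lra.
have bt : b < t by rewrite ltNge; apply/negP => tb; apply: tab; rewrite ta tb.
near=> s; apply: H => /andP[_ sb]; have : b < s by near: s; exact: (cvgr_gt t (@cvg_id _ _)).
lra.
Unshelve. all: by end_near. Qed.

Definition qij Q (i j : bool) : R :=
  if i then (if j then Q.2 else Q.1.2) else (if j then Q.1.2 else Q.1.1).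

Definition qpoly (u0 : R) (p x0 : E) Q : E -> R :=
  fun x => u0 + dot p (x - x0) + qf Q (x - x0) / 2.

Lemma qpoly_continuous u0 p x0 Q : continuous (qpoly u0 p x0 Q).
Proof.
have sm c (a : nat) : continuous (fun t : R => (t - c) ^+ a) by exact/smooth1_continuous/smooth1_pow.
have one : continuous (fun _ : R => 1 : R) by move=> ?; exact: cvg_cst.
pose T a b := tens (fun t => (t - x0.1) ^+ a) (fun t => (t - x0.2) ^+ b).
have cT a b : continuous (T a b) by apply: tens_continuous.
rewrite (_ : qpoly _ _ _ _ = (fun x => u0 + p.1 * T 1 0 x + p.2 * T 0 1 x
   + Q.1.1 / 2 * T 2 0 x + Q.1.2 * T 1 1 x + Q.2 / 2 * T 0 2 x)).
  have cZ (k : R) a b : continuous (fun y => k * T a b y).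
    by move=> x; apply: continuousM; [exact: cvg_cst|exact: cT].
  do 5 (apply: continuous_add; last exact: cZ); move=> x; exact: cvg_cst.
apply/funext => x; rewrite /qpoly /qf /dot /T /tens !vE !expr0 !expr1 !expr2 /=.
by field.
Qed.

Lemma int2_qpoly u0 p x0 Q F G : cc F -> cc G ->
  let m a := int1 (moment x0.1 a F) in let n b := int1 (moment x0.2 b G) in
  int2 (fun x => qpoly u0 p x0 Q x * tens F G x) =
  u0 * (m 0 * n 0) + p.1 * (m 1 * n 0) + p.2 * (m 0 * n 1)
   + Q.1.1 / 2 * (m 2 * n 0) + Q.1.2 * (m 1 * n 1) + Q.2 / 2 * (m 0 * n 2).
Proof.
move=> cF cG m n; pose T a b := tens (moment x0.1 a F) (moment x0.2 b G).
have cT a b : cc (T a b) by apply: cc_tens; exact: cc_moment.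
have cZ (k : R) a b : cc (fun y => k * T a b y) by apply: ccM => //; move=> ?; exact: cvg_cst.
rewrite (_ : (fun x => _) = (fun x => u0 * T 0 0 x + p.1 * T 1 0 x + p.2 * T 0 1 x
   + Q.1.1 / 2 * T 2 0 x + Q.1.2 * T 1 1 x + Q.2 / 2 * T 0 2 x)).
  rewrite !int2D ?int2Z ?int2_tens //; do ?apply: cc_moment => //; by do ?apply: ccD.
apply/funext => x; rewrite /qpoly /qf /dot /T /tens /moment !vE !expr0 !expr1 !expr2 /=.
by field.
Qed.

Lemma moment0 c F : moment c 0 F = F.
Proof. by apply/funext => t; rewrite /moment expr0 mul1r. Qed.

(** Two integrations by parts: the second derivative of a quadratic polynomial is the constant entry
    of [Q]. On moments, every lower-order coefficient drops out. *)
Lemma int2_dpart2 u0 p x0 Q F G i j : smooth1 F -> cc F -> smooth1 G -> cc G ->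
  int2 (fun x => qpoly u0 p x0 Q x * dpart [:: i; j] (tens F G) x) = qij Q i j * int2 (tens F G).
Proof.
move=> sF cF sG cG; rewrite tens_dpart2 // int2_qpoly ?int2_tens //; try by do ?apply: cc_der => //; exact: smooth1_der.
have sF' := smooth1_derive sF; have cF' := cc_derive1 sF cF.
have sG' := smooth1_derive sG; have cG' := cc_derive1 sG cG.
case: i; case: j; rewrite /der /= ?(moment_derive, moment0) //= ?moment0; by field.
Qed.

Lemma int2_bound g (c a : R) (B : set E) : cc g -> measurable B -> (lamE B <= a%:E)%E -> 0 <= c ->
  (forall x, B x -> `|g x| <= c) -> (forall x, ~ B x -> g x = 0) -> `|int2 g| <= c * a.
Proof.
move=> cg mB Ba c0 H H0.
have Bfin : (lam2 R B < +oo)%E by apply: le_lt_trans Ba _; rewrite ltry.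
have gB : g = g \_ B.
  by apply/funext => x; rewrite patchE; case: ifPn => // /negP xB; apply: H0 => Bx; apply: xB; rewrite inE.
have ig : (lam2 R).-integrable B (EFin \o g).
  by apply: integrableS (cc_integrable cg) => //.
have -> : int2 g = \int[lam2 R]_(x in B) g x by rewrite [RHS]Rintegral_mkcond -gB.
apply: le_trans (@le_normr_Rintegral _ _ R (lam2 R) B g mB ig) _.
apply: (@le_trans _ _ (\int[lam2 R]_(x in B) c)).
  apply: le_Rintegral => //.
    by have := integrable_norm ig.
  apply: measurable_bounded_integrable => //.
  by exists c; split; [exact: num_real|move=> r cr x _ /=; rewrite ger0_norm // ltW].
rewrite Rintegral_cst // ler_wpM2l // -lee_fin fineK //.
by rewrite ge0_fin_numE.
Qed.

Lemma integral_supported (Om : set E) f g : cc f -> measurable Om -> (forall x, Om x -> f x = g x) ->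
  (forall x, ~ Om x -> f x = 0) -> (\int[lam2 R]_(x in Om) (g x)%:E = (int2 f)%:E)%E.
Proof.
move=> cf mO fg f0; rewrite /int2 /Rintegral fineK; last by apply: integrable_fin_num => //; exact: cc_integrable.
rewrite [LHS]integral_mkcond; congr integral; apply/funext => x /=; rewrite /patch.
case: ifPn => [/set_mem/fg ->//|/negP xO].
by rewrite f0 // => Ox; apply: xO; rewrite inE.
Qed.

(** Supported in the square of side 2 s with lower left corner (k s, l s). *)
Definition bump2 (s k l : R) := tens (fun t => bump (s^-1 * t + - k)) (fun t => bump (s^-1 * t + - l)).

Lemma cc_bump1 (s k : R) : 0 < s -> cc (fun t : R => bump (s^-1 * t + - k)).
Proof.
move=> s0; split; first exact/smooth1_continuous/smooth1_affine/smooth1_bump.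
exists (s * (`|k| + 2)) => t tM; apply: bump_out => /andP[t1 t2].
have : `|s^-1 * t| < `|k| + 2.
  have := ler_norm k; have := ler_norm (- k); rewrite normrN => ? ?.
  by rewrite ltr_norml; apply/andP; split; lra.
by rewrite normrM gtr0_norm ?invr_gt0 // mulrC ltr_pdivrMr // mulrC; lra.
Qed.

Lemma smooth1_bump1 (s k : R) : smooth1 (fun t : R => bump (s^-1 * t + - k)).
Proof. exact/smooth1_affine/smooth1_bump. Qed.

Lemma cc_bump2 (s k l : R) : 0 < s -> cc (bump2 s k l).
Proof. by move=> s0; apply: cc_tens; exact: cc_bump1. Qed.

Lemma smooth_bump2 (s k l : R) : smooth (bump2 s k l).
Proof. by apply: smooth_tens; exact: smooth1_bump1. Qed.

Lemma bump2_ge0 (s k l : R) x : 0 <= bump2 s k l x.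
Proof. by rewrite /bump2 /tens mulr_ge0 ?bump_ge0. Qed.

Definition bump_center (s k l : R) : E := ((k + 1) * s, (l + 1) * s).

Lemma bump_center_close (s k l : R) x : 0 < s ->
  0 <= s^-1 * x.1 + - k <= 2 -> 0 <= s^-1 * x.2 + - l <= 2 -> enorm (x - bump_center s k l) <= 2 * s.
Proof.
move=> s0; have sE t : s^-1 * t = t / s by rewrite mulrC.
rewrite !sE !subr_ge0 !lerBlDr !ler_pdivlMr // !ler_pdivrMr // => /andP[a1 a2] /andP[b1 b2].
apply: le_trans (enorm_le_l1 _) _; rewrite /bump_center !vE /=.
have : `|x.1 - (k + 1) * s| <= s by rewrite ler_norml; apply/andP; split; lra.
have : `|x.2 - (l + 1) * s| <= s by rewrite ler_norml; apply/andP; split; lra.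
lra.
Qed.

Lemma bump2_neq0 (s k l : R) x : 0 < s -> bump2 s k l x != 0 -> enorm (x - bump_center s k l) <= 2 * s.
Proof.
move=> s0 b0; apply: bump_center_close => //.
  by apply: contrapT => h; move/eqP: b0; apply; rewrite /bump2 /tens bump_out ?mul0r //; lra.
by apply: contrapT => h; move/eqP: b0; apply; rewrite /bump2 /tens [bump (_ * x.2 + _)]bump_out ?mulr0 //; lra.
Qed.

Definition dbump b0 b1 : R -> R := der b0 (der b1 bump).

Lemma dbump_scaled (s k : R) b0 b1 t : der b0 (der b1 (fun t => bump (s^-1 * t + - k))) t =
  s^-1 ^+ (b0 + b1) * dbump b0 b1 (s^-1 * t + - k).
Proof.
have sb := @smooth1_bump R; have sb' := smooth1_derive sb.
have e1 := derive1_affine s^-1 (- k) sb.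
have e2 : derive1 (derive1 (fun t : R => bump (s^-1 * t + - k))) =
    (fun t => s^-1 * (s^-1 * derive1 (derive1 bump) (s^-1 * t + - k))).
  rewrite e1; transitivity (fun t => s^-1 * derive1 (fun t => derive1 bump (s^-1 * t + - k)) t).
    exact: (derive1_scale s^-1 (smooth1_affine s^-1 (- k) sb')).
  by have -> := derive1_affine s^-1 (- k) sb'.
case: b0; case: b1; rewrite /dbump /der.
- by rewrite expr2 -mulrA; exact: (congr1 (@^~ t) e2).
- by rewrite expr1; exact: (congr1 (@^~ t) e1).
- by rewrite expr1; exact: (congr1 (@^~ t) e1).
- by rewrite expr0 mul1r.
Qed.

Lemma dbump_out b0 b1 t : ~ (0 <= t <= 2) -> dbump b0 b1 t = 0.
Proof.
have sb := @smooth1_bump R; have sb' := smooth1_derive sb.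
have h0 : forall t : R, ~ (0 <= t <= 2) -> bump t = 0 by move=> r h; apply: bump_out; lra.
have h1 := derive1_out sb h0.
by case: b0; case: b1; rewrite /dbump /der //; [exact: derive1_out|exact: h1|exact: h1|exact: h0].
Qed.

Lemma dbump_bounded : exists2 C, 0 < C & forall b0 b1 t, `|dbump b0 b1 t| <= C.
Proof.
have sb := @smooth1_bump R.
have H b0 b1 : exists2 C, 0 < C & forall t, `|dbump b0 b1 t| <= C.
  apply: (@bounded_compact_support _ _ 0 2); last exact: dbump_out.
  by apply: smooth1_continuous; apply: smooth1_der; exact: smooth1_der.
have [A A0 HA] := H false false; have [B B0 HB] := H false true.
have [C C0 HC] := H true false; have [D D0 HD] := H true true.
exists (A + B + C + D) => [|b0 b1 t]; first lra.
by have := HA t; have := HB t; have := HC t; have := HD t; case: b0; case: b1; (clear -A0 B0 C0 D0; lra).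
Qed.

Lemma dpart_bump2 (s k l : R) i j x : dpart [:: i; j] (bump2 s k l) x =
  s^-1 ^+ 2 * (dbump (~~ i) (~~ j) (s^-1 * x.1 + - k) * dbump i j (s^-1 * x.2 + - l)).
Proof.
rewrite /bump2 tens_dpart2; [|exact: smooth1_bump1..]; rewrite /tens !dbump_scaled.
have -> : s^-1 ^+ 2 = s^-1 ^+ (~~ i + ~~ j) * s^-1 ^+ (i + j) by rewrite -exprD; case: i; case: j.
by ring.
Qed.

Lemma dpart_bump2_out (s k l : R) i j x : 0 < s -> ~ cball (bump_center s k l) (2 * s) x ->
  dpart [:: i; j] (bump2 s k l) x = 0.
Proof.
move=> s0 xz; rewrite dpart_bump2.
have [h|h] := pselect (0 <= s^-1 * x.1 + - k <= 2); last by rewrite dbump_out // mul0r mulr0.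
have [h'|h'] := pselect (0 <= s^-1 * x.2 + - l <= 2); last by rewrite [dbump i j _]dbump_out // !mulr0.
by exfalso; apply: xz; exact: bump_center_close.
Qed.

Lemma cc_dpart_bump2 (s k l : R) i j : 0 < s -> cc (dpart [:: i; j] (bump2 s k l)).
Proof.
move=> s0; have sF := smooth1_bump1 s k; have sG := smooth1_bump1 s l.
have cF := cc_bump1 k s0; have cG := cc_bump1 l s0.
by rewrite /bump2 tens_dpart2 //; apply: cc_tens; do ?apply: cc_der => //; exact: smooth1_der.
Qed.

Lemma cc_sum (I : eqType) (l : seq I) (f : I -> E -> R) : (forall a, cc (f a)) ->
  cc (fun x => \sum_(a <- l) f a x).
Proof.
move=> cf; elim: l => [|a l IH].
  rewrite (_ : (fun x => _) = fun=> 0); last by apply/funext => x; rewrite big_nil.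
  by split; [move=> ?; exact: cvg_cst|exists 0].
rewrite (_ : (fun x => _) = fun x => f a x + \sum_(b <- l) f b x); last by apply/funext => x; rewrite big_cons.
exact: ccD.
Qed.

Lemma int2_sum (I : eqType) (l : seq I) (f : I -> E -> R) : (forall a, cc (f a)) ->
  int2 (fun x => \sum_(a <- l) f a x) = \sum_(a <- l) int2 (f a).
Proof.
move=> cf; elim: l => [|a l IH].
  rewrite big_nil /int2 -[RHS](mul0r (fine (lam2 R setT))) -Rintegral_cst //.
  by congr Rintegral; apply/funext => x; rewrite big_nil.
rewrite big_cons -IH -int2D //; last exact: cc_sum.
by congr int2; apply/funext => x; rewrite big_cons.
Qed.

(* By parts, D_ij of a bump pairs with a quadratic polynomial to Q_ij times the
   integral of the bump; the error d s^2 meets |D_ij| <= C s^-2 on an area O(s^2). *)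
Lemma bump_pairing : exists2 M : R, 0 < M &
  forall (s k l : R) (U : E -> R) u0 p x0 Q (d : R) i j, 0 < s -> 0 <= d -> continuous U ->
  (forall y, enorm (y - bump_center s k l) <= 2 * s -> `|U y - qpoly u0 p x0 Q y| <= d * s ^+ 2) ->
  `|int2 (fun x => U x * dpart [:: i; j] (bump2 s k l) x) - qij Q i j * int2 (bump2 s k l)| <= M * d * s ^+ 2.
Proof.
(* 16 s^2 bounds the area of the disc of radius 2 s, and C^2 s^-2 the second derivative of the
   bump. *)
have [C C0 HC] := dbump_bounded; exists (16 * C ^+ 2); first by rewrite mulr_gt0 // exprn_gt0.
move=> s k l U u0 p x0 Q d i j s0 d0 cU H; pose z := bump_center s k l.
have sF := smooth1_bump1 s k; have sG := smooth1_bump1 s l.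
have cF := cc_bump1 k s0; have cG := cc_bump1 l s0.
have DE := dpart_bump2 s k l i j.
have cD := @cc_dpart_bump2 s k l i j s0.
have Dout x := @dpart_bump2_out s k l i j x s0.
have Dle x : `|dpart [:: i; j] (bump2 s k l) x| <= s^-1 ^+ 2 * C ^+ 2.
  have h0 : 0 <= s^-1 ^+ 2 by rewrite exprn_ge0 // invr_ge0 ltW.
  by rewrite DE normrM (ger0_norm h0) ler_wpM2l // normrM expr2 ler_pM.
have cq := @qpoly_continuous u0 p x0 Q.
have c1 : cc (fun x => U x * dpart [:: i; j] (bump2 s k l) x) by exact: ccM.
have c2 : cc (fun x => -1 * (qpoly u0 p x0 Q x * dpart [:: i; j] (bump2 s k l) x)).
  by apply: ccM; [move=> ?; exact: cvg_cst|exact: ccM].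
rewrite -(int2_dpart2 u0 p x0 Q i j sF cF sG cG) -[X in _ - X]mul1r -mulNr -int2Z; last exact: ccM.
rewrite -int2D //.
have mB : measurable (cball z (2 * s)) by apply: closed_measurable2; exact: cball_closed.
have s20 : 0 <= 2 * s by lra.
have aB := @square_area R _ z (2 * s) mB s20 (fun y h => h).
have c3 : 0 <= d * C ^+ 2 by rewrite mulr_ge0 // exprn_ge0 // ltW.
have := int2_bound (ccD c1 c2) mB aB c3.
rewrite [X in _ -> _ -> _ <= X](_ : _ = 16 * C ^+ 2 * d * s ^+ 2); last by ring.
apply=> x xB; last by rewrite Dout // !mulr0 addr0.
rewrite mulN1r -mulrBl normrM.
apply: le_trans (ler_pM _ _ (H x xB) (Dle x)) _ => //.
rewrite (_ : d * s ^+ 2 * (s^-1 ^+ 2 * C ^+ 2) = d * C ^+ 2 * (s * s^-1) ^+ 2); last by ring.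
by rewrite divff ?gt_eqF // expr1n mulr1.
Qed.

Lemma sum_bump2 (s : R) (n : nat) x : 0 < s -> `|x.1| <= (n%:R - 1) * s -> `|x.2| <= (n%:R - 1) * s ->
  \sum_(a < n + n) \sum_(b < n + n) bump2 s (a%:R - n%:R) (b%:R - n%:R) x = 1.
Proof.
move=> s0 x1 x2.
have H t : `|t| <= (n%:R - 1) * s -> \sum_(a < n + n) bump (s^-1 * t + - (a%:R - n%:R)) = 1.
  rewrite -ler_pdivrMr // -[X in `|t| / X](gtr0_norm s0) -normf_div mulrC ler_norml => /andP[t1 t2].
  by rewrite sum_bump step01_ge1 ?step01_le0 ?subr0 //; lra.
under eq_bigr do rewrite -mulr_sumr H // mulr1.
exact: H.
Qed.

End bump_pairing.

(** * The distributional Hessian *)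

Section localisation.
Context {R : realType}.
Local Notation E := (R * R)%type.
Implicit Types (P G W C Om : set E) (Q : R * R * R).

Lemma compact_open_margin P Om : compact P -> open Om -> P `<=` Om ->
  exists2 r : R, 0 < r & forall x y, P x -> enorm (y - x) < r -> Om y.
Proof.
move=> /compact_near_coveringP cP oO PO.
have H : \forall r \near (0 : R)^'+, P `<=` (fun x => forall y, enorm (y - x) < r -> Om y).
  apply: cP => x Px; have [d d0 Hd] := (open_enormP Om).1 oO x (PO x Px).
  exists ([set y | enorm (y - x) < d / 2], [set t : R | t < d / 2]) => /=.
    split; last by apply: nbhs_right_lt; lra.
    by apply/nbhs_enormP; exists (d / 2) => //; lra.
  move=> [y t] /= [yd td] z yz; apply: Hd.
  by have := enorm_triangle3 z y x; lra.
have [r [r0 Hr]] : exists r : R, 0 < r /\ P `<=` (fun x => forall y, enorm (y - x) < r -> Om y).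
  by near (0 : R)^'+ => r; exists r; split => //; near: r.
by exists r => // x y Px; exact: Hr.
Unshelve. all: by end_near. Qed.

Lemma compact_open_between P Om : compact P -> open Om -> P `<=` Om ->
  exists W C, [/\ open W, P `<=` W, W `<=` C, compact C & C `<=` Om].
Proof.
move=> cP oO PO; have [r r0 Hr] := compact_open_margin cP oO PO.
pose W := [set y | exists2 x, P x & enorm (y - x) < r / 2].
have [M M0 HM] := compact_bounded2 cP.
exists W, (closure W); split.
- apply/open_enormP => y [x Px yx]; exists (r / 2 - enorm (y - x)); first by rewrite subr_gt0.
  by move=> z zy; exists x => //; have := enorm_triangle3 z y x; lra.
- by move=> x Px; exists x => //; rewrite subrr enorm0 divr_gt0.
- exact: subset_closure.
- apply: (@bounded_closed_compact2 _ _ (M + r)); first exact: closed_closure.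
  move=> y /(_ [set z | enorm (z - y) < r / 2]) [|z [[x Px zx] zy]].
    by apply/nbhs_enormP; exists (r / 2) => //; rewrite divr_gt0.
  have := enorm_triangle3 y z x; have := enorm_triangle (y - x) x; rewrite subrK.
  by have := HM x Px; rewrite /= (enormB z y) in zy; lra.
- move=> y /(_ [set z | enorm (z - y) < r / 2]) [|z [[x Px zx] zy]].
    by apply/nbhs_enormP; exists (r / 2) => //; rewrite divr_gt0.
  apply: (Hr x y Px); have := enorm_triangle3 y z x; rewrite /= (enormB z y) in zy; lra.
Qed.

Lemma integral_sandwich d (T : measurableType d) (mu : {measure set T -> \bar R}) (P S Om : set T) (f : T -> R) :
  measurable P -> measurable S -> measurable Om -> P `<=` S -> S `<=` Om -> measurable_fun setT f ->
  (forall x, 0 <= f x <= 1) -> (forall x, P x -> f x = 1) -> (forall x, ~ S x -> f x = 0) ->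
  (mu P <= \int[mu]_(x in Om) (f x)%:E <= mu S)%E.
Proof.
move=> mP mS mO PS SO mf f01 f1 f0.
have meP (A : set T) : measurable A -> measurable_fun Om (fun x => (\1_A x)%:E : \bar R).
  by move=> mA; apply/measurable_EFinP; exact: measurable_indic.
have mef : measurable_fun Om (fun x => (f x)%:E).
  by apply/measurable_EFinP; exact: measurable_funS mf.
apply/andP; split.
  rewrite -[X in mu X](@setIidl _ P Om); last exact: subset_trans PS SO.
  rewrite -integral_indic //; apply: ge0_le_integral => //; first exact: meP.
  move=> x _; rewrite lee_fin indicE; case: (boolP (x \in P)) => [/set_mem/f1 -> //|_].
  by case/andP: (f01 x).
rewrite -[X in (_ <= mu X)%E](@setIidl _ S Om) //.
rewrite -integral_indic //; apply: ge0_le_integral => //.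
- by move=> x _; rewrite lee_fin; case/andP: (f01 x).
- exact: meP.
move=> x _; rewrite lee_fin indicE; case: (boolP (x \in S)) => [_|/negP xS].
  by case/andP: (f01 x).
by rewrite f0 // => Sx; apply: xS; rewrite inE.
Qed.

Lemma cells_count (s : R) (ps : seq (int * int)) G : 0 < s -> uniq ps -> measurable G ->
  (forall p, p \in ps -> cell s p `<=` G) -> (((size ps)%:R * s ^+ 2)%:E <= lamE G)%E.
Proof.
move=> s0; elim: ps G => [|p ps IH] G; first by move=> *; rewrite mul0r measure_ge0.
rewrite /= => /andP[pps ups] mG H.
have mc := @cell_measurable R s p.
have pG : cell s p `<=` G by apply: H; rewrite inE eqxx.
rewrite (measureDI (@lamE R) mG mc) setIidr // [X in (_ <= _ + X)%E](lamE_cell p s0).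
rewrite -natr1 mulrDl mul1r EFinD; apply: leeD => //.
apply: IH => //; first exact: measurableD.
move=> q qps y yq; split; first by apply: (H q) => //; rewrite inE qps orbT.
move=> yp; move: qps pps; rewrite (_ : q = p); first by move=> ->.
by rewrite ((cellP q y s0).1 yq) ((cellP p y s0).1 yp).
Qed.

Lemma outer_open (mu : {measure set E -> \bar R}) P W (e : R) : open W -> (mu W < +oo)%E -> compact P ->
  P `<=` W -> 0 < e -> exists G, [/\ open G, P `<=` G, G `<=` W & (mu G <= mu P + e%:E)%E].
Proof.
move=> oW muW cP PW e0; have mW := open_measurable2 oW.
have mP : measurable P by apply: closed_measurable2; apply: compact_closed => //; exact: norm_hausdorff.
have fin : (mrestr mu mW setT < +oo)%E by rewrite /mrestr setTI.
have [F [G [cF oG FP PG FG]]] := measure_regular fin mP e0.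
exists (G `&` W); split; [exact: openI| |by move=> x []|].
  by move=> x Px; split; [exact: PG|exact: PW].
have mF := closed_measurable2 cF; have mG := open_measurable2 oG.
rewrite (measureDI mu (measurableI _ _ mG mW) mF) addeC; apply: leeD.
  by apply: le_measure; rewrite ?inE //; [exact: measurableI (measurableI _ _ mG mW) mF|move=> x [_ /FP]].
apply: ltW; apply: le_lt_trans FG; rewrite /mrestr le_measure ?inE //.
- by apply: measurableD => //; exact: measurableI.
- by apply: measurableI => //; exact: measurableD.
by move=> x [[Gx Wx] Fx].
Qed.

(** The property of the constant from [bump_pairing], named so that a single [M] serves all later
    estimates. *)
Definition pairing_const (M : R) := 0 < M /\
  forall (s k l : R) (U : E -> R) u0 p x0 Q (d : R) i j, 0 < s -> 0 <= d -> continuous U ->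
  (forall y, enorm (y - bump_center s k l) <= 2 * s -> `|U y - qpoly u0 p x0 Q y| <= d * s ^+ 2) ->
  `|int2 (fun x => U x * dpart [:: i; j] (bump2 s k l) x) - qij Q i j * int2 (bump2 s k l)| <= M * d * s ^+ 2.

Lemma sum_bump2_le1 (s : R) (n : nat) (x : E) :
  \sum_(a < n + n) \sum_(b < n + n) bump2 s (a%:R - n%:R) (b%:R - n%:R) x <= 1.
Proof.
have H t : 0 <= \sum_(a < n + n) bump (s^-1 * t + - (a%:R - n%:R)) <= 1.
  rewrite sumr_ge0 => [|a _]; last exact: bump_ge0.
  by rewrite sum_bump lerBlDr ler_wpDr ?step01_ge0 ?step01_le1.
under eq_bigr do rewrite -mulr_sumr.
rewrite -mulr_suml; have /andP[h1 h2] := H x.1; have /andP[h3 h4] := H x.2.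
by rewrite -[X in _ <= X](mulr1 1) ler_pM.
Qed.

Lemma normr_perturb (a b c p1 p2 p3 q e X : R) :
  `|a - p1| <= e -> `|b - p2| <= e -> `|c - p3| <= e -> `|a - b - q * c| <= X ->
  `|p1 - p2 - q * p3| <= X + e * (2 + `|q|).
Proof.
move=> h1 h2 h3 h4.
have h5 : `|q * (c - p3)| <= `|q| * e by rewrite normrM ler_wpM2l.
rewrite (_ : p1 - p2 - q * p3 = (a - b - q * c) - (a - p1) + (b - p2) + q * (c - p3)); last by ring.
apply: le_trans (ler_normD _ _) _; apply: le_trans (lerD (ler_normD _ _) (lexx _)) _.
apply: le_trans (lerD (lerD (ler_normB _ _) (lexx _)) (lexx _)) _; lra.
Qed.

Context (M : R) (HM : pairing_const M).
Context (Om : set E) (oOm : open Om) (u U : E -> R) (cU : continuous U) (uU : forall x, Om x -> U x = u x).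
Context (i j : bool) (nup num : {measure set E -> \bar R}) (D2 : is_D2 Om u i j nup num).

Section grid_sum.
Context (P G : set E) (Q : R * R * R) (eps r0 s : R) (n : nat).
Hypotheses (oG : open G) (PG : P `<=` G) (GO : G `<=` Om).
Hypotheses (upG : (nup G < +oo)%E) (umG : (num G < +oo)%E) (laG : (lamE G < +oo)%E) (mP : measurable P).
Hypotheses (eps0 : 0 <= eps) (s0 : 0 < s) (sr : 4 * s < r0).
Hypothesis QP : forall x, P x -> exists u0 p, forall y, enorm (y - x) < r0 ->
    `|U y - qpoly u0 p x Q y| <= eps * enorm (y - x) ^+ 2.
Hypothesis margin : forall x y, P x -> enorm (y - x) <= 4 * s -> G y.
Hypothesis nP : forall x, P x -> `|x.1| <= (n%:R - 1) * s /\ `|x.2| <= (n%:R - 1) * s.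

Let I : Type := ('I_(n + n) * 'I_(n + n))%type.
Let psi (z : I) := bump2 s (z.1%:R - n%:R) (z.2%:R - n%:R).
Let ctr (z : I) := bump_center s (z.1%:R - n%:R) (z.2%:R - n%:R).
Let sel (z : I) := `[< exists2 x, P x & psi z x != 0 >].
Let zs : seq ('I_(n + n) * 'I_(n + n)) := [seq z <- enum {: 'I_(n + n) * 'I_(n + n)} | sel z].

Let sel_ball z : z \in zs -> exists2 x, P x & forall y, enorm (y - ctr z) <= 2 * s -> enorm (y - x) <= 4 * s.
Proof.
rewrite mem_filter => /andP[/asboolP[x Px xz] _]; exists x => // y yz.
by have := bump2_neq0 s0 xz; rewrite (enormB x) => h; have := enorm_triangle3 y (ctr z) x; rewrite /ctr; lra.
Qed.

Let sel_G z y : z \in zs -> enorm (y - ctr z) <= 2 * s -> G y.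
Proof. by move=> /sel_ball[x Px H] /H; exact: margin. Qed.

Let psi_ge0 z x : 0 <= psi z x. Proof. exact: bump2_ge0. Qed.

Let psi_out z x : z \in zs -> ~ G x -> psi z x = 0.
Proof.
move=> zz Gx; apply/eqP/negPn/negP => /(bump2_neq0 s0) h; apply: Gx; exact: sel_G h.
Qed.

Let Psi x := \sum_(z <- zs) psi z x.

Let sum_all x : \sum_z psi z x =
  \sum_(a < n + n) \sum_(b < n + n) bump2 s (a%:R - n%:R) (b%:R - n%:R) x.
Proof. by rewrite pair_bigA. Qed.

Let sum_zs (F : 'I_(n + n) * 'I_(n + n) -> R) : \sum_(z <- zs) F z = \sum_(z | sel z) F z.
Proof. by rewrite big_filter big_enum_cond. Qed.

Let Psi01 x : 0 <= Psi x <= 1.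
Proof.
rewrite /Psi sum_zs sumr_ge0 => [|z _]; last exact: psi_ge0.
rewrite (le_trans _ (sum_bump2_le1 s n x)) // -sum_all [leRHS](bigID sel) /= lerDl sumr_ge0 //.
Qed.

Let Psi1 x : P x -> Psi x = 1.
Proof.
move=> Px; have [x1 x2] := nP Px; rewrite /Psi sum_zs -(sum_bump2 s0 x1 x2) -sum_all.
rewrite [RHS](bigID sel) /= [X in _ + X]big1 ?addr0 // => z /asboolPn zx.
by apply/eqP/negPn/negP => h; apply: zx; exists x.
Qed.

Let Psi0 x : ~ G x -> Psi x = 0.
Proof. by move=> Gx; rewrite /Psi big_seq big1 // => z zz; exact: psi_out. Qed.

Let psi_cc z : cc (psi z). Proof. exact: cc_bump2. Qed.

Let Psi_cc : cc Psi.
Proof.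
by apply: cc_sum.
Qed.

Let mPsi : measurable_fun setT Psi. Proof. by apply: continuous_measurable2; case: Psi_cc. Qed.
Let mpsi z : measurable_fun setT (psi z). Proof. by apply: continuous_measurable2; case: (psi_cc z). Qed.

Let mG : measurable G. Proof. exact: open_measurable2. Qed.
Let mO : measurable Om. Proof. exact: open_measurable2. Qed.

Let psi_int (mu : {measure set E -> \bar R}) z : (mu G < +oo)%E -> z \in zs ->
  (\int[mu]_(x in Om) (psi z x)%:E)%E \is a fin_num.
Proof.
move=> muG zz.
have /andP[h1 h2] : (mu set0 <= \int[mu]_(x in Om) (psi z x)%:E <= mu G)%E.
  apply: integral_sandwich => //; last by move=> x; exact: psi_out.
  move=> x; rewrite psi_ge0 /=; have /andP[_] := Psi01 x; apply: le_trans.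
  rewrite /Psi (big_rem z) //= lerDl sumr_ge0 // => y _; exact: psi_ge0.
by rewrite ge0_fin_numE ?(le_lt_trans h2) // (le_trans _ h1).
Qed.

Let Psi_int (mu : {measure set E -> \bar R}) : (mu G < +oo)%E ->
  (mu P <= (\sum_(z <- zs) fine (\int[mu]_(x in Om) (psi z x)%:E)%E)%R%:E <= mu G)%E.
Proof.
move=> muG; pose a := \sum_(z <- zs) fine (\int[mu]_(x in Om) (psi z x)%:E)%E; rewrite -/a.
 rewrite (_ : a%:E = \int[mu]_(x in Om) (Psi x)%:E)%E.
  by apply: integral_sandwich.
rewrite /a -sumEFin big_seq (eq_bigr (fun z => \int[mu]_(x in Om) (psi z x)%:E)%E); last first.
  by move=> z zz; rewrite fineK //; exact: psi_int.
rewrite -big_seq -ge0_integral_sum //.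
- by apply: eq_integral => x _; rewrite sumEFin.
- by move=> z; apply/measurable_EFinP; exact: measurable_funS (mpsi z).
- by move=> z x _; rewrite lee_fin psi_ge0.
Qed.

(** A selected bump lies within 4 s of some point of [P], where the expansion has error eps (4 s)^2;
    this is the factor 16 in front of the constant of [bump_pairing]. *)
Let psi_pair z : z \in zs ->
  `|fine (\int[nup]_(x in Om) (psi z x)%:E)%E - fine (\int[num]_(x in Om) (psi z x)%:E)%E
    - qij Q i j * int2 (psi z)| <= 16 * M * eps * s ^+ 2.
Proof.
move=> zz; have ballO y : enorm (y - ctr z) <= 2 * s -> Om y by move=> h; apply/GO/(sel_G zz h).
have sup : supp_in (psi z) Om.
  exists (cball (ctr z) (2 * s)); split; [exact: cball_compact|exact: ballO|].
  by move=> x xz; apply/eqP/negPn/negP => /(bump2_neq0 s0).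
have := D2 (smooth_bump2 _ _ _) sup.
rewrite -[X in (_ = X - _)%E -> _](fineK (psi_int upG zz)) -[X in (_ = _ - X)%E -> _](fineK (psi_int umG zz)).
have Dc : cc (dpart [:: i; j] (psi z)) by exact: cc_dpart_bump2.
have Dout x : ~ cball (ctr z) (2 * s) x -> dpart [:: i; j] (psi z) x = 0 by exact: dpart_bump2_out.
rewrite (@integral_supported R Om (fun x => U x * dpart [:: i; j] (psi z) x)) //; first last.
- by move=> x Ox; rewrite Dout ?mulr0 // => h; apply: Ox; exact: ballO.
- by move=> x Ox; rewrite uU.
- exact: ccM.
rewrite -EFinB => -[<-].
have [x Px Hx] := sel_ball zz; have [u0 [p Hp]] := QP Px.
have e160 : 0 <= 16 * eps by rewrite mulr_ge0.
rewrite (_ : 16 * M * eps = M * (16 * eps)); last by ring.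
apply: (HM.2 s _ _ U u0 p x Q (16 * eps)) => // y /Hx yx.
apply: le_trans (Hp y _) _; first exact: le_lt_trans yx sr.
rewrite (_ : 16 * eps * s ^+ 2 = eps * (4 * s) ^+ 2); last by ring.
by rewrite ler_wpM2l // ler_sqr ?nnegrE ?enorm_ge0 // mulr_ge0 // ltW.
Qed.

(** Each selected bump owns the cell at its lower left corner. These cells are distinct and
    contained in [G]. *)
Let count_zs : (size zs)%:R * s ^+ 2 <= fine (lamE G).
Proof.
pose cp (z : I) : int * int := (z.1%:Z - n%:Z, z.2%:Z - n%:Z).
have cpi : injective cp.
  move=> [a b] [c d] [] /= /addIr[ac] /addIr[bd].
  by congr pair; apply: val_inj.
have := @cells_count s (map cp zs) G s0.
rewrite map_inj_uniq // size_map filter_uniq ?enum_uniq // => /(_ isT mG).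
have fG : lamE G \is a fin_num by rewrite ge0_fin_numE // measure_ge0.
move=> H; rewrite -lee_fin fineK //; apply: H => p /mapP[z zz ->] y yc; apply: (sel_G zz); apply: bump_center_close => //.
  move: yc => [/= + _]; rewrite in_itv /= -ler_pdivlMr // -ltr_pdivrMr // => /andP[].
  rewrite !intrD !mulrNz -!pmulrn mulrC => h1 h2; apply/andP; split; lra.
move: yc => [/= _]; rewrite in_itv /= -ler_pdivlMr // -ltr_pdivrMr // => /andP[].
by rewrite !intrD !mulrNz -!pmulrn mulrC => h1 h2; apply/andP; split; lra.
Qed.

(** The sum of the selected bumps is 1 on [P] and 0 off [G], so its three integrals lie between the
    measures of [P] and [G]; the pairing errors add up to the area of [G]. *)
Lemma grid_estimate : exists a b c : R, [/\ (nup P <= a%:E <= nup G)%E, (num P <= b%:E <= num G)%E,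
  (lamE P <= c%:E <= lamE G)%E & `|a - b - qij Q i j * c| <= 16 * M * eps * fine (lamE G)].
Proof.
exists (\sum_(z <- zs) fine (\int[nup]_(x in Om) (psi z x)%:E)%E),
  (\sum_(z <- zs) fine (\int[num]_(x in Om) (psi z x)%:E)%E), (\sum_(z <- zs) int2 (psi z)).
split; [exact: Psi_int|exact: Psi_int| |].
  have -> : \sum_(z <- zs) int2 (psi z) = int2 Psi by rewrite /Psi int2_sum.
  rewrite -(@integral_supported R Om Psi Psi Psi_cc mO) //; last by move=> x Ox; apply: Psi0 => /GO.
  exact: (@integral_sandwich _ _ (lam2 R) P G Om Psi mP mG mO PG GO mPsi Psi01 Psi1 Psi0).
rewrite mulr_sumr -!sumrB; apply: le_trans (ler_norm_sum _ _ _) _.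
have M0 := HM.1; have c0 : 0 <= 16 * M * eps by rewrite !mulr_ge0 // ltW.
apply: le_trans (ler_wpM2l c0 count_zs); rewrite mulrCA [leRHS]mulr_natl.
rewrite big_seq (le_trans (ler_sum _ (fun z zz => psi_pair zz))) // -big_seq.
by rewrite big_const_seq count_predT iter_addr_0.
Qed.

End grid_sum.

Lemma compact_lam P : compact P -> (lamE P < +oo)%E.
Proof.
move=> cP; have [Mb M0 HMb] := compact_bounded2 cP.
have mP : measurable P by apply: closed_measurable2; apply: compact_closed => //; exact: norm_hausdorff.
apply: (le_lt_trans (@square_area R P 0 Mb mP (ltW M0) _)); last by rewrite ltry.
by move=> z Pz; rewrite subr0; exact: HMb.
Qed.

(* The bumps of mesh s whose support meets P add up to 1 on P and vanish off a small
   neighbourhood G of P; the number of these bumps times s^2 is at most the area of G. *)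
Lemma compact_estimate P Q (eps r0 : R) : compact P -> P `<=` Om -> loc_finite Om nup -> loc_finite Om num ->
  0 <= eps -> 0 < r0 ->
  (forall x, P x -> exists u0 p, forall y, enorm (y - x) < r0 ->
    `|U y - qpoly u0 p x Q y| <= eps * enorm (y - x) ^+ 2) ->
  `|fine (nup P) - fine (num P) - qij Q i j * fine (lamE P)| <= 16 * M * eps * fine (lamE P).
Proof.
move=> cP PO lfp lfm eps0 r00 QP.
have [W [C [oW PW WC cC CO]]] := compact_open_between cP oOm PO.
have mP : measurable P by apply: closed_measurable2; apply: compact_closed => //; exact: norm_hausdorff.
have mC : measurable C by apply: closed_measurable2; apply: compact_closed => //; exact: norm_hausdorff.
have mW := open_measurable2 oW.
have finW (mu : {measure set E -> \bar R}) : (mu C < +oo)%E -> (mu W < +oo)%E.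
  by apply: le_lt_trans; rewrite le_measure ?inE.
have upW := finW _ (lfp C cC CO); have umW := finW _ (lfm C cC CO); have laW := finW _ (compact_lam cC).
have finP (mu : {measure set E -> \bar R}) : (mu W < +oo)%E -> mu P \is a fin_num.
  move=> h; rewrite ge0_fin_numE ?measure_ge0 //; apply: le_lt_trans h; rewrite le_measure ?inE //.
have fp := finP _ upW; have fm := finP _ umW; have fl := finP _ laW.
have M0 := HM.1; have c0 : 0 <= 16 * M * eps by rewrite !mulr_ge0 // ltW.
have key (e : R) : 0 < e ->
  `|fine (nup P) - fine (num P) - qij Q i j * fine (lamE P)| <=
    16 * M * eps * fine (lamE P) + e * (2 + `|qij Q i j| + 16 * M * eps).
  move=> e0.
  (* Three nested neighbourhoods, shrunk successively for [nup], [num] and Lebesgue measure, so that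
     one [G] serves all three. *)
  have [G1 [oG1 PG1 G1W le1]] := outer_open oW upW cP PW e0.
  have mG1 := open_measurable2 oG1.
  have um1 : (num G1 < +oo)%E by apply: le_lt_trans umW; rewrite le_measure ?inE.
  have [G2 [oG2 PG2 G2G1 le2]] := outer_open oG1 um1 cP PG1 e0.
  have mG2 := open_measurable2 oG2.
  have la2 : (lamE G2 < +oo)%E.
    by apply: le_lt_trans laW; rewrite le_measure ?inE //; exact: subset_trans G1W.
  have [G [oG PG GG2 le3]] := outer_open oG2 la2 cP PG2 e0.
  have mG := open_measurable2 oG; have GG1 := subset_trans GG2 G2G1.
  have leG1 : (nup G <= nup P + e%:E)%E by apply: le_trans le1; rewrite le_measure ?inE.
  have leG2 : (num G <= num P + e%:E)%E by apply: le_trans le2; rewrite le_measure ?inE.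
  have GO : G `<=` Om by move=> x /GG1 /G1W /WC /CO.
  have fadd (mu : {measure set E -> \bar R}) : mu P \is a fin_num -> (mu G <= mu P + e%:E)%E -> (mu G < +oo)%E.
    by move=> h h2; apply: le_lt_trans h2 _; rewrite -(fineK h) -EFinD ltry.
  have upG := fadd _ fp leG1; have umG := fadd _ fm leG2; have laG := fadd _ fl le3.
  have [r1 r10 Hr1] := compact_open_margin cP oG PG.
  have [Mb Mb0 HMb] := compact_bounded2 cP.
  pose s := Num.min r0 r1 / 8.
  have s0 : 0 < s by rewrite divr_gt0 // lt_min r00 r10.
  have [s8r0 s8r1] : 8 * s <= r0 /\ 8 * s <= r1.
    rewrite /s mulrC divfK //; split; rewrite ge_min lexx ?orbT //.
  clearbody s.
  (* Truncation loses less than one, and bumps with indices from - n to n - 1 are known to add up to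
     1 on coordinates of size at most (n - 1) s. *)
  pose n := (Num.truncn (Mb / s)).+2.
  have nM : Mb <= (n%:R - 1) * s.
    rewrite -ler_pdivrMr // /n -natr1 addrK; apply: ltW.
    by have /truncn_itv /andP[] : 0 <= Mb / s by rewrite divr_ge0 // ltW.
  have sr : 4 * s < r0 by clear -umG laG r10 Mb0 s0 s8r0; lra.
  have margin x y : P x -> enorm (y - x) <= 4 * s -> G y by move=> Px yx; apply: (Hr1 x y Px); (clear -Mb0 s0 s8r0 s8r1 Px yx; lra).
  have nP x : P x -> `|x.1| <= (n%:R - 1) * s /\ `|x.2| <= (n%:R - 1) * s.
    move=> /HMb h; split; apply: le_trans nM; apply: le_trans h; [exact: fst_le_enorm|exact: snd_le_enorm].
  have [a [b [c [/andP[a1 a2] /andP[b1 b2] /andP[c1 c2] H]]]] :=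
    @grid_estimate P G Q eps r0 s n oG PG GO upG umG laG mP eps0 s0 sr QP margin nP.
  have toR (mu : {measure set E -> \bar R}) (t : R) : mu P \is a fin_num -> (mu G <= mu P + e%:E)%E ->
      (mu P <= t%:E)%E -> (t%:E <= mu G)%E -> fine (mu P) <= t <= fine (mu P) + e.
    move=> h g1 g2 g3; rewrite -!lee_fin EFinD fineK // g2 /=; exact: le_trans g1.
  have /andP[a1' a2'] := toR _ a fp leG1 a1 a2; have /andP[b1' b2'] := toR _ b fm leG2 b1 b2.
  have /andP[c1' c2'] : fine (lamE P) <= c <= fine (lamE P) + e by exact: toR _ c fl le3 c1 c2.
  have lG : fine (lamE G) <= fine (lamE P) + e.
    rewrite -lee_fin EFinD (fineK fl) fineK // ge0_fin_numE ?measure_ge0 //.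
  have hG := ler_wpM2l c0 lG.
  have d1 : `|a - fine (nup P)| <= e by rewrite ger0_norm ?subr_ge0 // lerBlDl.
  have d2 : `|b - fine (num P)| <= e by rewrite ger0_norm ?subr_ge0 // lerBlDl.
  have d3 : `|c - fine (lamE P)| <= e by rewrite ger0_norm ?subr_ge0 // lerBlDl.
  apply: le_trans (normr_perturb d1 d2 d3 (le_trans H (ler_wpM2l c0 lG))) _.
  by rewrite le_eqVlt; apply/orP; left; apply/eqP; ring.
apply/ler_addgt0Pr => e e0.
have K0 : 0 < 2 + `|qij Q i j| + 16 * M * eps by have := normr_ge0 (qij Q i j); (clear -upW umW c0 e0; lra).
have := key (e / (2 + `|qij Q i j| + 16 * M * eps)) (divr_gt0 e0 K0).
by rewrite divfK // gt_eqF.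
Qed.

End localisation.

(** * Measurability of the Hessian *)

Section hessian_measurable.
Context {R : realType}.
Local Notation E := (R * R)%type.
Implicit Types (x y z h p q : E) (f : E -> R) (Q : R * R * R).

(* ['d F x] is chosen by [get], whose value on an empty predicate is [point] *)
Lemma diff_junk (F : E -> E) x h : ~ differentiable F x -> 'd F x h = 0.
Proof.
move=> nd; rewrite /diff; set D := (X in get X).
have [dF|dF] := pselect (exists g, D g); last by rewrite getPN // => g Dg; apply: dF; exists g.
exfalso; apply: nd; apply/diffP; exact: (getPex dF).
Qed.

Lemma differentiable_lindiff (F : E -> E) x : differentiable F x ->
  exists a b, lindiff (fun y => (F y).1) x a /\ lindiff (fun y => (F y).2) x b.
Proof.
move=> /diff_locallyP[cd /eqaddoP o].
pose A : E := (('d F x (e_ false)).1, ('d F x (e_ true)).1).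
pose B : E := (('d F x (e_ false)).2, ('d F x (e_ true)).2).
have dE h : 'd F x h = lin2 A B h.
  have {1}-> : h = h.1 *: e_ false + h.2 *: e_ true by apply: vec_ext; rewrite !vE /=; ring.
  by rewrite linearD !linearZ; apply: vec_ext; rewrite /lin2 /dot !vE /=; ring.
have H e : 0 < e -> exists2 d, 0 < d & forall h, enorm h < d ->
    enorm (F (x + h) - F x - lin2 A B h) <= e * enorm h.
  move=> e0; have e20 : 0 < e / 2 by rewrite divr_gt0.
  have /nbhs_enormP[d d0 Hd] := o _ e20; exists d => // h hd.
  have := Hd h; rewrite subr0 => /(_ hd); rewrite /= !fctE /= dE [h + x]addrC opprD addrA => h1.
  apply: le_trans (enorm_le_norm _) _.
  have := norm_le_enorm h; move: h1; move: (enorm h) `|h| => s t h1 h2.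
  by have := ler_wpM2l (ltW e20) h2; (clear -h1; lra).
exists A, B; split=> e e0; have [d d0 Hd] := H e e0; exists d => // h /Hd; apply: le_trans.
  by have := fst_le_enorm (F (x + h) - F x - lin2 A B h); rewrite !vE.
by have := snd_le_enorm (F (x + h) - F x - lin2 A B h); rewrite !vE.
Qed.

(** The set is relatively closed in [Om]: a violation at one [h] persists at nearby [x], so the
    uncountable quantifier over [h] does no harm. *)
Lemma relatively_closed_measurable (Om V : set E) (r : R) (phi : E -> E -> R) (c : E -> R) :
  open Om -> open V ->
  (forall h x, Om x -> V (x + h) -> {for x, continuous (phi h)}) ->
  measurable [set x | Om x /\ forall h, enorm h < r -> V (x + h) -> `|phi h x| <= c h].
Proof.
move=> oO oV cphi; set F := (X in measurable X).
have -> : F = Om `\` (Om `\` F).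
  by rewrite setDD; apply/seteqP; split => [x Fx|x []//]; split => //; case: Fx.
apply: measurableD; apply: open_measurable2 => //.
apply/open_enormP => x [Ox nF].
have [h [hr Vh ch]] : exists h, [/\ enorm h < r, V (x + h) & c h < `|phi h x|].
  apply: contrapT => nh; apply: nF; split => // h hr Vh; rewrite leNgt; apply/negP => ch.
  by apply: nh; exists h.
have [d1 d10 H1] := (open_enormP _).1 oO x Ox; have [d2 d20 H2] := (open_enormP _).1 oV _ Vh.
have e0 : 0 < `|phi h x| - c h by rewrite subr_gt0.
have [d3 d30 H3] := (continuous_enormP _ _).1 (cphi h x Ox Vh) _ e0.
exists (Num.min d1 (Num.min d2 d3)); first by rewrite !lt_min d10 d20.
move=> y; rewrite !lt_min => /and3P[y1 y2 y3]; split; first exact: H1.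
have Vy : V (y + h) by apply: H2; rewrite opprD addrACA subrr addr0.
move=> [_ /(_ h hr Vy)] ph; have := H3 y y3; have := ler_normD (phi h x - phi h y) (phi h y).
by rewrite subrK distrC; (clear -ph; lra).
Qed.

Lemma rat_close (t e : R) : 0 < e -> exists q : rat, `|ratr q - t| <= e.
Proof.
move=> e0; have /rat_in_itvoo[q] : t - e < t + e by lra.
rewrite in_itv /= => /andP[q1 q2]; exists q; rewrite ler_norml; apply/andP; split; lra.
Qed.

Lemma natSinv_lt (d : R) : 0 < d -> exists k : nat, k.+1%:R^-1 < d.
Proof. by move=> d0; have [k _ Hk] := near_infty_natSinv_lt (PosNum d0); exists k; apply: (Hk k) => /=. Qed.

Definition diffset (Om : set E) f := [set x | Om x /\ exists p, lindiff f x p].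

(** Rational slopes at accuracy 1 / (m + 1) present the set through countable operations;
    [lindiff_approx] recovers the derivative. *)
Lemma diffset_measurable (Om : set E) f : open Om -> (forall x, Om x -> {for x, continuous f}) ->
  measurable (diffset Om f).
Proof.
move=> oO cf; pose v (q : rat * rat) : E := (ratr q.1, ratr q.2).
pose F (m k : nat) (q : rat * rat) : set E := [set x | Om x /\ forall h, enorm h < k.+1%:R^-1 -> Om (x + h) ->
  `|f (x + h) - f x - dot (v q) h| <= m.+1%:R^-1 * enorm h].
have mF m k (q : rat * rat) : measurable (F m k q).
  apply: (@relatively_closed_measurable Om Om _ (fun h x => f (x + h) - f x - dot (v q) h)) => // h x Ox Oh.
  have c1 : {for x, continuous (fun y => f (y + h))}.
    apply: (@continuous_comp _ _ _ (fun y => y + h) f); last exact: cf.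
    by apply: continuousD; [exact: cvg_id|exact: cvg_cst].
  by apply: continuousB; [apply: continuousB => //; exact: cf|exact: cvg_cst].
rewrite (_ : diffset Om f = \bigcap_(m in setT) \bigcup_(kq in [set: nat * (rat * rat)]) F m kq.1 kq.2).
  by apply: bigcapT_measurable => m; apply: countable_bigcup_measurable => kq _.
apply/seteqP; split => [x [Ox [p Hp]] m _|x Hx].
  have c0 : 0 < m.+1%:R^-1 / 4 :> R by rewrite divr_gt0 // invr_gt0.
  have [d d0 Hd] := Hp _ c0; have [k kd] := natSinv_lt d0.
  have [q1 h1] := rat_close p.1 c0; have [q2 h2] := rat_close p.2 c0.
  exists (k, (q1, q2)) => //; split => // h hk _; have := Hd _ (lt_trans hk kd).
  rewrite (_ : f (x + h) - f x - dot (v (q1, q2)) h =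
    (f (x + h) - f x - dot p h) - dot (v (q1, q2) - p) h); last by rewrite dotDl dotNl; ring.
  move=> h3; apply: le_trans (ler_normB _ _) _.
  have h4 := dot_abs_le (v (q1, q2) - p) h.
  have h5 : enorm (v (q1, q2) - p) <= m.+1%:R^-1 / 2.
    apply: le_trans (enorm_le_l1 _) _; rewrite !vE /=; move: h1 h2; move: (m.+1%:R^-1) => c; lra.
  have := ler_wpM2r (enorm_ge0 h) h5; have h0 := enorm_ge0 h.
  by have := mulr_ge0 (ltW c0) h0; move: h3 h4; move: (m.+1%:R^-1) => c; (clear -R; lra).
have Ox : Om x by have [kq _ []] := Hx 0%N I.
split => //; apply: lindiff_approx => e e0; have [m me] := natSinv_lt e0.
have [[k q] _ [_ H]] := Hx m I; have [d d0 Hd] := (open_enormP _).1 oO x Ox.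
exists (v q), (Num.min d k.+1%:R^-1); first by rewrite lt_min d0 invr_gt0 /=.
move=> h; rewrite lt_min => /andP[hd hk]; apply: le_trans (H h hk _) _.
  by apply: Hd; rewrite [x + h]addrC addrK.
by rewrite ler_wpM2r ?enorm_ge0 // ltW.
Qed.

Lemma continuous_scale (c : R) f : continuous f -> continuous (fun x => c * f x).
Proof. by move=> cf x; apply: continuousM; [exact: cvg_cst|exact: cf]. Qed.

Lemma continuous_sub (f g : E -> R) : continuous f -> continuous g -> continuous (fun x => f x - g x).
Proof. by move=> cf cg x; apply: continuousB; [exact: cf|exact: cg]. Qed.

Context (Om : set E) (oOm : open Om) (u U : E -> R) (cU : continuous U).
Hypothesis uU : forall x, Om x -> U x = u x.
Context (P : E -> E) (fP : forall x, Om x -> lindiff U x (P x)).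
Hypothesis cP : forall x, Om x -> {for x, continuous (fun y => (P y).1)} /\ {for x, continuous (fun y => (P y).2)}.

Definition regular_points := diffset Om (fun y => (P y).1) `&` diffset Om (fun y => (P y).2).

Lemma regular_points_measurable : measurable regular_points.
Proof. by apply: measurableI; [exact: diffset_measurable oOm (fun x Ox => (cP Ox).1)|exact: diffset_measurable oOm (fun x Ox => (cP Ox).2)]. Qed.

Lemma local_data x : Om x -> exists2 r, 0 < r & forall y, enorm (y - x) < r -> lindiff U y (P y) /\ U y = u y.
Proof.
move=> Ox; have [r r0 Hr] := (open_enormP _).1 oOm x Ox; exists r => // y /Hr Oy.
by split; [exact: fP|exact: uU].
Qed.

Lemma regular_hess x : regular_points x -> exists a b,
  [/\ taylor U x (P x) a b, a.2 = b.1, (forall i j, hess u x i j = qij (a.1, a.2, b.2) i j) &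
   forall i j (e : R), 0 < e -> exists2 d, 0 < d & forall t : R, 0 < t < d ->
    `|t^-1 ^+ 2 * (U (x + t *: e_ j + t *: e_ i) - U (x + t *: e_ j) - U (x + t *: e_ i) + U x)
       - hess u x i j| <= e].
Proof.
move=> [[Ox [a da]] [_ [b db]]]; have [r r0 Hr] := local_data Ox.
have fP' y : enorm (y - x) < r -> lindiff U y (P y) by move=> /Hr[].
have [_ _ hE] := twice_diff_local r0 fP' da db (fun y yr => (Hr y yr).2).
have sym := hessian_symmetric r0 fP' da db.
have hq i j : hess u x i j = qij (a.1, a.2, b.2) i j.
  rewrite /hess hE; case: i; case: j; rewrite /qij /lin2 /dot /e_ /= ?sym; ring.
exists a, b; split => //; first by move=> e e0; exact: (taylor2 r0 fP' da db e0).
move=> i j e e0; have e60 : 0 < e / 6 by rewrite divr_gt0.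
have [d d0 Hd] := second_difference r0 fP' da db e60; exists d => // t /andP[t0 td].
have E1 k : enorm (t *: e_ k : E) = t by rewrite enorm_e gtr0_norm.
have tk k : enorm (t *: e_ k : E) < d by rewrite E1.
have := Hd _ _ (tk j) (tk i); rewrite !E1.
rewrite (_ : dot (lin2 a b (t *: e_ i)) (t *: e_ j) = t ^+ 2 * hess u x i j); last first.
  by rewrite hq; case: i; case: j; rewrite /qij /lin2 /dot /e_ !vE /= ?sym; ring.
set D := U _ - _ - _ + _ => H; have tt : 0 < t ^+ 2 by rewrite exprn_gt0.
rewrite -(ler_pM2l tt) -{1}[t ^+ 2]gtr0_norm // -normrM mulrBr mulrA -exprMn divff ?gt_eqF // expr1n mul1r.
by apply: le_trans H _; rewrite expr2; lra.
Qed.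

(** Where the gradient is not differentiable, [hess] takes the default value of the differential,
    which is 0; integrals over [Om] therefore reduce to regular points. *)
Lemma irregular_hess x i j : Om x -> ~ regular_points x -> hess u x i j = 0.
Proof.
move=> Ox nS; have [r r0 Hr] := local_data Ox.
have gP y : enorm (y - x) < r -> grad u y = P y.
  move=> yr; have [ly _] := Hr y yr; apply: (lindiff_grad (_ : lindiff u y (P y))).2 => e e0.
  have [d d0 Hd] := ly _ e0; exists (Num.min d (r - enorm (y - x))); first by rewrite lt_min d0 subr_gt0.
  move=> h; rewrite lt_min => /andP[hd hr]; rewrite -(Hr y yr).2 -(Hr _ _).2; first exact: Hd.
  have := enorm_triangle h (y - x); rewrite addrA [h + y]addrC; lra.
rewrite /hess /hessv diff_junk; first by case: j.
move=> /differentiable_lindiff[a [b [da db]]]; apply: nS.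
have lg (c : E -> R) v : lindiff (fun y => c (grad u y)) x v -> lindiff (fun y => c (P y)) x v.
  move=> H e e0; have [d d0 Hd] := H _ e0.
  exists (Num.min d r); first by rewrite lt_min d0.
  move=> h; rewrite lt_min => /andP[hd hr]; rewrite -!gP //; first exact: Hd.
  - by rewrite subrr enorm0.
  - by rewrite [x + h]addrC addrK.
by split; split => //; [exists a; exact: (lg (fun y => y.1))|exists b; exact: (lg (fun y => y.2))].
Qed.

(** On the regular points the Hessian is the limit of second difference quotients with step 1 / (n +
    1), which are continuous. *)
Lemma hess_measurable i j : measurable_fun Om (fun x => hess u x i j).
Proof.
have mS := regular_points_measurable; have mO := open_measurable2 oOm.
have SO : regular_points `<=` Om by move=> x [[]].
have -> : Om = regular_points `|` (Om `\` regular_points) by rewrite setDE setUIr setUCr setIT setUidr.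
apply/measurable_funU => //; first exact: measurableD.
split; last first.
  apply: (eq_measurable_fun (cst (0 : R))) => [x|]; last exact: measurable_cst.
  by rewrite inE => -[Ox nS]; rewrite irregular_hess.
pose t (n : nat) : R := n.+1%:R^-1.
apply: (@measurable_realfun.measurable_fun_cvg _ _ _ _ (fun n x => (t n)^-1 ^+ 2 *
  (U (x + t n *: e_ j + t n *: e_ i) - U (x + t n *: e_ j) - U (x + t n *: e_ i) + U x))).
  move=> n; apply: measurable_funS (continuous_measurable2 _) => //.
  have cT (v : E) : continuous (fun x => U (x + v)).
    move=> x; apply: (@continuous_comp _ _ _ (fun y => y + v) U); last exact: cU.
    by apply: continuousD; [exact: cvg_id|exact: cvg_cst].
  apply: continuous_scale; apply: continuous_add => //.
  do 2 (apply: continuous_sub; last exact: cT).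
  rewrite (_ : (fun y => _) = (fun y => U (y + (t n *: e_ j + t n *: e_ i)))); first exact: cT.
  by apply/funext => y; rewrite addrA.
move=> x Sx; have [a [b [_ _ _ H]]] := regular_hess Sx.
apply/cvgrPdist_le => e e0; have [d d0 Hd] := H i j e e0.
near=> n; rewrite distrC; apply: Hd; rewrite /t invr_gt0 ltr0n /=.
by near: n; exact: near_infty_natSinv_lt (PosNum d0).
Unshelve. all: by end_near. Qed.

Definition uniform_points (m k : nat) Q := [set x | Om x /\ forall h, enorm h < k.+1%:R^-1 -> Om (x + h) ->
  `|U (x + h) - U x - dot (P x) h - qf Q h / 2| <= m.+1%:R^-1 * enorm h ^+ 2].

Lemma uniform_points_measurable m k Q : measurable (uniform_points m k Q).
Proof.
apply: (@relatively_closed_measurable Om Om _ (fun h x => U (x + h) - U x - dot (P x) h - qf Q h / 2)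
  (fun h => m.+1%:R^-1 * enorm h ^+ 2)) => // h x Ox _.
have c1 : {for x, continuous (fun y => U (y + h))}.
  apply: (@continuous_comp _ _ _ (fun y => y + h) U); last exact: cU.
  by apply: continuousD; [exact: cvg_id|exact: cvg_cst].
have [p1 p2] := cP Ox.
apply: continuousB; last exact: cvg_cst.
apply: continuousB; first by apply: continuousB => //; exact: cU.
apply: (@continuousD _ _ _ (fun y => (P y).1 * h.1) (fun y => (P y).2 * h.2)).
  by apply: (@continuousM _ _ (fun y => (P y).1) (fun=> h.1)); [exact: p1|exact: cvg_cst].
by apply: (@continuousM _ _ (fun y => (P y).2) (fun=> h.2)); [exact: p2|exact: cvg_cst].
Qed.

Lemma taylor_qf a b h : a.2 = b.1 -> dot (lin2 a b h) h = qf (a.1, a.2, b.2) h.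
Proof. by move=> sym; rewrite /lin2 /dot /qf /= -sym; ring. Qed.

(** The true expansion and the one with [Q] agree to order 4 c |h|^2; testing at (t, 0), (0, t) and
    (t, t) recovers the entries by polarisation. For the off-diagonal entry, 2 |a12 - q12| is at
    most 8 c + 4 c + 4 c. *)
Lemma uniform_hess m k Q x i j : regular_points x -> uniform_points m k Q x ->
  `|hess u x i j - qij Q i j| <= 8 * m.+1%:R^-1.
Proof.
move=> Sx [Ox Tx]; have [a [b [ty sym hq _]]] := regular_hess Sx.
have c0 : 0 < m.+1%:R^-1 :> R by rewrite invr_gt0.
move: Tx; move: (m.+1%:R^-1 : R) c0 => c c0 Tx.
have [d d0 Hd] := ty _ c0; have [r r0 Hr] := (open_enormP _).1 oOm x Ox.
pose A := (a.1, a.2, b.2).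
pose t := Num.min d (Num.min r k.+1%:R^-1) / 4.
have k0 : 0 < k.+1%:R^-1 :> R by rewrite invr_gt0.
have t0 : 0 < t by rewrite divr_gt0 // !lt_min d0 r0.
have [td tr tk] : [/\ 4 * t <= d, 4 * t <= r & 4 * t <= k.+1%:R^-1].
  by rewrite /t mulrC divfK //; split; rewrite !ge_min lexx ?orbT.
clearbody t; move: (k.+1%:R^-1 : R) k0 tk Tx => k' k0 tk Tx.
have key (h : E) : enorm h < 4 * t -> `|qf A h - qf Q h| <= 4 * c * enorm h ^+ 2.
  move=> ht; have h1 : enorm h < d by lra.
  have h2 : enorm h < k' by lra.
  have h3 : Om (x + h) by apply: Hr; rewrite [x + h]addrC addrK; (clear -tr k0 tk ht; lra).
  have := Hd _ h1; have := Tx _ h2 h3; rewrite (taylor_qf h sym) -/A.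
  rewrite !ler_norml => /andP[a1 a2] /andP[b1 b2]; apply/andP; split; lra.
have tt : 0 < t ^+ 2 by rewrite exprn_gt0.
have k1 := key (t, 0); have k2 := key (0, t); have k3 := key (t, t).
have n1 : enorm (t, 0) = t :> R by rewrite (_ : (t, 0) = t *: e_ false) ?enorm_e ?gtr0_norm //; apply: vec_ext; rewrite !vE /=; ring.
have n2 : enorm (0, t) = t :> R by rewrite (_ : (0, t) = t *: e_ true) ?enorm_e ?gtr0_norm //; apply: vec_ext; rewrite !vE /=; ring.
have n3 : enorm (t, t) ^+ 2 = 2 * t ^+ 2 by rewrite enorm_sqr /dot /=; ring.
have n4 : enorm (t, t) < 4 * t.
  by apply: le_lt_trans (enorm_le_l1 _) _; rewrite /= gtr0_norm //; (clear -t0 td tr k0; lra).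
rewrite n1 in k1; rewrite n2 in k2; rewrite n3 in k3.
have {}k1 := k1 (_ : t < 4 * t); have {}k2 := k2 (_ : t < 4 * t); have {}k3 := k3 n4.
have t4 : t < 4 * t by clear -c0 d0 r0 t0; lra.
move: (k1 t4) (k2 t4) k3; rewrite /qf /= => {k1 k2}.
rewrite (_ : A.1.1 * t ^+ 2 + 2 * A.1.2 * (t * 0) + A.2 * 0 ^+ 2 -
  (Q.1.1 * t ^+ 2 + 2 * Q.1.2 * (t * 0) + Q.2 * 0 ^+ 2) = t ^+ 2 * (A.1.1 - Q.1.1)); last by rewrite !expr2; ring.
rewrite (_ : A.1.1 * 0 ^+ 2 + 2 * A.1.2 * (0 * t) + A.2 * t ^+ 2 -
  (Q.1.1 * 0 ^+ 2 + 2 * Q.1.2 * (0 * t) + Q.2 * t ^+ 2) = t ^+ 2 * (A.2 - Q.2)); last by rewrite !expr2; ring.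
rewrite (_ : A.1.1 * t ^+ 2 + 2 * A.1.2 * (t * t) + A.2 * t ^+ 2 -
  (Q.1.1 * t ^+ 2 + 2 * Q.1.2 * (t * t) + Q.2 * t ^+ 2) =
  t ^+ 2 * (A.1.1 - Q.1.1 + (A.2 - Q.2) + 2 * (A.1.2 - Q.1.2))); last by rewrite !expr2; ring.
rewrite (_ : 4 * c * (2 * t ^+ 2) = t ^+ 2 * (8 * c)); last by ring.
rewrite (_ : 4 * c * t ^+ 2 = t ^+ 2 * (4 * c)); last by ring.
rewrite ![`|t ^+ 2 * _|]normrM (gtr0_norm tt) !(ler_pM2l tt) => {}k1 {}k2 {}k3.
have q1 : `|A.1.1 - Q.1.1| <= 8 * c by apply: le_trans k1 _; lra.
have q2 : `|A.2 - Q.2| <= 8 * c by apply: le_trans k2 _; lra.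
have q3 : `|A.1.2 - Q.1.2| <= 8 * c.
  move: k1 k2 k3; rewrite !ler_norml => /andP[? ?] /andP[? ?] /andP[? ?]; apply/andP; split; lra.
by rewrite hq -/A; case: i; case: j.
Qed.

Lemma regular_uniform m x : regular_points x -> exists k (q : rat * rat * rat),
  uniform_points m k (ratr q.1.1, ratr q.1.2, ratr q.2) x.
Proof.
move=> Sx; have [a [b [ty sym _ _]]] := regular_hess Sx.
have c0 : 0 < m.+1%:R^-1 / 4 :> R by rewrite divr_gt0 // invr_gt0.
have [d d0 Hd] := ty _ c0; have [k kd] := natSinv_lt d0.
have [q1 h1] := rat_close a.1 c0; have [q2 h2] := rat_close a.2 c0; have [q3 h3] := rat_close b.2 c0.
exists k, (q1, q2, q3); split; first by case: Sx => -[].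
move=> h hk _; have := Hd _ (lt_trans hk kd); rewrite (taylor_qf h sym) => h4.
move: c0 h1 h2 h3 h4; move: (m.+1%:R^-1 : R) => c c0 h1 h2 h3 h4.
pose D := (ratr q1 - a.1, ratr q2 - a.2, ratr q3 - b.2).
rewrite (_ : _ - qf _ h / 2 = U (x + h) - U x - dot (P x) h - qf (a.1, a.2, b.2) h / 2 - qf D h / 2); last first.
  by rewrite /qf /D /=; field.
apply: le_trans (ler_normB _ _) _.
have hh : enorm h ^+ 2 = h.1 ^+ 2 + h.2 ^+ 2 by rewrite enorm_sqr /dot !expr2.
have s1 := sqr_ge0 h.1; have s2 := sqr_ge0 h.2.
have m1 : `|h.1 * h.2| <= (h.1 ^+ 2 + h.2 ^+ 2) / 2.
  have := sqr_ge0 (h.1 + h.2); have := sqr_ge0 (h.1 - h.2).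
  by rewrite !expr2 ler_norml => ? ?; apply/andP; split; lra.
have : `|qf D h| <= c / 4 * (2 * (h.1 ^+ 2 + h.2 ^+ 2)).
  rewrite /qf /D /=; apply: le_trans (ler_normD _ _) _.
  apply: le_trans (lerD (ler_normD _ _) (lexx _)) _.
  have nM (w r : R) : 0 <= r -> `|w * r| = `|w| * r by move=> r0; rewrite normrM (ger0_norm r0).
  have n2 (w r : R) : `|2 * w * r| = 2 * (`|w| * `|r|) by rewrite !normrM normr_nat mulrA.
  rewrite (nM _ _ s1) (nM _ _ s2) n2.
  have g1 := ler_wpM2r s1 h1; have g3 := ler_wpM2r s2 h3.
  have g2 := ler_pM (normr_ge0 _) (normr_ge0 _) h2 m1.
  move: g1 g2 g3; lra.
rewrite [`|qf D h / 2|]normrM (ger0_norm (_ : 0 <= 2^-1)) ?invr_ge0 //.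
by have cS := mulr_ge0 (ltW c0) (addr_ge0 s1 s2); move: h4; rewrite hh; (clear -cS; lra).
Qed.

End hessian_measurable.

(** * The absolutely continuous part *)

Section absolutely_continuous_part.
Context {R : realType}.
Local Notation E := (R * R)%type.
Implicit Types (x y z h p q : E) (Q : R * R * R) (A B : set E).

(** Nonnegativity and countable additivity along one sequence: what is needed to sum inequalities
    between combinations of measures and integrals over pieces. *)
Definition csum (B : nat -> set E) (f : set E -> \bar R) :=
  (forall l, (0 <= f (B l))%E) /\ f (\bigcup_l B l) = (\sum_(0 <= l <oo) f (B l))%E.

Lemma csumD (B : nat -> set E) (f g : set E -> \bar R) : csum B f -> csum B g -> csum B (fun A => (f A + g A)%E).
Proof.
move=> [f0 fE] [g0 gE]; split; first by move=> l; exact: adde_ge0.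
by rewrite fE gE nneseriesD // => l _ _.
Qed.

Lemma csumZ (B : nat -> set E) (f : set E -> \bar R) (c : R) : 0 <= c -> csum B f -> csum B (fun A => (c%:E * f A)%E).
Proof.
move=> c0 [f0 fE]; split; first by move=> l; rewrite mule_ge0.
by rewrite fE nneseriesZl // => l _.
Qed.

Lemma csum_le (B : nat -> set E) (f g : set E -> \bar R) : csum B f -> csum B g -> (forall l, (f (B l) <= g (B l))%E) ->
  (f (\bigcup_l B l) <= g (\bigcup_l B l))%E.
Proof.
by move=> [f0 fE] [g0 gE] fg; rewrite fE gE; apply: lee_nneseries => [l _ _|l _].
Qed.

Lemma csum_measure (B : nat -> set E) (mu : {measure set E -> \bar R}) : (forall l, measurable (B l)) ->
  trivIset setT B -> csum B mu.
Proof.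
move=> mB tB; split=> [l|]; first exact: measure_ge0.
by apply: measure_semi_bigcup => //; exact: bigcupT_measurable.
Qed.

Lemma csum_integral (B : nat -> set E) (f : E -> \bar R) : (forall l, measurable (B l)) -> trivIset setT B ->
  measurable_fun (\bigcup_l B l) f -> (forall x, (0 <= f x)%E) ->
  csum B (fun A => \int[lam2 R]_(x in A) f x)%E.
Proof.
move=> mB tB mf f0; split=> [l|]; first by apply: integral_ge0 => x _.
exact: (@ge0_integral_bigcup _ _ R (lam2 R) B f mB mf (fun x _ => f0 x) tB).
Qed.

Lemma normr_le_sub (a b t K : R) : 0 <= a -> 0 <= b -> `|a - b - t| <= K -> `|t| <= a + b + K.
Proof. by rewrite !ler_norml => a0 b0 /andP[t1 t2]; apply/andP; split; lra. Qed.

Lemma normr_balance (a b p n K : R) : a + n <= b + p + K -> b + p <= a + n + K -> `|a - b - (p - n)| <= K.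
Proof. by rewrite ler_norml => h1 h2; apply/andP; split; lra. Qed.

Context (M : R) (HM : pairing_const M).
Context (Om : set E) (oOm : open Om) (u U : E -> R) (cU : continuous U).
Hypothesis uU : forall x, Om x -> U x = u x.
Context (P : E -> E) (fP : forall x, Om x -> lindiff U x (P x)).
Hypothesis cP : forall x, Om x -> {for x, continuous (fun y => (P y).1)} /\ {for x, continuous (fun y => (P y).2)}.
Context (i j : bool) (nup num : {measure set E -> \bar R}) (D2 : is_D2 Om u i j nup num).
Hypotheses (lfp : loc_finite Om nup) (lfm : loc_finite Om num).

Local Notation S := (regular_points Om P).

Lemma rel_cpt_sub A B : rel_cpt A Om -> B `<=` A -> rel_cpt B Om.
Proof.
move=> [cA AO] BA; have cl := closure_subset BA; split; last exact: subset_trans AO.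
exact: (subclosed_compact (@closed_closure _ B) cA).
Qed.

Lemma rel_cpt_fin A (mu : {measure set E -> \bar R}) : loc_finite Om mu -> rel_cpt A Om -> measurable A ->
  mu A \is a fin_num.
Proof.
move=> lf [cA AO] mA; rewrite ge0_fin_numE ?measure_ge0 //; apply: le_lt_trans (lf _ cA AO).
by rewrite le_measure ?inE //; [apply: closed_measurable2; exact: closed_closure|exact: subset_closure].
Qed.

Lemma loc_finite_lam : loc_finite Om (@lamE R).
Proof. by move=> A cA _; exact: compact_lam. Qed.

Lemma inner_closed A (mu : {measure set E -> \bar R}) (e : R) : loc_finite Om mu -> rel_cpt A Om -> measurable A ->
  0 < e -> exists F, [/\ closed F, F `<=` A & (mu (A `\` F) <= e%:E)%E].
Proof.
move=> lf [cA AO] mA e0.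
have mV : measurable (closure A) by apply: closed_measurable2; exact: closed_closure.
have fin : (mrestr mu mV setT < +oo)%E by rewrite /mrestr setTI; exact: lf.
have [F [G [cF oG FA AG FG]]] := measure_regular fin mA e0.
exists F; split => //; apply: ltW; apply: le_lt_trans FG; rewrite /mrestr le_measure ?inE //.
- by apply: measurableD => //; exact: closed_measurable2.
- by apply: measurableI => //; apply: measurableD; [exact: open_measurable2|exact: closed_measurable2].
by move=> x [Ax Fx]; split; [split => //; exact: AG|exact: subset_closure].
Qed.

(** From compact to Borel sets by inner regularity. The union of three closed subsets, one for each
    measure, is almost full for all three at once. *)
Lemma borel_estimate m k Q B : measurable B -> rel_cpt B Om -> B `<=` uniform_points Om U P m k Q ->
  `|fine (nup B) - fine (num B) - qij Q i j * fine (lamE B)| <= 16 * M * m.+1%:R^-1 * fine (lamE B).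
Proof.
move=> mB rB BT.
have c0 : 0 <= m.+1%:R^-1 :> R by rewrite invr_ge0.
have M0 := HM.1; have Mc0 : 0 <= 16 * M * m.+1%:R^-1 by rewrite !mulr_ge0 // ltW.
have [r r0 Hr] := compact_open_margin rB.1 oOm rB.2.
pose r1 := Num.min r k.+1%:R^-1.
have r10 : 0 < r1 by rewrite lt_min r0 invr_gt0 /=.
have key e : 0 < e -> `|fine (nup B) - fine (num B) - qij Q i j * fine (lamE B)| <=
    16 * M * m.+1%:R^-1 * fine (lamE B) + e * (2 + `|qij Q i j|).
  move=> e0; have [F1 [cF1 FB1 le1]] := inner_closed lfp rB mB e0.
  have [F2 [cF2 FB2 le2]] := inner_closed lfm rB mB e0.
  have [F3 [cF3 FB3 le3]] := inner_closed loc_finite_lam rB mB e0.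
  pose F := F1 `|` F2 `|` F3.
  have cF : closed F by apply: closedU => //; exact: closedU.
  have FB : F `<=` B by move=> x [[/FB1|/FB2]|/FB3].
  have mF := closed_measurable2 cF.
  have kF : compact F by apply: (subclosed_compact cF rB.1) => x /FB; exact: subset_closure.
  have FO : F `<=` Om by move=> x /FB /subset_closure /rB.2.
  have QF x : F x -> exists u0 p, forall y, enorm (y - x) < r1 ->
      `|U y - qpoly u0 p x Q y| <= m.+1%:R^-1 * enorm (y - x) ^+ 2.
    move=> Fx; exists (U x), (P x) => y; rewrite lt_min => /andP[yr yk].
    have [_ H] := BT x (FB x Fx).
    have xy : x + (y - x) = y by rewrite addrC subrK.
    have := H (y - x) yk; rewrite xy => /(_ (Hr x y (subset_closure (FB x Fx)) yr)).
    by rewrite /qpoly => h; apply: le_trans h; rewrite le_eqVlt; apply/orP; left; apply/eqP; congr `|_|; ring.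
  have est := @compact_estimate R M HM Om oOm u U cU uU i j nup num D2 F Q _ r1 kF FO lfp lfm c0 r10 QF.
  have toR (mu : {measure set E -> \bar R}) (F' : set E) : closed F' -> F' `<=` F -> loc_finite Om mu ->
      (mu (B `\` F') <= e%:E)%E -> fine (mu F) <= fine (mu B) <= fine (mu F) + e.
    move=> cF' F'F lf h; have fB := rel_cpt_fin lf rB mB.
    have fF := rel_cpt_fin lf (rel_cpt_sub rB FB) mF.
    rewrite -!lee_fin EFinD (fineK fB) (fineK fF); apply/andP; split; first by rewrite le_measure ?inE.
    have -> : mu B = (mu (B `\` F) + mu (B `&` F))%E by exact: measureDI.
    have h3 : (mu (B `\` F) <= e%:E)%E.
      apply: le_trans h; rewrite le_measure ?inE //; try exact: measurableD.
        by apply: measurableD => //; exact: closed_measurable2.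
      by move=> x [Bx nF]; split => // /F'F.
    have -> : B `&` F = F by exact: setIidr.
    by rewrite addeC; apply: leeD.
  have /andP[a1 a2] : fine (nup F) <= fine (nup B) <= fine (nup F) + e.
    by apply: toR le1 => // x; left; left.
  have /andP[b1 b2] : fine (num F) <= fine (num B) <= fine (num F) + e.
    by apply: toR le2 => // x; left; right.
  have /andP[l1 l2] : fine (lamE F) <= fine (lamE B) <= fine (lamE F) + e.
    by apply: (toR [the measure _ _ of @lamE R]) le3 => // [x|]; [right|exact: loc_finite_lam].
  have close (s t : R) : s <= t -> t <= s + e -> `|s - t| <= e.
    by move=> st ts; rewrite distrC ger0_norm ?subr_ge0 // lerBlDl.
  apply: le_trans (normr_perturb (close _ _ a1 a2) (close _ _ b1 b2) (close _ _ l1 l2) est) _.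
  by rewrite lerD2r ler_wpM2l.
apply/ler_addgt0Pr => e e0.
have K0 : 0 < 2 + `|qij Q i j| by have := normr_ge0 (qij Q i j); lra.
by have := key (e / (2 + `|qij Q i j|)) (divr_gt0 e0 K0); rewrite divfK // gt_eqF.
Qed.

Local Notation g := (fun x => hess u x i j).
Local Notation ge := (fun x => (hess u x i j)%:E).
Local Notation C0 := (16 * M + 8).

Lemma g_measurable A : A `<=` Om -> measurable A -> measurable_fun A g.
Proof.
move=> AO mA; apply: measurable_funS AO _; first exact: open_measurable2.
exact: (hess_measurable oOm cU uU fP cP).
Qed.

(** Positive and negative parts stand on opposite sides, so every term is a nonnegative extended
    real and infinitely many pieces can be added without subtraction. In the constant, 16 M comes
    from [borel_estimate] and 8 from [uniform_hess]. *)
Lemma piece_estimate m k Q B : measurable B -> rel_cpt B Om -> B `<=` S -> B `<=` uniform_points Om U P m k Q ->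
  [/\ (nup B + \int[lam2 R]_(x in B) (ge^\- x) <=
        num B + \int[lam2 R]_(x in B) (ge^\+ x) + (C0 * m.+1%:R^-1)%:E * lamE B)%E,
      (num B + \int[lam2 R]_(x in B) (ge^\+ x) <=
        nup B + \int[lam2 R]_(x in B) (ge^\- x) + (C0 * m.+1%:R^-1)%:E * lamE B)%E &
      (\int[lam2 R]_(x in B) `|ge x| <= nup B + num B + (C0 * m.+1%:R^-1)%:E * lamE B)%E].
Proof.
move=> mB rB BS BT; have est := borel_estimate mB rB BT.
have fp := rel_cpt_fin lfp rB mB; have fm := rel_cpt_fin lfm rB mB.
have fl := rel_cpt_fin loc_finite_lam rB mB.
have BO : B `<=` Om by move=> x /subset_closure /rB.2.
have mg := g_measurable BO mB.
have c0 : 0 < m.+1%:R^-1 :> R by rewrite invr_gt0.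
pose q := qij Q i j; rewrite -/q in est.
have gq x : B x -> `|hess u x i j - q| <= 8 * m.+1%:R^-1.
  by move=> Bx; exact: (uniform_hess oOm uU fP _ _ (BS x Bx) (BT x Bx)).
move: gq est; move: (m.+1%:R^-1) c0 => c c0 gq est.
have lfin : (lam2 R B < +oo)%E by rewrite -ge0_fin_numE.
have bnd (f : E -> R) K : measurable_fun B f -> (forall x, B x -> `|f x| <= K) -> (lam2 R).-integrable B (EFin \o f).
  move=> mf H; apply: measurable_bounded_integrable => //.
  by exists K; split; [exact: num_real|move=> r Kr x Bx; apply: le_trans (H x Bx) _; exact: ltW].
have ncst K : (lam2 R).-integrable B (EFin \o (fun=> K)) by apply: (bnd _ `|K|).
have gK x : B x -> `|hess u x i j| <= `|q| + 8 * c.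
  by move=> /gq; have := ler_normD (hess u x i j - q) q; rewrite subrK; (clear -BS BT BO c0; lra).
have ig : (lam2 R).-integrable B ge by exact: bnd gK.
have ia : (lam2 R).-integrable B (EFin \o (fun x => `|hess u x i j|)).
  by apply: (bnd _ (`|q| + 8 * c)); [exact: measurableT_comp|move=> x /gK; rewrite normr_id].
pose l := fine (lamE B); rewrite -/l in est.
have cst K : \int[lam2 R]_(x in B) K = K * l by exact: Rintegral_cst.
have s1 : (q - 8 * c) * l <= \int[lam2 R]_(x in B) hess u x i j.
  rewrite -cst; apply: (@le_Rintegral _ _ R (lam2 R)) => // x /gq; rewrite ler_norml => /andP[]; (clear -BT BO c0 lfin; lra).
have s2 : \int[lam2 R]_(x in B) hess u x i j <= (q + 8 * c) * l.
  rewrite -cst; apply: (@le_Rintegral _ _ R (lam2 R)) => // x /gq; rewrite ler_norml => /andP[]; (clear -BO c0 est s1; lra).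
have s3 : \int[lam2 R]_(x in B) `|hess u x i j| <= (`|q| + 8 * c) * l.
  by rewrite -cst; apply: (@le_Rintegral _ _ R (lam2 R)).
have fip := @integrable_pos_fin_num _ _ R (lam2 R) B mB _ ig.
have fin := @integrable_neg_fin_num _ _ R (lam2 R) B mB _ ig.
have sE : \int[lam2 R]_(x in B) hess u x i j =
    fine (\int[lam2 R]_(x in B) (ge^\+ x))%E - fine (\int[lam2 R]_(x in B) (ge^\- x))%E.
  by rewrite /Rintegral integralE fineB.
have l0 : 0 <= l by rewrite fine_ge0 // measure_ge0.
have ql : `|q * l| = `|q| * l by rewrite normrM (ger0_norm l0).
have [n0 m0] : 0 <= fine (nup B) /\ 0 <= fine (num B) by rewrite !fine_ge0 ?measure_ge0.
have q1 : `|q| * l <= fine (nup B) + fine (num B) + 16 * M * c * l.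
  by rewrite -ql; exact: normr_le_sub est.
rewrite sE in s1 s2.
rewrite -(fineK fp) -(fineK fm) -(fineK fl) -/l -(fineK fip) -(fineK fin).
have -> : (\int[lam2 R]_(x in B) `|ge x|)%E = (\int[lam2 R]_(x in B) `|hess u x i j|)%:E.
  by rewrite /Rintegral fineK //; exact: integrable_fin_num ia.
rewrite -!EFinM -!EFinD !lee_fin.
move: est; rewrite ler_norml => /andP[e1 e2].
by split; (clear -e1 e2 s1 s2 s3 q1 n0 m0 l0 c0; lra).
Qed.

(** Summation over disjoint pieces loses nothing, since the errors are proportional to area. The
    third inequality bounds the integral of |D_ij u| and gives local integrability. *)
Lemma regular_estimate m A : measurable A -> rel_cpt A Om ->
  [/\ (nup (A `&` S) + \int[lam2 R]_(x in A `&` S) (ge^\- x) <=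
        num (A `&` S) + \int[lam2 R]_(x in A `&` S) (ge^\+ x) + (C0 * m.+1%:R^-1)%:E * lamE (A `&` S))%E,
      (num (A `&` S) + \int[lam2 R]_(x in A `&` S) (ge^\+ x) <=
        nup (A `&` S) + \int[lam2 R]_(x in A `&` S) (ge^\- x) + (C0 * m.+1%:R^-1)%:E * lamE (A `&` S))%E &
      (\int[lam2 R]_(x in A `&` S) `|ge x| <=
        nup (A `&` S) + num (A `&` S) + (C0 * m.+1%:R^-1)%:E * lamE (A `&` S))%E].
Proof.
move=> mA rA; have mS : measurable S by exact: regular_points_measurable.
(* An enumeration of all scales and rational matrices; numbers that encode nothing give the piece of
   a default index, which is emptied where it repeats once the pieces are made disjoint. *)
pose kq l := odflt (0%N, (0, 0, 0)) (@unpickle (nat * (rat * rat * rat))%type l).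
pose T l := uniform_points Om U P m (kq l).1 (ratr (kq l).2.1.1, ratr (kq l).2.1.2, ratr (kq l).2.2).
pose F l := A `&` S `&` T l; pose B := seqDU F.
have mF l : measurable (F l).
  by apply: measurableI; [exact: measurableI|exact: uniform_points_measurable].
have mB l : measurable (B l) by exact: seqDU_measurable.
have tB : trivIset setT B by exact: trivIset_seqDU.
have BF l : B l `<=` F l by move=> x [].
have UB : \bigcup_l B l = A `&` S.
  rewrite -seqDU_bigcup_eq; apply/seteqP; split => [x [l _ [//]]|x [Ax Sx]].
  have [k [qq Tx]] := regular_uniform oOm uU fP m Sx.
  exists (pickle (k, qq)) => //; split => //.
  by rewrite /T /kq pickleK.
have rB l : rel_cpt (B l) Om by apply: rel_cpt_sub rA _ => x /BF[[]].
have BS l : B l `<=` S by move=> x /BF[[]].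
have BT l : B l `<=` T l by move=> x /BF[].
have pe l := piece_estimate (mB l) (rB l) (BS l) (BT l).
have UO : \bigcup_l B l `<=` Om by rewrite UB => x [/subset_closure /rA.2].
have mU : measurable (\bigcup_l B l) by exact: bigcupT_measurable.
have mg := g_measurable UO mU.
have mge : measurable_fun (\bigcup_l B l) ge by apply/measurable_EFinP.
have cp := csum_measure nup mB tB; have cm := csum_measure num mB tB.
have K0 : 0 <= C0 * m.+1%:R^-1 by rewrite mulr_ge0 ?invr_ge0 // addr_ge0 // mulr_ge0 // ltW // HM.1.
have cl := csumZ K0 (csum_measure [the measure _ _ of @lamE R] mB tB).
have ip := csum_integral mB tB (measurable_funepos mge) (fun x => funepos_ge0 _ x).
have im := csum_integral mB tB (measurable_funeneg mge) (fun x => funeneg_ge0 _ x).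
have ia : csum B (fun A => \int[lam2 R]_(x in A) `|ge x|)%E.
  by apply: csum_integral => //; exact: measurableT_comp.
rewrite -UB; split.
- by apply: (csum_le (csumD cp im) (csumD (csumD cm ip) cl)) => l; case: (pe l).
- by apply: (csum_le (csumD cm ip) (csumD (csumD cp im) cl)) => l; case: (pe l).
- by apply: (csum_le ia (csumD (csumD cp cm) cl)) => l; case: (pe l).
Qed.

Lemma integral_regular A (f : E -> \bar R) : A `<=` Om -> (forall x, Om x -> ~ S x -> f x = 0%E) ->
  (\int[lam2 R]_(x in A) f x = \int[lam2 R]_(x in A `&` S) f x)%E.
Proof.
move=> AO f0; rewrite [RHS]integral_mkcondr; apply: eq_integral => x /set_mem Ax.
rewrite patchE; case: ifPn => // /negP xS; apply: f0; first exact: AO.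
by move=> Sx; apply: xS; rewrite inE.
Qed.

(** The irregular points of [Om] form the null set that carries the singular part. Off them the two
    sides differ by at most a constant times 1 / (m + 1) for every [m]; the case m = 0 already gives
    integrability. *)
Lemma ac_part (N0 : set E) : measurable N0 -> lamE N0 = 0%E -> (forall x, Om x -> ~ N0 x -> S x) ->
  ac_part_is Om nup num (fun x => hess u x i j).
Proof.
move=> mN0 N00 NS; have mS : measurable S by exact: regular_points_measurable.
have mO := open_measurable2 oOm.
have g0 x : Om x -> ~ S x -> hess u x i j = 0 by exact: (irregular_hess oOm uU fP).
have AOm A : rel_cpt A Om -> A `<=` Om by move=> rA x /subset_closure /rA.2.
have int A : measurable A -> rel_cpt A Om -> (lam2 R).-integrable A ge.
  move=> mA rA; apply/integrableP; split.
    by apply/measurable_EFinP; exact: g_measurable (AOm A rA) mA.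
  rewrite (integral_regular (AOm A rA)); last by move=> x Ox Sx; rewrite g0 // abse0.
  have [_ _ h] := regular_estimate 0 mA rA; apply: le_lt_trans h _.
  have rAS : rel_cpt (A `&` S) Om by apply: rel_cpt_sub rA _ => x [].
  have mAS : measurable (A `&` S) by exact: measurableI.
  rewrite -(fineK (rel_cpt_fin lfp rAS mAS)) -(fineK (rel_cpt_fin lfm rAS mAS)).
  by rewrite -(fineK (rel_cpt_fin loc_finite_lam rAS mAS)) -EFinM -!EFinD ltry.
split => //; exists (Om `\` S); split; first exact: measurableD.
  apply: (@subset_measure0 _ _ _ [the measure _ _ of @lamE R] _ N0) => //; first exact: measurableD.
  by move=> x [Ox Sx]; apply: contrapT => /(NS x Ox).
move=> A mA rA; have -> : A `\` (Om `\` S) = A `&` S.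
  apply/seteqP; split => [x [Ax H]|x [Ax Sx]]; last by split => // -[].
  by split => //; apply: contrapT => Sx; apply: H; split => //; exact: (AOm A rA).
have rAS : rel_cpt (A `&` S) Om by apply: rel_cpt_sub rA _ => x [].
have mAS : measurable (A `&` S) by exact: measurableI.
have fp := rel_cpt_fin lfp rAS mAS; have fm := rel_cpt_fin lfm rAS mAS.
have fl : lamE (A `&` S) \is a fin_num := rel_cpt_fin loc_finite_lam rAS mAS.
rewrite (integral_regular (AOm A rA)); last by move=> x Ox Sx; rewrite g0.
have ig := int _ mAS rAS; have fip := @integrable_pos_fin_num _ _ R (lam2 R) _ mAS _ ig.
have fin := @integrable_neg_fin_num _ _ R (lam2 R) _ mAS _ ig.
have H m := regular_estimate m mA rA.
rewrite integralE -(fineK fp) -(fineK fm) -(fineK fip) -(fineK fin) -!EFinB; congr EFin.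
have {}H m : `|fine (nup (A `&` S)) - fine (num (A `&` S)) -
    (fine (\int[lam2 R]_(x in A `&` S) (ge^\+ x))%E - fine (\int[lam2 R]_(x in A `&` S) (ge^\- x))%E)| <=
    C0 * m.+1%:R^-1 * fine (lamE (A `&` S)).
  have [h1 h2 _] := H m.
  by apply: normr_balance; rewrite -lee_fin !EFinD EFinM !fineK.
apply/eqP; rewrite -subr_eq0 -normr_le0 leNgt; apply/negP.
set d := `|_| in H *; move=> d0.
have L0 : 0 <= C0 * fine (lamE (A `&` S)).
  by rewrite mulr_ge0 ?fine_ge0 ?measure_ge0 // addr_ge0 // mulr_ge0 // ltW // HM.1.
have K0 : 0 < C0 * fine (lamE (A `&` S)) + 1 by rewrite ltr_wpDl.
have [m mK] := natSinv_lt (divr_gt0 d0 K0).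
have := H m; apply/negP; rewrite -ltNge; move: mK; rewrite ltr_pdivlMr //.
have c0 : 0 < m.+1%:R^-1 :> R by rewrite invr_gt0.
by move: c0; move: (m.+1%:R^-1) => c c0; (clear -N00 d0 L0 K0 c0; lra).
Qed.

End absolutely_continuous_part.

Lemma pgrad_continuous (R : realType) (O K : set (R * R)) (U : R * R -> R) (M : R) x :
  ringpot O K U M -> (O `\` K) x ->
  {for x, continuous (fun y => (pgrad U y).1)} /\ {for x, continuous (fun y => (pgrad U y).2)}.
Proof.
move=> rp Rx; have cs := slope_cont rp Rx.
have cd p : {for x, continuous (fun y => dot p (nrm U y))} by exact: (@dot_nrm_cont _ _ _ _ _ rp p x Rx).
have H b : {for x, continuous (fun y => - (slope U y * dot (e_ b) (nrm U y)))}.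
  by apply: continuousN; apply: continuousM; [exact: cs|exact: cd].
split.
  rewrite (_ : (fun y => _) = (fun y => - (slope U y * dot (e_ false) (nrm U y)))); first exact: H.
  by apply/funext => y; rewrite /pgrad /dot /e_ !vE /=; ring.
rewrite (_ : (fun y => _) = (fun y => - (slope U y * dot (e_ true) (nrm U y)))); first exact: H.
by apply/funext => y; rewrite /pgrad /dot /e_ !vE /=; ring.
Qed.

Theorem theorem1p6 (R : realType) (O0 K : set (R * R)) (u : R * R -> R) :
  convex_ring O0 K -> inf_potential O0 K u ->
  [/\
   (* Du differentiable and u twice differentiable a.e. in Omega *)
   {ae lam2 R, forall x, (O0 `\` K) x -> twice_diff u x},
   (* the absolutely continuous part of the Radon measure D^2 u is D^2 u dx *)
   (forall (i j : bool) (nup num : {measure set (R * R) -> \bar R}),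
      loc_finite (O0 `\` K) nup -> loc_finite (O0 `\` K) num ->
      is_D2 (O0 `\` K) u i j nup num ->
      ac_part_is (O0 `\` K) nup num (fun x => hess u x i j)) &
   (* consequences, a.e. in Omega *)
   {ae lam2 R, forall x, (O0 `\` K) x ->
      [/\ dot (hessv u x (grad u x)) (grad u x) = 0,
          (fun h : R => (u x - (u (x + h *: grad u x) + u (x - h *: grad u x)) / 2)
                          / h ^+ 2) @ 0^' --> 0 &
          (fun e : R => (u x - (sup (u @` cball x e) + inf (u @` cball x e)) / 2)
                          / e ^+ 2) @ 0^'+ --> 0]}].
Proof.
move=> cr ip; have [U [M [rp Uu]]] := inf_potential_ringpot cr ip.
have [N [mN N0 HN]] := ae_second_order rp Uu.
split.
- exists N; split => // x /= nx; apply: contrapT => Nx; apply: nx => Ox.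
  by have [a [b []]] := HN x Ox Nx.
- move=> i j nup num lfp lfm D2.
  have oOm : open (O0 `\` K) by case: rp => -[oO _ _] [cK _ _ _] _ _; exact: open_ring.
  have cU : continuous U by case: rp => _ _ [].
  have [M' HM0 HM] := @bump_pairing R.
  have [N' [mN' N'0 HN']] := pgrad_ae_differentiable rp.
  apply: (ac_part (conj HM0 HM) oOm cU Uu (pgrad_lindiff rp) _ D2 lfp lfm mN' N'0).
    by move=> x; exact: pgrad_continuous rp.
  move=> x Ox Nx; have [a [b [da db]]] := HN' x Ox Nx.
  by split; split => //; [exists a|exists b].
- exists N; split => // x /= nx; apply: contrapT => Nx; apply: nx => Ox.
  have [a [b [_ ty hE sym [p0 h0]]]] := HN x Ox Nx.
  rewrite hE; split => //; first exact: second_quotient ty h0.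
  exact: ball_mean_value ty sym p0 h0.
Qed.
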